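(* Let $(M^n,g(t))_{t\in[0,T)}$, $T<\infty$, be a Ricci flow on a closed manifold, let $p\in M$, let $\tau(t):=T-t$, and for each $t\in[0,T)$ let $\widehat f_{p,T}(t)=\widehat f_{p,T}(\cdot,t):M\to\mathbb{R}$ be a function obtained by minimizing $\mathcal{W}(g(t),f(\cdot,t),T-t)$ over $f\in\mathcal{F}_p$ at the fixed time $t$ (see context). Define $\theta_p(t):=\mathcal{W}(g(t),\widehat f_{p,T}(t),\tau(t))$. Then the function $\theta_p:[0,T)\to\mathbb{R}$ is nonpositive and non-decreasing, with derivative $$\frac{\partial}{\partial t}\theta_p(t)=2\tau\int_M\Big|\mathrm{Rc}_{g(t)}+\nabla^2\widehat f_{p,T}(t)-\frac{g(t)}{2\tau}\Big|^2_{g(t)}\frac{e^{-\widehat f_{p,T}(t)}}{(4\pi\tau)^{n/2}}\,dV_{g(t)}\ \geq 0$$ at almost every $t\in[0,T)$.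
   Context: Manifolds are assumed connected. A Ricci flow is a smooth family $g(t)$ with $\partial_t g(t)=-2\mathrm{Rc}_{g(t)}$; $\mathrm{R}_g$ is scalar curvature. Adjoint heat kernels. For $p\in M$, $s\in(0,T)$, the adjoint heat kernel based at $(p,s)$ is the unique smooth positive solution $u_{p,s}:M\times[0,s)\to\mathbb{R}$ of $\partial_t u=-\Delta_{g(t)} u+\mathrm{R}_{g(t)}u$ with $\lim_{t\to s}u_{p,s}(\cdot,t)=\delta_p$ as measures. An adjoint heat kernel based at the singular time $(p,T)$ is a smooth function $u_{p,T}:M\times[0,T)\to\mathbb{R}$ which is the limit, smoothly on every compact subset of $M\times[0,T)$, of a sequence $u_{p,s_i}$ with $s_i\to T$ (such limits exist and are positive). $\mathcal{U}_p$ is the set of all such limits, and $\mathcal{F}_p$ is the set of smooth functions $f_{p,T}:M\times[0,T)\to\mathbb{R}$ such that $u_{p,T}=\frac{e^{-f_{p,T}}}{[4\pi(T-t)]^{n/2}}$ belongs to $\mathcal{U}_p$. Entropy. $\mathcal{W}(g,f,\tau):=\int_M\big(\tau(\mathrm{R}_g+|\nabla f|_g^2)+f-n\big)\frac{e^{-f}}{(4\pi\tau)^{n/2}}dV_g$. Minimizers. $\mathcal{F}_p$ is compact in the topology of $C^\infty$-convergence on compact subsets of $M\times[0,T)$, so for every $t\in[0,T)$ there is a minimizer $f^t_{p,T}\in\mathcal{F}_p$ of $f\mapsto\mathcal{W}(g(t),f(\cdot,t),T-t)$ over $\mathcal{F}_p$; one sets $\widehat f_{p,T}(\cdot,t):=f^t_{p,T}(\cdot,t)$.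 *)

(* Defs.v *)
From HB Require Import structures.
From mathcomp Require Import all_boot all_order all_algebra.
From mathcomp Require Import all_classical all_reals all_analysis.

Set Implicit Arguments.
Unset Strict Implicit.
Unset Printing Implicit Defensive.

Import Order.TTheory GRing.Theory Num.Theory.
Import numFieldNormedType.Exports.

Local Open Scope classical_set_scope.
Local Open Scope ring_scope.

(** * Smooth functions *)

(* The derivative of [F] at [z] along [v], the increments being restricted to
   those that stay in [D]. It is the usual directional derivative ['D_v F z]
   when [z] is interior to [D]; the restriction makes time derivatives at the
   initial time of a half-open interval [0, s[ one-sided. *)
Definition diff_quotient (R : realType) (E : normedModType R)
    (v : E) (F : E -> R) (z : E) (h : R) : R :=
  h^-1 * (F (z + h *: v) - F z).

Definition increments (R : realType) (E : normedModType R)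
    (D : set E) (v z : E) : set_system R :=
  within [set h : R | D (z + h *: v)] 0^'.

Definition pderiv (R : realType) (E : normedModType R)
    (D : set E) (v : E) (F : E -> R) (z : E) : R :=
  lim (diff_quotient v F z @ increments D v z).

Definition iter_pderiv (R : realType) (E : normedModType R)
    (D : set E) (l : seq E) (F : E -> R) : E -> R :=
  foldr (pderiv D) F l.

(* C^oo on [D], used for [D] open in R^n, or [D] the product of an open subset
   of R^n and an interval [0, s[. *)
Definition smooth (R : realType) (E : normedModType R)
    (D : set E) (F : E -> R) : Prop :=
  forall l : seq E,
    {within D, continuous (iter_pderiv D l F)} /\
    forall v z : E, D z ->
      cvg (diff_quotient v (iter_pderiv D l F) z @ increments D v z).

(** * Closed manifolds *)

(* A smooth structure on a compact space is given by a finite atlas. The maps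
   [chart_inv] are inverse to the charts on their images, and are arbitrary
   elsewhere. *)
Record closedManifold (R : realType) (n : nat) := ClosedManifold {
  points :> topologicalType ;
  charts : nat ;
  chart_dom : 'I_charts -> set points ;
  chart : 'I_charts -> points -> 'rV[R]_n ;
  chart_inv : 'I_charts -> 'rV[R]_n -> points ;
  points_hausdorff : hausdorff_space points ;
  points_compact : compact [set: points] ;
  points_connected : connected [set: points] ;
  chart_dom_open : forall i, open (chart_dom i) ;
  chart_cover : forall q, exists i, chart_dom i q ;
  chart_img_open : forall i, open (chart i @` chart_dom i) ;
  chartK : forall i q, chart_dom i q -> chart_inv i (chart i q) = q ;
  chart_continuous : forall i, {within chart_dom i, continuous (chart i)} ;
  chart_inv_continuous :
    forall i, {within chart i @` chart_dom i, continuous (chart_inv i)} ;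
  transition_smooth : forall i j k,
    smooth (chart i @` (chart_dom i `&` chart_dom j))
           (fun x => chart j (chart_inv i x) ord0 k) }.

Definition chart_img (R : realType) (n : nat) (M : closedManifold R n)
    (i : 'I_(charts M)) : set 'rV[R]_n :=
  chart i @` chart_dom i.

Definition spacetime (R : realType) (n : nat) (M : closedManifold R n)
    (s : R) (i : 'I_(charts M)) : set ('rV[R]_n * R) :=
  chart_img i `*` [set t | 0 <= t < s].

(* The coordinate expression in the chart [i] of a function on M x [0, s[. *)
Definition in_chart (R : realType) (n : nat) (M : closedManifold R n)
    (i : 'I_(charts M)) (u : M -> R -> R) : 'rV[R]_n * R -> R :=
  fun z => u (chart_inv i z.1) z.2.

Definition smooth_spacetime (R : realType) (n : nat) (M : closedManifold R n)
    (s : R) (u : M -> R -> R) : Prop :=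
  forall i, smooth (spacetime s i) (in_chart i u).

(** * Riemannian metrics *)

(* Coordinate expressions, chart by chart; only the values at the points of
   [chart_img i] are meaningful. *)
Definition metric (R : realType) (n : nat) (M : closedManifold R n) : Type :=
  'I_(charts M) -> 'rV[R]_n -> 'M[R]_n.

Definition partial (R : realType) (n : nat) (M : closedManifold R n)
    (i : 'I_(charts M)) (k : 'I_n) (F : 'rV[R]_n -> R) : 'rV[R]_n -> R :=
  pderiv (chart_img i) (delta_mx ord0 k) F.

Definition transition_jacobian (R : realType) (n : nat)
    (M : closedManifold R n) (i j : 'I_(charts M)) (x : 'rV[R]_n) : 'M[R]_n :=
  \matrix_(k, l) partial i k (fun y => chart j (chart_inv i y) ord0 l) x.

Definition riemannian (R : realType) (n : nat) (M : closedManifold R n)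
    (g : metric M) : Prop :=
  [/\ forall i k l, smooth (chart_img i) (fun x => g i x k l),
      forall i x, chart_img i x -> (g i x)^T = g i x,
      forall i x, chart_img i x ->
        forall v : 'rV[R]_n, v != 0 -> 0 < (v *m g i x *m v^T) ord0 ord0 &
      forall i j x, (chart i @` (chart_dom i `&` chart_dom j)) x ->
        g i x = transition_jacobian i j x
                *m g j (chart j (chart_inv i x))
                *m (transition_jacobian i j x)^T].

Definition christoffel (R : realType) (n : nat) (M : closedManifold R n)
    (g : metric M) (i : 'I_(charts M)) (m k l : 'I_n) (x : 'rV[R]_n) : R :=
  2^-1 * \sum_r invmx (g i x) m r *
    (partial i k (fun y => g i y l r) x + partial i l (fun y => g i y k r) x
     - partial i r (fun y => g i y k l) x).

(* The sign convention is the one for which round spheres have positive Ricci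
   curvature. *)
Definition ricci (R : realType) (n : nat) (M : closedManifold R n)
    (g : metric M) (i : 'I_(charts M)) (x : 'rV[R]_n) : 'M[R]_n :=
  let Gamma m k l := christoffel g i m k l in
  \matrix_(k, l)
    (\sum_m (partial i m (Gamma m k l) x - partial i l (Gamma m k m) x)
     + \sum_m \sum_r
         (Gamma m m r x * Gamma r k l x - Gamma m l r x * Gamma r k m x)).

Definition scalar_curvature (R : realType) (n : nat) (M : closedManifold R n)
    (g : metric M) (i : 'I_(charts M)) (x : 'rV[R]_n) : R :=
  \tr (invmx (g i x) *m ricci g i x).

Definition hessian (R : realType) (n : nat) (M : closedManifold R n)
    (g : metric M) (i : 'I_(charts M)) (F : 'rV[R]_n -> R)
    (x : 'rV[R]_n) : 'M[R]_n :=
  \matrix_(k, l) (partial i k (partial i l F) x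
                  - \sum_m christoffel g i m k l x * partial i m F x).

Definition laplacian (R : realType) (n : nat) (M : closedManifold R n)
    (g : metric M) (i : 'I_(charts M)) (F : 'rV[R]_n -> R)
    (x : 'rV[R]_n) : R :=
  \tr (invmx (g i x) *m hessian g i F x).

Definition sqnorm_gradient (R : realType) (n : nat) (M : closedManifold R n)
    (g : metric M) (i : 'I_(charts M)) (F : 'rV[R]_n -> R)
    (x : 'rV[R]_n) : R :=
  \sum_k \sum_l invmx (g i x) k l * partial i k F x * partial i l F x.

Definition sqnorm_tensor (R : realType) (n : nat) (M : closedManifold R n)
    (g : metric M) (i : 'I_(charts M)) (x : 'rV[R]_n) (S : 'M[R]_n) : R :=
  \sum_k \sum_l \sum_m \sum_r
    invmx (g i x) k m * invmx (g i x) l r * S k l * S m r.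

(** * Integration *)

(* The Lebesgue integral over R^n of a nonnegative function, as an iterated
   integral. *)
Fixpoint nonneg_integral (R : realType) (n : nat) :
    ('rV[R]_n -> \bar R) -> \bar R :=
  match n with
  | 0 => fun F => F 0
  | m.+1 => fun F =>
      (\int[@lebesgue_measure R]_t
         nonneg_integral (fun v : 'rV[R]_m =>
           F (row_mx (const_mx t : 'rV[R]_1) v : 'rV[R]_(m.+1))))%E
  end.

Definition rn_integral (R : realType) (n : nat) (D : set 'rV[R]_n)
    (F : 'rV[R]_n -> R) : R :=
  fine (nonneg_integral (fun x => (Num.max (F x) 0 * \1_D x)%:E))
  - fine (nonneg_integral (fun x => (Num.max (- F x) 0 * \1_D x)%:E)).

(* The integral over M, with respect to the Riemannian volume, of the function
   with coordinate expression [h i] in the chart [i]. Each point is counted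
   once, in the first chart that contains it. *)
Definition first_chart (R : realType) (n : nat) (M : closedManifold R n)
    (i : 'I_(charts M)) : set M :=
  [set q | chart_dom i q /\ forall j : 'I_(charts M), (j < i)%N -> ~ chart_dom j q].

Definition vol_integral (R : realType) (n : nat) (M : closedManifold R n)
    (g : metric M) (h : 'I_(charts M) -> 'rV[R]_n -> R) : R :=
  \sum_i rn_integral (chart i @` first_chart i)
           (fun x => h i x * Num.sqrt (\det (g i x))).

(** * Ricci flow and adjoint heat kernels *)

Definition ricci_flow (R : realType) (n : nat) (M : closedManifold R n)
    (T : R) (g : R -> metric M) : Prop :=
  [/\ forall t, 0 <= t < T -> riemannian (g t),
      forall i k l, smooth (spacetime T i) (fun z => g z.2 i z.1 k l) &
      forall i k l z, spacetime T i z ->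
        pderiv (spacetime T i) (0, 1) (fun y => g y.2 i y.1 k l) z
        = - 2 * ricci (g z.2) i z.1 k l].

Definition adjoint_heat_kernel (R : realType) (n : nat)
    (M : closedManifold R n) (g : R -> metric M) (p : M) (s : R)
    (u : M -> R -> R) : Prop :=
  [/\ smooth_spacetime s u,
      forall q t, 0 <= t < s -> 0 < u q t,
      forall i z, spacetime s i z ->
        pderiv (spacetime s i) (0, 1) (in_chart i u) z
        = - laplacian (g z.2) i (fun x => u (chart_inv i x) z.2) z.1
          + scalar_curvature (g z.2) i z.1 * in_chart i u z &
      forall phi : M -> R, continuous phi ->
        vol_integral (g t)
          (fun i x => phi (chart_inv i x) * u (chart_inv i x) t)
        @[t --> s^'-] --> phi p].

(* Uniform convergence of all derivatives on the compact subsets of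
   M x [0, T[. As [v k] need only be defined on M x [0, s k[ with [s k] tending
   to [T], on a given compact set this concerns large [k] only. *)
Definition smooth_limit (R : realType) (n : nat) (M : closedManifold R n)
    (T : R) (v : nat -> M -> R -> R) (u : M -> R -> R) : Prop :=
  forall (i : 'I_(charts M)) (l : seq ('rV[R]_n * R))
         (K : set ('rV[R]_n * R)),
    compact K -> K `<=` spacetime T i ->
    forall e : R, 0 < e -> \forall k \near \oo, forall z, K z ->
      `| iter_pderiv (spacetime T i) l (in_chart i (v k)) z
         - iter_pderiv (spacetime T i) l (in_chart i u) z | < e.

Definition singular_kernel (R : realType) (n : nat) (M : closedManifold R n)
    (T : R) (g : R -> metric M) (p : M) (u : M -> R -> R) : Prop :=
  smooth_spacetime T u /\
  exists (s : nat -> R) (v : nat -> M -> R -> R),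
    [/\ forall k, 0 < s k < T,
        s k @[k --> \oo] --> T,
        forall k, adjoint_heat_kernel g p (s k) (v k) &
        smooth_limit T v u].

Definition gauss_weight (R : realType) (n : nat) (tau y : R) : R :=
  expR (- y) / (4 * pi * tau) `^ (n%:R / 2).

Definition singular_potential (R : realType) (n : nat)
    (M : closedManifold R n) (T : R) (g : R -> metric M) (p : M)
    (f : M -> R -> R) : Prop :=
  smooth_spacetime T f /\
  singular_kernel T g p (fun q t => gauss_weight n (T - t) (f q t)).

(** * Entropy *)

Definition W_entropy (R : realType) (n : nat) (M : closedManifold R n)
    (g : metric M) (f : M -> R) (tau : R) : R :=
  vol_integral g (fun i x =>
    let F y := f (chart_inv i y) in
    (tau * (scalar_curvature g i x + sqnorm_gradient g i F x) + F x - n%:R)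
    * gauss_weight n tau (F x)).

Definition minimizing_potential (R : realType) (n : nat)
    (M : closedManifold R n) (T : R) (g : R -> metric M) (p : M) (t : R)
    (fhat : M -> R) : Prop :=
  exists f : M -> R -> R,
    [/\ singular_potential T g p f,
        forall f' : M -> R -> R, singular_potential T g p f' ->
          W_entropy (g t) (f ^~ t) (T - t)
          <= W_entropy (g t) (f' ^~ t) (T - t) &
        fhat = f ^~ t].

Definition soliton_defect (R : realType) (n : nat) (M : closedManifold R n)
    (g : metric M) (f : M -> R) (tau : R) : R :=
  vol_integral g (fun i x =>
    let F y := f (chart_inv i y) in
    sqnorm_tensor g i x
      (ricci g i x + hessian g i F x - (2 * tau)^-1 *: g i x)
    * gauss_weight n tau (F x)).

(* Main.v *)
Require Import Defs.
From HB Require Import structures.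
From mathcomp Require Import all_boot all_order all_algebra fingroup perm.
From mathcomp Require Import all_classical all_reals all_analysis measurable_realfun.
From mathcomp Require Import ring lra.

Set Implicit Arguments.
Unset Strict Implicit.
Unset Printing Implicit Defensive.

Import Order.TTheory GRing.Theory Num.Theory.
Import numFieldNormedType.Exports.

Local Open Scope classical_set_scope.
Local Open Scope ring_scope.

(** For a positive solution u of the conjugate heat equation with unit mass and
    L = ln u, Perelman's pointwise identity and the vanishing of the integral of
    a Laplacian give d/dt V(u L) = V((R + |dL|^2) u) =: F and
    F' = 2 V(|Rc - Hess L|^2 u), whence the monotonicity of the entropy W and its
    derivative. Cauchy-Schwarz turns the second formula into F' >= (2/n) F^2, so
    F <= n / (2 tau) and W is at most the Nash entropy; testing u against a bump
    function at the pole and comparing with a Gaussian by a ln a - a ln b >= a - b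
    shows that the latter has nonpositive upper limit at the pole, so W <= 0.
    Both facts pass to kernels based at the singular time. As theta is the
    infimum over F_p of nondecreasing functions, it is nondecreasing, hence
    differentiable almost everywhere; at such a time the smooth function of the
    minimizer touches theta from above, so that the derivatives agree. *)

(** * Riemannian geometry in a ring with commuting derivations *)

(** The pointwise identities are proved over any commutative ring with commuting derivations, an
    element 1/2 and an invertible symmetric matrix [g]. Smooth functions on an open set form such a
    ring, and Bianchi, Bochner and Perelman's identity become polynomial identities between
    matrices. The integral over M attributes each point to the first chart containing it, so its
    independence of charts, and with it the vanishing of the integral of a Laplacian, rests on
    change of variables and a partition of unity. At the pole only weak convergence to the point
    mass is known. It suffices because the bump e^(-1/z), z = 1 - |x-c|^2/r, lies below z/e with
    equality at the centre, so that a shifted multiple of it bounds the logarithm of the Gaussian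
    from below, and because the first order change of its mean, 2n/(er) per unit of time, yields
    exactly the constant n/2. Fields live on open time intervals, where derivatives are two-sided;
    time 0 is reached by continuity. At a touching point the competitor bounds the growth of theta
    on the right, which keeps the derivative of the inverse of t + theta(t) away from 0. *)

Section MatrixEntries.
Variables (A : comPzRingType) (m n : nat).
Implicit Types (X Y : 'M[A]_(m, n)) (i : 'I_m) (j : 'I_n).

Lemma mx_entryD X Y i j : (X + Y) i j = X i j + Y i j.
Proof. by rewrite mxE. Qed.

Lemma mx_entryN X i j : (- X) i j = - X i j.
Proof. by rewrite mxE. Qed.

Lemma mx_entryZ a X i j : (a *: X) i j = a * X i j.
Proof. by rewrite mxE. Qed.

Lemma mx_entryT X i j : X^T j i = X i j.
Proof. by rewrite mxE. Qed.

Lemma mx_trD X Y : (X + Y)^T = X^T + Y^T.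
Proof. by apply/matrixP => i j; rewrite !mxE. Qed.

Lemma mx_trN X : (- X)^T = - X^T.
Proof. by apply/matrixP => i j; rewrite !mxE. Qed.

Lemma mx_entry0 i j : (0 : 'M[A]_(m, n)) i j = 0.
Proof. by rewrite mxE. Qed.
End MatrixEntries.

Definition mx_entry := (mx_entryD, mx_entryN, mx_entryZ, mx_entry0).

Definition mx_expand := (mulmxDl, mulmxDr, mulNmx, mulmxN, mulmxA).

(* Decides equalities that are linear in the matrix products that occur. *)
Ltac mx_linear :=
  rewrite ?mx_expand; refine (proj1 (matrixP _ _) _) => ? ?; rewrite ?mx_entry; ring.

Definition derivation (A : comPzRingType) (d : A -> A) : Prop :=
  (forall x y, d (x + y) = d x + d y) /\
  (forall x y, d (x * y) = d x * y + x * d y).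

Section Derivation.
Variables (A : comPzRingType) (d : A -> A) (hd : derivation d).

Lemma derivD x y : d (x + y) = d x + d y.
Proof. exact: hd.1. Qed.

Lemma derivM x y : d (x * y) = d x * y + x * d y.
Proof. exact: hd.2. Qed.

Lemma deriv0 : d 0 = 0.
Proof. by apply: (addrI (d 0)); rewrite -derivD !addr0. Qed.

Lemma derivN x : d (- x) = - d x.
Proof. by apply: (addrI (d x)); rewrite -derivD !subrr deriv0. Qed.

Lemma derivB x y : d (x - y) = d x - d y.
Proof. by rewrite derivD derivN. Qed.

Lemma deriv1 : d 1 = 0.
Proof. by apply: (addrI (d 1)); rewrite addr0 -{3}(mulr1 1) derivM mulr1 mul1r. Qed.

Lemma derivMn x k : d (x *+ k) = d x *+ k.
Proof. by elim: k => [|k ih]; rewrite ?deriv0 // !mulrS derivD ih. Qed.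

Lemma deriv_sum (I : Type) (r : seq I) (P : pred I) (F : I -> A) :
  d (\sum_(i <- r | P i) F i) = \sum_(i <- r | P i) d (F i).
Proof. by apply: (big_morph d derivD deriv0). Qed.

Definition dmx m n (X : 'M[A]_(m, n)) : 'M[A]_(m, n) := map_mx d X.

Lemma dmxD m n (X Y : 'M[A]_(m, n)) : dmx (X + Y) = dmx X + dmx Y.
Proof. by apply/matrixP => i j; rewrite !mxE derivD. Qed.

Lemma dmxN m n (X : 'M[A]_(m, n)) : dmx (- X) = - dmx X.
Proof. by apply/matrixP => i j; rewrite !mxE derivN. Qed.

Lemma dmx1 m : dmx (1%:M : 'M[A]_m) = 0.
Proof. by apply/matrixP => i j; rewrite !mxE derivMn deriv1 mul0rn. Qed.

Lemma dmxT m n (X : 'M[A]_(m, n)) : dmx X^T = (dmx X)^T.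
Proof. by apply/matrixP => i j; rewrite !mxE. Qed.

Lemma dmxM m n k (X : 'M[A]_(m, n)) (Y : 'M[A]_(n, k)) :
  dmx (X *m Y) = dmx X *m Y + X *m dmx Y.
Proof.
apply/matrixP => i j; rewrite !mxE deriv_sum -big_split /=.
by apply: eq_bigr => l _; rewrite derivM !mxE.
Qed.

Lemma deriv_tr m (X : 'M[A]_m) : d (\tr X) = \tr (dmx X).
Proof. by rewrite deriv_sum; apply: eq_bigr => i _; rewrite mxE. Qed.

Lemma dmx_entry m n (X : 'M[A]_(m, n)) i j : dmx X i j = d (X i j).
Proof. by rewrite mxE. Qed.

Lemma dmx_inv m (X Y : 'M[A]_m) : Y *m X = 1%:M -> X *m Y = 1%:M ->
  dmx Y = - (Y *m dmx X *m Y).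
Proof.
move=> YX XY; have : dmx (Y *m X) *m Y = 0 by rewrite YX dmx1 mul0mx.
rewrite dmxM mulmxDl -(mulmxA (dmx Y)) XY mulmx1 => /eqP.
by rewrite addr_eq0 => /eqP.
Qed.
End Derivation.

Lemma dmx_comm (A : comPzRingType) (d e : A -> A) m n (X : 'M[A]_(m, n)) :
  (forall x, d (e x) = e (d x)) -> dmx d (dmx e X) = dmx e (dmx d X).
Proof. by move=> de; apply/matrixP => i j; rewrite !mxE de. Qed.

(** * Levi-Civita connection, curvature and the Bianchi identities *)

Section Geometry.
Variables (A : comPzRingType) (n : nat) (half : A).
Hypothesis half2 : half * 2 = 1.
Variables (d : 'I_n -> A -> A) (g G : 'M[A]_n).
Hypothesis hd : forall k, derivation (d k).
Hypothesis dC : forall k l x, d k (d l x) = d l (d k x).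
Hypothesis gT : g^T = g.
Hypothesis Gg : G *m g = 1%:M.

Lemma metric_inv : g *m G = 1%:M.
Proof. exact: mulmx1C. Qed.
Local Notation gG := metric_inv.

Lemma inv_metricT : G^T = G.
Proof.
have e : g *m G^T = 1%:M by rewrite -{1}gT -trmx_mul Gg trmx1.
by rewrite -(mul1mx G^T) -Gg -mulmxA e mulmx1.
Qed.
Local Notation GT := inv_metricT.

Lemma metric_sym i j : g i j = g j i.
Proof. by rewrite -{1}gT mxE. Qed.

Lemma inv_metric_sym i j : G i j = G j i.
Proof. by rewrite -{1}GT mxE. Qed.

Lemma halfK x : half * x + half * x = x.
Proof. by rewrite -mulr2n -mulr_natl; ring: half2. Qed.

Lemma two_inj (x y : A) : x *+ 2 = y *+ 2 -> x = y.
Proof.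
move=> e; rewrite -[x]mul1r -[y]mul1r -half2.
by rewrite -!mulrA !mulr_natl e.
Qed.

(* Opaque, so that neither [mxE] nor unification unfolds it. *)
Fact Gam_subproof : {Y : 'I_n -> 'M[A]_n | forall k m l, Y k m l =
  half * \sum_r G m r * (d k (g l r) + d l (g k r) - d r (g k l))}.
Proof.
exists (fun k => \matrix_(m, l) (half *
  \sum_r G m r * (d k (g l r) + d l (g k r) - d r (g k l)))) => k m l.
by rewrite mxE.
Qed.

(** Connection matrix in the direction k: the entry (m, l) is the Christoffel symbol with upper
    index m and lower indices k, l. Covariant differentiation of a column is then [d k] plus a left
    multiplication. *)
Definition Gam : 'I_n -> 'M[A]_n := sval Gam_subproof.

Lemma GamE k m l : Gam k m l =
  half * \sum_r G m r * (d k (g l r) + d l (g k r) - d r (g k l)).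
Proof. exact: (svalP Gam_subproof). Qed.

Lemma Gam_sym k l m : Gam k m l = Gam l m k.
Proof.
rewrite !GamE; congr (_ * _); apply: eq_bigr => r _.
by rewrite (metric_sym k l); ring.
Qed.

Lemma Gam_lower k a l :
  (g *m Gam k) a l = half * (d k (g l a) + d l (g k a) - d a (g k l)).
Proof.
have -> : Gam k = half *: (G *m
    \matrix_(r, l) (d k (g l r) + d l (g k r) - d r (g k l))).
  apply/matrixP => i j; rewrite GamE !mxE; congr (_ * _).
  by apply: eq_bigr => r _; rewrite mxE.
by rewrite -scalemxAr mulmxA gG mul1mx !mxE.
Qed.

Lemma metric_compat k : dmx (d k) g = (Gam k)^T *m g + g *m Gam k.
Proof.
have -> : (Gam k)^T *m g = (g *m Gam k)^T by rewrite trmx_mul gT.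
apply/matrixP => a b; rewrite mx_entryD [(_^T) a b]mxE [dmx _ _ a b]mxE.
rewrite !Gam_lower (metric_sym b a) (metric_sym k b) (metric_sym k a).
by rewrite -{1}[d k _]halfK; ring.
Qed.

Lemma inv_metric_compat k :
  dmx (d k) G = - (Gam k *m G) - G *m (Gam k)^T.
Proof.
rewrite (dmx_inv (hd k) Gg gG) metric_compat mulmxDr mulmxDl.
rewrite (mulmxA G g) Gg mul1mx -!mulmxA gG mulmx1 opprD.
by rewrite addrC.
Qed.

(** Trace of metric compatibility: both of its terms have the trace of [Gam k]. Combined with
    Jacobi's formula this gives the derivative of the volume density. *)
Lemma tr_Gam k : \tr (Gam k) *+ 2 = \tr (G *m dmx (d k) g).
Proof.
rewrite metric_compat mulmxDr mxtraceD [G *m (g *m _)]mulmxA Gg mul1mx.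
by rewrite mxtrace_mulC -mulmxA gG mulmx1 mxtrace_tr mulr2n.
Qed.

Definition nab k (X : 'cV[A]_n) : 'cV[A]_n := dmx (d k) X + Gam k *m X.

(** Covariant derivative of an endomorphism. On [Riem l m] it leaves the form indices l and m
    uncorrected: the missing connection terms cancel in cyclic sums, and have to be tracked in the
    contractions below. *)
Definition nabE k (X : 'M[A]_n) : 'M[A]_n :=
  dmx (d k) X + Gam k *m X - X *m Gam k.

(** The curvature two-form of the connection, with values in matrices; the matrix entries are the
    remaining upper and lower index. *)
Definition Riem k l : 'M[A]_n :=
  dmx (d k) (Gam l) - dmx (d l) (Gam k) + Gam k *m Gam l - Gam l *m Gam k.

Definition Ric : 'M[A]_n := \matrix_(k, l) \sum_m Riem m l m k.

Definition Scal : A := \tr (G *m Ric).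

Lemma Riem_anti k l : Riem k l = - Riem l k.
Proof. by rewrite /Riem; mx_linear. Qed.

Lemma Ricci_identity k l X :
  nab k (nab l X) - nab l (nab k X) = Riem k l *m X.
Proof.
rewrite /nab /Riem !(dmxD (hd _)) !(dmxM (hd _)).
by rewrite (dmx_comm X (dC k l)); mx_linear.
Qed.

(** Mixed second derivatives of [G] commute. Once both are expressed through metric compatibility,
    their difference is the sum of [Riem k l *m G] and its transpose. *)
Lemma Riem_skew k l : (Riem k l *m G)^T = - (Riem k l *m G).
Proof.
have E a b : dmx (d a) (dmx (d b) G) =
    - (dmx (d a) (Gam b) *m G) + Gam b *m (Gam a *m G) + Gam b *m G *m (Gam a)^T
    + Gam a *m G *m (Gam b)^T + G *m (Gam a)^T *m (Gam b)^T
    - G *m (dmx (d a) (Gam b))^T.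
  rewrite inv_metric_compat (dmxD (hd a)) !(dmxN (hd a)) !(dmxM (hd a)) dmxT.
  by rewrite inv_metric_compat; mx_linear.
rewrite trmx_mul GT; apply/eqP; rewrite -subr_eq0 opprK; apply/eqP.
transitivity (dmx (d l) (dmx (d k) G) - dmx (d k) (dmx (d l) G)); last first.
  by rewrite (dmx_comm G (dC l k)) subrr.
rewrite !E /Riem !mx_trD !mx_trN !trmx_mul.
move: (dmx (d k) (Gam l)) (dmx (d l) (Gam k)) (Gam k) (Gam l) => X Y U V.
by move: X^T Y^T U^T V^T => X' Y' U' V'; mx_linear.
Qed.

(** The symmetry of the Christoffel symbols in their lower indices pairs the terms of the cyclic sum
    with opposite signs. *)
Lemma Bianchi1 k l m r : Riem k l r m + Riem l m r k + Riem m k r l = 0.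
Proof.
have e a b c : (Gam a *m Gam b) r c = (Gam a *m Gam c) r b.
  by rewrite !mxE; apply: eq_bigr => j _; rewrite (Gam_sym b c).
rewrite /Riem !mx_entry !dmx_entry (e k l m) (e l m k) (e m k l).
rewrite (Gam_sym l m r) (Gam_sym k m r) (Gam_sym l k r).
by ring.
Qed.

(** The trace of the skew matrix [Riem k l *m G] times the symmetric [g] is its own opposite, and 2
    is invertible. *)
Lemma tr_Riem k l : \tr (Riem k l) = 0.
Proof.
have e : \tr (Riem k l) = - \tr (Riem k l).
  rewrite -{1}(mulmx1 (Riem k l)) -Gg mulmxA mxtrace_mulC -mxtrace_tr.
  rewrite trmx_mul Riem_skew gT mulNmx linearN /= -mulmxA Gg mulmx1.
  by [].
by apply: two_inj; rewrite mul0rn mulr2n {1}e addNr.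
Qed.

(** By the first Bianchi identity the antisymmetric part of [Ric] is a trace of the curvature
    matrix, hence zero. *)
Lemma Ric_sym k l : Ric k l = Ric l k.
Proof.
apply/eqP; rewrite -subr_eq0 !mxE -sumrB; apply/eqP.
rewrite -[RHS](tr_Riem k l); apply: eq_bigr => m _.
have := Bianchi1 m l k m; rewrite (Riem_anti k m) (Riem_anti l k) !mx_entry.
by move/eqP; rewrite addrAC subr_eq0 => /eqP.
Qed.

Lemma RicT : Ric^T = Ric.
Proof. by apply/matrixP => i j; rewrite mxE Ric_sym. Qed.

Lemma Bianchi2 k l m :
  nabE k (Riem l m) + nabE l (Riem m k) + nabE m (Riem k l) = 0.
Proof.
rewrite /nabE /Riem !(dmxD (hd _)) !(dmxN (hd _)) !(dmxM (hd _)).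
rewrite (dmx_comm (Gam m) (dC k l)) (dmx_comm (Gam l) (dC k m)).
by rewrite (dmx_comm (Gam k) (dC l m)); mx_linear.
Qed.

Lemma tr_nabE k X : \tr (nabE k X) = d k (\tr X).
Proof.
rewrite /nabE !mxtraceD [\tr (- _)]raddfN /= (mxtrace_mulC X) addrK.
by rewrite (deriv_tr (hd k)).
Qed.

Lemma nabE_raise k X : nabE k X *m G =
  dmx (d k) (X *m G) + Gam k *m (X *m G) + X *m G *m (Gam k)^T.
Proof. by rewrite (dmxM (hd k)) inv_metric_compat /nabE; mx_linear. Qed.

Lemma RiemG_anti k l i j : (Riem k l *m G) i j = - (Riem k l *m G) j i.
Proof. by rewrite -[in RHS]mx_entryN -Riem_skew [RHS]mxE. Qed.

Lemma RiemG_Ric k m : \sum_l (Riem k l *m G) m l = (G *m Ric) m k.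
Proof.
under eq_bigr do rewrite Riem_anti mulNmx mx_entryN RiemG_anti opprK !mxE.
rewrite exchange_big mxE; apply: eq_bigr => r _ /=.
by rewrite -mulr_suml (inv_metric_sym r m) [Ric r k]mxE mulrC.
Qed.

(** The second Bianchi identity with an index raised, contracted twice. Two terms of the cyclic sum
    become [X], essentially the divergence of the Ricci tensor; the third becomes [Y], essentially
    minus the derivative of [Scal]. *)
Lemma contracted_Bianchi k :
  (\sum_m nabE m (G *m Ric) m k) *+ 2 = d k Scal.
Proof.
set Q := G *m Ric.
pose B k l := Riem k l *m G.
pose D2 k (X : 'M[A]_n) := dmx (d k) X + Gam k *m X + X *m (Gam k)^T.
have B0 a b c : D2 a (B b c) + D2 b (B c a) + D2 c (B a b) = 0.
  by rewrite /D2 -!nabE_raise -!mulmxDl Bianchi2 mul0mx.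
have BT b c : (B b c)^T = B c b.
  by rewrite /B Riem_skew (Riem_anti c b) mulNmx.
have D2T a b c i j : D2 a (B b c) i j = D2 a (B c b) j i.
  by rewrite -BT /D2 dmxT -mx_entryT !mx_trD !trmx_mul !trmxK !mx_entry; ring.
pose X := \sum_m \sum_l D2 m (B k l) m l.
pose Y := \sum_m \sum_l D2 k (B l m) m l.
have XY : X *+ 2 + Y = 0.
  have : \sum_m \sum_l (D2 m (B k l) + D2 k (B l m) + D2 l (B m k)) m l = 0.
    by apply: big1 => m _; apply: big1 => l _; rewrite B0 mx_entry0.
  have e3 (U V W : 'M[A]_n) m l : (U + V + W) m l = U m l + V m l + W m l.
    by rewrite !mx_entryD.
  under eq_bigr do under eq_bigr do rewrite e3.
  under eq_bigr do rewrite !big_split /=.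
  rewrite !big_split /= -/X -/Y => <-.
  rewrite (_ : \sum_i \sum_j D2 j (B i k) i j = X); first by ring.
  by rewrite exchange_big /=; apply: eq_bigr => m _; apply: eq_bigr => l _.
(* [Z] collects the connection terms of the form indices, which [nabE] leaves out. It enters [X]
   with factor 1 and [Y] with factor -2, and so drops out of 2 X + Y. *)
pose Z := \sum_m \sum_j Q m j * Gam k j m.
(* A factor skew in m and r is contracted with Christoffel symbols symmetric in m and r. *)
have T0 : \sum_m \sum_l (B k l *m (Gam m)^T) m l = 0.
  apply: two_inj; rewrite mul0rn mulr2n -[X in _ + X]opprK; apply/eqP.
  rewrite subr_eq0 exchange_big /=; apply/eqP.
  rewrite -sumrN; apply: eq_bigr => l _.
  under eq_bigr do rewrite mxE.
  rewrite -sumrN exchange_big /=; apply: eq_bigr => r _.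
  rewrite -sumrN; apply: eq_bigr => m _.
  by rewrite !mx_entryT (Gam_sym m r l) /B RiemG_anti mulNr.
have eX : X = \sum_m nabE m Q m k + Z.
  transitivity (\sum_m (nabE m Q m k + \sum_j Q m j * Gam k j m
                        + \sum_l (B k l *m (Gam m)^T) m l)); last first.
    by rewrite !big_split /= T0 addr0.
  apply: eq_bigr => m _.
  under eq_bigr do rewrite /D2 !mx_entryD !dmx_entry.
  rewrite !big_split /= -(deriv_sum (hd m)) RiemG_Ric /nabE !mx_entry dmx_entry.
  rewrite (_ : \sum_i (Gam m *m B k i) m i = (Gam m *m Q) m k); last first.
    under eq_bigr do rewrite mxE.
    rewrite exchange_big mxE; apply: eq_bigr => r _ /=.
    by rewrite -mulr_sumr RiemG_Ric.
  rewrite (_ : (Q *m Gam m) m k = \sum_j Q m j * Gam k j m); first by ring.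
  by rewrite mxE; apply: eq_bigr => j _; rewrite (Gam_sym m k).
have eY : Y = - d k Scal - Z *+ 2.
  rewrite /Y; under eq_bigr do under eq_bigr do
    rewrite /D2 !mx_entryD !dmx_entry.
  under eq_bigr do rewrite !big_split /=.
  rewrite !big_split /= mulr2n opprD addrA; congr (_ + _ + _).
  - under eq_bigr do rewrite -(deriv_sum (hd k)).
    rewrite -(deriv_sum (hd k)) -(derivN (hd k)); congr (d k _).
    rewrite -sumrN; apply: eq_bigr => m _; rewrite -RiemG_Ric -sumrN.
    by apply: eq_bigr => l _; rewrite /B Riem_anti mulNmx mx_entryN.
  - rewrite -sumrN [RHS](_ : _ = \sum_m \sum_j - (Q m j * Gam k j m)); last first.
      by apply: eq_bigr => m _; rewrite sumrN.
    rewrite [RHS]exchange_big /=; apply: eq_bigr => m _.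
    under eq_bigr do rewrite mxE.
    rewrite exchange_big /=; apply: eq_bigr => r _.
    rewrite -mulr_sumr mulrC -mulNr; congr (_ * _).
    by rewrite -RiemG_Ric -sumrN; apply: eq_bigr => l _;
       rewrite /B Riem_anti mulNmx mx_entryN.
  - under eq_bigr do under eq_bigr do rewrite mxE.
    rewrite exchange_big /= -sumrN.
    under eq_bigr do rewrite exchange_big /=.
    rewrite exchange_big /=; apply: eq_bigr => r _.
    rewrite -sumrN; apply: eq_bigr => l _.
    rewrite -mulr_suml mx_entryT -mulNr; congr (_ * _).
    rewrite -RiemG_Ric -sumrN; apply: eq_bigr => m _.
    exact: RiemG_anti.
by apply/eqP; rewrite -subr_eq0 -[X in _ == X]XY eX eY; apply/eqP; ring.
Qed.

(** * Gradient, Hessian, Laplacian and the Bochner formula *)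

Definition grad (f : A) : 'cV[A]_n := G *m \col_k d k f.

Definition Hess (f : A) : 'M[A]_n :=
  \matrix_(k, l) (d k (d l f) - \sum_m Gam k m l * d m f).

Definition Lap (f : A) : A := \tr (G *m Hess f).

Definition Inner (a b : A) : A := \sum_k \sum_l G k l * d k a * d l b.

Definition Div (Y : 'cV[A]_n) : A := \sum_k nab k Y k 0.

Lemma Hess_sym f k l : Hess f k l = Hess f l k.
Proof.
rewrite !mxE dC; congr (_ - _); apply: eq_bigr => m _.
by rewrite Gam_sym.
Qed.

Lemma HessT f : (Hess f)^T = Hess f.
Proof. by apply/matrixP => i j; rewrite mxE Hess_sym. Qed.

Lemma gradE f k : grad f k 0 = \sum_l G k l * d l f.
Proof. by rewrite mxE; apply: eq_bigr => l _; rewrite mxE. Qed.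

Lemma InnerE a b : Inner a b = \sum_k d k a * grad b k 0.
Proof.
apply: eq_bigr => k _; rewrite gradE mulr_sumr; apply: eq_bigr => l _.
by ring.
Qed.

Lemma Inner_sym a b : Inner a b = Inner b a.
Proof.
rewrite /Inner exchange_big; apply: eq_bigr => k _; apply: eq_bigr => l _ /=.
by rewrite inv_metric_sym; ring.
Qed.

Lemma Inner_grad a b : Inner a b = ((grad a)^T *m g *m grad b) 0 0.
Proof.
rewrite /grad trmx_mul inv_metricT -!mulmxA (mulmxA g) gG mul1mx InnerE mxE.
by apply: eq_bigr => k _; rewrite !mxE.
Qed.

Lemma nab_lower k X : (g *m nab k X) = dmx (d k) (g *m X) - (Gam k)^T *m (g *m X).
Proof. by rewrite (dmxM (hd k)) metric_compat /nab; mx_linear. Qed.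

Lemma nab_grad k f : nab k (grad f) = G *m col k (Hess f).
Proof.
rewrite -[LHS]mul1mx -Gg -mulmxA; congr (_ *m _).
rewrite nab_lower /grad mulmxA gG mul1mx.
apply/matrixP => i j; rewrite !mxE dC; congr (_ - _).
by apply: eq_bigr => m _; rewrite !mxE Gam_sym.
Qed.

Lemma Div_grad f : Div (grad f) = Lap f.
Proof.
apply: eq_bigr => k _; rewrite nab_grad !mxE; apply: eq_bigr => l _.
by rewrite !mxE.
Qed.

Lemma d_Inner l a b :
  d l (Inner a b) = (Hess a *m grad b) l 0 + (Hess b *m grad a) l 0.
Proof.
have e (X Y : 'cV[A]_n) : d l ((X^T *m g *m Y) 0 0)
    = ((nab l X)^T *m g *m Y) 0 0 + (X^T *m g *m nab l Y) 0 0.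
  rewrite -dmx_entry !(dmxM (hd l)) dmxT metric_compat -mx_entryD.
  congr (fun_of_matrix _ 0 0); rewrite /nab !mx_trD trmx_mul.
  by mx_linear.
rewrite Inner_grad e !nab_grad; congr (_ + _).
  rewrite trmx_mul inv_metricT -(mulmxA _ G) Gg mulmx1.
  rewrite mxE [RHS]mxE; apply: eq_bigr => k _.
  by rewrite mx_entryT [col _ _ _ _]mxE Hess_sym.
rewrite -(mulmxA _ g) (mulmxA g) gG mul1mx mxE [RHS]mxE.
by apply: eq_bigr => k _; rewrite mx_entryT [col _ _ _ _]mxE Hess_sym mulrC.
Qed.

(** Polarised form of the derivative of an inner product: the Hessian is determined by iterated
    inner products of gradients. Since these obey the first order chain rule, the Laplacian can be
    shown invariant under changes of chart without second derivatives of the transition maps. *)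
Lemma Hess_Inner f a b :
  ((grad a)^T *m Hess f *m grad b) 0 0 *+ 2 =
  Inner a (Inner f b) + Inner b (Inner f a) - Inner f (Inner a b).
Proof.
have i3 x y z : Inner x (Inner y z) = ((grad x)^T *m Hess y *m grad z) 0 0
                                    + ((grad x)^T *m Hess z *m grad y) 0 0.
  rewrite Inner_sym InnerE -!mulmxA mxE [X in _ = _ + X]mxE -big_split.
  apply: eq_bigr => k _; rewrite d_Inner !mx_entryT /= -mulrDr.
  by rewrite mulrC.
have tr11 (X : 'M[A]_1) : X 0 0 = X^T 0 0 by rewrite mxE.
have s x y z : ((grad x)^T *m Hess y *m grad z) 0 0
             = ((grad z)^T *m Hess y *m grad x) 0 0.
  by rewrite [LHS]tr11 trmx_mul (trmx_mul (grad x)^T) trmxK HessT mulmxA.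
rewrite !i3 (s b f a) (s b a f) (s a b f) (s f a b); ring.
Qed.

Definition sqn (S : 'M[A]_n) : A :=
  \sum_k \sum_l \sum_m \sum_r G k m * G l r * S k l * S m r.

Lemma sqnE S : S^T = S -> sqn S = \tr (G *m S *m G *m S).
Proof.
move=> ST; have Ss i j : S i j = S j i by rewrite -{1}ST mxE.
transitivity (\tr (G^T *m (S *m G *m S^T))); last by rewrite GT ST !mulmxA.
rewrite /mxtrace; under [RHS]eq_bigr do rewrite mxE.
rewrite [RHS]exchange_big /=; apply: eq_bigr => k _.
rewrite exchange_big /=; apply: eq_bigr => m _.
rewrite !mxE mulr_sumr exchange_big /=; apply: eq_bigr => r _.
rewrite !mxE mulr_suml mulr_sumr; apply: eq_bigr => l _.
by ring.
Qed.

Lemma LapD a b : Lap (a + b) = Lap a + Lap b.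
Proof.
rewrite -mxtraceD -mulmxDr; congr (\tr (_ *m _)).
apply/matrixP => k l; rewrite !mxE !(derivD (hd _)).
under eq_bigr do rewrite (derivD (hd _)) mulrDr.
by rewrite big_split /=; ring.
Qed.

Lemma LapN a : Lap (- a) = - Lap a.
Proof.
have l0 : Lap 0 = 0 by apply: (addrI (Lap 0)); rewrite -LapD !addr0.
by apply: (addrI (Lap a)); rewrite -LapD !subrr.
Qed.

Lemma InnerDr a b c : Inner a (b + c) = Inner a b + Inner a c.
Proof.
rewrite /Inner -big_split; apply: eq_bigr => k _; rewrite -big_split.
by apply: eq_bigr => l _ /=; rewrite (derivD (hd _)); ring.
Qed.

Lemma InnerNr a b : Inner a (- b) = - Inner a b.
Proof.
rewrite /Inner -sumrN; apply: eq_bigr => k _; rewrite -sumrN.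
by apply: eq_bigr => l _ /=; rewrite (derivN (hd _)); ring.
Qed.

Lemma LapM a b : Lap (a * b) = a * Lap b + b * Lap a + Inner a b *+ 2.
Proof.
have HM : Hess (a * b) = a *: Hess b + b *: Hess a
    + \matrix_(k, l) (d k a * d l b + d l a * d k b).
  apply/matrixP => k l; rewrite !mxE (derivM (hd l)) (derivD (hd k)).
  rewrite !(derivM (hd k)) !mulrBr !mulr_sumr.
  under eq_bigr do rewrite (derivM (hd _)) mulrDr.
  rewrite big_split /=.
  rewrite (_ : \sum_(i < n) Gam k i l * (d i a * b)
             = \sum_(i < n) b * (Gam k i l * d i a)); last first.
    by apply: eq_bigr => i _; ring.
  rewrite (_ : \sum_(i < n) Gam k i l * (a * d i b)
             = \sum_(i < n) a * (Gam k i l * d i b)); last first.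
    by apply: eq_bigr => i _; ring.
  by ring.
rewrite /Lap HM !mulmxDr !mxtraceD -!scalemxAr !mxtraceZ; congr (_ + _).
rewrite mulr2n {1}Inner_sym /Inner -big_split; apply: eq_bigr => k _.
rewrite mxE -big_split; apply: eq_bigr => l _ /=.
by rewrite mxE; ring.
Qed.

(** The hypothesis stands for u = exp L: the ring carries no exponential, and only logarithmic
    derivatives enter. *)
Lemma Lap_exp u L : (forall k, d k u = u * d k L) ->
  Lap u = u * (Lap L + Inner L L).
Proof.
move=> du; have HM : Hess u = u *: Hess L + u *: \matrix_(k, l) (d k L * d l L).
  apply/matrixP => k l; rewrite !mxE du (derivM (hd k)) du.
  under eq_bigr do rewrite du mulrCA.
  by rewrite -mulr_sumr; ring.
rewrite /Lap HM mulmxDr mxtraceD -!scalemxAr !mxtraceZ -mulrDr.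
congr (_ * (_ + _)); apply: eq_bigr => k _; rewrite mxE.
by apply: eq_bigr => l _ /=; rewrite mxE; ring.
Qed.

Lemma Div_mul X (N : 'M[A]_n) :
  Div (N *m X) = \sum_k (nabE k N *m X) k 0 + \sum_k (N *m nab k X) k 0.
Proof.
rewrite /Div -big_split; apply: eq_bigr => k _ /=.
rewrite -mx_entryD; congr (fun_of_matrix _ k 0); rewrite /nab /nabE (dmxM (hd k)).
by mx_linear.
Qed.

(** Half the gradient of |df|^2 is [N *m X], with N the Hessian as an endomorphism. Its divergence
    is the square of the Hessian plus the divergence of N applied to the gradient. *)
Lemma Bochner f : Lap (Inner f f) =
  (\tr (G *m Hess f *m G *m Hess f) + Inner f (Lap f)
   + ((grad f)^T *m Ric *m grad f) 0 0) *+ 2.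
Proof.
set X := grad f; set N := G *m Hess f.
have gI : grad (Inner f f) = (N *m X) + (N *m X).
  rewrite /N -mulmxA -mulmxDr /grad; congr (_ *m _).
  by apply/colP => l; rewrite mxE d_Inner mx_entryD.
have nX k : nab k X = col k N.
  apply/colP => i; rewrite nab_grad mxE [RHS]mxE [RHS]mxE.
  by apply: eq_bigr => l _; rewrite [col _ _ _ _]mxE.
(* The divergence of the Hessian is the differential of the Laplacian plus a Ricci term: exchanging
   the two covariant derivatives costs a curvature, whose contraction is [Ric]. *)
have dN l : \sum_k nabE k N k l = d l (Lap f) + (Ric *m X) l 0.
  have e k : nabE k N k l = nabE l N k k + (Riem k l *m X) k 0.
    rewrite -Ricci_identity !nX /nab /nabE !mx_entry !dmx_entry !mxE.
    rewrite (_ : \sum_j N k j * Gam k j l = \sum_j N k j * Gam l j k); last first.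
      by apply: eq_bigr => j _; rewrite Gam_sym.
    under [X in _ = _ + (_ + X - _)]eq_bigr do rewrite mxE.
    under [X in _ = _ + (_ - (_ + X))]eq_bigr do rewrite mxE.
    by ring.
  under eq_bigr do rewrite e.
  rewrite big_split /=; congr (_ + _).
    by rewrite -/(mxtrace _) tr_nabE.
  rewrite mxE; under eq_bigr do rewrite mxE.
  rewrite exchange_big; apply: eq_bigr => r _ /=.
  by rewrite -mulr_suml Ric_sym [Ric r l]mxE.
rewrite -Div_grad gI /Div.
have nD k (Y Z : 'cV[A]_n) : nab k (Y + Z) = nab k Y + nab k Z.
  by rewrite /nab (dmxD (hd k)) mulmxDr; apply/matrixP => ? ?; rewrite !mx_entry; ring.
under eq_bigr do rewrite nD mx_entryD.
rewrite big_split /= -mulr2n -/(Div _) Div_mul; congr (_ *+ 2).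
rewrite addrC -addrA; congr (_ + _).
  rewrite -(mulmxA _ G) -/N.
  apply: eq_bigr => k _; rewrite nX mxE [RHS]mxE.
  by apply: eq_bigr => l _; rewrite [col _ _ _ _]mxE.
under eq_bigr do rewrite mxE.
rewrite exchange_big /=; under eq_bigr do rewrite -mulr_suml dN mulrDl.
rewrite big_split /=; congr (_ + _).
  by rewrite Inner_sym InnerE.
rewrite -mulmxA [RHS]mxE; apply: eq_bigr => k _.
by rewrite mulrC mx_entryT.
Qed.

(* Jacobi's formula, by Laplace expansion along the row that is derived. *)
Lemma deriv_det e m (X : 'M[A]_m) : derivation e ->
  e (\det X) = \tr (\adj X *m dmx e X).
Proof.
move=> he.
pose Xi i := \matrix_(a, b) (if a == i then e (X a b) else X a b).
transitivity (\sum_i \det (Xi i)).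
  have eprod s i : \prod_j Xi i j (s j) = e (X i (s i)) * \prod_(j | j != i) X j (s j).
    rewrite (bigD1 i) //= mxE eqxx; congr (_ * _).
    by apply: eq_bigr => j /negPf ji; rewrite mxE ji.
  have dprod (I : eqType) (r : seq I) (F : I -> A) : uniq r ->
      e (\prod_(j <- r) F j)
      = \sum_(i <- r) e (F i) * \prod_(j <- r | j != i) F j.
    elim: r => [|x r ih] /=; first by rewrite !big_nil (deriv1 he).
    case/andP => xr ur; rewrite !big_cons eqxx /= (derivM he) ih // mulr_sumr.
    congr (_ * _ + _).
      rewrite [RHS]big_seq_cond [LHS]big_seq; apply: eq_bigl => j.
      by case: (boolP (j \in r)) => //= jr; apply/esym; apply: contraNneq xr => <-.
    rewrite [LHS]big_seq [RHS]big_seq; apply: eq_bigr => j jr; rewrite big_cons.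
    have -> : x != j by apply: contraNneq xr => ->.
    by rewrite mulrCA.
  rewrite /determinant (deriv_sum he) exchange_big /=; apply: eq_bigr => s _.
  rewrite (derivM he) (_ : e ((-1) ^+ perm.odd_perm s) = 0) ?mul0r ?add0r; last first.
    by case: (perm.odd_perm s); rewrite ?expr1 ?expr0 ?(derivN he) (deriv1 he) ?oppr0.
  by rewrite -mulr_sumr dprod ?index_enum_uniq //; congr (_ * _);
     apply: eq_bigr => i _; rewrite eprod.
rewrite mxtrace_mulC; apply: eq_bigr => i _; rewrite (expand_det_row _ i) mxE.
apply: eq_bigr => j _; rewrite !mxE eqxx; congr (_ * _).
rewrite /cofactor; congr (_ * \det _); apply/matrixP => a b; rewrite !mxE.
by rewrite eq_sym (negPf (neq_lift _ _)).
Qed.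

(** * The divergence and the volume density *)

Section Volume.
Variables (rho rho' : A).
Hypothesis rho2 : rho * rho = \det g.
Hypothesis rhoV : rho * rho' = 1.

Lemma deriv_volume e : derivation e ->
  e rho *+ 2 = rho * \tr (G *m dmx e g).
Proof.
move=> he; have adjE : \adj g = (rho * rho) *: G.
  have := mul_adj_mx g; rewrite -rho2 => /(congr1 (mulmx^~ G)).
  by rewrite -mulmxA gG mulmx1 mul_scalar_mx.
have : e (rho * rho) = rho * rho * \tr (G *m dmx e g).
  by rewrite rho2 (deriv_det _ he) adjE -scalemxAl mxtraceZ rho2.
rewrite (derivM he) => /(congr1 ( *%R rho')) h.
transitivity (rho' * (e rho * rho + rho * e rho)).
  by rewrite mulr2n -{1 2}(mulr1 (e rho)) -rhoV; ring.
by rewrite h -[in RHS](mulr1 rho) -rhoV; ring.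
Qed.

(** As [d k rho = rho * \tr (Gam k)], the density absorbs the connection term of the divergence. The
    left-hand side is a plain coordinate divergence, which integrates to zero under compact
    support. *)
Lemma divergence_form (X : 'cV[A]_n) :
  \sum_k d k (rho * X k 0) = rho * Div X.
Proof.
rewrite /Div mulr_sumr.
have dr k : d k rho = rho * \tr (Gam k).
  by apply: two_inj; rewrite deriv_volume // -mulrnAr tr_Gam.
under eq_bigr do rewrite (derivM (hd _)) dr.
under [RHS]eq_bigr do rewrite /nab mx_entryD dmx_entry mulrDr.
rewrite !big_split /= addrC; congr (_ + _).
under [RHS]eq_bigr do rewrite mxE mulr_sumr.
rewrite [RHS]exchange_big; apply: eq_bigr => k _ /=.
rewrite -mulrA mulr_suml mulr_sumr; apply: eq_bigr => l _.
by rewrite (Gam_sym k).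
Qed.

Lemma divergence_Green a b :
  \sum_k d k (rho * (a * grad b k 0 - b * grad a k 0))
  = rho * (a * Lap b - b * Lap a).
Proof.
have DivZ x (Y : 'cV[A]_n) : Div (x *: Y) = x * Div Y + \sum_k d k x * Y k 0.
  rewrite /Div mulr_sumr -big_split; apply: eq_bigr => k _.
  by rewrite /nab -scalemxAr !mx_entry !dmx_entry mx_entryZ (derivM (hd k)) /=; ring.
have DivB (Y Z : 'cV[A]_n) : Div (Y - Z) = Div Y - Div Z.
  rewrite /Div -sumrB; apply: eq_bigr => k _.
  rewrite /nab mulmxDr mulmxN !mx_entry !dmx_entry !mx_entry.
  by rewrite (derivD (hd k)) (derivN (hd k)); ring.
rewrite (_ : \sum_k _ = \sum_k d k (rho * (a *: grad b - b *: grad a) k 0)).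
  rewrite divergence_form DivB !DivZ !Div_grad -!InnerE (Inner_sym b); ring.
by apply: eq_bigr => k _; rewrite !mx_entry.
Qed.
End Volume.

(** * Evolution of geometric quantities under the Ricci flow *)

Section Flow.
Variable delta : A -> A.
Hypothesis hdelta : derivation delta.
Hypothesis deltaC : forall k x, delta (d k x) = d k (delta x).
Hypothesis flow : dmx delta g = - (Ric + Ric).

Let C k := dmx delta (Gam k).

Lemma flow_inv : dmx delta G = G *m Ric *m G + G *m Ric *m G.
Proof.
by rewrite (dmx_inv hdelta Gg gG) flow mulmxN mulmxDr mulNmx opprK mulmxDl.
Qed.

Lemma flow_volume (rho rho' : A) : rho * rho = \det g -> rho * rho' = 1 ->
  delta rho = - (Scal * rho).
Proof.
move=> r2 rV; apply: two_inj; rewrite (deriv_volume r2 rV hdelta) flow.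
by rewrite mulmxN raddfN /= mulmxDr mxtraceD -/Scal; ring.
Qed.

(** Metric compatibility differentiated in time. Only the symmetric part of [C k *m G] is found;
    with the symmetry of the lower indices it determines the two contractions that follow. *)
Lemma flow_Gam k :
  C k *m G + (C k *m G)^T = - (nabE k (G *m Ric) *m G) *+ 2.
Proof.
have e : dmx (d k) (dmx delta g) = (C k)^T *m g + g *m C k
    + (Gam k)^T *m dmx delta g + dmx delta g *m Gam k.
  rewrite (dmx_comm g (fun x => esym (deltaC k x))) metric_compat.
  by rewrite (dmxD hdelta) !(dmxM hdelta) dmxT /C; mx_linear.
have eR : dmx (d k) Ric = (Gam k)^T *m Ric + g *m Gam k *m G *m Ric
    + g *m dmx (d k) (G *m Ric).
  rewrite -{1}(mul1mx Ric) -gG -mulmxA (dmxM (hd k)) metric_compat.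
  rewrite mulmxDl -!mulmxA (mulmxA g G) gG mul1mx.
  by [].
have h : (C k)^T *m g + g *m C k = - (g *m nabE k (G *m Ric)) *+ 2.
  apply/eqP; rewrite -(inj_eq (addIr ((Gam k)^T *m dmx delta g + dmx delta g *m Gam k))).
  rewrite addrA -e flow (dmxN (hd k)) (dmxD (hd k)) eR /nabE mulr2n.
  apply/eqP; rewrite !mulmxDr !mulmxN (mulmxA g _ (Gam k)) (mulmxA g G) gG mul1mx.
  by rewrite !mulmxA; mx_linear.
have := congr1 (fun X => G *m X *m G) h; rewrite mulmxDr mulmxDl.
rewrite -!(mulmxA G) -(mulmxA _ g) gG mulmx1.
rewrite -(mulmxA g) [G *m (g *m _)]mulmxA Gg mul1mx trmx_mul GT addrC => ->.
rewrite mulr2n mulmxDl mulmxDr !mulNmx !mulmxN -(mulmxA g) (mulmxA G g) Gg.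
by rewrite mul1mx mulr2n.
Qed.

Lemma flow_tr_Gam k : \tr (C k) = - d k Scal.
Proof.
apply: two_inj; have := congr1 (fun X => \tr (X *m g)) (flow_Gam k).
rewrite mulmxDl mxtraceD -mulmxA Gg mulmx1 trmx_mul GT.
rewrite -[in X in _ + X = _]mulmxA mxtrace_mulC -mulmxA gG mulmx1 mxtrace_tr.
rewrite -mulr2n => ->; rewrite mulr2n mulmxDl mxtraceD !mulNmx -mulmxA Gg mulmx1.
by rewrite raddfN /= tr_nabE mulr2n.
Qed.

(** The contraction is minus twice the divergence of Ricci minus the other contraction of [C], and
    the contracted Bianchi identity makes these cancel. This is why the variation of the Laplacian
    has no first order term. *)
Lemma flow_contr_Gam m : \sum_k (C k *m G) m k = 0.
Proof.
have h k : (C k *m G) m k = - (nabE k (G *m Ric) *m G) k m *+ 2 - (C k *m G) k m.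
  have := flow_Gam k; rewrite mulr2n.
  move: (C k *m G) (nabE _ _ *m G) => U V /matrixP/(_ k m).
  by rewrite !mxE mulr2n => <-; ring.
under eq_bigr do rewrite h.
rewrite big_split /= sumrN sumrMnl.
have -> : (\sum_k - (nabE k (G *m Ric) *m G) k m) *+ 2
        = - \sum_r d r Scal * G r m.
  rewrite sumrN mulNrn -sumrMnl; congr (- _).
  under eq_bigr do rewrite mxE -sumrMnl.
  rewrite exchange_big; apply: eq_bigr => r _ /=.
  by rewrite -contracted_Bianchi sumrMnl -mulr_suml mulrnAl.
rewrite (_ : \sum_k (C k *m G) k m = - \sum_r d r Scal * G r m) ?subrr //.
under eq_bigr do rewrite mxE.
rewrite exchange_big -sumrN; apply: eq_bigr => r _ /=.
rewrite -mulr_suml -mulNr -flow_tr_Gam; congr (_ * _); apply: eq_bigr => k _.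
by rewrite !dmx_entry Gam_sym.
Qed.

Lemma flow_Lap f :
  delta (Lap f) = Lap (delta f) + \tr (G *m Ric *m G *m Hess f) *+ 2.
Proof.
have dH : dmx delta (Hess f) = Hess (delta f)
    - \matrix_(k, l) \sum_m C k m l * d m f.
  apply/matrixP => k l; rewrite !mxE (derivB hdelta) !deltaC -addrA.
  congr (_ + _); rewrite -opprD -big_split (deriv_sum hdelta) /=; congr (- _).
  by apply: eq_bigr => m _; rewrite (derivM hdelta) deltaC !mxE addrC.
rewrite /Lap (deriv_tr hdelta) (dmxM hdelta) flow_inv dH !mulmxDl !mulmxDr.
rewrite !mxtraceD addrC [X in _ + X + _](_ : _ = 0) ?addr0 -?mulr2n //.
rewrite mulmxN raddfN /= /mxtrace.
under eq_bigr do rewrite mxE; under eq_bigr do under eq_bigr do rewrite mxE mulr_sumr.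
rewrite exchange_big /= (_ : \sum_j _ =
    \sum_m (\sum_k (C k *m G) m k) * d m f).
  by rewrite big1 ?oppr0 // => m _; rewrite flow_contr_Gam mul0r.
under eq_bigr do rewrite exchange_big /=.
rewrite exchange_big; apply: eq_bigr => m _ /=; rewrite mulr_suml.
apply: eq_bigr => k _; rewrite mxE mulr_suml; apply: eq_bigr => l _.
by rewrite inv_metric_sym; ring.
Qed.

(** The variation of the curvature is the antisymmetrised covariant derivative [K] of the variation
    of the connection. In the contraction of its two halves, [flow_contr_Gam] removes the
    derivatives from one, and [flow_tr_Gam] turns the other into the divergence of the gradient of
    [Scal]. *)
Lemma flow_Scal : delta Scal = Lap Scal + \tr (G *m Ric *m G *m Ric) *+ 2.
Proof.
pose K (m l : 'I_n) := nabE m (C l) - nabE l (C m).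
have dRiem m l : dmx delta (Riem m l) = K m l.
  rewrite /K /Riem !(dmxD hdelta) !(dmxN hdelta) !(dmxM hdelta) /nabE /C.
  rewrite (dmx_comm (Gam l) (deltaC m)) (dmx_comm (Gam m) (deltaC l)).
  by mx_linear.
have dRic : dmx delta Ric = \matrix_(k, l) \sum_m K m l m k.
  apply/matrixP => k l; rewrite !mxE (deriv_sum hdelta).
  by apply: eq_bigr => m _; rewrite -dRiem dmx_entry.
rewrite [LHS](deriv_tr hdelta) (dmxM hdelta) flow_inv mulmxDl !mxtraceD.
rewrite -mulr2n addrC; congr (_ + _); rewrite dRic.
transitivity (\sum_m \sum_l (nabE m (C l) *m G) m l
              - \sum_m \sum_l (nabE l (C m) *m G) m l).
  rewrite /mxtrace; under eq_bigr do rewrite mxE.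
  under eq_bigr do under eq_bigr do rewrite mxE mulr_sumr.
  under eq_bigr do rewrite exchange_big /=.
  rewrite exchange_big /= -sumrB; apply: eq_bigr => m _; rewrite -sumrB.
  apply: eq_bigr => k _.
  have e (X Y Z : 'M[A]_n) i j : (X *m Z) i j - (Y *m Z) i j = ((X - Y) *m Z) i j.
    by rewrite mulmxBl !mx_entry.
  rewrite e mxE.
  by apply: eq_bigr => l _; rewrite inv_metric_sym mulrC.
pose V := grad Scal.
have eV l : \sum_m (C m *m G) m l = - V l 0.
  rewrite /V gradE -sumrN; under eq_bigr do rewrite mxE.
  rewrite exchange_big; apply: eq_bigr => r _ /=.
  rewrite -mulr_suml inv_metric_sym -mulrN mulrC -flow_tr_Gam.
  by congr (_ * _); apply: eq_bigr => m _; rewrite !dmx_entry Gam_sym.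
(* Connection term of the form index that [nabE] leaves out; it occurs in both sums and cancels. *)
pose T := \sum_m \sum_l (Gam l *m (C m *m G)) m l.
have -> : \sum_m \sum_l (nabE m (C l) *m G) m l = T.
  under eq_bigr do under eq_bigr do rewrite nabE_raise !mx_entryD dmx_entry.
  under eq_bigr do rewrite !big_split /=.
  rewrite !big_split /= big1 ?add0r; last first.
    by move=> m _; rewrite -(deriv_sum (hd m)) flow_contr_Gam (deriv0 (hd m)).
  rewrite big1 ?add0r; last first.
    move=> m _; under eq_bigr do rewrite mxE.
    rewrite exchange_big big1 // => r _ /=.
    by rewrite -mulr_sumr flow_contr_Gam mulr0.
  rewrite exchange_big; apply: eq_bigr => m _ /=.
  under eq_bigr do rewrite mxE; under [RHS]eq_bigr do rewrite mxE.
  rewrite [RHS]exchange_big; apply: eq_bigr => l _; apply: eq_bigr => r _ /=.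
  by rewrite mulrC mx_entryT Gam_sym.
have -> : \sum_m \sum_l (nabE l (C m) *m G) m l = T - Lap Scal.
  under eq_bigr do under eq_bigr do rewrite nabE_raise !mx_entryD dmx_entry.
  under eq_bigr do rewrite !big_split /=.
  rewrite !big_split /= -/T (addrC _ T) -addrA; congr (_ + _).
  rewrite -Div_grad /Div -sumrN exchange_big /= [X in _ + X]exchange_big -big_split.
  apply: eq_bigr => l _ /=; rewrite -(deriv_sum (hd l)) eV (derivN (hd l)).
  rewrite /nab mx_entryD dmx_entry opprD; congr (_ + _).
  under eq_bigr do rewrite mxE.
  rewrite exchange_big mxE -sumrN; apply: eq_bigr => r _ /=.
  by rewrite -mulr_suml eV mx_entryT mulNr mulrC.
by ring.
Qed.

(* Perelman's pointwise identity for the conjugate heat equation. *)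
Lemma conjugate_heat_entropy_density (u L : A) :
  (forall k, d k u = u * d k L) -> delta u = u * delta L ->
  delta L = - Lap L - Inner L L + Scal ->
  let w := (Scal - Lap L *+ 2 - Inner L L) * u in
  delta w + Lap w - Scal * w = u * sqn (Ric - Hess L) *+ 2.
Proof.
move=> du deltau dL w.
set P := Scal - Lap L *+ 2 - Inner L L.
have Iu x : Inner x u = u * Inner x L.
  rewrite /Inner mulr_sumr; apply: eq_bigr => k _; rewrite mulr_sumr.
  by apply: eq_bigr => l _; rewrite du; ring.
pose GRR := \tr (G *m Ric *m G *m Ric).
pose GRH := \tr (G *m Ric *m G *m Hess L).
pose GHH := \tr (G *m Hess L *m G *m Hess L).
pose RLL := ((grad L)^T *m Ric *m grad L) 0 0.
have sqnD : sqn (Ric - Hess L) = GRR - GRH *+ 2 + GHH.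
  rewrite sqnE; last by rewrite mx_trD mx_trN RicT HessT.
  rewrite !(mulmxDr, mulmxDl, mulmxN, mulNmx) !(mxtraceD, raddfN) /= -/GRR -/GHH -/GRH.
  rewrite (_ : \tr (G *m Hess L *m G *m Ric) = GRH); first by ring.
  by rewrite -mulmxA mxtrace_mulC mulmxA.
have dI : delta (Inner L L) = RLL *+ 2 + Inner L (delta L) *+ 2.
  have e : delta (Inner L L) = \sum_k \sum_l
     (dmx delta G k l * d k L * d l L + (G k l * d k (delta L) * d l L
      + G k l * d k L * d l (delta L))).
    rewrite (deriv_sum hdelta); apply: eq_bigr => k _; rewrite (deriv_sum hdelta).
    apply: eq_bigr => l _; rewrite !(derivM hdelta) !deltaC dmx_entry; ring.
  rewrite e; under eq_bigr do rewrite !big_split /=.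
  rewrite !big_split /= -!/(Inner _ _) (Inner_sym (delta L)) -mulr2n.
  congr (_ + _); rewrite flow_inv.
  under eq_bigr do under eq_bigr do rewrite mx_entryD -mulr2n !mulrnAl.
  under eq_bigr do rewrite sumrMnl.
  rewrite sumrMnl; congr (_ *+ 2).
  rewrite /RLL /grad trmx_mul inv_metricT.
  rewrite [X in _ = fun_of_matrix X 0 0](_ : _ = (\col_k d k L)^T
     *m ((G *m Ric *m G) *m (\col_k d k L))); last by rewrite !mulmxA.
  rewrite [RHS]mxE; apply: eq_bigr => k _; rewrite mx_entryT [(\col_ _ _) _ _]mxE.
  rewrite [X in _ = _ * X]mxE mulr_sumr; apply: eq_bigr => l _.
  by rewrite [(\col_ _ _) _ _]mxE; ring.
have LapI : Lap (Inner L L) = (GHH + Inner L (Lap L) + RLL) *+ 2 by exact: Bochner.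
have LapdL : Lap (delta L) = - Lap (Lap L) - Lap (Inner L L) + Lap Scal.
  by rewrite dL !LapD !LapN.
have IdL : Inner L (delta L)
    = - Inner L (Lap L) - Inner L (Inner L L) + Inner L Scal.
  by rewrite dL !InnerDr !InnerNr.
have dP : delta P = Lap Scal + GRR *+ 2 - (Lap (delta L) + GRH *+ 2) *+ 2
    - (RLL *+ 2 + Inner L (delta L) *+ 2).
  by rewrite !(derivB hdelta) (derivMn hdelta) flow_Scal flow_Lap dI.
have LapP : Lap P = Lap Scal - Lap (Lap L) *+ 2 - Lap (Inner L L).
  by rewrite !LapD !LapN mulr2n LapD mulr2n.
have IP : Inner P u = u * (Inner L Scal - Inner L (Lap L) *+ 2 - Inner L (Inner L L)).
  by rewrite Iu Inner_sym !InnerDr !InnerNr mulr2n InnerDr mulr2n.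
rewrite /w -/P (derivM hdelta) deltau LapM (Lap_exp du) IP LapP dP LapdL IdL LapI.
by rewrite sqnD dL /P; ring.
Qed.
End Flow.
End Geometry.

(** * Calculus on open sets *)

Section Line.
Variables (R : realType) (E : normedModType R).
Implicit Types (F : E -> R) (z v w : E).

Lemma is_derive_line F z v (t df : R) :
  is_derive (z + t *: v) v F df -> is_derive (t : R) (1 : R) (fun s : R => F (z + s *: v)) df.
Proof.
have e : (fun h => h^-1 *: (((fun s : R => F (z + s *: v)) \o shift t) (h *: 1)
                            - F (z + t *: v)))
       = (fun h => h^-1 *: ((F \o shift (z + t *: v)) (h *: v) - F (z + t *: v))).
  apply/funext => h /=; congr (_ *: (F _ - _)).
  by rewrite -mulr_algl mulr1 scaler1 scalerDl addrCA.
by case=> dF <-; split; rewrite /derivable /derive /= e.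
Qed.

Lemma is_derive_line0 F z v (df : R) :
  is_derive (0 : R) (1 : R) (fun s : R => F (z + s *: v)) df -> is_derive z v F df.
Proof.
have e : (fun h => h^-1 *: (((fun s : R => F (z + s *: v)) \o shift 0) (h *: 1)
                            - F (z + 0 *: v)))
       = (fun h => h^-1 *: ((F \o shift z) (h *: v) - F z)).
  apply/funext => h /=; rewrite scale0r addr0; congr (_ *: (F _ - F _)).
    by rewrite [h%:A]mulr1 addrC.
  by rewrite addr0.
by case=> dF <-; split; [rewrite /derivable -e|rewrite /derive -e].
Qed.

Lemma is_derive_scalar_comp F (h : R -> R) z v (dF dh : R) :
  is_derive z v F dF -> is_derive (F z) 1 h dh ->
  is_derive z v (h \o F) (dh * dF).
Proof.
move=> HF Hh; apply: is_derive_line0.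
have HF' : is_derive (0 : R) (1 : R) (fun s : R => F (z + s *: v)) dF.
  by apply: is_derive_line; rewrite scale0r addr0.
have Hh' : is_derive (F (z + 0 *: v)) 1 h dh by rewrite scale0r addr0.
exact: (@is_derive1_comp _ h (fun s : R => F (z + s *: v)) 0 dh dF Hh' HF').
Qed.

Lemma MVT_line F z v (h : R) :
  (forall t : R, 0 <= t <= 1 -> derivable F (z + (t * h) *: v) v) ->
  exists2 t : R, 0 <= t <= 1 &
    F (z + h *: v) - F z = h * 'D_v F (z + (t * h) *: v).
Proof.
move=> dF.
have D (t : R) : 0 <= t <= 1 ->
    is_derive (t : R) (1 : R) (fun s : R => F (z + s *: (h *: v))) (h * 'D_v F (z + (t * h) *: v)).
  move=> t01; have := dF t t01 => /derivableP /is_derive_line H.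
  have -> : (fun s : R => F (z + s *: (h *: v)))
          = (fun s : R => F (z + s *: v)) \o (fun s => s * h).
    by apply/funext => s /=; rewrite scalerA.
  rewrite mulrC; apply: (@is_derive1_comp _ _ ( *%R^~ h)) => //.
  have -> : ( *%R^~ h) = h *: (@id R) by apply/funext => s /=; rewrite mulrC.
  by rewrite -[X in is_derive _ _ _ X](mulr1 h); apply: is_deriveZ.
have [t t01 e] : exists2 t : R, t \in `[0, 1]%R &
    F (z + 1 *: (h *: v)) - F (z + 0 *: (h *: v))
    = h * 'D_v F (z + (t * h) *: v) * (1 - 0).
  apply: (@MVT_segment _ (fun s : R => F (z + s *: (h *: v)))
           (fun t => h * 'D_v F (z + (t * h) *: v))) => //.
    by move=> t; rewrite in_itv /= => /andP[/ltW t0 /ltW t1]; apply: D; rewrite t0.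
  apply: continuous_in_subspaceT => t; rewrite inE /= in_itv /= => /D [dt _].
  by apply: differentiable_continuous; apply/derivable1_diffP.
exists t; first by rewrite in_itv in t01.
by move: e; rewrite subr0 mulr1 scale1r scale0r addr0.
Qed.
End Line.

(** * Functions of class C^k *)

Section Ck.
Variables (R : realType) (E : normedModType R).
Implicit Types (F G : E -> R) (z v w : E) (O : set E) (k : nat).

(** Regularity through directional derivatives along all vectors, which is the information that
    [smooth] provides. Continuity is demanded at every level because directional derivability does
    not imply it. *)
Fixpoint Ck k O F : Prop :=
  match k with
  | 0 => forall z, O z -> {for z, continuous F}
  | k'.+1 => [/\ forall z, O z -> {for z, continuous F},
                 forall z v, O z -> derivable F z v &
                 forall v, Ck k' O ('D_v F)]
  end.

Lemma Ck_continuous k O F : Ck k O F -> forall z, O z -> {for z, continuous F}.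
Proof. by case: k => [|k] //= []. Qed.

Lemma CkS k O F : Ck k.+1 O F -> Ck k O F.
Proof.
elim: k F => [|k ih] F [cF dF DF] //; split=> // v; exact: ih.
Qed.

Lemma CkW j k O F : (j <= k)%N -> Ck k O F -> Ck j O F.
Proof.
move=> /subnK <-; elim: (k - j)%N => // i ih; rewrite addSn => /CkS; exact: ih.
Qed.

Lemma Ck_sub k O O' F : O' `<=` O -> Ck k O F -> Ck k O' F.
Proof.
elim: k F => [|k ih] F OO' /=; first by move=> h z /OO'; exact: h.
move=> [cF dF DF]; split=> [z /OO' /cF //|z v /OO' /dF //|v].
exact: ih.
Qed.

Lemma eq_near_open O F G z : open O -> {in O, F =1 G} -> O z ->
  \forall y \near z, F y = G y.
Proof.
move=> oO FG Oz; near=> y; apply: FG; rewrite inE; near: y.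
exact: open_nbhs_nbhs.
Unshelve. all: by end_near.
Qed.

Lemma eq_derive_open O F G v z : open O -> {in O, F =1 G} -> O z ->
  'D_v F z = 'D_v G z.
Proof.
move=> oO FG Oz; have [->|v0] := eqVneq v 0; first by rewrite !derive0.
by apply: near_eq_derive => //; apply: (@eq_near_open O).
Qed.

Lemma eq_derivable_open O F G v z : open O -> {in O, F =1 G} -> O z ->
  derivable F z v -> derivable G z v.
Proof.
move=> oO FG Oz; have [->|v0] := eqVneq v 0.
  by move=> _; apply: derivable0.
by apply: near_eq_derivable => //; apply: (@eq_near_open O).
Qed.

Lemma eq_Ck k O F G : open O -> {in O, F =1 G} -> Ck k O F -> Ck k O G.
Proof.
move=> oO; have cont F' G' : {in O, F' =1 G'} ->
    (forall z, O z -> {for z, continuous F'}) ->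
    forall z, O z -> {for z, continuous G'}.
  move=> FG cF z Oz; rewrite /prop_for /continuous_at -FG ?inE //.
  apply: cvg_trans (cF z Oz); apply: near_eq_cvg.
  exact: (@eq_near_open O).
elim: k F G => [|k ih] F G FG /=; first exact: cont.
move=> [cF dF DF]; split; first exact: cont cF.
  by move=> z v Oz; apply: (eq_derivable_open oO FG) => //; exact: dF.
move=> v; apply: ih (DF v) => z; rewrite inE => Oz.
exact: (eq_derive_open _ oO FG).
Qed.

Lemma Ck_cst k O (c : R) : Ck k O (cst c).
Proof.
elim: k c => [|k ih] c /=; first by move=> z _; exact: cst_continuous.
split=> [z _|z v _|v]; [exact: cst_continuous|exact: derivable_cst|].
rewrite (_ : 'D_v (cst c) = cst 0) //; apply/funext => z.
exact: derive_cst.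
Qed.

Lemma CkD k O F G : open O -> Ck k O F -> Ck k O G -> Ck k O (F \+ G).
Proof.
move=> oO; elim: k F G => [|k ih] F G /=.
  by move=> cF cG z Oz; apply: continuousD; [exact: cF|exact: cG].
move=> [cF dF DF] [cG dG DG]; split.
- by move=> z Oz; apply: continuousD; [exact: cF|exact: cG].
- by move=> z v Oz; apply: derivableD; [exact: dF|exact: dG].
- move=> v; apply: eq_Ck (ih _ _ (DF v) (DG v)) => // z; rewrite inE => Oz.
  by rewrite /= deriveD //; [exact: dF|exact: dG].
Qed.

Lemma CkM k O F G : open O -> Ck k O F -> Ck k O G -> Ck k O (F \* G).
Proof.
move=> oO; elim: k F G => [|k ih] F G /=.
  by move=> cF cG z Oz; apply: continuousM; [exact: cF|exact: cG].
move=> [cF dF DF] [cG dG DG]; split.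
- by move=> z Oz; apply: continuousM; [exact: cF|exact: cG].
- by move=> z v Oz; apply: derivableM; [exact: dF|exact: dG].
- move=> v; have CF : Ck k.+1 O F by [].
  have CG : Ck k.+1 O G by [].
  apply: eq_Ck (CkD oO (ih _ _ (CkS CF) (DG v)) (ih _ _ (CkS CG) (DF v))) => //.
  by move=> z; rewrite inE => Oz /=; rewrite deriveM //; [exact: dF|exact: dG].
Qed.

Lemma CkN k O F : open O -> Ck k O F -> Ck k O (\- F).
Proof.
move=> oO CF; apply: eq_Ck (CkM oO (Ck_cst k O (- 1)) CF) => // z _ /=.
by rewrite mulN1r.
Qed.

Lemma CkB k O F G : open O -> Ck k O F -> Ck k O G -> Ck k O (F \- G).
Proof. by move=> oO CF CG; apply: (CkD oO CF); exact: CkN. Qed.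

Lemma Ck_sum k O (I : Type) (r : seq I) (P : pred I) (F : I -> E -> R) :
  open O -> (forall i, P i -> Ck k O (F i)) ->
  Ck k O (fun z => \sum_(i <- r | P i) F i z).
Proof.
move=> oO CF; elim: r => [|i r ih].
  by apply: eq_Ck (Ck_cst k O 0) => // z _; rewrite big_nil.
case Pi: (P i); last by apply: eq_Ck ih => // z _; rewrite big_cons Pi.
apply: eq_Ck (CkD oO (CF i Pi) ih) => // z _; by rewrite big_cons Pi.
Qed.

Lemma Ck_prod k O (I : Type) (r : seq I) (P : pred I) (F : I -> E -> R) :
  open O -> (forall i, P i -> Ck k O (F i)) ->
  Ck k O (fun z => \prod_(i <- r | P i) F i z).
Proof.
move=> oO CF; elim: r => [|i r ih].
  by apply: eq_Ck (Ck_cst k O 1) => // z _; rewrite big_nil.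
case Pi: (P i); last by apply: eq_Ck ih => // z _; rewrite big_cons Pi.
apply: eq_Ck (CkM oO (CF i Pi) ih) => // z _; by rewrite big_cons Pi.
Qed.

Lemma Ck_derive k O F v : Ck k.+1 O F -> Ck k O ('D_v F).
Proof. by case=> _ _; exact. Qed.

(* The derivative of [h] may be given by an auxiliary function that involves
   the composite itself, as for [expR] or [Num.sqrt]. *)
Lemma Ck_scalar_comp (h h' : R -> R) (P : R -> Prop) O :
  open O -> (forall x, P x -> is_derive x 1 h (h' x)) ->
  (forall k F, (forall z, O z -> P (F z)) -> Ck k O F -> Ck k O (h \o F) ->
     Ck k O (h' \o F)) ->
  forall k F, (forall z, O z -> P (F z)) -> Ck k O F -> Ck k O (h \o F).
Proof.
move=> oO dh Ch' k F PF.
have ch z : O z -> {for F z, continuous h}.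
  move=> /PF /dh [dhz _]; apply: differentiable_continuous.
  exact/derivable1_diffP.
elim: k => [|k ih] /=.
  by move=> cF z Oz; apply: continuous_comp; [exact: cF|exact: ch].
move=> CF; have [cF dF DF] := CF.
have D z v : O z -> is_derive z v (h \o F) (h' (F z) * 'D_v F z).
  move=> Oz; apply: is_derive_scalar_comp; last exact/dh/PF.
  by apply/derivableP; exact: dF.
split.
- by move=> z Oz; apply: continuous_comp; [exact: cF|exact: ch].
- by move=> z v /(D _ v) [].
- move=> v; have CkF := CkS CF.
  apply: eq_Ck (CkM oO (Ch' _ _ PF CkF (ih CkF)) (DF v)) => // z.
  by rewrite inE => Oz /=; have [_ ->] := D z v Oz.
Qed.

Lemma Ck_exp k O F : open O -> Ck k O F -> Ck k O (fun z => expR (F z)).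
Proof.
by move=> oO; apply: (@Ck_scalar_comp _ (@expR R) xpredT) => // x _;
  exact: is_derive_expR.
Qed.

Lemma Ck_inv k O F : open O -> (forall z, O z -> F z != 0) ->
  Ck k O F -> Ck k O (fun z => (F z)^-1).
Proof.
move=> oO; apply: (@Ck_scalar_comp _ (fun x => - (x^-1 * x^-1))
   (fun x => x != 0)) => // [x x0|j G _ _ CV].
  have := @is_deriveV _ id x 1 1 x0 (is_derive_id _ _).
  by rewrite -exprVn expr2 /GRing.scale /= mulr1.
apply: eq_Ck (CkN oO (CkM oO CV CV)) => //.
Qed.

Lemma Ck_ln k O F : open O -> (forall z, O z -> 0 < F z) ->
  Ck k O F -> Ck k O (fun z => ln (F z)).
Proof.
move=> oO; apply: (@Ck_scalar_comp _ (fun x => x^-1) (fun x => 0 < x)) => //.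
by move=> j G G0 CG _; apply: Ck_inv => // z /G0; rewrite lt0r => /andP[].
Qed.

Lemma Ck_sqrt k O F : open O -> (forall z, O z -> 0 < F z) ->
  Ck k O F -> Ck k O (fun z => Num.sqrt (F z)).
Proof.
move=> oO; apply: (@Ck_scalar_comp _ (fun x => (2 * Num.sqrt x)^-1)
   (fun x => 0 < x)) => //.
move=> j G G0 _ CS; apply: Ck_inv => //.
  by move=> z /G0 Gz; rewrite mulf_neq0 ?pnatr_eq0 // gt_eqF // sqrtr_gt0.
apply: eq_Ck (CkM oO (Ck_cst j O 2) CS) => //.
Qed.
End Ck.

Section Schwarz.
Variables (R : realType) (E : normedModType R) (O : set E) (oO : open O).
Variable F : E -> R.

Lemma eq_of_near (A B : E -> R) z :
  {for z, continuous A} -> {for z, continuous B} ->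
  (forall r, 0 < r -> exists p q, [/\ ball z r p, ball z r q & A q = B p]) ->
  A z = B z.
Proof.
move=> cA cB AB; apply/eqP; rewrite -subr_eq0 -normr_le0.
apply/ler_addgt0Pl => e e0; rewrite addr0.
have e20 : 0 < e / 2 by rewrite divr_gt0.
have /cvgrPdist_lt/(_ _ e20)/nbhs_ballP[r1 r10 h1] := cA.
have /cvgrPdist_lt/(_ _ e20)/nbhs_ballP[r2 r20 h2] := cB.
have [|p [q [pb qb pq]]] := AB (Num.min r1 r2); first by rewrite lt_min; apply/andP.
have /h1 /ltW hA : ball z r1 q by apply: le_ball qb; rewrite ge_min lexx.
have /h2 /ltW hB : ball z r2 p by apply: le_ball pb; rewrite ge_min lexx orbT.
rewrite (_ : A z - B z = (A z - A q) - (B z - B p)); last first.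
  by rewrite pq; move: (A z) (B z) (B p) => a b c; ring.
by rewrite (le_trans (ler_normB _ _)) // [leRHS]splitr lerD.
Qed.

Lemma continuous_ball (G : E -> R) z e : {for z, continuous G} -> 0 < e ->
  exists2 r : R, 0 < r & forall y, ball z r y -> `|G y - G z| < e.
Proof.
move=> cG e0; have /cvgrPdist_lt /(_ e e0) /nbhs_ballP [r r0 h] := cG.
by exists r => // y /h; rewrite distrC.
Qed.

Let mixed v w z (r d : R) : 0 < d -> d * (`|v| + `|w|) < r ->
  ball z r `<=` O -> Ck 2 O F ->
  exists2 p, ball z r p &
   F (z + d *: v + d *: w) - F (z + d *: v) - (F (z + d *: w) - F z)
   = d * (d * 'D_w ('D_v F) p).
Proof.
move=> d0 dr zO CF; have [cF dF DF] := CF.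
have near_z (s t : R) : 0 <= s <= 1 -> 0 <= t <= 1 ->
    ball z r (z + (s * d) *: v + (t * d) *: w).
  move=> /andP[s0 s1] /andP[t0 t1].
  rewrite -ball_normE /= -addrA opprD addrA subrr sub0r normrN.
  apply: le_lt_trans dr.
  apply: le_trans (ler_normD _ _) _; rewrite !normrZ !mulrDr.
  rewrite (ger0_norm s0) (ger0_norm t0) (ger0_norm (ltW d0)).
  by rewrite lerD // ler_wpM2r // ger_pMl.
pose H y := F (y + d *: w) - F y.
have dH (t : R) : 0 <= t <= 1 ->
    is_derive (z + (t * d) *: v) v H
      ('D_v F (z + (t * d) *: v + d *: w) - 'D_v F (z + (t * d) *: v)).
  move=> t01; apply: is_deriveB; last first.
    apply/derivableP; apply: dF; apply: zO.
    by have := near_z t 0 t01; rewrite mul0r scale0r addr0; apply; rewrite lexx ler01.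
  have dG : derivable F (z + (t * d) *: v + d *: w) v.
    apply: dF; apply: zO; rewrite -[X in X *: w]mul1r; apply: near_z => //.
    by rewrite lexx ler01.
  have e : (fun h => h^-1 *: (((fun y => F (y + d *: w)) \o shift (z + (t * d) *: v)) (h *: v)
                            - F (z + (t * d) *: v + d *: w)))
       = (fun h => h^-1 *: ((F \o shift (z + (t * d) *: v + d *: w)) (h *: v)
             - F (z + (t * d) *: v + d *: w))).
    by apply/funext => h /=; rewrite !addrA.
  by split; rewrite ?/derivable ?/derive /= e.
have [t t01 e1] : exists2 t : R, 0 <= t <= 1 &
    H (z + d *: v) - H z = d * 'D_v H (z + (t * d) *: v).
  by apply: MVT_line => t /dH [].
have [s s01 e2] : exists2 s : R, 0 <= s <= 1 &
    'D_v F (z + (t * d) *: v + d *: w) - 'D_v F (z + (t * d) *: v)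
    = d * 'D_w ('D_v F) (z + (t * d) *: v + (s * d) *: w).
  apply: (@MVT_line _ _ ('D_v F)) => s s01; have [_ d2 _] := DF v.
  exact: (d2 _ _ (zO _ (near_z t s t01 s01))).
exists (z + (t * d) *: v + (s * d) *: w); first exact: near_z.
by rewrite -e2 -(derive_val (is_derive := dH t t01)) -e1.
Qed.

(** The second difference over a small parallelogram is symmetric in v and w; two applications of
    the mean value theorem identify it with d^2 times either mixed derivative at some nearby point.
    Continuity of both derivatives concludes. *)
Lemma Schwarz v w z : O z -> Ck 2 O F -> 'D_v ('D_w F) z = 'D_w ('D_v F) z.
Proof.
move=> Oz CF; have [cF dF DF] := CF.
have CD x y : Ck 0 O ('D_x ('D_y F)).
  by apply: (@Ck_derive _ _ 0); exact: (@Ck_derive _ _ 1).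
apply: (@eq_of_near ('D_v ('D_w F)) ('D_w ('D_v F))); [exact: (CD v w z Oz)|exact: (CD w v z Oz)|move=> r1 r10].
have [r3 r30 h3] : exists2 r : R, 0 < r & ball z r `<=` O.
  by have /nbhs_ballP[r r0 h] := open_nbhs_nbhs (conj oO Oz); exists r.
pose r := Num.min r3 r1.
have r0 : 0 < r by rewrite !lt_min r10 r30.
have rO : ball z r `<=` O.
  by apply: subset_trans h3; apply: le_ball; rewrite ge_min lexx.
have rr1 : ball z r `<=` ball z r1 by apply: le_ball; rewrite ge_min lexx orbT.
have c0 : 0 < `|v| + `|w| + 1 by rewrite ltr_wpDl ?addr_ge0.
pose d := r / 2 / (`|v| + `|w| + 1).
have d0 : 0 < d by rewrite !divr_gt0.
have dr : d * (`|v| + `|w|) < r.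
  apply: (@lt_le_trans _ _ (d * (`|v| + `|w| + 1))); first by rewrite ltr_pM2l // ltrDl.
  by rewrite /d divfK ?gt_eqF // ler_pdivrMr // mulr_natr mulr2n lerDl ltW.
have dr' : d * (`|w| + `|v|) < r by rewrite addrC.
have [p pb ep] := mixed d0 dr rO CF.
have [q qb eq] := mixed d0 dr' rO CF.
exists p, q; split; [exact: rr1|exact: rr1|].
apply: (mulfI (lt0r_neq0 d0)); apply: (mulfI (lt0r_neq0 d0)).
apply: (etrans (esym eq)); apply: (etrans _ ep); rewrite (addrAC z (d *: w)).
move: (F (z + d *: v + d *: w)) (F (z + d *: v)) (F (z + d *: w)) => a b b'.
by rewrite !opprB !addrA; move: (F z) => f; ring.
Qed.
End Schwarz.

(** * Strict differentiability and the chain rule *)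

Section Coordinates.
Variables (R : realType) (n : nat).
Local Notation V := 'rV[R]_n.
Implicit Types (F : V -> R) (O : set V).

Definition unit_vec (i : 'I_n) : V := delta_mx ord0 i.

Lemma ball_rowP (z y : V) (r : R) : 0 < r ->
  ball z r y <-> (forall i, `|z ord0 i - y ord0 i| < r).
Proof.
move=> r0; split=> [[_ h] i|h]; first exact: h.
by split=> // a i; rewrite (ord1 a); exact: h.
Qed.

Lemma entry_le_norm (x : V) i : `|x ord0 i| <= `|x|.
Proof.
rewrite /(`|x|) /= mx_normrE.
exact: (le_bigmax _ (fun j : 'I_1 * 'I_n => `|x j.1 j.2|) (ord0, i)).
Qed.

Lemma continuous_row (T : topologicalType) (y : T -> V) (x : T) :
  (forall i, {for x, continuous (fun x => y x ord0 i)}) -> {for x, continuous y}.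
Proof.
move=> Cy; apply/cvg_ballP => e e0.
have : \forall x' \near x, forall i, `|y x ord0 i - y x' ord0 i| < e.
  by apply: filter_forall => i; have /cvgrPdist_lt := Cy i; apply.
by apply: filterS => h; move/(ball_rowP _ _ e0).
Qed.

Lemma norm_row_le (x : V) (c : R) : 0 <= c -> (forall i, `|x ord0 i| <= c) ->
  `|x| <= c.
Proof.
move=> c0 xc; rewrite /(`|x|) /= mx_normrE; apply: bigmax_le => // i _.
by rewrite (ord1 i.1).
Qed.

Lemma convex_norm_lt (a b r t : R) : 0 <= t <= 1 -> `|a| < r -> `|b| < r ->
  `|a + t * (b - a)| < r.
Proof.
move=> /andP[t0 t1] ar br; set m := Num.max `|a| `|b|.
have mr : m < r by rewrite gt_max ar br.
apply: le_lt_trans mr; rewrite (_ : _ + _ = (1 - t) * a + t * b); last by ring.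
rewrite (le_trans (ler_normD _ _)) // !normrM (ger0_norm t0).
rewrite [X in X * _]ger0_norm ?subr_ge0 //.
rewrite [leRHS](_ : m = (1 - t) * m + t * m); last by ring.
by rewrite lerD // ler_wpM2l ?subr_ge0 // /m le_max lexx ?orbT.
Qed.

(** Strict differentiability: the mean value theorem is applied on each edge of a path that changes
    one coordinate at a time. The estimate is uniform in both end points, as the change of variables
    formula requires. *)
Lemma Ck_linearize O F z (e : R) : open O -> Ck 1 O F -> O z -> 0 < e ->
  exists2 r : R, 0 < r & ball z r `<=` O /\
   forall x y, ball z r x -> ball z r y ->
   `|F y - F x - \sum_i (y - x) ord0 i * 'D_(unit_vec i) F z| <= e * `|y - x|.
Proof.
move=> oO CF Oz e0; have [_ dF DF] := CF.
pose c := e / n.+1%:R; have c0 : 0 < c by rewrite divr_gt0.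
have /choice[rr hrr] : forall i : 'I_n, exists r : R, 0 < r /\
    forall y, ball z r y -> `|'D_(unit_vec i) F y - 'D_(unit_vec i) F z| < c.
  by move=> i; have [r r0 h] := continuous_ball (DF (unit_vec i) z Oz) c0; exists r.
have [r3 r30 h3] : exists2 r : R, 0 < r & ball z r `<=` O.
  by have /nbhs_ballP[r r0 h] := open_nbhs_nbhs (conj oO Oz); exists r.
pose r := \big[Num.min/r3]_i rr i.
have r0 : 0 < r by apply: lt_bigmin => // i _; exact: (hrr i).1.
have rb i y : ball z r y -> `|'D_(unit_vec i) F y - 'D_(unit_vec i) F z| < c.
  by move=> h; apply: (hrr i).2; apply: le_ball h; exact: bigmin_le_cond.
have rO : ball z r `<=` O.
  by apply: subset_trans h3; apply: le_ball; exact: bigmin_le_id.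
exists r => //; split=> // x y xb yb.
(* The first k coordinates are those of y, the others those of x. The edges stay in the ball because
   a ball of the sup norm is a product of intervals. *)
pose p (k : nat) : V := \row_j (if (j < k)%N then y ord0 j else x ord0 j).
have p0 : p 0%N = x by apply/rowP => j; rewrite mxE.
have pn : p n = y by apply/rowP => j; rewrite mxE ltn_ord.
have pS (i : 'I_n) : p i.+1 = p i + (y - x) ord0 i *: unit_vec i.
  apply/rowP => j; rewrite !mxE eqxx /= ltnS leq_eqVlt.
  have [->|ij] := eqVneq j i; first by rewrite eqxx ltnn /= mulr1 addrC subrK.
  by rewrite (negPf (_ : (j != i :> nat))) ?mulr0 ?addr0.
have step (i : 'I_n) : `|F (p i.+1) - F (p i) - (y - x) ord0 i * 'D_(unit_vec i) F z|
    <= c * `|y - x|.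
  have bt (t : R) : 0 <= t <= 1 -> ball z r (p i + (t * (y - x) ord0 i) *: unit_vec i).
    move=> /andP[t0 t1]; apply/ball_rowP => // j.
    have xj := (ball_rowP z x r0).1 xb j; have yj := (ball_rowP z y r0).1 yb j.
    rewrite !mxE eqxx /=; have [j_i|ij] := eqVneq j i; rewrite ?j_i.
      rewrite ltnn mulr1 (_ : _ - _ = (z ord0 i - x ord0 i)
        + t * ((z ord0 i - y ord0 i) - (z ord0 i - x ord0 i))); last by ring.
      by rewrite j_i in xj yj; apply: convex_norm_lt; rewrite ?t0.
    by rewrite mulr0 addr0; case: ifP.
  have [t t01 ->] : exists2 t : R, 0 <= t <= 1 & F (p i.+1) - F (p i) =
      (y - x) ord0 i * 'D_(unit_vec i) F (p i + (t * (y - x) ord0 i) *: unit_vec i).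
    by rewrite pS; apply: MVT_line => t t01; apply: dF; apply: rO; exact: bt.
  rewrite -mulrBr normrM mulrC ler_pM // ?entry_le_norm // ltW //.
  exact/rb/bt.
have -> : F y - F x - \sum_i (y - x) ord0 i * 'D_(unit_vec i) F z =
   \sum_(i < n) (F (p i.+1) - F (p i) - (y - x) ord0 i * 'D_(unit_vec i) F z).
  rewrite sumrB; congr (_ - _).
  have := telescope_sumr (fun k => F (p k)) (leq0n n).
  by rewrite big_mkord p0 pn => ->.
apply: le_trans (ler_norm_sum _ _ _) _.
apply: le_trans (ler_sum _ (fun i _ => step i)) _.
rewrite sumr_const card_ord -mulr_natl mulrA ler_wpM2r // /c mulrCA ger_pMr //.
by rewrite ler_pdivrMr // mul1r ler_nat.
Qed.
End Coordinates.

Lemma cvg_sumr (R : realType) (T : Type) (F : set_system T) {FF : Filter F}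
    (I : Type) (r : seq I) (P : pred I) (f : I -> T -> R) (l : I -> R) :
  (forall i, P i -> f i x @[x --> F] --> l i) ->
  (\sum_(i <- r | P i) f i x) @[x --> F] --> \sum_(i <- r | P i) l i.
Proof.
move=> fl; elim: r => [|i r ih].
  by rewrite big_nil; under eq_cvg do rewrite big_nil; exact: cvg_cst.
rewrite big_cons; under eq_cvg do rewrite big_cons.
by case: ifP => // Pi; apply: cvgD => //; exact: fl.
Qed.

Section ChainRule.
Variables (R : realType) (m : nat).
Local Notation V := 'rV[R]_m.
Implicit Types (F : V -> R).

Lemma is_derive_path F (O : set V) (y : R -> V) (t : R) (dy : 'I_m -> R) :
  open O -> Ck 1 O F -> O (y t) ->
  (forall l, is_derive t (1 : R) (fun s => y s ord0 l) (dy l)) ->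
  is_derive t (1 : R) (F \o y) (\sum_l dy l * 'D_(unit_vec R l) F (y t)).
Proof.
move=> oO CF Oz Hy; set S := \sum_l _.
pose q l h := h^-1 *: ((fun s => y s ord0 l) (h + t) - y t ord0 l).
have cq l : q l h @[h --> 0^'] --> dy l.
  have [/cvg_ex [a Ha] e] := Hy l.
  have Ha' : q l h @[h --> 0^'] --> a.
    by apply: cvg_trans Ha; apply: near_eq_cvg; near=> h => /=; rewrite /q [h%:A]mulr1.
  suff -> : dy l = a by [].
  by rewrite -e; apply: cvg_lim.
have cy : (y (h + t)) @[h --> 0] --> y t.
  have ct : h + t @[h --> (0 : R)] --> t.
    by rewrite -[X in _ --> X]add0r; apply: cvgD; [exact: cvg_id|exact: cvg_cst].
  have cyt : {for t, continuous y}.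
    apply: continuous_row => i; have [dyi _] := Hy i.
    exact/differentiable_continuous/derivable1_diffP.
  exact: (cvg_comp _ _ ct cyt).
suff cF : h^-1 *: (F (y (h + t)) - F (y t)) @[h --> 0^'] --> S.
  have cF' : h^-1 *: ((F \o y \o shift t) (h *: (1 : R)) - (F \o y) t) @[h --> 0^'] --> S.
    by apply: cvg_trans cF; apply: near_eq_cvg; near=> h => /=; rewrite [h%:A]mulr1.
  by split; [apply/cvg_ex; exists S|exact: cvg_lim].
pose D l := 'D_(unit_vec R l) F (y t).
have cS : \sum_l q l h * D l @[h --> 0^'] --> S.
  apply: (@cvg_sumr _ _ _ _ _ _ _ (fun l h => q l h * D l)) => l _.
  by apply: cvgMr_tmp; exact: cq.
suff cr : h^-1 *: (F (y (h + t)) - F (y t)) - \sum_l q l h * D l @[h --> 0^'] --> 0.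
  have := cvgD cr cS; rewrite add0r => /(_ _) H.
  rewrite (_ : (fun h => h^-1 *: _) = (fun h =>
     h^-1 *: (F (y (h + t)) - F (y t)) - \sum_l q l h * D l) + (fun h => \sum_l q l h * D l)) //.
  by apply/funext => h; rewrite fctE subrK.
apply/cvgr0Pnorm_le => e e0.
(* [M] bounds the difference quotients of [y], so that the linearisation error e / M times the
   increment of [y] is at most e |h|. *)
pose M := \sum_l `|dy l| + 1.
have M0 : 0 < M by rewrite ltr_wpDl // sumr_ge0.
have [r r0 [rO lin]] := Ck_linearize oO CF Oz (divr_gt0 e0 M0).
have nq : \forall h \near 0^', forall l, `|q l h| <= M.
  apply: filter_forall => l; have /cvgrPdist_lt/(_ 1 ltr01) := cq l.
  apply: filterS => h hq; rewrite -[q l h](subKr (dy l)).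
  rewrite (le_trans (ler_normB _ _)) // lerD ?(ltW hq) //.
  by rewrite (bigD1 l) //= lerDl sumr_ge0.
have nb : \forall h \near 0^', ball (y t) r (y (h + t)).
  by apply: nbhs_dnbhs; have /cvg_ballP/(_ r r0) := cy.
near=> h.
have h0 : h != 0 by near: h; exact: nbhs_dnbhs_neq.
have qh l : (y (h + t) - y t) ord0 l = h * q l h.
  by rewrite /q /= !mxE /GRing.scale /= mulrA divff // mul1r.
have -> : h^-1 *: (F (y (h + t)) - F (y t)) - \sum_l q l h * D l
    = h^-1 * (F (y (h + t)) - F (y t) - \sum_l (y (h + t) - y t) ord0 l * D l).
  rewrite mulrBr; congr (_ - _); rewrite mulr_sumr; apply: eq_bigr => l _.
  by rewrite qh !mulrA mulVf // mul1r.
rewrite normrM normfV ler_pdivrMl ?normr_gt0 //.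
apply: le_trans (lin _ _ (ballxx _ r0) _) _; first by near: h.
rewrite mulrAC ler_pdivrMr // mulrC [leRHS]mulrAC ler_wpM2r ?(ltW e0) //.
apply: norm_row_le; first by rewrite mulr_ge0 // ltW.
move=> l; rewrite qh normrM ler_wpM2l //.
by move: l; near: h.
Unshelve. all: by end_near.
Qed.

Lemma is_derive_chain (E : normedModType R) F (O : set V) (y : E -> V) (z v : E)
    (dy : 'I_m -> R) :
  open O -> Ck 1 O F -> O (y z) ->
  (forall l, is_derive z v (fun x => y x ord0 l) (dy l)) ->
  is_derive z v (F \o y) (\sum_l dy l * 'D_(unit_vec R l) F (y z)).
Proof.
move=> oO CF Oz Hy; apply: is_derive_line0.
have e : y (z + (0 : R) *: v) = y z by rewrite scale0r addr0.
rewrite -e; apply: (@is_derive_path F O (fun s => y (z + s *: v)) 0 dy) => //.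
  by rewrite e.
move=> l; apply: (is_derive_line (F := fun x => y x ord0 l)).
by rewrite scale0r addr0.
Qed.

Lemma Ck_comp (E : normedModType R) (O : set V) (O' : set E) (y : E -> V) k F :
  open O -> open O' -> (forall x, O' x -> O (y x)) -> 
  (forall l, Ck k O' (fun x => y x ord0 l)) -> Ck k O F -> Ck k O' (F \o y).
Proof.
move=> oO oO' yO; elim: k F => [|k ih] F Cy CF.
  move=> x Ox; apply: continuous_comp; last exact/CF/yO.
  by apply: continuous_row => i; exact: Cy.
have CF1 : Ck 1 O F by exact: CkW CF.
have D z v : O' z -> is_derive z v (F \o y)
    (\sum_l 'D_v (fun x => y x ord0 l) z * 'D_(unit_vec R l) F (y z)).
  move=> Oz; apply: (is_derive_chain oO CF1 (yO _ Oz)) => l.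
  by have [_ + _] := Cy l; move=> /(_ z v Oz) /derivableP.
split.
- have := ih F (fun l => CkS (Cy l)) (CkS CF); exact: Ck_continuous.
- by move=> z v /(D z v) [].
- move=> v.
  have H : Ck k O' (fun z => \sum_l 'D_v (fun x => y x ord0 l) z
                           * ('D_(unit_vec R l) F \o y) z).
    apply: Ck_sum => // l _; apply: CkM => //; first exact: Ck_derive.
    by apply: ih => [i|]; [exact: CkS|exact: Ck_derive].
  apply: eq_Ck H => // z; rewrite inE => Oz /=.
  by have [_ ->] := D z v Oz.
Qed.
End ChainRule.

Section SmoothCk.
Variables (R : realType) (E : normedModType R) (D : set E) (F : E -> R).

Lemma increments_interior v z : (\forall y \near z, D y) ->
  increments D v z = (0 : R)^'.
Proof.
move=> Dz; apply/seteqP; split=> P; last exact: cvg_within.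
rewrite /increments /within /=.
have : \forall h \near (0 : R)^', D (z + h *: v).
  apply: nbhs_dnbhs.
  have cz : (z + h *: v) @[h --> (0 : R)] --> z.
    rewrite -[X in _ --> X]addr0 -[X in _ + X](scale0r v).
    by apply: cvgD; [exact: cvg_cst|apply: cvgZr_tmp; exact: cvg_id].
  exact: cz Dz.
by apply: filterS2 => h Dh; apply.
Qed.

Lemma diff_quotientE (G : E -> R) v z :
  diff_quotient v G z = (fun h => h^-1 *: ((G \o shift z) (h *: v) - G z)).
Proof. by apply/funext => h; rewrite /diff_quotient /= (addrC z). Qed.

Lemma pderiv_interior (G : E -> R) v z : (\forall y \near z, D y) ->
  pderiv D v G z = 'D_v G z.
Proof.
by move=> Dz; rewrite /pderiv increments_interior // diff_quotientE.
Qed.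

(** On an open subset the restricted derivatives are ordinary ones. The list [l] is general so that
    the induction can prepend the direction of the next derivative. *)
Lemma smooth_Ck k (O : set E) l : open O -> O `<=` D -> smooth D F ->
  Ck k O (iter_pderiv D l F).
Proof.
move=> oO OD sF.
have near_D z : O z -> \forall y \near z, D y.
  by move=> Oz; apply: filterS OD _; exact: open_nbhs_nbhs.
have cont l' z : O z -> {for z, continuous (iter_pderiv D l' F)}.
  move=> Oz; have [+ _] := sF l'; move/(continuous_subspaceW OD).
  by rewrite continuous_open_subspace // => /(_ z); rewrite inE; apply.
elim: k l => [|k ih] l; first by move=> z; exact: cont.
split; first by move=> z; exact: cont.
  move=> z v Oz; have [_ /(_ v z (OD _ Oz))] := sF l.
  by rewrite increments_interior ?diff_quotientE //; exact: near_D.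
move=> v; apply: eq_Ck (ih (v :: l)) => // z; rewrite inE => Oz /=.
by rewrite pderiv_interior //; exact: near_D.
Qed.
End SmoothCk.

(** * The ring of smooth functions on an open set *)

Record opens (R : realType) (E : normedModType R) :=
  Opens { oset :> set E ; oset_open : open oset }.

(* Extended by 0, so that extensional equality on the domain is equality. *)
Record cfun (R : realType) (E : normedModType R) (D : opens E) := Cfun {
  cfun_val :> E -> R ;
  cfun_Ck : forall k, Ck k D cfun_val ;
  cfun_out : forall z, ~ oset D z -> cfun_val z = 0 }.

Section SmoothRing.
Variables (R : realType) (E : normedModType R) (D : opens E).
Implicit Types (f g : cfun D) (z v : E).

Lemma cfunP f g : (forall z, oset D z -> f z = g z) -> f = g.
Proof.
move=> fg; have e : cfun_val f = cfun_val g.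
  apply/funext => z; have [/fg //|nDz] := pselect (oset D z).
  by rewrite !cfun_out.
case: f g e {fg} => [F cF oF] [G cG oG] /= e; subst G.
by rewrite (Prop_irrelevance cF cG) (Prop_irrelevance oF oG).
Qed.

Let patch0_Ck F : (forall k, Ck k D F) -> forall k, Ck k D (F \_ (oset D)).
Proof.
move=> CF k; apply: eq_Ck (CF k); first exact: oset_open.
by move=> z zD; rewrite patchT.
Qed.

Let patch0_out (F : E -> R) z : ~ oset D z -> (F \_ (oset D)) z = 0.
Proof. by move=> nDz; rewrite patchC // inE. Qed.

Definition mk_cfun F (CF : forall k, Ck k D F) : cfun D :=
  Cfun (patch0_Ck CF) (patch0_out F).

Lemma mk_cfunE F (CF : forall k, Ck k D F) z : oset D z -> mk_cfun CF z = F z.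
Proof. by move=> Dz; rewrite /= patchT ?inE. Qed.

Lemma cfun_open : open D. Proof. exact: oset_open. Qed.
Local Notation oD := cfun_open.

(* The ring operations are opaque, which keeps unification fast. *)
Fact cfun_add_subproof :
  {F : cfun D -> cfun D -> cfun D | forall f g z, F f g z = f z + g z}.
Proof.
exists (fun f g => mk_cfun (fun k => CkD oD (cfun_Ck f k) (cfun_Ck g k))) => f g z.
have [Dz|nDz] := pselect (oset D z); first by rewrite mk_cfunE.
by rewrite !cfun_out ?addr0.
Qed.

Fact cfun_mul_subproof :
  {F : cfun D -> cfun D -> cfun D | forall f g z, F f g z = f z * g z}.
Proof.
exists (fun f g => mk_cfun (fun k => CkM oD (cfun_Ck f k) (cfun_Ck g k))) => f g z.
have [Dz|nDz] := pselect (oset D z); first by rewrite mk_cfunE.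
by rewrite !cfun_out ?mulr0.
Qed.

Fact cfun_opp_subproof : {F : cfun D -> cfun D | forall f z, F f z = - f z}.
Proof.
exists (fun f => mk_cfun (fun k => CkN oD (cfun_Ck f k))) => f z.
have [Dz|nDz] := pselect (oset D z); first by rewrite mk_cfunE.
by rewrite !cfun_out ?oppr0.
Qed.

Fact cfun_cst_subproof :
  {F : R -> cfun D | forall c z, oset D z -> F c z = c}.
Proof.
by exists (fun c => mk_cfun (fun k => Ck_cst k D c)) => c z; exact: mk_cfunE.
Qed.

Definition cfun_add := sval cfun_add_subproof.
Definition cfun_mul := sval cfun_mul_subproof.
Definition cfun_opp := sval cfun_opp_subproof.
Definition cfun_cst := sval cfun_cst_subproof.

Lemma cfun_addE f g z : cfun_add f g z = f z + g z.
Proof. exact: (svalP cfun_add_subproof). Qed.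

Lemma cfun_mulE f g z : cfun_mul f g z = f z * g z.
Proof. exact: (svalP cfun_mul_subproof). Qed.

Lemma cfun_oppE f z : cfun_opp f z = - f z.
Proof. exact: (svalP cfun_opp_subproof). Qed.

Lemma ev_cst c z : oset D z -> cfun_cst c z = c.
Proof. exact: (svalP cfun_cst_subproof). Qed.

Lemma cfun_cst0 z : cfun_cst 0 z = 0.
Proof.
have [Dz|nDz] := pselect (oset D z); first exact: ev_cst.
by rewrite cfun_out.
Qed.

HB.instance Definition _ := gen_eqMixin (cfun D).
HB.instance Definition _ := gen_choiceMixin (cfun D).

Let cfun_addA : associative cfun_add.
Proof. by move=> f g h; apply: cfunP => z _; rewrite !cfun_addE addrA. Qed.
Let cfun_addC : commutative cfun_add.
Proof. by move=> f g; apply: cfunP => z _; rewrite !cfun_addE addrC. Qed.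
Let cfun_add0 : left_id (cfun_cst 0) cfun_add.
Proof. by move=> f; apply: cfunP => z _; rewrite cfun_addE cfun_cst0 add0r. Qed.
Let cfun_addN : left_inverse (cfun_cst 0) cfun_opp cfun_add.
Proof.
by move=> f; apply: cfunP => z _; rewrite cfun_addE cfun_cst0 cfun_oppE addNr.
Qed.

HB.instance Definition _ := GRing.isZmodule.Build (cfun D)
  cfun_addA cfun_addC cfun_add0 cfun_addN.

Let cfun_mulA : associative cfun_mul.
Proof. by move=> f g h; apply: cfunP => z _; rewrite !cfun_mulE mulrA. Qed.
Let cfun_mulC : commutative cfun_mul.
Proof. by move=> f g; apply: cfunP => z _; rewrite !cfun_mulE mulrC. Qed.
Let cfun_mul1 : left_id (cfun_cst 1) cfun_mul.
Proof.
by move=> f; apply: cfunP => z Dz; rewrite cfun_mulE ev_cst // mul1r.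
Qed.
Let cfun_mulDl : left_distributive cfun_mul cfun_add.
Proof.
by move=> f g h; apply: cfunP => z _; rewrite !(cfun_mulE, cfun_addE) mulrDl.
Qed.

HB.instance Definition _ := GRing.Zmodule_isComPzRing.Build (cfun D)
  cfun_mulA cfun_mulC cfun_mul1 cfun_mulDl.

Lemma evD f g z : (f + g) z = f z + g z. Proof. exact: cfun_addE. Qed.
Lemma evM f g z : (f * g) z = f z * g z. Proof. exact: cfun_mulE. Qed.
Lemma evN f z : (- f) z = - f z. Proof. exact: cfun_oppE. Qed.
Lemma ev0 z : (0 : cfun D) z = 0. Proof. exact: cfun_cst0. Qed.
Lemma ev1 z : oset D z -> (1 : cfun D) z = 1. Proof. exact: ev_cst. Qed.

Lemma evMn f k z : (f *+ k) z = f z *+ k.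
Proof. by elim: k => [|k ih]; rewrite ?ev0 // !mulrS evD ih. Qed.

Lemma ev_sum (I : Type) (r : seq I) (P : pred I) (F : I -> cfun D) z :
  (\sum_(i <- r | P i) F i) z = \sum_(i <- r | P i) F i z.
Proof. exact: (big_morph (fun f : cfun D => f z) (fun f g => evD f g z) (ev0 z)). Qed.

Lemma ev_prod (I : Type) (r : seq I) (P : pred I) (F : I -> cfun D) z : oset D z ->
  (\prod_(i <- r | P i) F i) z = \prod_(i <- r | P i) F i z.
Proof.
move=> Dz; exact: (big_morph (fun f : cfun D => f z) (fun f g => evM f g z) (ev1 Dz)).
Qed.

Definition evm m n (X : 'M[cfun D]_(m, n)) z : 'M[R]_(m, n) :=
  \matrix_(i, j) X i j z.

Lemma evmM m n p (X : 'M[cfun D]_(m, n)) (Y : 'M[cfun D]_(n, p)) z :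
  evm (X *m Y) z = evm X z *m evm Y z.
Proof.
apply/matrixP => i j; rewrite !mxE ev_sum; apply: eq_bigr => k _.
by rewrite evM !mxE.
Qed.

Lemma evm_det n (X : 'M[cfun D]_n) z : oset D z -> (\det X) z = \det (evm X z).
Proof.
move=> Dz; rewrite /determinant ev_sum; apply: eq_bigr => s _.
rewrite evM ev_prod //; congr (_ * _); last by apply: eq_bigr => i _; rewrite mxE.
by case: (perm.odd_perm s); rewrite ?expr1 ?expr0 ?evN ev1.
Qed.

Lemma evm1 n z : oset D z -> evm (1%:M : 'M[cfun D]_n) z = 1%:M.
Proof.
by move=> Dz; apply/matrixP => i j; rewrite !mxE evMn ev1.
Qed.

Lemma ev_tr n (X : 'M[cfun D]_n) z : (\tr X) z = \tr (evm X z).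
Proof. by rewrite ev_sum; apply: eq_bigr => i _; rewrite mxE. Qed.

Definition half_cst : cfun D := cfun_cst 2^-1.

Lemma half_cst2 : half_cst * 2 = 1.
Proof.
apply: cfunP => z Dz; rewrite evM evMn !ev1 // ev_cst //.
by rewrite mulVf // pnatr_eq0.
Qed.

Fact dd_subproof :
  {F : E -> cfun D -> cfun D | forall v f z, oset D z -> F v f z = 'D_v f z}.
Proof.
have Cf v f k : Ck k D ('D_v f) by exact: Ck_derive (cfun_Ck f k.+1).
by exists (fun v f => mk_cfun (Cf v f)) => v f z; exact: mk_cfunE.
Qed.

Definition dd : E -> cfun D -> cfun D := sval dd_subproof.

Lemma ddE v f z : oset D z -> dd v f z = 'D_v f z.
Proof. exact: (svalP dd_subproof). Qed.

Lemma cfun_derivable f z v : oset D z -> derivable f z v.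
Proof. by move=> Dz; have [_ + _] := cfun_Ck f 1; apply. Qed.

Lemma is_derive_cfun f z v : oset D z -> is_derive z v f (dd v f z).
Proof.
by move=> Dz; rewrite ddE //; apply/derivableP; exact: cfun_derivable.
Qed.

Lemma eq_D (F G : E -> R) v z : oset D z -> (forall y, oset D y -> F y = G y) ->
  'D_v F z = 'D_v G z.
Proof.
move=> Dz FG; apply: (@eq_derive_open _ _ D) => //; first exact: oD.
by move=> y; rewrite inE; exact: FG.
Qed.

Lemma dd_derivation v : derivation (dd v).
Proof.
split=> f g; apply: cfunP => z Dz.
  rewrite evD !ddE // (@eq_D _ (cfun_val f \+ cfun_val g)) //.
    by rewrite deriveD //; exact: cfun_derivable.
  by move=> y _; rewrite evD.
rewrite evD !evM !ddE // (@eq_D _ (cfun_val f \* cfun_val g)) //.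
  rewrite deriveM; [|exact: cfun_derivable..].
  by rewrite addrC /GRing.scale /= mulrC.
by move=> y _; rewrite evM.
Qed.

Lemma ddC v w f : dd v (dd w f) = dd w (dd v f).
Proof.
apply: cfunP => z Dz.
have e a b : dd a (dd b f) z = 'D_a ('D_b f) z.
  exact: (etrans (ddE a (dd b f) Dz) (eq_D a Dz (fun y => ddE b f (z := y)))).
exact: (etrans (e v w) (etrans (Schwarz oD v w Dz (cfun_Ck f 2)) (esym (e w v)))).
Qed.
End SmoothRing.

(** * Positive definite matrices *)

Section PosDef.
Variables (R : realType) (n : nat) (g : 'M[R]_n).
Hypothesis g_pos : forall v : 'rV[R]_n, v != 0 -> 0 < (v *m g *m v^T) ord0 ord0.

Lemma sqnorm_row (v : 'rV[R]_n) : (v *m v^T) ord0 ord0 = \sum_i v ord0 i ^+ 2.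
Proof. by rewrite mxE; apply: eq_bigr => i _; rewrite mxE. Qed.

Lemma sqnorm_row_gt0 (v : 'rV[R]_n) : v != 0 -> 0 < (v *m v^T) ord0 ord0.
Proof.
move=> v0; rewrite sqnorm_row lt_def sumr_ge0 ?andbT => [|i _]; last exact: sqr_ge0.
apply: contra v0; rewrite psumr_eq0 => [/allP h|i _]; last exact: sqr_ge0.
apply/eqP/rowP => i; rewrite mxE; apply/eqP.
by have := h i (mem_index_enum _); rewrite sqrf_eq0.
Qed.

(** The determinant of (1 - t) I + t g is a polynomial in t, equal to 1 at t = 0 and without root in
    [0, 1] by positivity; the intermediate value theorem fixes its sign at t = 1. *)
Lemma posdef_det : 0 < \det g.
Proof.
pose M : 'M[{poly R}]_n :=
  \matrix_(i, j) ((1 - 'X) * (i == j)%:R + 'X * (g i j)%:P).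
have ev t : (\det M).[t] = \det ((1 - t) *: 1%:M + t *: g).
  rewrite -[LHS]/(horner_eval t _) -det_map_mx; congr (\det _).
  apply/matrixP => i j; rewrite !mxE /= /horner_eval !hornerE.
  by case: (i == j); rewrite ?hornerE.
have nroot t : 0 <= t <= 1 -> ~~ root (- \det M) t.
  move=> /andP[t0 t1]; rewrite rootN; apply/negP; rewrite /root ev => /det0P[v v0].
  move/(congr1 (mulmx^~ v^T)).
  rewrite mulmxDr mulmxDl -!scalemxAr mulmx1 -!scalemxAl mul0mx.
  move/matrixP/(_ ord0 ord0); rewrite !mx_entry => e.
  have a0 := sqnorm_row_gt0 v0; have b0 := g_pos v0.
  have [t00|tn0] := eqVneq t 0.
    by move: e a0; rewrite t00 subr0 mul1r mul0r addr0 => ->; rewrite ltxx.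
  have h2 : 0 < t * (v *m g *m v^T) ord0 ord0 by rewrite mulr_gt0 // lt0r tn0.
  have h1 : 0 <= (1 - t) * (v *m v^T) ord0 ord0 by rewrite mulr_ge0 ?subr_ge0 // ltW.
  by have := ltr_wpDl h1 h2; rewrite e ltxx.
rewrite ltNge; apply/negP => g0.
have [t t01 rt] : exists2 t, 0 <= t <= 1 & root (- \det M) t.
  apply: poly_ivt => //; rewrite !hornerN !ev subr0 scale1r scale0r addr0 det1.
  by rewrite subrr scale0r add0r scale1r oppr_le0 ler01 oppr_ge0.
by have := nroot t t01; rewrite rt.
Qed.
End PosDef.

(** * Riemannian geometry in a chart *)

Lemma Riem_entry (A : comPzRingType) n half (d : 'I_n -> A -> A)
    (g G : 'M[A]_n) k l a b (Y := Gam half d g G) :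
  Riem half d g G k l a b = d k (Y l a b) - d l (Y k a b)
    + (\sum_r Y k a r * Y l r b - \sum_r Y l a r * Y k r b).
Proof.
by rewrite addrA /Riem !mx_entry !dmx_entry; congr (_ + _ - _); rewrite mxE.
Qed.

Section Tube.
Variables (R : realType) (n : nat) (M : closedManifold R n) (i : 'I_(charts M)).
Variables (E : normedModType R) (D : opens E).
Variables (iota : 'rV[R]_n -> E) (sl : 'rV[R]_n -> E).
Hypothesis sl_line : forall x v (h : R), sl (x + h *: v) = sl x + h *: iota v.
Hypothesis sl_cont : continuous sl.
Hypothesis sl_chart : forall x, oset D (sl x) -> chart_img i x.

Let O : set 'rV[R]_n := [set x | oset D (sl x)].

Lemma tube_open : open O.
Proof. by apply: open_comp; [move=> x _; exact: sl_cont|exact: oset_open]. Qed.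

(** [sl] places the chart in [E], lines in the direction v going to lines in the direction [iota v].
    It is the identity for a fixed metric and a time slice for a flow; both uses share the
    evaluation lemmas below. *)
Definition dk (k : 'I_n) : cfun D -> cfun D := dd (iota (unit_vec R k)).

Lemma dk_derivation k : derivation (dk k).
Proof. exact: dd_derivation. Qed.

Lemma dkC k l f : dk k (dk l f) = dk l (dk k f).
Proof. exact: ddC. Qed.

Lemma derive_slice (F : E -> R) v x : 'D_v (F \o sl) x = 'D_(iota v) F (sl x).
Proof.
have e : (fun h => h^-1 *: (((F \o sl) \o shift x) (h *: v) - (F \o sl) x))
       = (fun h => h^-1 *: ((F \o shift (sl x)) (h *: iota v) - F (sl x))).
  have e y : sl (y *: v + x) = y *: iota v + sl x.
    by rewrite (addrC (y *: v)) sl_line addrC.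
  by apply/funext => y /=; rewrite e.
by rewrite /derive e.
Qed.

Lemma chart_img_near x : chart_img i x -> \forall y \near x, chart_img i y.
Proof.
move=> ix; apply: open_nbhs_nbhs; split=> //; exact: chart_img_open.
Qed.

Lemma partial_ev (F : 'rV[R]_n -> R) (f : cfun D) k x : O x ->
  (forall y, O y -> F y = f (sl y)) -> partial i k F x = dk k f (sl x).
Proof.
move=> Ox Ff; rewrite /partial pderiv_interior; last first.
  by apply: chart_img_near; exact: sl_chart.
rewrite /dk ddE // -(derive_slice f) -/(unit_vec R k).
apply: (@eq_derive_open _ _ O) => //; first exact: tube_open.
by move=> y; rewrite inE => /Ff.
Qed.

Variables (h : metric M) (gA GA : 'M[cfun D]_n).
Hypothesis gA_T : gA^T = gA.
Hypothesis GgA : GA *m gA = 1%:M.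
Hypothesis h_gA : forall x, O x -> h i x = evm gA (sl x).

Local Notation hf := (half_cst D).
Local Notation hf2 := (half_cst2 D).

Lemma invmx_ev x : O x -> invmx (h i x) = evm GA (sl x).
Proof.
move=> Ox; have e : evm GA (sl x) *m h i x = 1%:M by rewrite h_gA // -evmM GgA evm1.
have [_ u] := mulmx1_unit e.
by rewrite -[LHS]mul1mx -e -mulmxA mulmxV // mulmx1.
Qed.

Lemma christoffel_ev m k l x : O x ->
  christoffel h i m k l x = Gam hf dk gA GA k m l (sl x).
Proof.
move=> Ox; rewrite /christoffel GamE evM ev_cst //; congr (_ * _).
have p a b c : partial i a (fun y => h i y b c) x = dk a (gA b c) (sl x).
  by apply: partial_ev => // y Oy; rewrite h_gA // mxE.
rewrite ev_sum; apply: eq_bigr => r _.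
by rewrite !p invmx_ev // mxE evM !evD evN.
Qed.

Lemma ricci_ev x : O x -> ricci h i x = evm (Ric hf dk gA GA) (sl x).
Proof.
move=> Ox; apply/matrixP => k l; rewrite !mxE ev_sum.
have p a m b c : partial i a (christoffel h i m b c) x
     = dk a (Gam hf dk gA GA b m c) (sl x).
  by apply: partial_ev => // y Oy; rewrite christoffel_ev.
have GS a b c : Gam hf dk gA GA a b c = Gam hf dk gA GA c b a.
  exact: Gam_sym.
rewrite -big_split; apply: eq_bigr => m _; rewrite Riem_entry.
rewrite (evD (_ - _)) (evD (dk _ _)) (evD (\sum_r _)) !evN sumrB.
congr (_ - _ + (_ - _)).
- by rewrite p GS.
- by rewrite p GS.
- rewrite ev_sum; apply: eq_bigr => r _.
  by rewrite evM !christoffel_ev // (GS k r l).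
- rewrite ev_sum; apply: eq_bigr => r _.
  by rewrite evM !christoffel_ev // (GS k r m).
Qed.

Lemma scalar_curvature_ev x : O x ->
  scalar_curvature h i x = Scal hf dk gA GA (sl x).
Proof.
by move=> Ox; rewrite /scalar_curvature /Scal ev_tr evmM invmx_ev // ricci_ev.
Qed.

Section Function.
Variables (F : 'rV[R]_n -> R) (f : cfun D).
Hypothesis F_f : forall y, O y -> F y = f (sl y).

Lemma hessian_ev x : O x -> hessian h i F x = evm (Hess hf dk gA GA f) (sl x).
Proof.
move=> Ox; apply/matrixP => k l; rewrite !mxE evD evN; congr (_ - _).
  apply: partial_ev => // y Oy; exact: partial_ev.
rewrite ev_sum; apply: eq_bigr => m _; rewrite evM christoffel_ev //.
by congr (_ * _); exact: partial_ev.
Qed.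

Lemma laplacian_ev x : O x -> laplacian h i F x = Lap hf dk gA GA f (sl x).
Proof.
by move=> Ox; rewrite /laplacian /Lap ev_tr evmM invmx_ev // hessian_ev.
Qed.

Lemma sqnorm_gradient_ev x : O x ->
  sqnorm_gradient h i F x = Inner dk GA f f (sl x).
Proof.
move=> Ox; rewrite /Inner ev_sum; apply: eq_bigr => k _.
rewrite ev_sum; apply: eq_bigr => l _.
by rewrite 2!evM invmx_ev // mxE; congr (_ * _ * _); exact: partial_ev.
Qed.
End Function.

Lemma sqnorm_tensor_ev (S : 'M[cfun D]_n) x : O x ->
  sqnorm_tensor h i x (evm S (sl x)) = sqn GA S (sl x).
Proof.
move=> Ox; rewrite /sqn ev_sum; apply: eq_bigr => k _.
rewrite ev_sum; apply: eq_bigr => l _.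
rewrite ev_sum; apply: eq_bigr => m _.
rewrite ev_sum; apply: eq_bigr => r _.
by rewrite 3!evM invmx_ev // !mxE.
Qed.
End Tube.

(** * Metrics as matrices over the ring of smooth functions *)

Section MetricRing.
Variables (R : realType) (n : nat) (E : normedModType R) (D : opens E).
Variable m : E -> 'M[R]_n.
Hypothesis m_Ck : forall k a b, Ck k D (fun z => m z a b).
Hypothesis m_sym : forall z, oset D z -> (m z)^T = m z.
Hypothesis m_pos : forall z, oset D z ->
  forall v : 'rV[R]_n, v != 0 -> 0 < (v *m m z *m v^T) ord0 ord0.

Definition mA : 'M[cfun D]_n := \matrix_(a, b) mk_cfun (fun k => m_Ck k a b).

Lemma evm_mA z : oset D z -> evm mA z = m z.
Proof. by move=> Dz; apply/matrixP => a b; rewrite !mxE mk_cfunE. Qed.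

Lemma mA_T : mA^T = mA.
Proof.
apply/matrixP => a b; rewrite !mxE; apply: cfunP => z Dz.
by rewrite !mk_cfunE // -{1}(m_sym Dz) mxE.
Qed.

Lemma mA_det_gt0 z : oset D z -> 0 < (\det mA) z.
Proof. by move=> Dz; rewrite evm_det // evm_mA //; apply: posdef_det; exact: m_pos. Qed.

Let detV_Ck k : Ck k D (fun z => ((\det mA) z)^-1).
Proof.
apply: Ck_inv => [|z /mA_det_gt0|]; [exact: cfun_open|by rewrite lt0r => /andP[]|].
exact: cfun_Ck.
Qed.

(** Cramer's rule, the positive determinant being inverted as a smooth function. *)
Definition MA : 'M[cfun D]_n := mk_cfun detV_Ck *: \adj mA.

Lemma MmA : MA *m mA = 1%:M.
Proof.
rewrite -scalemxAl mul_adj_mx scale_scalar_mx (_ : _ * _ = 1) //.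
apply: cfunP => z Dz; rewrite evM mk_cfunE // ev1 // mulVf //.
by rewrite gt_eqF // mA_det_gt0.
Qed.

Let sqrt_Ck k : Ck k D (fun z => Num.sqrt ((\det mA) z)).
Proof.
by apply: Ck_sqrt => [|z /mA_det_gt0//|]; [exact: cfun_open|exact: cfun_Ck].
Qed.

Let sqrtV_Ck k : Ck k D (fun z => (Num.sqrt ((\det mA) z))^-1).
Proof.
apply: Ck_inv => [|z /mA_det_gt0|]; [exact: cfun_open| |exact: sqrt_Ck].
by rewrite -sqrtr_gt0 lt0r => /andP[].
Qed.

Definition rhoA : cfun D := mk_cfun sqrt_Ck.
Definition rhoVA : cfun D := mk_cfun sqrtV_Ck.

Lemma rhoA_sq : rhoA * rhoA = \det mA.
Proof.
apply: cfunP => z Dz; rewrite evM mk_cfunE // -expr2 sqr_sqrtr //.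
exact/ltW/mA_det_gt0.
Qed.

Lemma rhoA_inv : rhoA * rhoVA = 1.
Proof.
apply: cfunP => z Dz; rewrite evM !mk_cfunE // ev1 // divff //.
by rewrite gt_eqF // sqrtr_gt0 mA_det_gt0.
Qed.

Lemma rhoAE z : oset D z -> rhoA z = Num.sqrt (\det (m z)).
Proof. by move=> Dz; rewrite mk_cfunE // evm_det // evm_mA. Qed.
End MetricRing.

(** * Change of chart *)

Section Chart.
Variables (R : realType) (n : nat) (M : closedManifold R n).
Local Notation V := 'rV[R]_n.
Implicit Types (i j : 'I_(charts M)).

Lemma chart_img_openset i : open (chart_img i).
Proof. exact: chart_img_open. Qed.

Lemma chart_imgP i q : chart_dom i q -> chart_img i (chart i q).
Proof. by move=> iq; exists q. Qed.

Lemma chart_inv_dom i x : chart_img i x -> chart_dom i (chart_inv i x).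
Proof. by move=> [q iq <-]; rewrite chartK. Qed.

Lemma chart_invK i x : chart_img i x -> chart i (chart_inv i x) = x.
Proof. by move=> [q iq <-]; rewrite chartK. Qed.

Lemma chart_at i q : chart_dom i q -> {for q, continuous (chart i)}.
Proof.
move=> iq; have := @chart_continuous R n M i.
by rewrite continuous_open_subspace ?inE => [/(_ q)|]; [rewrite inE; apply|exact: chart_dom_open].
Qed.

Lemma chart_inv_at i x : chart_img i x -> {for x, continuous (chart_inv i)}.
Proof.
move=> ix; have := @chart_inv_continuous R n M i.
by rewrite continuous_open_subspace ?inE => [/(_ x)|]; [rewrite inE; apply|exact: chart_img_open].
Qed.

Definition overlap i j : set V := chart i @` (chart_dom i `&` chart_dom j).

Definition transition i j (x : V) : V := chart j (chart_inv i x).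

Lemma overlapP i j x :
  overlap i j x <-> chart_img i x /\ chart_dom j (chart_inv i x).
Proof.
split=> [[q [iq jq] <-]|[[q iq <-]]]; first by rewrite chartK //; split=> //; exists q.
by rewrite chartK // => jq; exists q.
Qed.

Lemma overlap_sub i j : overlap i j `<=` chart_img i.
Proof. by move=> x /overlapP[]. Qed.

Lemma overlap_open i j : open (overlap i j).
Proof.
rewrite openE => x /overlapP[ix jx].
have h : \forall y \near x, chart_dom j (chart_inv i y).
  by apply: (chart_inv_at ix); apply: open_nbhs_nbhs; split=> //; exact: chart_dom_open.
have h' : \forall y \near x, chart_img i y.
  by apply: open_nbhs_nbhs; split=> //; exact: chart_img_openset.
by apply: filterS2 h h' => y jy iy; apply/overlapP.
Qed.

Lemma transition_img i j x : overlap i j x -> chart_img j (transition i j x).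
Proof. by move=> /overlapP[_ jx]; exact: chart_imgP. Qed.

Lemma transition_overlap i j x : overlap i j x -> overlap j i (transition i j x).
Proof.
move=> /overlapP[ix jx]; apply/overlapP; split; first exact: chart_imgP.
by rewrite chartK //; exact: chart_inv_dom.
Qed.

Lemma transition_inv i j x : overlap i j x ->
  chart_inv j (transition i j x) = chart_inv i x.
Proof. by move=> /overlapP[ix jx]; rewrite /transition chartK. Qed.

Lemma transitionK i j x : overlap i j x -> transition j i (transition i j x) = x.
Proof.
by move=> ox; rewrite /transition transition_inv // chart_invK //; exact: overlap_sub ox.
Qed.

Lemma transition_Ck i j k l : Ck k (overlap i j) (fun x => transition i j x ord0 l).
Proof.
exact: (@smooth_Ck _ _ _ _ k _ [::] (overlap_open (i:=i) (j:=j)) (@subset_refl _ _) (transition_smooth i j l)).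
Qed.

Definition chart_opens i : opens V := Opens (chart_img_openset (i:=i)).

Definition overlap_opens i j : opens V := Opens (overlap_open (i:=i) (j:=j)).

Lemma partialE i k (F : V -> R) x : chart_img i x ->
  partial i k F x = 'D_(unit_vec R k) F x.
Proof. by move=> ix; rewrite /partial pderiv_interior //; exact: chart_img_near. Qed.

Lemma transition_jacobianE i j x a b : overlap i j x ->
  transition_jacobian i j x a b
  = 'D_(unit_vec R a) (fun y => transition i j y ord0 b) x.
Proof. by move=> /overlap_sub ix; rewrite mxE partialE. Qed.

Lemma partial_transition i j k (F : V -> R) (Fi : V -> R) x : overlap i j x ->
  Ck 1 (chart_img j) F -> (forall y, overlap i j y -> Fi y = F (transition i j y)) ->
  partial i k Fi x
  = \sum_l transition_jacobian i j x k l * partial j l F (transition i j x).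
Proof.
move=> ox CF FiF; have ix := overlap_sub ox; have jy := transition_img ox.
rewrite partialE //.
have -> : 'D_(unit_vec R k) Fi x = 'D_(unit_vec R k) (F \o transition i j) x.
  apply: (@eq_derive_open _ _ (overlap i j)) => //; first exact: overlap_open.
  by move=> y; rewrite inE => /FiF.
have [_ ->] : is_derive x (unit_vec R k) (F \o transition i j)
    (\sum_l 'D_(unit_vec R k) (fun y => transition i j y ord0 l) x
            * 'D_(unit_vec R l) F (transition i j x)).
  apply: (@is_derive_chain _ _ _ F (chart_img j)) => //; first exact: chart_img_openset.
  by move=> l; apply/derivableP; have [_ + _] := @transition_Ck i j 1 l; apply.
by apply: eq_bigr => l _; rewrite transition_jacobianE // partialE.
Qed.

Definition dcol i (F : V -> R) (x : V) : 'cV[R]_n := \col_k partial i k F x.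

Definition inner (h : metric M) i (F G : V -> R) (x : V) : R :=
  \sum_k \sum_l invmx (h i x) k l * partial i k F x * partial i l G x.

Lemma innerE h i F G x :
  inner h i F G x = ((dcol i F x)^T *m invmx (h i x) *m dcol i G x) ord0 ord0.
Proof.
rewrite -mulmxA mxE; apply: eq_bigr => k _.
rewrite mx_entryT [dcol _ _ _ _ _]mxE [X in _ = _ * X]mxE mulr_sumr.
by apply: eq_bigr => l _; rewrite [dcol _ _ _ _ _]mxE; ring.
Qed.

Lemma sqnorm_gradientE h i F x : sqnorm_gradient h i F x = inner h i F F x.
Proof. by []. Qed.

Lemma is_derive_coord (x v : V) l :
  is_derive x v (fun y : V => y ord0 l) (v ord0 l).
Proof.
apply: is_derive_line0.
have -> : (fun s : R => (x + s *: v) ord0 l)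
        = cst (x ord0 l) + v ord0 l *: (@id R).
  by apply/funext => s; rewrite !mxE mulrC.
rewrite -[X in is_derive _ _ _ X]add0r.
apply: is_deriveD; rewrite -[X in is_derive _ _ _ X](mulr1 (v ord0 l)).
exact: is_deriveZ.
Qed.

Lemma Ck_coord k (O : set V) l : open O -> Ck k O (fun y => y ord0 l).
Proof.
move=> oO; have c1 (y : V) : {for y, continuous (fun y : V => y ord0 l)}.
  exact: coord_continuous.
case: k => [|k]; first by move=> y _; exact: c1.
split=> [y _|y v _|v]; [exact: c1|by have [] := is_derive_coord y v l|].
rewrite (_ : 'D_v _ = cst (v ord0 l)); first exact: Ck_cst.
by apply/funext => y; have [_ ->] := is_derive_coord y v l.
Qed.

Lemma eq_partial i k (O : set V) (F G : V -> R) x : open O -> O `<=` chart_img i ->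
  O x -> (forall y, O y -> F y = G y) -> partial i k F x = partial i k G x.
Proof.
move=> oO Oi Ox FG; rewrite !partialE; try exact: Oi.
by apply: (@eq_derive_open _ _ O) => // y; rewrite inE => /FG.
Qed.

Lemma eq_inner h i (O : set V) (F F' G G' : V -> R) x :
  open O -> O `<=` chart_img i -> O x -> (forall y, O y -> F y = F' y) ->
  (forall y, O y -> G y = G' y) -> inner h i F G x = inner h i F' G' x.
Proof.
move=> oO Oi Ox FF GG; apply: eq_bigr => k _; apply: eq_bigr => l _.
by rewrite (eq_partial k oO Oi Ox FF) (eq_partial l oO Oi Ox GG).
Qed.

Section Riemannian.
Variables (h : metric M) (hR : riemannian h).

Lemma metric_Ck i k a b : Ck k (chart_img i) (fun x => h i x a b).
Proof.
have [hs _ _ _] := hR.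
exact: (@smooth_Ck _ _ _ _ k _ [::] (chart_img_openset (i:=i)) (@subset_refl _ _) (hs i a b)).
Qed.

Lemma metric_unit i x : chart_img i x -> h i x \in unitmx.
Proof.
have [_ _ hp _] := hR; move=> ix; rewrite unitmxE unitfE gt_eqF //.
by apply: posdef_det; exact: hp.
Qed.

Lemma metric_transition i j x : overlap i j x ->
  h i x = transition_jacobian i j x *m h j (transition i j x)
          *m (transition_jacobian i j x)^T.
Proof. by have [_ _ _] := hR; apply. Qed.

Lemma jacobian_unit i j x : overlap i j x -> transition_jacobian i j x \in unitmx.
Proof.
move=> ox; have := metric_unit (overlap_sub ox).
rewrite (metric_transition ox) unitmx_mul => /andP[+ _].
by rewrite unitmx_mul => /andP[].
Qed.

Lemma invmx_transition i j x : overlap i j x ->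
  (transition_jacobian i j x)^T *m invmx (h i x) *m transition_jacobian i j x
  = invmx (h j (transition i j x)).
Proof.
move=> ox; have uJ := jacobian_unit ox.
have uj := metric_unit (transition_img ox); have ui := metric_unit (overlap_sub ox).
set J := transition_jacobian i j x in uJ *.
have e : h i x *m invmx (h i x) = 1%:M by exact: mulmxV.
rewrite {1}(metric_transition ox) -/J -!mulmxA in e.
have e2 : h j (transition i j x) *m (J^T *m invmx (h i x)) = invmx J.
  by rewrite -[LHS]mul1mx -(mulVmx uJ) -mulmxA e mulmx1.
rewrite -[LHS]mul1mx -(mulVmx uj) -!mulmxA (mulmxA _ (invmx _)) (mulmxA (h j _)).
by rewrite (mulmxA (h j _)) -(mulmxA (h j _)) e2 mulVmx // mulmx1.
Qed.

Lemma dcol_transition i j (F Fi : V -> R) x : overlap i j x ->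
  Ck 1 (chart_img j) F -> (forall y, overlap i j y -> Fi y = F (transition i j y)) ->
  dcol i Fi x = transition_jacobian i j x *m dcol j F (transition i j x).
Proof.
move=> ox CF FiF; apply/colP => k; rewrite !mxE (partial_transition _ ox CF FiF).
by apply: eq_bigr => l _; rewrite [dcol _ _ _ _ _]mxE.
Qed.

Lemma inner_transition i j (F Fi G Gi : V -> R) x : overlap i j x ->
  Ck 1 (chart_img j) F -> (forall y, overlap i j y -> Fi y = F (transition i j y)) ->
  Ck 1 (chart_img j) G -> (forall y, overlap i j y -> Gi y = G (transition i j y)) ->
  inner h i Fi Gi x = inner h j F G (transition i j x).
Proof.
move=> ox CF FiF CG GiG; rewrite !innerE.
rewrite (dcol_transition ox CF FiF) (dcol_transition ox CG GiG) trmx_mul.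
by rewrite -(invmx_transition ox) !mulmxA.
Qed.

Lemma volume_transition i j x : overlap i j x ->
  Num.sqrt (\det (h i x)) =
  `|\det (transition_jacobian i j x)| * Num.sqrt (\det (h j (transition i j x))).
Proof.
move=> ox; rewrite (metric_transition ox) !det_mulmx det_tr mulrAC -expr2.
by rewrite sqrtrM ?sqr_ge0 // sqrtr_sqr.
Qed.

Section Static.
Variables (i : 'I_(charts M)) (O : opens V) (Oi : oset O `<=` chart_img i).

Let mk_Ck k a b : Ck k O (fun x => h i x a b).
Proof. exact: Ck_sub Oi (metric_Ck i k a b). Qed.
Let mk_sym x : oset O x -> (h i x)^T = h i x.
Proof. by have [_ + _ _] := hR; move=> hs /Oi; exact: hs. Qed.
Let mk_pos x : oset O x ->
  forall v : 'rV[R]_n, v != 0 -> 0 < (v *m h i x *m v^T) ord0 ord0.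
Proof. by have [_ _ + _] := hR; move=> hs /Oi; exact: hs. Qed.

Let gO := mA mk_Ck.
Let GO := MA mk_Ck mk_pos.
Let dO := @dk R n V O id.

Let h_gO x : [set x | oset O (id x)] x -> h i x = evm gO (id x).
Proof. by move=> Ox; rewrite evm_mA. Qed.

Let id_line (x v : V) (s : R) : id (x + s *: v) = id x + s *: id v.
Proof. by []. Qed.

Let id_cont : continuous (@id V). Proof. by move=> x. Qed.

Let inv_ev x : oset O x -> invmx (h i x) = evm GO x.
Proof. exact: (invmx_ev (sl := id) (MmA mk_Ck mk_pos) h_gO). Qed.

Let partial_O (f : cfun O) k x : oset O x -> partial i k f x = dO k f x.
Proof.
by move=> Ox; apply: (partial_ev id_line id_cont (fun x => @Oi x)).
Qed.

Lemma inner_ev (F G : V -> R) (f g : cfun O) x :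
  (forall y, oset O y -> F y = f y) -> (forall y, oset O y -> G y = g y) ->
  oset O x -> inner h i F G x = Inner dO GO f g x.
Proof.
move=> Ff Gg Ox.
rewrite (eq_inner _ (cfun_open O) Oi Ox Ff Gg) /inner /Inner ev_sum.
apply: eq_bigr => k _; rewrite ev_sum; apply: eq_bigr => l _.
by rewrite 2!evM inv_ev // mxE !partial_O.
Qed.

Lemma inner_Ck k (F G : V -> R) : (forall k, Ck k O F) -> (forall k, Ck k O G) ->
  Ck k O (inner h i F G).
Proof.
move=> CF CG; have oO := cfun_open O.
apply: eq_Ck (cfun_Ck (Inner dO GO (mk_cfun CF) (mk_cfun CG)) k) => // y.
by rewrite inE => Oy; rewrite (@inner_ev F G (mk_cfun CF) (mk_cfun CG)) // => z Oz;
  rewrite mk_cfunE.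
Qed.

(** The Hessian with both indices raised. Its entries are its values on pairs of differentials of
    coordinate functions, which [hess_sharp_inner] expresses by inner products. *)
Definition hess_sharp (F : V -> R) (x : V) : 'M[R]_n :=
  invmx (h i x) *m hessian h i F x *m invmx (h i x).

Lemma laplacian_hess_sharp F x : oset O x ->
  laplacian h i F x = \tr (h i x *m hess_sharp F x).
Proof.
move=> /Oi ix; rewrite /hess_sharp /laplacian !mulmxA mulmxV ?mul1mx; last exact: metric_unit.
by rewrite mxtrace_mulC.
Qed.

Lemma hess_sharp_inner (F A B : V -> R) x :
  (forall k, Ck k O F) -> (forall k, Ck k O A) -> (forall k, Ck k O B) -> oset O x ->
  ((dcol i A x)^T *m hess_sharp F x *m dcol i B x) ord0 ord0 *+ 2
  = inner h i A (inner h i F B) x + inner h i B (inner h i F A) x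
    - inner h i F (inner h i A B) x.
Proof.
move=> CF CA CB Ox.
pose f := mk_cfun CF; pose a := mk_cfun CA; pose b := mk_cfun CB.
have Ef y : oset O y -> F y = f y by move=> Oy; rewrite mk_cfunE.
have Ea y : oset O y -> A y = a y by move=> Oy; rewrite mk_cfunE.
have Eb y : oset O y -> B y = b y by move=> Oy; rewrite mk_cfunE.
rewrite (@inner_ev A _ a (Inner dO GO f b)) //; last by move=> y Oy; exact: inner_ev.
rewrite (@inner_ev B _ b (Inner dO GO f a)) //; last by move=> y Oy; exact: inner_ev.
rewrite (@inner_ev F _ f (Inner dO GO a b)) //; last by move=> y Oy; exact: inner_ev.
have H := @Hess_Inner (cfun O) n (half_cst O) (half_cst2 O) dO gO GO
  (@dk_derivation _ _ _ O id) (@dkC _ _ _ O id) (mA_T mk_Ck mk_sym) (MmA mk_Ck mk_pos) f a b.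
rewrite -evN -!evD -H evMn; congr (_ *+ 2).
rewrite -[RHS](_ : evm ((grad dO GO a)^T *m Hess (half_cst O) dO gO GO f *m grad dO GO b) x ord0 ord0 = _); last by rewrite mxE.
congr (fun_of_matrix _ ord0 ord0); rewrite (evmM (_ *m _)) (evmM (_^T)).
have Eg (C : V -> R) (c : cfun O) : (forall y, oset O y -> C y = c y) ->
    evm (grad dO GO c) x = invmx (h i x) *m dcol i C x.
  move=> Cc; rewrite /grad evmM inv_ev //; congr (_ *m _).
  apply/colP => k; rewrite !mxE (eq_partial k (cfun_open O) Oi Ox Cc).
  by rewrite partial_O.
have eT m p (X : 'M[cfun O]_(m, p)) : evm X^T x = (evm X x)^T.
  by apply/matrixP => k l; rewrite !mxE.
have iT : (invmx (h i x))^T = invmx (h i x) by rewrite trmx_inv mk_sym.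
rewrite (eT _ _ (grad dO GO a)) (Eg _ _ Ea) (Eg _ _ Eb) trmx_mul iT.
rewrite -(hessian_ev id_line id_cont (fun x => @Oi x) (MmA mk_Ck mk_pos) h_gO Ef) //.
by rewrite /hess_sharp !mulmxA.
Qed.
Lemma laplacian_Ck k (F : V -> R) : (forall k, Ck k O F) -> Ck k O (laplacian h i F).
Proof.
move=> CF; have oO := cfun_open O.
apply: eq_Ck (cfun_Ck (Lap (half_cst O) dO gO GO (mk_cfun CF)) k) => // x.
rewrite inE => Ox; apply/esym.
apply: (laplacian_ev id_line id_cont (fun x => @Oi x) (MmA mk_Ck mk_pos) h_gO) => // y Oy.
by rewrite mk_cfunE.
Qed.

(** The components of rho (F grad G - G grad F). The last clause allows the field to be extended by
    zero when F has compact support in the chart. *)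
Lemma chart_green (F G : V -> R) : (forall k, Ck k O F) -> (forall k, Ck k O G) ->
  exists Y : 'I_n -> V -> R,
  [/\ forall l k, Ck k O (Y l),
      forall x, oset O x -> \sum_l 'D_(unit_vec R l) (Y l) x
        = Num.sqrt (\det (h i x)) * (F x * laplacian h i G x - G x * laplacian h i F x) &
      forall x l, oset O x -> (\forall y \near x, F y = 0) -> Y l x = 0].
Proof.
move=> CF CG; pose f := mk_cfun CF; pose g := mk_cfun CG.
have lapE (H : V -> R) (CH : forall k, Ck k O H) x : oset O x ->
    laplacian h i H x = Lap (half_cst O) dO gO GO (mk_cfun CH) x.
  move=> Ox.
  apply: (laplacian_ev id_line id_cont (fun x => @Oi x) (MmA mk_Ck mk_pos) h_gO) => // y Oy.
  by rewrite mk_cfunE.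
pose Y l : cfun O := rhoA mk_Ck mk_pos * (f * grad dO GO g l 0 - g * grad dO GO f l 0).
exists (fun l => Y l : V -> R); split.
- by move=> l k; exact: cfun_Ck.
- have hd k : derivation (dO k) by exact: dd_derivation.
  have hC k l c : dO k (dO l c) = dO l (dO k c) by exact: ddC.
  move=> x Ox; have := divergence_Green (half_cst2 O) hd hC
    (mA_T mk_Ck mk_sym) (MmA mk_Ck mk_pos) (rhoA_sq mk_Ck mk_pos) (rhoA_inv mk_Ck mk_pos) f g.
  move=> /(congr1 (fun c : cfun O => c x)); rewrite ev_sum => E.
  transitivity (\sum_l dO l (Y l) x).
    by apply: eq_bigr => l _; rewrite /dO /dk ddE.
  apply: etrans E _; rewrite evM evD evN 2!evM rhoAE // !mk_cfunE //.
  by rewrite (lapE F CF x Ox) (lapE G CG x Ox).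
- move=> x l Ox F0; have fx : f x = 0 by rewrite mk_cfunE //; exact: (nbhs_singleton F0).
  rewrite /Y evM evD evN 2!evM fx mul0r.
  have -> : grad dO GO f l 0 x = 0.
    rewrite /grad mxE ev_sum big1 // => k _; rewrite evM [(\col_ _ _) _ _]mxE /dO /dk ddE //.
    have -> : 'D_(unit_vec R k) f x = 0.
      have E0 : \forall y \near x, f y = (cst 0 : V -> R) y.
        have Onear : \forall y \near x, oset O y by apply: open_nbhs_nbhs; split=> //; exact: cfun_open.
        by near=> y; rewrite mk_cfunE; near: y.
      by rewrite (near_eq_derive _ E0) // derive_cst.
    by rewrite mulr0.
  by rewrite mulr0 subr0 mulr0.
Unshelve. all: by end_near. Qed.
End Static.

(** The entries of the raised Hessian in the chart j are iterated inner products of F with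
    coordinate functions of j, and these agree in both charts by the first order chain rule. The
    trace against the metric is then invariant. *)
Lemma laplacian_transition i j (F Fi : V -> R) x : overlap i j x ->
  (forall k, Ck k (chart_img j) F) ->
  (forall y, overlap i j y -> Fi y = F (transition i j y)) ->
  laplacian h i Fi x = laplacian h j F (transition i j x).
Proof.
move=> ox CF FiF; set J := transition_jacobian i j x.
have Oi : oset (overlap_opens i j) `<=` chart_img i by exact: overlap_sub.
have Oj : oset (chart_opens j) `<=` chart_img j by [].
have jy := transition_img ox.
rewrite (laplacian_hess_sharp (O := overlap_opens i j) Oi) //.
rewrite (laplacian_hess_sharp (O := chart_opens j) Oj) //.
suff -> : hess_sharp j F (transition i j x) = J^T *m hess_sharp i Fi x *m J.
  by rewrite (metric_transition ox) -/J -!mulmxA mxtrace_mulC -!mulmxA.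
(* The coordinate functions of the chart j, read in j and in i; their differentials at the point are
   the standard basis and the columns of the Jacobian. *)
pose y l (z : V) := z ord0 l.
pose t l (z : V) := transition i j z ord0 l.
have Cy k l : Ck k (chart_img j) (y l) by apply: Ck_coord; exact: chart_img_openset.
have Ct k l : Ck k (overlap i j) (t l) by exact: transition_Ck.
have CFi k : Ck k (overlap i j) Fi.
  apply: (@eq_Ck _ _ k (overlap i j) (F \o transition i j)); first exact: overlap_open.
    by move=> z; rewrite inE => oz; rewrite /= FiF.
  apply: (@Ck_comp _ _ _ (chart_img j)) => //; [exact: chart_img_openset|exact: overlap_open|exact: transition_img|exact: Ct].
have in1 (A Ai B Bi : V -> R) : (forall k, Ck k (chart_img j) A) ->
    (forall z, overlap i j z -> Ai z = A (transition i j z)) ->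
    (forall k, Ck k (chart_img j) B) ->
    (forall z, overlap i j z -> Bi z = B (transition i j z)) ->
    forall z, overlap i j z -> inner h i Ai Bi z = inner h j A B (transition i j z).
  by move=> CA AiA CB BiB z oz; exact: inner_transition.
have Cin (A B : V -> R) : (forall k, Ck k (chart_img j) A) ->
    (forall k, Ck k (chart_img j) B) -> forall k, Ck k (chart_img j) (inner h j A B).
  by move=> CA CB k; exact: (inner_Ck (O := chart_opens j) Oj).
apply/matrixP => k l; apply/eqP; rewrite -(eqr_pMn2r (n := 2)) //; apply/eqP.
have Hj := @hess_sharp_inner j (chart_opens j) Oj F (y k) (y l) _ CF (Cy^~ k) (Cy^~ l) jy.
have Hi := @hess_sharp_inner i (overlap_opens i j) Oi Fi (t k) (t l) _ CFi (Ct^~ k) (Ct^~ l) ox.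
have ey a z : overlap i j z -> t a z = y a (transition i j z) by [].
have dy a : dcol j (y a) (transition i j x) = delta_mx a ord0.
  apply/colP => b; rewrite !mxE partialE //.
  have [_ e] := is_derive_coord (transition i j x) (unit_vec R b) a.
  by rewrite [LHS]e mxE !eqxx andbT /= eq_sym.
have dt a : dcol i (t a) x = col a J.
  by apply/colP => b; rewrite !mxE.
transitivity (((dcol j (y k) (transition i j x))^T *m hess_sharp j F (transition i j x) *m dcol j (y l) (transition i j x)) ord0 ord0 *+ 2).
  congr (_ *+ 2); rewrite !dy trmx_delta -rowE.
  by rewrite -colE !mxE.
have in2 (A Ai B Bi C Ci : V -> R) : (forall k, Ck k (chart_img j) A) ->
    (forall z, overlap i j z -> Ai z = A (transition i j z)) ->
    (forall k, Ck k (chart_img j) B) ->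
    (forall z, overlap i j z -> Bi z = B (transition i j z)) ->
    (forall k, Ck k (chart_img j) C) ->
    (forall z, overlap i j z -> Ci z = C (transition i j z)) ->
    inner h i Ai (inner h i Bi Ci) x = inner h j A (inner h j B C) (transition i j x).
  move=> CA AiA CB BiB CC CiC; have I := in1; apply: I => //; first exact: Cin.
  by move=> z oz; exact: in1.
have e1 := in2 _ _ _ _ _ _ (Cy^~ k) (ey k) CF FiF (Cy^~ l) (ey l).
have e2 := in2 _ _ _ _ _ _ (Cy^~ l) (ey l) CF FiF (Cy^~ k) (ey k).
have e3 := in2 _ _ _ _ _ _ CF FiF (Cy^~ k) (ey k) (Cy^~ l) (ey l).
have Hij := etrans Hi (congr2 (fun a b => a - b) (congr2 +%R e1 e2) e3).
apply: (etrans Hj); apply: (etrans (esym Hij)).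
rewrite !dt; congr (_ *+ 2).
rewrite tr_col -!row_mul -mulmxA.
rewrite mxE -[in RHS]mulmxA mxE [RHS]mxE; apply: eq_bigr => a _.
congr (_ * _); rewrite mxE [RHS]mxE; apply: eq_bigr => b _.
by rewrite [col _ _ _ _]mxE.
Qed.
End Riemannian.
End Chart.

(** * Lebesgue measure on R^n *)

Section ImageMeasure.
Local Open Scope ereal_scope.
Context d d' (T1 : measurableType d) (T2 : measurableType d') (R : realType).
Variables (m : {measure set T1 -> \bar R}) (f : T1 -> T2).

Definition image_measure of measurable_fun [set: T1] f : set T2 -> \bar R :=
  fun A => m (f @^-1` A).

Variable mf : measurable_fun [set: T1] f.

Let image0 : image_measure mf set0 = 0.
Proof. by rewrite /image_measure preimage_set0 measure0. Qed.

Let image_ge0 A : 0 <= image_measure mf A.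
Proof. exact: measure_ge0. Qed.

Let image_sigma_additive : semi_sigma_additive (image_measure mf).
Proof.
move=> F mF tF mUF; rewrite /image_measure preimage_bigcup.
apply: measure_semi_sigma_additive.
- by move=> n; rewrite -[X in measurable X]setTI; exact: mf.
- apply/trivIsetP => /= i j _ _ ij; rewrite -preimage_setI.
  by move/trivIsetP : tF => /(_ _ _ _ _ ij) ->//; rewrite preimage_set0.
- by rewrite -preimage_bigcup -[X in measurable X]setTI; exact: mf.
Qed.

HB.instance Definition _ := isMeasure.Build _ _ _
  (image_measure mf) image0 image_ge0 image_sigma_additive.
End ImageMeasure.

Definition coord_preimages (R : realType) n : set (set 'rV[R]_n) :=
  [set A | exists i (B : set (measurableTypeR R)), measurable B /\
           A = [set v : 'rV[R]_n | B (v ord0 i)]].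

Definition vec (R : realType) n := g_sigma_algebraType (@coord_preimages R n).

Section Vec.
Variable R : realType.
Local Notation RR := (measurableTypeR R).

Lemma measurable_coord n (i : 'I_n) :
  measurable_fun setT (fun v : vec R n => v ord0 i : RR).
Proof.
move=> _ B mB; rewrite setTI; apply: sub_sigma_algebra.
by exists i, B.
Qed.

Lemma measurable_to_vec d (T : measurableType d) n (D : set T) (f : T -> vec R n) :
  (forall i, measurable_fun D (fun x => f x ord0 i : RR)) -> measurable_fun D f.
Proof.
move=> mf mD; move: (mD); apply: (@measurability _ _ _ _ D f (@coord_preimages R n)) => //.
by move=> _ [A [i [B [mB ->]]] <-]; exact: mf.
Qed.

(** The splitting of R^(n+1) used in [nonneg_integral]. [leb] is built along it, so that Tonelli's
    theorem identifies integrals against [leb] with the iterated integral. *)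
Definition consv n (p : RR * vec R n) : vec R n.+1 :=
  row_mx (const_mx p.1 : 'rV[R]_1) (p.2 : 'rV[R]_n).

Definition unconsv n (v : vec R n.+1) : RR * vec R n :=
  ((v : 'rV[R]_(1 + n)) ord0 (lshift n ord0), rsubmx (v : 'rV[R]_(1 + n))).

Lemma consvK n : cancel (@consv n) (@unconsv n).
Proof.
move=> [t v]; rewrite /unconsv /consv /=; congr (_, _).
  by rewrite row_mxEl mxE.
by rewrite row_mxKr.
Qed.

Lemma unconsvK n : cancel (@unconsv n) (@consv n).
Proof.
move=> v; rewrite /unconsv /consv /= -[RHS](hsubmxK (v : 'rV[R]_(1 + n))).
suff -> : const_mx ((v : 'rV[R]_(1 + n)) ord0 (lshift n ord0)) =
    lsubmx (v : 'rV[R]_(1 + n)) by [].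
by apply/rowP => i; rewrite !mxE (ord1 i).
Qed.

Lemma consv0 n (p : RR * vec R n) : (consv p : 'rV[R]_(1 + n)) ord0 (lshift n ord0) = p.1.
Proof. by apply: etrans (row_mxEl _ _ _ _) _; rewrite mxE. Qed.

Lemma consvS n (p : RR * vec R n) (j : 'I_n) :
  (consv p : 'rV[R]_(1 + n)) ord0 (rshift 1 j) = p.2 ord0 j.
Proof. exact: row_mxEr. Qed.

Lemma consvE0 n (p : RR * vec R n) : consv p ord0 ord0 = p.1.
Proof. by rewrite -(consv0 p); congr (consv p _ _); apply/val_inj. Qed.

Lemma consvE n (p : RR * vec R n) (j : 'I_n) : consv p ord0 (lift ord0 j) = p.2 ord0 j.
Proof. by rewrite -consvS; congr (consv p _ _); apply/val_inj. Qed.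

Lemma measurable_consv n : measurable_fun setT (@consv n).
Proof.
apply: measurable_to_vec => i; case: (@splitP 1 n i) => j ij.
  have -> : i = (lshift n ord0 : 'I_(1 + n)) by apply/val_inj; move: ij; rewrite (ord1 j).
  under eq_fun do rewrite consv0; exact: measurable_fst.
have -> : i = (rshift 1 j : 'I_(1 + n)) by apply/val_inj.
under eq_fun do rewrite consvS.
exact: (measurableT_comp (measurable_coord j) measurable_snd).
Qed.

Lemma measurable_unconsv n : measurable_fun setT (@unconsv n).
Proof.
apply: measurable_fun_pair; first exact: measurable_coord.
apply: measurable_to_vec => i; under eq_fun do rewrite mxE.
exact: measurable_coord.
Qed.

Local Open Scope ereal_scope.

Let leb1 : {sigma_finite_measure set RR -> \bar R} := @lebesgue_measure R.

Section Step.
Variables (n : nat) (m : {sigma_finite_measure set (vec R n) -> \bar R}).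

Definition leb_step : set (vec R n.+1) -> \bar R :=
  image_measure (leb1 \x m)%E (@measurable_consv n).

HB.instance Definition _ := Measure.copy leb_step (image_measure (leb1 \x m)%E (@measurable_consv n)).

Let leb_step_sigma_finite : sigma_finite setT leb_step.
Proof.
have /sigma_finiteP[F [TF ndF Foo]] := sigma_finiteT leb1.
have /sigma_finiteP[G [TG ndG Goo]] := sigma_finiteT m.
exists (fun k => @unconsv n @^-1` (F k `*` G k)).
  apply/esym; rewrite -subTset => v _; have [a _ Fa] : (\bigcup_k F k) (unconsv v).1 by rewrite -TF.
  have [b _ Gb] : (\bigcup_k G k) (unconsv v).2 by rewrite -TG.
  exists (maxn a b) => //; split => /=.
    by move: Fa; apply/subsetPset/ndF/leq_maxl.
  by move: Gb; apply/subsetPset/ndG/leq_maxr.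
move=> k; have [mF Fk] := Foo k; have [mG Gk] := Goo k; split.
  rewrite -[X in measurable X]setTI; apply: measurable_unconsv => //.
  exact: measurableX.
rewrite /leb_step /image_measure.
have -> : @consv n @^-1` (@unconsv n @^-1` (F k `*` G k)) = F k `*` G k.
  have E q : unconsv (@consv n q) = q := consvK q.
  by apply/seteqP; split => q; rewrite /preimage /mkset E.
apply: (@eq_ind_r _ _ (fun z => z < +oo) _ _ (product_measure1E leb1 m mF mG)).
by rewrite lte_mul_pinfty // ge0_fin_numE.
Qed.

HB.instance Definition _ := Measure_isSigmaFinite.Build _ _ _ leb_step leb_step_sigma_finite.
End Step.

Fixpoint leb n : {sigma_finite_measure set (vec R n) -> \bar R} :=
  match n with
  | 0 => @dirac _ (vec R 0) (0%R : 'rV[R]_0) R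
  | k.+1 => leb_step (leb k)
  end.

Lemma measurable_section n (F : vec R n.+1 -> \bar R) (t : RR) :
  measurable_fun [set: vec R _] F -> measurable_fun setT (fun v => F (consv (t, v))).
Proof.
move=> mF; apply: (measurableT_comp mF).
apply: (measurableT_comp (@measurable_consv n)).
exact: measurable_fun_pair.
Qed.

Lemma integral_leb_step n (F : vec R n.+1 -> \bar R) :
  measurable_fun [set: vec R _] F -> (forall v, 0 <= F v) ->
  \int[leb n.+1]_v F v = \int[@lebesgue_measure R]_t \int[leb n]_v F (consv (t, v)).
Proof.
move=> mF F0.
transitivity (\int[@lebesgue_measure R \x leb n]_p F (consv p)).
  rewrite -(@ge0_integral_pushforward _ _ _ _ _ (@consv n) (@measurable_consv n)
    (@lebesgue_measure R \x leb n) setT F) //.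
by rewrite fubini_tonelli1 //; exact: (measurableT_comp mF (@measurable_consv n)).
Qed.

Lemma integral_leb n (F : vec R n -> \bar R) :
  measurable_fun [set: vec R _] F -> (forall v, 0 <= F v) ->
  \int[leb n]_v F v = nonneg_integral F.
Proof.
elim: n F => [|n ih] F mF F0 /=.
  by rewrite integral_dirac // diracT mul1e.
rewrite integral_leb_step //; apply: eq_integral => t _.
by rewrite -ih //; exact: measurable_section.
Qed.

Definition box n (a b : 'rV[R]_n) : set (vec R n) :=
  [set v | forall i, a ord0 i < v ord0 i <= b ord0 i]%R.

Lemma measurable_box n (a b : 'rV[R]_n) : measurable (box a b).
Proof.
have -> : box a b = \bigcap_(i in [set: 'I_n])
    ((fun v : vec R n => v ord0 i : RR) @^-1` `]a ord0 i, b ord0 i]).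
  apply/seteqP; split => v /= H i; first by move=> _; rewrite /= in_itv /=; exact: H.
  by have := H i I; rewrite /= in_itv.
apply: fin_bigcap_measurable => // i _.
rewrite -[X in measurable X]setTI; exact: measurable_coord.
Qed.

Lemma box_setI n (a b a' b' : 'rV[R]_n) : box a b `&` box a' b' =
  box (\row_i Num.max (a ord0 i) (a' ord0 i)) (\row_i Num.min (b ord0 i) (b' ord0 i)).
Proof.
apply/seteqP; split => v /=.
  by move=> [H H'] i; rewrite !mxE gt_max le_min; have /andP[-> ->] := H i; exact: H'.
move=> H; split => i; have := H i; rewrite !mxE gt_max le_min.
  by move=> /andP[/andP[-> _] /andP[-> _]].
by move=> /andP[/andP[_ ->] /andP[_ ->]].
Qed.

Lemma box_cover n : \bigcup_k box (const_mx (- k%:R)%R : 'rV[R]_n) (const_mx k%:R%R) = setT.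
Proof.
apply/seteqP; split => // v _.
exists (Num.trunc `|v : 'rV[R]_n|).+1 => // i; rewrite !mxE.
have := entry_le_norm (v : 'rV[R]_n) i; have := truncnS_gt `|v : 'rV[R]_n|.
by rewrite ler_norml => h /andP[h1 h2]; apply/andP; split; lra.
Qed.

Definition boxes n : set (set (vec R n)) := [set A | exists a b, A = box a b].

Lemma vec_measurableE n : measurable = <<s @boxes n >> :> set (set (vec R n)).
Proof.
apply/seteqP; split; last first.
  apply: smallest_sub; first exact: sigma_algebra_measurable.
  by move=> _ [a [b ->]]; exact: measurable_box.
apply: smallest_sub; first exact: smallest_sigma_algebra.
move=> _ [i [B [mB ->]]].
suff mi : measurable_fun setT
    (fun v : g_sigma_algebraType (@boxes n) => (v : 'rV[R]_n) ord0 i : RR).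
  by have := mi measurableT B mB; rewrite setTI.
apply: (@measurability _ _ _ _ _ _ R.-ocitv.-measurable) => //.
move=> _ [_ [[x y] _ <-] <-]; rewrite setTI.
suff -> : (fun v : g_sigma_algebraType (@boxes n) => (v : 'rV[R]_n) ord0 i : RR)
    @^-1` `]x, y]%classic = \bigcup_k box (\row_j if j == i then x else - k%:R)%R
    (\row_j if j == i then y else k%:R)%R.
  apply: bigcup_measurable => k _; apply: sub_sigma_algebra.
  by eexists; eexists.
apply/seteqP; split => v /=; rewrite ?in_itv.
  move=> vi; have : [set: vec R n] v by []; rewrite -(@box_cover n) => -[k _ Hk].
  exists k => // j; rewrite !mxE; case: eqVneq => [-> //|_].
  by have := Hk j; rewrite !mxE.
by move=> [k _ /(_ i)]; rewrite !mxE eqxx.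
Qed.

Lemma vec_measure_unique n (m1 m2 : {measure set (vec R n) -> \bar R}) :
  (forall a b, m1 (box a b) = m2 (box a b)) -> (forall a b, m1 (box a b) < +oo) ->
  forall A, measurable A -> m1 A = m2 A.
Proof.
move=> m12 m1oo A mA.
apply: (measure_unique (@boxes n)
  (fun k => box (const_mx (- k%:R)%R) (const_mx k%:R%R))) => //.
- exact: vec_measurableE.
- by move=> _ _ [a [b ->]] [a' [b' ->]]; rewrite box_setI; eexists; eexists.
- by move=> i; eexists; eexists.
- exact: box_cover.
- by move=> _ [a [b ->]].
Qed.

Lemma leb_box n (a b : 'rV[R]_n) :
  leb n (box a b) = (\prod_i Num.max (b ord0 i - a ord0 i) 0)%:E.
Proof.
elim: n => [|n ih] in a b *.
  rewrite big_ord0 /= diracE mem_set // => i; by case: i.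
have H : @consv n @^-1` box a b = `]a ord0 ord0, b ord0 ord0] `*`
    box (\row_j a ord0 (lift ord0 j)) (\row_j b ord0 (lift ord0 j)).
  apply/seteqP; split => -[t v] /=.
    move=> H; split; first by have := H ord0; rewrite consvE0 in_itv.
    by move=> j; have := H (lift ord0 j); rewrite consvE !mxE.
  move=> [Ht Hv] i; case: (unliftP ord0 i) => [j|] ->; last first.
    by rewrite consvE0; rewrite in_itv in Ht.
  by rewrite consvE; have := Hv j; rewrite !mxE.
apply: etrans (congr1 (leb1 \x leb n)%E H) _.
apply: etrans (product_measure1E leb1 (leb n) _ (measurable_box _ _)) _ => //.
rewrite ih big_ord_recl EFinM; congr (_ * _)%E.
  apply: etrans (lebesgue_measure_itv `]a ord0 ord0, b ord0 ord0]) _.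
  rewrite /= lte_fin; case: ltP => h.
    by rewrite -EFinD; congr (_%:E); apply/esym/max_idPl; rewrite subr_ge0 ltW.
  by congr (_%:E); apply/esym/max_idPr; rewrite subr_le0.
by congr (_%:E); apply: eq_bigr => j _; rewrite !mxE.
Qed.

Lemma leb_box_lty n (a b : 'rV[R]_n) : leb n (box a b) < +oo.
Proof. by rewrite leb_box ltry. Qed.

Let affine1 (d c : R) : RR -> RR := fun t => (t * d + c)%R.

Let measurable_affine1 d c : measurable_fun setT (affine1 d c).
Proof.
apply: measurable_funD => //; apply: measurable_funM => //.
Qed.

Let affine1_oc (d c a b : R) : d != 0%R ->
  lebesgue_measure (affine1 d c @^-1` `]a, b]%classic) =
  if (a < b)%R then ((b - a) / `|d|)%:E else 0.
Proof.
move=> d0; case: (ltrgt0P d) (d0) => // dg _.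
  have -> : affine1 d c @^-1` `]a, b]%classic = `]((a - c) / d)%R, ((b - c) / d)%R]%classic.
    apply/seteqP; split => t; rewrite /affine1 /= !in_itv /=.
      by move=> /andP[h1 h2]; rewrite ltr_pdivrMr // ler_pdivlMr //; apply/andP; split; lra.
    by rewrite ltr_pdivrMr // ler_pdivlMr // => /andP[h1 h2]; apply/andP; split; lra.
  rewrite lebesgue_measure_itv /= lte_fin ltr_pM2r ?invr_gt0 // ltrD2r.
  by case: ltP => // _; rewrite -EFinD; congr (_%:E); field.
have -> : affine1 d c @^-1` `]a, b]%classic = `[((b - c) / d)%R, ((a - c) / d)%R[%classic.
  apply/seteqP; split => t; rewrite /affine1 /= !in_itv /=.
    by move=> /andP[h1 h2]; rewrite ltr_ndivlMr // ler_ndivrMr //; apply/andP; split; lra.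
  by rewrite ltr_ndivlMr // ler_ndivrMr // => /andP[h1 h2]; apply/andP; split; lra.
rewrite lebesgue_measure_itv /= lte_fin ltr_nM2r ?invr_lt0 // ltrD2r.
by case: ltP => // _; rewrite -EFinD; congr (_%:E); field.
Qed.

(** |d| times the image of Lebesgue measure under the affine map agrees with Lebesgue measure on
    half-open intervals, hence everywhere. For negative d the preimage is half-open at the other
    end, which does not change its length. *)
Lemma lebesgue_integral_affine (d c : R) (F : RR -> \bar R) : d != 0%R ->
  measurable_fun setT F -> (forall t, 0 <= F t) ->
  `|d|%:E * \int[@lebesgue_measure R]_t F (t * d + c)%R = \int[@lebesgue_measure R]_t F t.
Proof.
move=> d0 mF F0.
pose m := mscale (NngNum (normr_ge0 d)) (image_measure leb1 (measurable_affine1 d c)).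
have E A : measurable A -> lebesgue_measure A = m A.
  apply: lebesgue_measure_unique => _ [[a b] _ <-].
  apply: etrans (congr1 (fun x => `|d|%:E * x) (esym (affine1_oc c a b d0))).
  rewrite lebesgue_measure_itv /= lte_fin; case: ltP => h; last by rewrite mule0.
  by rewrite -EFinM -EFinD mulrC divfK // normr_eq0.
rewrite [RHS](@eq_measure_integral _ _ _ _ m); last by move=> A mA _; exact: E.
rewrite /m ge0_integral_mscale //; congr (_ * _).
by rewrite -(@ge0_integral_pushforward _ _ _ _ _ _ (measurable_affine1 d c) leb1 setT F).
Qed.

Lemma measurable_consvr n (t : RR) : measurable_fun setT (fun v : vec R n => consv (t, v)).
Proof. by apply: (measurableT_comp (@measurable_consv n)); exact: measurable_fun_pair. Qed.

Lemma measurable_consvl n (v : vec R n) : measurable_fun setT (fun t : RR => consv (t, v)).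
Proof. by apply: (measurableT_comp (@measurable_consv n)); exact: measurable_fun_pair. Qed.

Lemma measurable_affine n (L : 'M[R]_n) (c : 'rV[R]_n) :
  measurable_fun setT (fun v : vec R n => (v *m L + c)%R : vec R n).
Proof.
apply: measurable_to_vec => i; under eq_fun do rewrite !mxE.
apply: measurable_funD => //; apply: measurable_sum => j.
by apply: measurable_funM => //; exact: measurable_coord.
Qed.

(** * Linear substitutions in integrals over R^n *)

Definition scales n (L : 'M[R]_n) := forall (c : 'rV[R]_n) (F : vec R n -> \bar R),
  measurable_fun [set: vec R n] F -> (forall v, 0 <= F v) ->
  `|\det L|%:E * \int[leb n]_v F (v *m L + c)%R = \int[leb n]_v F v.

Lemma scalesM n (L L' : 'M[R]_n) : scales L -> scales L' -> scales (L *m L').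
Proof.
move=> sL sL' c F mF F0; rewrite -(sL' c F) // -(sL 0%R (fun v => F (v *m L' + c)%R)) //.
  rewrite muleA -EFinM -normrM det_mulmx mulrC; congr (_ * _).
  by apply: eq_integral => v _; rewrite addr0 mulmxA.
exact: (measurableT_comp mF (measurable_affine _ _)).
Qed.

Lemma integral_consv_swap n (F : vec R n.+1 -> \bar R) :
  measurable_fun [set: vec R _] F -> (forall v, 0 <= F v) ->
  \int[leb n.+1]_v F v = \int[leb n]_v \int[leb1]_t F (consv (t, v)).
Proof.
move=> mF F0; rewrite integral_leb_step //.
apply: (@fubini_tonelli _ _ _ _ _ leb1 (leb n) (fun p => F (consv p))) => //.
exact: (measurableT_comp mF (@measurable_consv n)).
Qed.

Lemma measurable_integral_vec n (F : vec R n.+1 -> \bar R) :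
  measurable_fun [set: vec R _] F -> (forall v, 0 <= F v) ->
  measurable_fun setT (fun t : RR => \int[leb n]_v F (consv (t, v))).
Proof.
move=> mF F0.
apply: (@measurable_fun_fubini_tonelli_F _ _ _ _ _ (leb n) (fun p => F (consv p))) => //.
exact: (measurableT_comp mF (@measurable_consv n)).
Qed.

Lemma measurable_integral_coord n (F : vec R n.+1 -> \bar R) :
  measurable_fun [set: vec R _] F -> (forall v, 0 <= F v) ->
  measurable_fun setT (fun v : vec R n => \int[leb1]_t F (consv (t, v))).
Proof.
move=> mF F0.
apply: (@measurable_fun_fubini_tonelli_G _ _ _ _ _ leb1 (fun p => F (consv p))) => //.
exact: (measurableT_comp mF (@measurable_consv n)).
Qed.

Let row_affine n (L : 'M[R]_(1 + n)) (c : 'rV[R]_(1 + n)) t (v : 'rV[R]_n) :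
  (row_mx (const_mx t : 'rV[R]_1) v *m L + c =
  row_mx (const_mx (t * L ord0 ord0 + ((v *m dlsubmx L) ord0 ord0 + c ord0 ord0)))
         (v *m drsubmx L + (t *: ursubmx L + rsubmx c)))%R.
Proof.
rewrite -{1}[L]submxK -{1}[c]hsubmxK mul_row_block add_row_mx; congr (row_mx _ _).
  apply/rowP => i; rewrite !mxE !big_ord1 !mxE (ord1 i) -addrA.
  by congr (_ * L _ _ + (_ + c _ _))%R; apply/val_inj.
rewrite addrA [X in (X + _)%R]addrC; congr (_ + _ + _)%R; apply/rowP => i.
by rewrite !mxE !big_ord1 !mxE.
Qed.

Lemma consv_affine n (L : 'M[R]_n.+1) (c : 'rV[R]_n.+1) t (v : vec R n) :
  let B : 'M[R]_(1 + n) := L in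
  (consv (t, v) *m L + c)%R =
  consv (t * L ord0 ord0 + ((v *m dlsubmx B) ord0 ord0 + c ord0 ord0),
         v *m drsubmx B + (t *: ursubmx B + rsubmx (c : 'rV_(1 + n))))%R.
Proof.
exact: row_affine.
Qed.

(** Rows multiply from the left, so the first coordinate of v L depends on that of v alone. For a
    fixed first coordinate the rest is an affine map of lower dimension, whose translation depends
    on that coordinate; this is why [scales] allows translations. *)
Lemma scales_upper n (L : 'M[R]_n) : is_trig_mx L^T -> L \in unitmx -> scales L.
Proof.
elim: n => [|n ih] in L *.
  move=> _ _ c F mF F0; rewrite det_mx00 normr1 mul1e.
  by apply: eq_integral => v _; congr (F _); apply/rowP; case.
move=> trL uL c F mF F0; pose B : 'M[R]_(1 + n) := L.
have : is_trig_mx (block_mx (ulsubmx B) (ursubmx B) (dlsubmx B) (drsubmx B))^T.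
  by rewrite submxK.
rewrite tr_block_mx is_trig_block_mx // => /and3P[/eqP/(congr1 trmx)].
rewrite trmxK trmx0 => B0 _ trB.
have detL : \det L = (L ord0 ord0 * \det (drsubmx B))%R.
  have {1}-> : L = block_mx (ulsubmx B) (ursubmx B) 0 (drsubmx B) by rewrite -B0 submxK.
  rewrite (@det_ublock _ 1 n) det_mx11 !mxE; congr (L _ _ * _)%R; exact/val_inj.
have : \det L != 0%R by rewrite -unitfE -unitmxE.
rewrite detL mulf_eq0 negb_or => /andP[d0 D0].
have sB : scales (drsubmx B) by apply: ih => //; rewrite unitmxE unitfE.
have mFL : measurable_fun setT (fun v : vec R n.+1 => F (v *m L + c)%R).
  exact: (measurableT_comp mF (measurable_affine _ _)).
rewrite (integral_leb_step mFL) // integral_leb_step //.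
rewrite normrM EFinM -muleA -ge0_integralZl //; last 2 first.
- exact: (measurable_integral_vec mFL).
- by move=> t _; exact: integral_ge0.
rewrite -(lebesgue_integral_affine (c ord0 ord0) d0); last 2 first.
- exact: measurable_integral_vec.
- by move=> t; exact: integral_ge0.
congr (_ * _); apply: eq_integral => t _.
rewrite -(sB (t *: ursubmx B + rsubmx (c : 'rV_(1 + n)))%R
  (fun v => F (consv (t * L ord0 ord0 + c ord0 ord0, v)%R))); last 2 first.
- exact: (measurableT_comp mF (measurable_consvr _)).
- by [].
by congr (_ * _); apply: eq_integral => v _; rewrite consv_affine B0 mulmx0 mxE add0r.
Qed.

(** Now the last n coordinates do not involve the first, so the first one is integrated innermost,
    after an exchange by Tonelli. *)
Lemma scales_lower n (L : 'M[R]_n) : is_trig_mx L -> L \in unitmx -> scales L.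
Proof.
elim: n => [|n ih] in L *.
  move=> _ _ c F mF F0; rewrite det_mx00 normr1 mul1e.
  by apply: eq_integral => v _; congr (F _); apply/rowP; case.
move=> trL uL c F mF F0; pose B : 'M[R]_(1 + n) := L.
have : is_trig_mx (block_mx (ulsubmx B) (ursubmx B) (dlsubmx B) (drsubmx B)).
  by rewrite submxK.
rewrite is_trig_block_mx // => /and3P[/eqP B0 _ trB].
have detL : \det L = (L ord0 ord0 * \det (drsubmx B))%R.
  have {1}-> : L = block_mx (ulsubmx B) 0 (dlsubmx B) (drsubmx B) by rewrite -B0 submxK.
  rewrite (@det_lblock _ 1 n) det_mx11 !mxE; congr (L _ _ * _)%R; exact/val_inj.
have : \det L != 0%R by rewrite -unitfE -unitmxE.
rewrite detL mulf_eq0 negb_or => /andP[d0 D0].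
have sB : scales (drsubmx B) by apply: ih => //; rewrite unitmxE unitfE.
have mFL : measurable_fun setT (fun v : vec R n.+1 => F (v *m L + c)%R).
  exact: (measurableT_comp mF (measurable_affine _ _)).
rewrite (integral_consv_swap mFL) // integral_consv_swap //.
rewrite mulrC normrM EFinM -muleA -ge0_integralZl //; last 2 first.
- exact: (measurable_integral_coord mFL).
- by move=> t _; exact: integral_ge0.
rewrite -(sB (rsubmx (c : 'rV_(1 + n)))); last 2 first.
- exact: measurable_integral_coord.
- by move=> t; exact: integral_ge0.
congr (_ * _); apply: eq_integral => v _.
rewrite -(@lebesgue_integral_affine _ ((v *m dlsubmx B) ord0 ord0 + c ord0 ord0)%R
  (fun t => F (consv (t, v *m drsubmx B + rsubmx (c : 'rV_(1 + n)))%R)) d0); last 2 first.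
- exact: (measurableT_comp mF (measurable_consvl _)).
- by [].
by congr (_ * _); apply: eq_integral => t _; rewrite consv_affine B0 scaler0 add0r.
Qed.
Lemma scales1 n : scales (1%:M : 'M[R]_n).
Proof. apply: scales_lower; [exact: scalar_mx_is_trig|exact: unitmx1]. Qed.

Lemma integral_leb_shift n (c : 'rV[R]_n) (F : vec R n -> \bar R) :
  measurable_fun [set: vec R n] F -> (forall v, 0 <= F v) ->
  \int[leb n]_v F (v + c)%R = \int[leb n]_v F v.
Proof.
move=> mF F0; rewrite -(scales1 c mF F0) det1 normr1 mul1e.
by under [in RHS]eq_integral do rewrite mulmx1.
Qed.

(** A permutation of coordinates carries boxes to boxes with the same side lengths, and boxes
    determine the measure. *)
Lemma scales_perm n (s : 'S_n) : scales (perm_mx s : 'M[R]_n).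
Proof.
have d1 : (`|\det (perm_mx s : 'M[R]_n)| = 1)%R.
  by rewrite det_perm normrX normrN1 expr1n.
have mp := measurable_affine (perm_mx s : 'M[R]_n) 0%R.
pose m := image_measure (leb n) mp.
have E a b : leb n (box a b) = m (box a b).
  have pE (v : 'rV[R]_n) i : (v *m perm_mx s + 0)%R ord0 i = v ord0 ((s^-1)%g i).
    by rewrite addr0 -[s in perm_mx s]invgK -col_permE mxE.
  have H : (fun v : vec R n => (v *m (perm_mx s : 'M[R]_n) + 0)%R : vec R n) @^-1` box a b =
      box (\row_i a ord0 (s i)) (\row_i b ord0 (s i)).
    apply/seteqP; split => v /= H i.
      by have := H (s i); rewrite pE permK !mxE.
    by rewrite pE; have := H ((s^-1)%g i); rewrite !mxE permKV.
  apply: etrans (congr1 (leb n) (esym H)).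
  rewrite !leb_box; congr (_%:E).
  rewrite (reindex_inj (@perm_inj _ s)); apply: eq_bigr => i _.
  by rewrite !mxE.
move=> c F mF F0; rewrite d1 mul1e -(integral_leb_shift c mF F0).
have mFc : measurable_fun setT (fun v : vec R n => F (v + c)%R).
  apply: (measurableT_comp mF); have := measurable_affine (1%:M : 'M[R]_n) c.
  by under eq_fun do rewrite mulmx1.
have mE A : measurable A -> leb n A = m A.
  by move=> mA; apply: (vec_measure_unique E) => // a b; exact: leb_box_lty.
rewrite [RHS](@eq_measure_integral _ _ _ _ m); last by move=> A mA _; exact: mE.
rewrite (@ge0_integral_pushforward _ _ _ _ _ _ mp (leb n) setT (fun v => F (v + c)%R)) //.
by apply: eq_integral => v _ /=; rewrite addr0.
Qed.

(** LUP decomposition: a permutation, a lower and an upper triangular matrix are treated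
    separately. *)
Lemma scales_unitmx n (L : 'M[R]_n) : L \in unitmx -> scales L.
Proof.
case: n => [|n] in L *.
  by apply/scales_lower/is_trig_mxP => i; case: i.
move=> uL; have := cormen_lup_correct L; have := cormen_lup_perm L.
have := cormen_lup_lower L; have := cormen_lup_upper L; have := cormen_lup_detL L.
case: (cormen_lup L) => [[P A] U] /= dA hU hA /is_perm_mxP[s ->] E0.
have E : perm_mx s *m L = A *m U := E0.
have uA : A \in unitmx by rewrite unitmxE dA unitr1.
have -> : L = perm_mx (s^-1)%g *m (A *m U).
  by rewrite -E mulmxA -perm_mxM mulVg perm_mx1 mul1mx.
have uU : U \in unitmx.
  have : A *m U \in unitmx by rewrite -E unitmx_mul unitmx_perm.
  by rewrite unitmx_mul => /andP[].
apply: scalesM; first exact: scales_perm.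
apply: scalesM.
  apply: scales_lower => //; apply/is_trig_mxP => i j ij.
  by rewrite hA 1?ltnW // -val_eqE /= (ltn_eqF ij).
by apply: scales_upper => //; apply/is_trig_mxP => i j ij; rewrite mxE hU.
Qed.

Lemma open_box n (O : set 'rV[R]_n) x : open O -> O x ->
  exists a b : {ffun 'I_n -> rat},
    (forall i, ratr (a i) < x ord0 i < ratr (b i))%R /\
    (forall v : 'rV[R]_n, (forall i, ratr (a i) <= v ord0 i <= ratr (b i))%R -> O v).
Proof.
rewrite openE => /(_ x) Ox /Ox /nbhs_ballP[e /= e0 He].
have /fin_all_exists[a Ha] : forall i, exists q : rat,
    (x ord0 i - e < ratr q < x ord0 i)%R.
  by move=> i; apply: rat_in_itvoo; rewrite gtrBl.
have /fin_all_exists[b Hb] : forall i, exists q : rat,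
    (x ord0 i < ratr q < x ord0 i + e)%R.
  by move=> i; apply: rat_in_itvoo; rewrite ltrDl.
exists [ffun i => a i], [ffun i => b i]; split => [i|v Hv].
  by rewrite !ffunE; have /andP[_ ->] := Ha i; have /andP[-> _] := Hb i.
apply: He; apply/ball_rowP => // i; have := Hv i; rewrite !ffunE => /andP[h1 h2].
have /andP[h3 _] := Ha i; have /andP[_ h4] := Hb i.
by rewrite ltr_norml; apply/andP; split; lra.
Qed.

(** Boxes with rational corners, enumerated by codes of pairs of corners; other codes give the empty
    set. The closed box must lie in [O], which provides compactness inside [O]. *)
Definition open_boxes n (O : set 'rV[R]_n) (k : nat) : set (vec R n) :=
  if unpickle k is Some (a, b) then
    let a' := (\row_i ratr ((a : {ffun 'I_n -> rat}) i))%R in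
    let b' := (\row_i ratr ((b : {ffun 'I_n -> rat}) i))%R in
    [set v | box a' b' v /\
       forall w : 'rV[R]_n, (forall i, a' ord0 i <= w ord0 i <= b' ord0 i)%R -> O w]
  else set0.

Lemma open_boxesP n (O : set 'rV[R]_n) k : open_boxes O k = set0 \/
  exists a b, open_boxes O k = box a b /\
    forall w : 'rV[R]_n, (forall i, a ord0 i <= w ord0 i <= b ord0 i)%R -> O w.
Proof.
rewrite /open_boxes; case: unpickle => [[a b]|]; last by left.
set a' := (\row_i _)%R; set b' := (\row_i _)%R.
have [H|H] := pselect (forall w : 'rV[R]_n,
  (forall i, a' ord0 i <= w ord0 i <= b' ord0 i)%R -> O w).
  by right; exists a', b'; split => //; apply/seteqP; split => v //= [].
by left; apply/seteqP; split => v //= [].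
Qed.

Lemma measurable_open_boxes n (O : set 'rV[R]_n) k : measurable (open_boxes O k).
Proof.
by case: (open_boxesP O k) => [->//|[a [b [-> _]]]]; exact: measurable_box.
Qed.

Lemma bigcup_open_boxes n (O : set 'rV[R]_n) : open O -> \bigcup_k open_boxes O k = O.
Proof.
move=> oO; apply/seteqP; split => x.
  move=> [k _]; case: (open_boxesP O k) => [->//|[a [b [-> H]]]] Hx.
  by apply: H => i; have /andP[/ltW -> ->] := Hx i.
move=> /(open_box oO)[a [b [Hx H]]]; exists (pickle (a, b)) => //.
rewrite /open_boxes pickleK; split => [i|w Hw].
  by have /andP[h1 h2] := Hx i; rewrite !mxE h1 ltW.
by apply: H => i; have := Hw i; rewrite !mxE.
Qed.

Lemma open_measurable_vec n (O : set 'rV[R]_n) : open O -> measurable (O : set (vec R n)).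
Proof.
move=> /bigcup_open_boxes <-; apply: bigcupT_measurable => k.
exact: measurable_open_boxes.
Qed.

Lemma continuous_measurable_vec n (O : set 'rV[R]_n) (F : 'rV[R]_n -> R) : open O ->
  {in O, continuous F} -> measurable_fun (O : set (vec R n)) (F : vec R n -> RR).
Proof.
move=> oO cF; apply: (measurability _ (RGenOpens.measurableE R)) => //.
move=> _ [_ [a [b ->] <-]]; apply: open_measurable_vec.
rewrite openE => x [Ox Fx]; apply: filterI; first exact: open_nbhs_nbhs.
by apply: (cF x (mem_set Ox)); apply: open_nbhs_nbhs; split => //; exact: interval_open.
Qed.

Lemma measure_eq_cover d (T : measurableType d) (m1 m2 : {measure set T -> \bar R})
    (g : nat -> set T) (A : set T) :
  (forall k, measurable (g k)) ->
  (forall k B, measurable B -> B `<=` g k -> m1 B = m2 B) ->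
  measurable A -> A `<=` \bigcup_k g k -> m1 A = m2 A.
Proof.
move=> mg E mA Ag; pose h := seqDU (fun k => A `&` g k).
have -> : A = \bigcup_k h k.
  by rewrite -seqDU_bigcup_eq -setI_bigcupr; apply/esym/setIidl.
have mh k : measurable (h k).
  apply: measurableD; first exact: measurableI.
  by apply: bigsetU_measurable => i _; exact: measurableI.
have mU : measurable (\bigcup_k h k) by exact: bigcupT_measurable.
rewrite !measure_bigcup //; try exact: trivIset_seqDU.
apply: eq_eseriesr => k _; apply: (E k) => // x [[]] //.
Qed.
End Vec.

(** * Change of variables *)

Section Density.
Local Open Scope ereal_scope.
Context d (T : measurableType d) (R : realType).
Variables (m : {measure set T -> \bar R}) (D : set T) (f : T -> \bar R).

Definition density (mD : measurable D) (mf : measurable_fun D f)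
  (f0 : forall x, D x -> 0 <= f x) : set T -> \bar R :=
  fun A => \int[m]_(x in D `&` A) f x.

Hypotheses (mD : measurable D) (mf : measurable_fun D f) (f0 : forall x, D x -> 0 <= f x).

Let density0 : density mD mf f0 set0 = 0.
Proof. by rewrite /density setI0 integral_set0. Qed.

Let density_ge0 A : 0 <= density mD mf f0 A.
Proof. by apply: integral_ge0 => x [/f0]. Qed.

Let density_sigma_additive : semi_sigma_additive (density mD mf f0).
Proof.
move=> F mF tF mUF; rewrite /density setI_bigcupr.
have mDF k : measurable (D `&` F k) by exact: measurableI.
rewrite ge0_integral_bigcup //.
- by apply: is_cvg_ereal_nneg_natsum => k _; apply: integral_ge0 => x [/f0].
- by apply: measurable_funS mf => // x [k _ []].
- by move=> x [k _ [/f0]].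
- exact: trivIset_setIl.
Qed.

HB.instance Definition _ := isMeasure.Build _ _ _
  (density mD mf f0) density0 density_ge0 density_sigma_additive.
End Density.

Section IntegralBounds.
Local Open Scope ereal_scope.
Context d (T : measurableType d) (R : realType).
Variables (m : {measure set T -> \bar R}) (S : set T) (f : T -> R) (c : R).
Hypotheses (mS : measurable S) (mf : measurable_fun S (fun x => (f x)%:E)).
Hypotheses (c0 : (0 <= c)%R) (f0 : forall x, S x -> (0 <= f x)%R).

Lemma integral_ub : (forall x, S x -> (f x <= c)%R) -> \int[m]_(x in S) (f x)%:E <= c%:E * m S.
Proof.
move=> fc; rewrite -integral_cst //; apply: ge0_le_integral => //.
all: by move=> x Sx; rewrite lee_fin ?f0 ?fc.
Qed.

Lemma integral_lb : (forall x, S x -> (c <= f x)%R) -> c%:E * m S <= \int[m]_(x in S) (f x)%:E.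
Proof.
move=> fc; rewrite -integral_cst //; apply: ge0_le_integral => //.
all: by move=> x Sx; rewrite lee_fin ?f0 ?fc.
Qed.
End IntegralBounds.

Lemma ereal_between (R : realType) (x : \bar R) (a b : R) :
  (a%:E <= x)%E -> (x <= b%:E)%E -> a <= fine x <= b.
Proof. by case: x => [x| |] //; rewrite !lee_fin => -> ->. Qed.

Lemma fine_split (R : realType) (x1 x2 y1 y2 : \bar R) (e p : R) :
  (0 <= x1)%E -> (0 <= x2)%E -> (0 <= y1)%E -> (0 <= y2)%E ->
  (x1 < +oo)%E -> (y1 < +oo)%E -> `|fine x1 - fine y1| <= e * p ->
  (x2 < +oo)%E -> (y2 < +oo)%E -> `|fine x2 - fine y2| <= e * p ->
  [/\ (x1 + x2 < +oo)%E, (y1 + y2 < +oo)%E &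
      `|fine (x1 + x2) - fine (y1 + y2)| <= e * (2 * p)].
Proof.
case: x1 x2 y1 y2 => [x1| |] [x2| |] [y1| |] [y2| |] //= _ _ _ _ _ _ h1 _ _ h2.
split; rewrite ?ltry //; move: h1 h2; rewrite !ler_norml => /andP[h1 h2] /andP[h3 h4].
by apply/andP; split; lra.
Qed.

(** * Boxes and parallelepipeds *)

Section Sandwich.
Variables (R : realType) (n : nat).
Local Notation V := 'rV[R]_n.

(** Box with centre c and half-widths v; being half-open, it is the disjoint union of its two halves
    under bisection. *)
Definition bx (c v : V) : set (vec R n) := box (c - v) (c + v).

Lemma bxP (c v x : V) : (forall i, `|x ord0 i - c ord0 i| < v ord0 i) -> bx c v x.
Proof.
by move=> H i; have := H i; rewrite !mxE ltr_norml => /andP[h1 h2]; apply/andP; split; lra.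
Qed.

Lemma bx_le (c v x : V) i : bx c v x -> `|x ord0 i - c ord0 i| <= v ord0 i.
Proof.
by move=> /(_ i); rewrite !mxE ler_norml => /andP[h1 h2]; apply/andP; split; lra.
Qed.

Lemma leb_bx (c v : V) : (forall i, 0 <= v ord0 i) ->
  leb R n (bx c v) = (\prod_i (2 * v ord0 i))%:E.
Proof.
move=> v0; rewrite leb_box; congr (_%:E); apply: eq_bigr => i _; rewrite !mxE.
by rewrite (_ : _ - _ = 2 * v ord0 i); [apply/max_idPl; rewrite mulr_ge0|ring].
Qed.

Lemma integral_indic_leb (A : set (vec R n)) : measurable A ->
  (\int[leb R n]_y (\1_A y)%:E = leb R n A)%E.
Proof. by move=> mA; rewrite integral_indic //; congr (leb R n _); exact: setIT. Qed.

Lemma leb_affine_preimage (L : 'M[R]_n) (c : V) (A : set (vec R n)) :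
  L \in unitmx -> measurable A ->
  (`|\det L|%:E * leb R n ((fun y : vec R n => (y *m L + c)%R : vec R n) @^-1` A) = leb R n A)%E.
Proof.
move=> uL mA; have H := scales_unitmx uL c (F := fun y => (\1_A y)%:E).
rewrite -[RHS]integral_indic_leb // -H //; last first.
  exact/measurable_EFinP/measurable_indic.
rewrite -integral_indic_leb // -[X in measurable X]setTI.
exact: measurable_affine.
Qed.

(** The parallelepiped c + (box) L, written as a preimage so that it is measurable at once. *)
Definition affine_bx (L : 'M[R]_n) (c v : V) : set (vec R n) :=
  [set y | bx 0 v ((y - c) *m invmx L)].

Lemma affine_bxE (L : 'M[R]_n) (c v : V) : affine_bx L c v =
  (fun y : vec R n => (y *m invmx L - c *m invmx L)%R : vec R n) @^-1` bx 0 v.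
Proof. by apply/seteqP; split => y; rewrite /affine_bx /= mulmxBl. Qed.

Lemma measurable_affine_bx (L : 'M[R]_n) (c v : V) : measurable (affine_bx L c v).
Proof.
rewrite affine_bxE -[X in measurable X]setTI; apply: measurable_affine => //.
exact: measurable_box.
Qed.

Lemma leb_affine_bx (L : 'M[R]_n) (c v : V) : L \in unitmx -> (forall i, 0 <= v ord0 i) ->
  leb R n (affine_bx L c v) = (`|\det L| * \prod_i (2 * v ord0 i))%:E.
Proof.
move=> uL v0; have uV : invmx L \in unitmx by rewrite unitmx_inv.
rewrite EFinM -(leb_bx 0 v0).
rewrite -(leb_affine_preimage (- (c *m invmx L)) uV (A := bx 0 v)); last exact: measurable_box.
rewrite muleA -EFinM -normrM det_inv mulrV -?unitmxE // normr1 mul1e.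
by rewrite affine_bxE.
Qed.

Lemma mulmx_norm_le (L : 'M[R]_n) : exists2 K, 0 < K & forall u : V, `|u *m L| <= K * `|u|.
Proof.
pose K := 1 + \sum_i \sum_j `|L i j|.
have K0 : 0 <= \sum_i \sum_j `|L i j|.
  by apply: sumr_ge0 => i _; apply: sumr_ge0.
exists K => [|u]; first by rewrite /K; lra.
apply: norm_row_le => [|j]; first by rewrite mulr_ge0 // /K; lra.
rewrite mxE; apply: le_trans (ler_norm_sum _ _ _) _.
rewrite mulrDl mul1r mulr_suml; apply: ler_wpDl => //.
apply: ler_sum => i _; rewrite normrM mulrC; apply: ler_pM => //.
  by rewrite (bigD1 j) //= ler_wpDr // sumr_ge0.
exact: entry_le_norm.
Qed.
End Sandwich.

Section ChangeOfVariables.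
Variables (R : realType) (n : nat).
Local Notation V := 'rV[R]_n.
Variables (O O' : set V) (phi psi : V -> V) (b : V -> R).
Hypotheses (oO : open O) (oO' : open O').
Hypothesis phiO : forall x, O x -> O' (phi x).
Hypotheses (phiK : forall x, O x -> psi (phi x) = x) (psiK : forall y, O' y -> phi (psi y) = y).
Hypothesis phi_Ck : forall l, Ck 1 O (fun x => phi x ord0 l).
Hypothesis psiC : forall y, O' y -> {for y, continuous psi}.
Hypothesis b_ge0 : forall y, O' y -> 0 <= b y.
Hypothesis bC : forall y, O' y -> {for y, continuous b}.

Definition jacobian (f : V -> V) (x : V) : 'M[R]_n :=
  \matrix_(k, l) 'D_(unit_vec R k) (fun y => f y ord0 l) x.

Local Notation jac := (jacobian phi).
Hypothesis jacU : forall x, O x -> jac x \in unitmx.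

Let phiC x : O x -> {for x, continuous phi}.
Proof. by move=> Ox; apply: continuous_row => i; exact: Ck_continuous (phi_Ck i) _ Ox. Qed.

Let detC x : O x -> {for x, continuous (fun x => \det (jac x))}.
Proof.
have : Ck 0 O (fun x => \det (jac x)).
  apply: Ck_sum => // s _; apply: CkM => //; first exact: Ck_cst.
  apply: Ck_prod => // i _; under eq_fun do rewrite mxE.
  by have [_ _] := phi_Ck (s i); apply.
by move=> H Ox; exact: Ck_continuous H _ Ox.
Qed.

Let h (x : V) : R := b (phi x) * `|\det (jac x)|.

Let hC x : O x -> {for x, continuous h}.
Proof.
move=> Ox.
have H1 : {for x, continuous (fun x => b (phi x))}.
  exact: (@continuous_comp _ _ _ phi b x (phiC Ox) (bC (phiO Ox))).
have H2 : {for x, continuous (fun x => `|\det (jac x)|)}.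
  by apply: (@cvg_norm _ _ _ _ (nbhs_filter x)); exact: detC.
exact: (@continuousM _ _ (fun x => b (phi x)) _ x H1 H2).
Qed.

Let h_ge0 x : O x -> 0 <= h x.
Proof. by move=> Ox; rewrite mulr_ge0 // b_ge0 //; exact: phiO. Qed.

Let linearize x (e : R) : O x -> 0 < e -> exists2 r : R, 0 < r & ball x r `<=` O /\
  forall y z, ball x r y -> ball x r z ->
    `|(phi z - phi y) *m invmx (jac x) - (z - y)| <= e * `|z - y|.
Proof.
move=> Ox e0; have [K K0 HK] := mulmx_norm_le (invmx (jac x)).
have eK : 0 < e / K by rewrite divr_gt0.
have H l : \forall r \near 0^'+, ball x r `<=` O /\
    forall y z, ball x r y -> ball x r z ->
    `|phi z ord0 l - phi y ord0 l - ((z - y) *m jac x) ord0 l| <= e / K * `|z - y|.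
  have [r r0 [rO Hr]] := Ck_linearize oO (phi_Ck l) Ox eK.
  near=> s; have sr : ball x s `<=` ball x r by apply: le_ball; near: s; exact: nbhs_right_le.
  split=> [y /sr /rO //|y z /sr yr /sr zr].
  have -> : ((z - y) *m jac x) ord0 l =
      \sum_i (z - y) ord0 i * 'D_(unit_vec R i) (fun x => phi x ord0 l) x.
    by rewrite mxE; apply: eq_bigr => i _; rewrite [jac x _ _]mxE.
  exact: Hr.
have O1 : \forall r \near 0^'+, ball x r `<=` O.
  have /nbhs_ballP[r r0 h1] := open_nbhs_nbhs (conj oO Ox).
  near=> s; apply: subset_trans h1; apply: le_ball; near: s; exact: nbhs_right_le.
near (0 : R)^'+ => r; exists r => //.
have Hr : forall l : 'I_n, ball x r `<=` O /\ forall y z, ball x r y -> ball x r z ->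
    `|phi z ord0 l - phi y ord0 l - ((z - y) *m jac x) ord0 l| <= e / K * `|z - y|.
  by near: r; exact: filter_forall.
split; first by near: r.
move=> y z xy xz; rewrite -[z - y in X in _ - X](mulmxK (jacU Ox)) -mulmxBl.
apply: le_trans (HK _) _; rewrite mulrC -ler_pdivlMr // mulrAC.
apply: norm_row_le => [|l]; first by rewrite mulr_ge0 // ltW.
by have [_ /(_ _ _ xy xz)] := Hr l; rewrite !mxE.
Unshelve. all: by end_near. Qed.

(** Extended by 0 outside [O'], to be measurable on the whole space. *)
Let psi' (y : vec R n) : vec R n := if y \in (O' : set V) then psi y else 0.

Let mO : measurable (O : set (vec R n)). Proof. exact: open_measurable_vec. Qed.
Let mO' : measurable (O' : set (vec R n)). Proof. exact: open_measurable_vec. Qed.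

Let mpsi' : measurable_fun setT psi'.
Proof.
apply: measurable_to_vec => i.
have -> : (fun y : vec R n => psi' y ord0 i : measurableTypeR R) =
    ((fun y : vec R n => psi y ord0 i : measurableTypeR R) \_ O').
  by apply/funext => y; rewrite /psi' patchE; case: ifP => // _; rewrite mxE.
apply/(measurable_restrictT _ mO').
have C : {in O', continuous (fun y => psi y ord0 i)}.
  move=> y /set_mem O'y.
  exact: (@continuous_comp _ _ _ psi (fun v => v ord0 i) y (psiC O'y) (@coord_continuous _ _ _ _ _ _)).
exact: (continuous_measurable_vec oO' C).
Qed.

Let mb : measurable_fun (O' : set (vec R n)) (fun y => (b y)%:E).
Proof.
by apply/measurable_EFinP; apply: (continuous_measurable_vec oO') => y /set_mem; exact: bC.
Qed.

Let mh : measurable_fun (O : set (vec R n)) (fun y => (h y)%:E).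
Proof.
by apply/measurable_EFinP; apply: (continuous_measurable_vec oO) => y /set_mem; exact: hC.
Qed.

(** The formula is the equality on subsets of [O] of two measures: the push-forward of b dy under
    [psi], and the measure with density b(phi x) |det phi'(x)|. *)
Let m1 := image_measure (density (leb R n) mO' mb (fun y O'y => b_ge0 O'y)) mpsi'.
Let m2 := density (leb R n) mO mh (fun y Oy => h_ge0 Oy).


Section Local.
Variables (x w : V).
Hypotheses (Ox : O x) (w0 : forall i, 0 < w ord0 i).
Let D := `|\det (jac x)|.

Let wm : R := \big[Num.min/1]_i w ord0 i.

Let wm_gt0 : 0 < wm.
Proof. by rewrite /wm; elim/big_ind: _ => // p q p0 q0; rewrite lt_min p0. Qed.

Let wm_le i : wm <= w ord0 i.
Proof. by rewrite /wm (bigD1 i) //= ge_min lexx. Qed.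

Let W := `|w| + 1.

Let W_gt0 : 0 < W. Proof. by rewrite /W ltr_pwDr. Qed.

(** [s] is the error allowed both in the values of b and, relatively, in the sides of the
    parallelepipeds. Both products are continuous in s and equal to b(phi x) D at s = 0. *)
Let choose_s e : 0 < e -> exists2 s : R, 0 < s < 1 & [/\ s <= e / 2,
  (b (phi x) + s) * (D * (1 + s) ^+ n) <= b (phi x) * D + e / 2 &
  b (phi x) * D - e / 2 <= (b (phi x) - s) * (D * (1 - s) ^+ n)].
Proof.
move=> e0; set c := b (phi x).
have C1 : {for (0 : R), continuous (fun s : R => (c + s) * (D * (1 + s) ^+ n))}.
  apply: cvgM; first by apply: cvgD; [exact: cvg_cst|exact: cvg_id].
  apply: cvgM; first exact: cvg_cst.
  apply: (@continuous_comp _ _ _ (fun s : R => 1 + s) (fun x : R => x ^+ n)).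
    by apply: cvgD; [exact: cvg_cst|exact: cvg_id].
  exact: exprn_continuous.
have C2 : {for (0 : R), continuous (fun s : R => (c - s) * (D * (1 - s) ^+ n))}.
  apply: cvgM; first by apply: cvgB; [exact: cvg_cst|exact: cvg_id].
  apply: cvgM; first exact: cvg_cst.
  apply: (@continuous_comp _ _ _ (fun s : R => 1 - s) (fun x : R => x ^+ n)).
    by apply: cvgB; [exact: cvg_cst|exact: cvg_id].
  exact: exprn_continuous.
have e2 : 0 < e / 2 by rewrite divr_gt0.
have [r1 r10 H1] := continuous_ball C1 e2; have [r2 r20 H2] := continuous_ball C2 e2.
near (0 : R)^'+ => s; exists s.
  by apply/andP; split; near: s; [exact: nbhs_right_gt|exact: nbhs_right_lt].
have s0 : 0 < s by near: s; exact: nbhs_right_gt.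
have B1 : ball (0 : R) r1 s.
  by rewrite /ball /= sub0r normrN gtr0_norm //; near: s; exact: nbhs_right_lt.
have B2 : ball (0 : R) r2 s.
  by rewrite /ball /= sub0r normrN gtr0_norm //; near: s; exact: nbhs_right_lt.
have := H1 s B1; have := H2 s B2; rewrite !subr0 !addr0 expr1n !mulr1 !ltr_norml.
move=> /andP[h1 h2] /andP[h3 h4]; split; [by near: s; exact: nbhs_right_le|lra|lra].
Unshelve. all: by end_near. Qed.

(** The set of y with [psi y] in a small box lies between two parallelepipeds, the images under the
    linear part of the box scaled by 1 - s and by 1 + s ([F3] and [F2]), so both measures are close
    to b(phi x) D times the volume. The estimate is uniform in the centre near x, in view of a
    compactness argument. *)
Lemma density_local e : 0 < e -> \forall c \near x & r \near 0^'+,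
  [/\ (forall z, bx c (r *: w) z -> O z), (m1 (bx c (r *: w)) < +oo)%E,
     (m2 (bx c (r *: w)) < +oo)%E &
  `|fine (m1 (bx c (r *: w))) - fine (m2 (bx c (r *: w)))|
   <= e * \prod_i (2 * (r *: w) ord0 i)].
Proof.
move=> e0; have [s /andP[s0 s1] [se ub lb]] := choose_s e0.
(* The linearisation error, at most eta times 2 r W, has to stay below s times the shortest
   half-width r wm. The bound 1/2 gives |z - c| <= 2 |u| in [F3], whence the factor 2. *)
pose eta := Num.min (2^-1) (s * wm / (4 * W)).
have eta0 : 0 < eta by rewrite lt_min invr_gt0 ltr0n /= divr_gt0 // mulr_gt0.
have eta2 : eta <= 2^-1 by rewrite ge_min lexx.
have etaW : 2 * eta * W < s * wm.
  have : eta <= s * wm / (4 * W) by rewrite ge_min lexx orbT.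
  rewrite ler_pdivlMr ?mulr_gt0 // => h1; have := mulr_gt0 s0 wm_gt0; lra.
have [r1 r10 [r1O lin]] := linearize Ox eta0.
have [K2 K20 HK2] := mulmx_norm_le (jac x).
set c0 := b (phi x) in ub lb.
have c00 : 0 <= c0 by apply/b_ge0/phiO.
have [r2 r20 Hr2] : exists2 r : R, 0 < r & forall z, ball x r z ->
    `|b (phi z) - c0| < s /\ `|h z - c0 * D| < s.
  have Cb : {for x, continuous (fun x => b (phi x))}.
    exact: (@continuous_comp _ _ _ phi b x (phiC Ox) (bC (phiO Ox))).
  have [r r0 Hr] := continuous_ball Cb s0.
  have [r' r'0 Hr'] := continuous_ball (hC Ox) s0.
  exists (Num.min r r') => [|z Hz]; first by rewrite lt_min r0.
  by split; [apply: Hr|apply: Hr']; apply: le_ball Hz; rewrite ge_min lexx ?orbT.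
pose r3 := Num.min r1 r2; have r30 : 0 < r3 by rewrite lt_min r10.
have r3P z : ball x r3 z -> ball x r1 z /\ ball x r2 z.
  by move=> Hz; split; apply: le_ball Hz; rewrite ge_min lexx ?orbT.
have O'x := phiO Ox.
have [r4 r40 [r4O Hr4]] : exists2 r : R, 0 < r & (forall y, ball (phi x) r y -> O' y) /\
    forall y, ball (phi x) r y -> ball x r3 (psi y).
  have /nbhs_ballP[r r0 Hr] := open_nbhs_nbhs (conj oO' O'x).
  have /cvg_ballP /(_ _ r30) := psiC O'x; rewrite phiK // => /nbhs_ballP[r' r'0 Hr'].
  exists (Num.min r r') => [|]; first by rewrite lt_min r0.
  by split=> y Hy; [apply: Hr|apply: Hr']; apply: le_ball Hy; rewrite ge_min lexx ?orbT.
near=> c r.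
have r0 : 0 < r by near: r; exact: nbhs_right_gt.
have rW : r * W < r3 / 2.
  by rewrite -ltr_pdivlMr //; near: r; apply: nbhs_right_lt; rewrite !divr_gt0.
have rK : K2 * (r * W) < r4 / 2.
  rewrite mulrCA -ltr_pdivlMr ?mulr_gt0 //; near: r; apply: nbhs_right_lt.
  by rewrite !divr_gt0 ?mulr_gt0.
have xc : ball x (r3 / 2) c by near: c; apply: nbhsx_ballx; rewrite divr_gt0.
have pc : ball (phi x) (r4 / 2) (phi c).
  near: c; have /cvg_ballP := phiC Ox; apply; by rewrite divr_gt0.
set v := r *: w.
have vi i : v ord0 i = r * w ord0 i by rewrite mxE.
have v0 i : 0 < v ord0 i by rewrite vi mulr_gt0.
have vW i : v ord0 i <= r * W.
  by rewrite vi ler_pM2l //; apply: le_trans (ler_norm _) _; apply: le_trans (entry_le_norm _ _) _; rewrite /W; lra.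
have vm i : r * wm <= v ord0 i by rewrite vi ler_pM2l.
have cx3 : ball x r3 c by apply: le_ball xc; lra.
have F1 z : bx c v z -> ball x r3 z.
  move=> /bx_le Hz; apply: (@ball_splitr _ _ c); first exact: ball_sym.
  by apply/ball_rowP => [|i]; rewrite ?divr_gt0 // distrC; apply: le_lt_trans (Hz i) _; exact: le_lt_trans (vW i) _.
have normle (u : V) : (forall i, `|u ord0 i| <= v ord0 i) -> `|u| <= r * W.
  by move=> Hu; apply: norm_row_le => [|i]; [rewrite ltW // mulr_gt0|apply: le_trans (Hu i) (vW i)].
have F2 y : O' y -> bx c v (psi y) -> affine_bx (jac x) (phi c) ((1 + s) *: v) y.
  move=> O'y By; apply: bxP => i.
  have -> : (0 : V) ord0 i = 0 by rewrite mxE.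
  have -> : ((1 + s) *: v) ord0 i = (1 + s) * v ord0 i by rewrite mxE.
  rewrite subr0.
  have [x1z _] := r3P _ (F1 _ By); have [x1c _] := r3P _ cx3.
  have := lin _ _ x1c x1z; rewrite psiK //; set z := psi y in By *.
  set u := (y - phi c) *m invmx (jac x) => H.
  have zc : `|z - c| <= r * W.
    by apply: normle => j; have := bx_le j By; rewrite !mxE.
  have zi : `|z ord0 i - c ord0 i| <= v ord0 i := bx_le i By.
  have ui : `|u ord0 i - (z ord0 i - c ord0 i)| <= eta * (r * W).
    apply: le_trans (ler_wpM2l (ltW eta0) zc); apply: le_trans H.
    by have := entry_le_norm (u - (z - c)) i; rewrite !mxE.
  have k1 := vm i; have k2 := ler_wpM2l (ltW s0) k1; have k3 := ltr_pM2l r0.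
  have k4 : eta * (r * W) < s * (r * wm).
    by rewrite mulrCA [s * _]mulrCA ltr_pM2l //; have := mulr_gt0 eta0 W_gt0; lra.
  move: ui zi; rewrite !ler_norml ltr_norml => /andP[u1 u2] /andP[z1 z2].
  by apply/andP; split; lra.
have F3 y : affine_bx (jac x) (phi c) ((1 - s) *: v) y -> O' y /\ bx c v (psi y).
  move=> /bx_le Hy; set u := (y - phi c) *m invmx (jac x).
  have yE : y = phi c + u *m jac x by rewrite mulmxKV ?jacU // addrC subrK.
  have uv i : `|u ord0 i| <= (1 - s) * v ord0 i by have := Hy i; rewrite !mxE subr0.
  have un : `|u| <= r * W.
    by apply: normle => i; apply: le_trans (uv i) _; rewrite ler_piMl ?ltW //; lra.
  have y4 : ball (phi x) r4 y.
    apply: (@ball_splitr _ _ (phi c)); first exact: ball_sym.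
    rewrite -ball_normE /= yE opprD addNKr normrN; apply: le_lt_trans (HK2 _) _.
    by apply: le_lt_trans rK; rewrite ler_pM2l.
  split; first exact: r4O.
  have [x1z _] := r3P _ (Hr4 _ y4); have [x1c _] := r3P _ cx3.
  have := lin _ _ x1c x1z; rewrite psiK; last exact: r4O.
  rewrite -/u; set z := psi y => H.
  have zc : `|z - c| <= 2 * (r * W).
    have h1 : `|z - c| <= `|u| + `|u - (z - c)|.
      by rewrite -{1}(subKr u (z - c)) ler_normB.
    have h2 := ler_wpM2r (normr_ge0 (z - c)) eta2; lra.
  apply: bxP => i.
  have ui : `|u ord0 i - (z ord0 i - c ord0 i)| <= eta * (2 * (r * W)).
    apply: le_trans (ler_wpM2l (ltW eta0) zc); apply: le_trans H.
    by have := entry_le_norm (u - (z - c)) i; rewrite !mxE.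
  have k1 := vm i; have k2 := ler_wpM2l (ltW s0) k1.
  have k4 : eta * (2 * (r * W)) < s * (r * wm).
    by rewrite (_ : eta * _ = r * (2 * eta * W)) ?[s * _]mulrCA ?ltr_pM2l //; ring.
  have := uv i; move: ui; rewrite !ler_norml ltr_norml => /andP[u1 u2] /andP[z1 z2].
  by apply/andP; split; lra.
set P := \prod_i (2 * v ord0 i).
have P0 : 0 < P by apply: prodr_gt0 => i _; rewrite mulr_gt0.
have prodZ (a : R) : \prod_i (2 * (a *: v) ord0 i) = a ^+ n * P.
  rewrite -[n in RHS]card_ord -prodr_const -big_split /=; apply: eq_bigr => i _.
  by rewrite !mxE; ring.
have vs a : 0 <= a -> forall i, 0 <= (a *: v) ord0 i.
  by move=> a0 i; rewrite mxE mulr_ge0 // ltW.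
have mS : measurable ((O' : set (vec R n)) `&` psi' @^-1` bx c v).
  apply: measurableI => //; rewrite -[X in measurable X]setTI; apply: mpsi' => //.
  exact: measurable_box.
have SP y : (O' `&` psi' @^-1` bx c v) y -> O' y /\ bx c v (psi y).
  by case=> O'y; rewrite /= /psi' mem_set.
have fb y : (O' `&` psi' @^-1` bx c v) y -> 0 <= b y <= c0 + s.
  move=> /SP[ O'y By]; rewrite b_ge0 //=; have [_ x2] := r3P _ (F1 _ By).
  by have [+ _] := Hr2 _ x2; rewrite psiK // ltr_norml => /andP[_ +]; lra.
have mbS : measurable_fun (O' `&` psi' @^-1` bx c v : set (vec R n)) (fun y => (b y)%:E).
  by apply: measurable_funS mb => // y [].
have B1 : (m1 (bx c v) <= ((c0 + s) * (D * (1 + s) ^+ n * P))%:E)%E.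
  have k1 y (Sy : (O' `&` psi' @^-1` bx c v) y) : 0 <= b y by have /andP[] := fb y Sy.
  have k2 y (Sy : (O' `&` psi' @^-1` bx c v) y) : b y <= c0 + s by have /andP[] := fb y Sy.
  have H := integral_ub (leb R n) mS mbS k1 k2; apply: le_trans H _.
  rewrite EFinM lee_pmul2l ?lte_fin ?ltr_wpDl //.
  rewrite -mulrA -prodZ -(leb_affine_bx (phi c) (jacU Ox)); last by apply: vs; rewrite addr_ge0 // ltW.
  apply: le_measure; [exact: mem_set|apply/mem_set; exact: measurable_affine_bx|].
  by move=> y /SP[ O'y By]; exact: F2.
pose A := affine_bx (jac x) (phi c) ((1 - s) *: v).
have mA : measurable A by exact: measurable_affine_bx.
have B2 : (((c0 - s) * (D * (1 - s) ^+ n * P))%:E <= m1 (bx c v))%E.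
  have [cs|cs] := leP (c0 - s) 0.
    apply: le_trans (measure_ge0 _ _); rewrite lee_fin mulr_le0_ge0 //.
    by rewrite mulr_ge0 ?(ltW P0) // mulr_ge0 ?normr_ge0 // exprn_ge0 // subr_ge0 ltW.
  rewrite -mulrA -prodZ EFinM -(leb_affine_bx (phi c) (jacU Ox)); last by apply: vs; rewrite subr_ge0 ltW.
  have AS : A `<=` O' `&` psi' @^-1` bx c v.
    by move=> y /F3[ O'y By]; split=> //; rewrite /= /psi' mem_set.
  apply: (@le_trans _ _ (\int[leb R n]_(y in A) (b y)%:E)%E).
    apply: integral_lb; [by []|exact: measurable_funS mbS|by rewrite ltW|].
    move=> y /AS /SP [ O'y By]; have [_ x2] := r3P _ (F1 _ By).
      by have [+ _] := Hr2 _ x2; rewrite psiK // ltr_norml => /andP[+ _]; lra.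
  by apply: ge0_subset_integral => // y [ O'y _]; rewrite lee_fin b_ge0.
have mB : measurable (bx c v) by exact: measurable_box.
have OB : O `&` bx c v = bx c v.
  by apply: setIidr => z /F1 /r3P[/r1O].
have mhB : measurable_fun (bx c v) (fun y => (h y)%:E).
  by apply: measurable_funS mh => // z /F1 /r3P[/r1O].
have hb z : bx c v z -> [/\ 0 <= h z, c0 * D - s <= h z & h z <= c0 * D + s].
  move=> /F1 /r3P[/r1O Oz] x2; have [_ +] := Hr2 _ x2; rewrite ltr_norml => /andP[h1 h2].
  by split; [exact: h_ge0|lra|lra].
have lebB : leb R n (bx c v) = P%:E by rewrite leb_bx // => i; exact: ltW.
have m2E : m2 (bx c v) = (\int[leb R n]_(y in bx c v) (h y)%:E)%E.
  by rewrite -{2}OB.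
have B3 : (m2 (bx c v) <= ((c0 * D + s) * P)%:E)%E.
  rewrite m2E EFinM -lebB; apply: integral_ub => //.
  - by move=> z /hb[].
  - by move=> z /hb[].
have B4 : (((c0 * D - s) * P)%:E <= m2 (bx c v))%E.
  have [cs|cs] := leP (c0 * D - s) 0.
    by apply: le_trans (measure_ge0 _ _); rewrite lee_fin mulr_le0_ge0 // ltW.
  rewrite m2E EFinM -lebB; apply: integral_lb; [by []|by []|exact: ltW|].
  by move=> z /hb[].
split.
- by move=> z /F1 /r3P[/r1O].
- exact: le_lt_trans B1 (ltry _).
- exact: le_lt_trans B3 (ltry _).
have /andP[h1 h2] := ereal_between B2 B1; have /andP[h3 h4] := ereal_between B4 B3.
have k1 := ler_wpM2r (ltW P0) ub; have k2 := ler_wpM2r (ltW P0) lb.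
have k3 := ler_wpM2r (ltW P0) se.
rewrite ler_norml; apply/andP; split; lra.
Unshelve. all: by end_near. Qed.
End Local.

(** * From small boxes to all boxes by bisection *)

Section Halving.
Variables (e : R) (e0 : 0 < e) (al be : V).

(** The tolerance is proportional to the volume, so it adds up exactly when a box is cut in two.
    Finiteness is included because [fine] sends infinite values to 0. *)
Let good (c v : V) : Prop := [/\ (m1 (bx c v) < +oo)%E, (m2 (bx c v) < +oo)%E &
  `|fine (m1 (bx c v)) - fine (m2 (bx c v))| <= e * \prod_i (2 * v ord0 i)].

Let inside (c v : V) := forall i,
  [/\ al ord0 i <= c ord0 i - v ord0 i, c ord0 i + v ord0 i <= be ord0 i & 0 < v ord0 i].

Let shrink (k : 'I_n) (v : V) : V := \row_i (if i == k then v ord0 i / 2 else v ord0 i).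
Let move_center (k : 'I_n) (c : V) (t : R) : V := \row_i (if i == k then c ord0 i + t else c ord0 i).

Let bx_split (k : 'I_n) (c v : V) : 0 < v ord0 k ->
  bx c v = bx (move_center k c (- (v ord0 k / 2))) (shrink k v) `|`
           bx (move_center k c (v ord0 k / 2)) (shrink k v).
Proof.
move=> v0; apply/seteqP; split => x.
  move=> H; have [xk|xk] := leP (x ord0 k) (c ord0 k); [left|right] => i; have := H i.
    by rewrite !mxE; case: eqVneq => [->|_] // /andP[h1 h2]; apply/andP; split; lra.
  by rewrite !mxE; case: eqVneq => [->|_] // /andP[h1 h2]; apply/andP; split; lra.
case=> H i; have := H i; rewrite !mxE; case: eqVneq => [->|_] //.
  by move=> /andP[h1 h2]; apply/andP; split; lra.
by move=> /andP[h1 h2]; apply/andP; split; lra.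
Qed.

Let measure_split (m : {measure set (vec R n) -> \bar R}) (k : 'I_n) (c v : V) : 0 < v ord0 k ->
  m (bx c v) = (m (bx (move_center k c (- (v ord0 k / 2))) (shrink k v)) +
           m (bx (move_center k c (v ord0 k / 2)) (shrink k v)))%E.
Proof.
move=> v0; rewrite {1}(bx_split c v0); apply: measureU; try exact: measurable_box.
apply/seteqP; split => x // -[/(_ k) + /(_ k)].
by rewrite !mxE eqxx => /andP[_ h1] /andP[h2 _]; lra.
Qed.

Let good_split (k : 'I_n) (c v : V) : 0 < v ord0 k ->
  good (move_center k c (- (v ord0 k / 2))) (shrink k v) ->
  good (move_center k c (v ord0 k / 2)) (shrink k v) -> good c v.
Proof.
move=> v0 [f1 f2 H] [f1' f2' H'].
have E1 : m1 (bx c v) = (m1 (bx (move_center k c (- (v ord0 k / 2))) (shrink k v)) +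
  m1 (bx (move_center k c (v ord0 k / 2)) (shrink k v)))%E := measure_split _ c v0.
have E2 : m2 (bx c v) = (m2 (bx (move_center k c (- (v ord0 k / 2))) (shrink k v)) +
  m2 (bx (move_center k c (v ord0 k / 2)) (shrink k v)))%E := measure_split _ c v0.
rewrite /good E1 E2.
have -> : \prod_i (2 * v ord0 i) = 2 * \prod_i (2 * shrink k v ord0 i).
  rewrite (bigD1 k) // [in RHS](bigD1 k) //= !mxE eqxx.
  rewrite (eq_bigr (fun i => 2 * shrink k v ord0 i)); last first.
    by move=> i /negbTE ik; rewrite !mxE ik.
  by field.
by apply: fine_split.
Qed.

Let shrinks (s : seq 'I_n) (v : V) : V :=
  \row_i (if i \in s then v ord0 i / 2 else v ord0 i).

Let good_shrinks s (c v : V) : uniq s -> inside c v ->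
  (forall c', inside c' (shrinks s v) -> good c' (shrinks s v)) -> good c v.
Proof.
elim: s c v => [|k s ih] c v us icv H.
  have E : shrinks [::] v = v by apply/rowP => i; rewrite mxE.
  by move: H; rewrite E; apply.
move: us => /= /andP[ks us]; have [_ _ vk] := icv k.
have E : shrinks (k :: s) v = shrinks s (shrink k v).
  apply/rowP => i; rewrite !mxE inE; case: eqVneq => [->|_] //=.
  by rewrite (negbTE ks).
rewrite E in H; apply: (good_split vk); apply: ih => // i.
  rewrite !mxE; have [h1 h2 h3] := icv i; case: eqVneq => [ik|_] //.
  by rewrite -ik; split; lra.
rewrite !mxE; have [h1 h2 h3] := icv i; case: eqVneq => [ik|_] //.
by rewrite -ik; split; lra.
Qed.

Let good_half (c v : V) : inside c v ->
  (forall c', inside c' (2^-1 *: v) -> good c' (2^-1 *: v)) -> good c v.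
Proof.
move=> icv; have -> : 2^-1 *: v = shrinks (enum 'I_n) v.
  by apply/rowP => i; rewrite !mxE mem_enum mulrC.
by apply: good_shrinks => //; exact: enum_uniq.
Qed.

Let good_pow N (c v : V) : inside c v ->
  (forall c', inside c' (2^-1 ^+ N *: v) -> good c' (2^-1 ^+ N *: v)) -> good c v.
Proof.
elim: N c v => [|N ih] c v icv H; first by move: H; rewrite expr0 scale1r; apply.
by apply: ih => // c' ic'; apply: good_half => //; rewrite scalerA -exprS.
Qed.

Hypothesis hull_sub : forall x : V, (forall i, al ord0 i <= x ord0 i <= be ord0 i) -> O x.

(** By compactness of the closed hull, for all small r the boxes of half-widths r v centred in the
    hull are good. N halvings in every direction bring 2^-N below that threshold, and additivity
    reassembles the box. *)
Lemma good_inside (c v : V) : inside c v -> good c v.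
Proof.
move=> icv; have v0 i : 0 < v ord0 i by have [] := icv i.
pose C := [set x : V | forall i, `[al ord0 i, be ord0 i]%classic (x ord0 i)].
have cC : compact C.
  apply: (@rV_compact _ _ (fun i => `[al ord0 i, be ord0 i]%classic)) => i.
  exact: segment_compact.
have : \forall r \near (0 : R)^'+, C `<=` (fun c => good c (r *: v)).
  apply: (compact_near_coveringP _).1 cC _ _ _ _ _ => x Cx.
  have Ox : O x by apply: hull_sub => i; have := Cx i; rewrite /= in_itv.
  have := density_local Ox v0 e0; apply: filterS => -[c' r] /= [_ h1 h2 h3].
  by split.
rewrite near_withinE => /nbhs_ballP[d /= d0 Hd].
pose N := (Num.trunc d^-1).+1.
have Nd : (2^-1 : R) ^+ N < d.
  rewrite exprVn -[d]invrK ltf_pV2 ?posrE ?invr_gt0 ?exprn_gt0 //.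
  apply: lt_trans (truncnS_gt _) _; rewrite -natrX ltr_nat; exact: ltn_expl.
apply: (good_pow icv (N := N)) => c' ic'; apply: Hd.
- by rewrite /ball /= sub0r normrN ger0_norm // exprn_ge0 // invr_ge0.
- by rewrite /= exprn_gt0 // invr_gt0.
- move=> i /=; rewrite in_itv /=; have [h1 h2 h3] := ic' i; apply/andP; split; lra.
Qed.

End Halving.

Lemma density_box (al be : V) :
  (forall x : V, (forall i, al ord0 i <= x ord0 i <= be ord0 i) -> O x) ->
  m1 (box al be) = m2 (box al be) /\ (m1 (box al be) < +oo)%E.
Proof.
move=> sub.
have [[i Hi]|Hab] := pselect (exists i, be ord0 i <= al ord0 i).
  have -> : box al be = set0.
    apply/seteqP; split => x // /(_ i) /andP[h1 h2]; lra.
  have e1 : m1 set0 = 0%E := measure0 _; have e2 : m2 set0 = 0%E := measure0 _.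
  by rewrite e1 e2.
pose c := 2^-1 *: (al + be); pose w := 2^-1 *: (be - al).
have E : box al be = bx c w by congr box; apply/rowP => i; rewrite !mxE; field.
have icw i : [/\ al ord0 i <= c ord0 i - w ord0 i, c ord0 i + w ord0 i <= be ord0 i & 0 < w ord0 i].
  have : al ord0 i < be ord0 i by rewrite ltNge; apply/negP => h1; apply: Hab; exists i.
  by rewrite !mxE => h1; split; lra.
have G e (e0 : 0 < e) := good_inside e0 sub icw.
have [f1 f2 _] := G 1 ltr01; rewrite E; split=> //.
rewrite -[LHS]fineK ?ge0_fin_numE // -[RHS]fineK ?ge0_fin_numE //; congr (_%:E).
apply/eqP; rewrite -subr_eq0 -normr_eq0; apply/eqP/le_anti; rewrite normr_ge0 andbT.
set P := \prod_i (2 * w ord0 i) in G.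
have P0 : 0 < P by apply: prodr_gt0 => i _; rewrite mulr_gt0 //; have [] := icw i.
apply/ler_addgt0Pr => e e0; rewrite add0r.
by have [_ _] := G (e / P) (divr_gt0 e0 P0); rewrite -/P divfK // gt_eqF.
Qed.

(** Inside each box of the cover the two restricted measures agree on all subboxes, hence on all
    measurable sets. *)
Lemma density_eq (A : set (vec R n)) : measurable A -> A `<=` O -> m1 A = m2 A.
Proof.
move=> mA AO; apply: (measure_eq_cover (g := open_boxes O)) => //; last first.
- by rewrite bigcup_open_boxes.
- move=> k B mB; case: (open_boxesP O k) => [->|[al [be [-> sub]]]].
    have e1 : m1 set0 = 0%E := measure0 _; have e2 : m2 set0 = 0%E := measure0 _.
    by rewrite subset0 => ->; exact: etrans e1 (esym e2).
  move=> BD; have mD := measurable_box al be.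
  suff : mrestr m1 mD B = mrestr m2 mD B by rewrite /mrestr setIidl.
  apply: vec_measure_unique => // a' b'.
    rewrite /= /mrestr box_setI; apply: (density_box _).1 => x Hx; apply: sub => i.
    by have := Hx i; rewrite !mxE ge_max le_min => /andP[/andP[_ ->] /andP[_ ->]].
  rewrite /= /mrestr box_setI; apply: (density_box _).2 => x Hx; apply: sub => i.
  by have := Hx i; rewrite !mxE ge_max le_min => /andP[/andP[_ ->] /andP[_ ->]].
- by move=> k; exact: measurable_open_boxes.
Qed.

Theorem change_of_variables (A : set (vec R n)) : measurable A -> A `<=` O ->
  [/\ measurable (phi @` A : set (vec R n)) &
  (\int[leb R n]_(x in A) (b (phi x) * `|\det (jac x)|)%:E =
   \int[leb R n]_(y in phi @` A) (b y)%:E)%E].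
Proof.
move=> mA AO.
have E : phi @` A = (O' : set (vec R n)) `&` psi' @^-1` A.
  apply/seteqP; split => y.
    move=> [x Ax <-]; have O'x := phiO (AO _ Ax).
    by split=> //; rewrite /= /psi' mem_set // phiK //; exact: AO.
  by case=> O'y; rewrite /= /psi' mem_set // => Ay; exists (psi y); rewrite ?psiK.
have mE : measurable ((O' : set (vec R n)) `&` psi' @^-1` A).
  by apply: measurableI => //; rewrite -[X in measurable X]setTI; exact: mpsi'.
split; first by rewrite E.
transitivity (m2 A); first by rewrite /m2 /density setIidr.
by rewrite -(density_eq mA AO) E.
Qed.
End ChangeOfVariables.

(** * The Riemannian volume *)

Section Pieces.
Variables (R : realType) (n : nat) (M : closedManifold R n).
Local Notation V := 'rV[R]_n.
Implicit Types (i j : 'I_(charts M)) (x : V).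

(** Compactness of M brought to coordinates. The finitely many neighbourhoods cover each point in
    some chart only; the first hypothesis moves the property to the other charts, whose images are
    not compact. *)
Lemma near_charts (I : Type) (F : set_system I) (FF : Filter F)
    (P : I -> 'I_(charts M) -> V -> Prop) :
  (forall e i j x, overlap i j x -> P e j (transition i j x) -> P e i x) ->
  (forall i x, chart_img i x -> \forall y \near x & e \near F, P e i y) ->
  \forall e \near F, forall i x, chart_img i x -> P e i x.
Proof.
move=> Pt Pn.
have : \forall e \near F, [set: M] `<=`
    (fun q => exists2 i, chart_dom i q & P e i (chart i q)).
  apply: (compact_near_coveringP _).1 (@points_compact _ _ M) _ _ _ _ _ => q _.
  have [i iq] := chart_cover q.
  have := Pn i _ (chart_imgP iq) => -[[A B] /= [HA HB] HAB].
  exists ((chart i @^-1` A) `&` chart_dom i, B) => /=.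
    split=> //; apply: filterI; first exact: (chart_at iq).
    by apply: open_nbhs_nbhs; split=> //; exact: chart_dom_open.
  by move=> [q' e] /= [[Aq' iq'] Be]; exists i => //; exact: (HAB (_, _)).
apply: filterS => e H i x ix; have [//|j jq Pj] := H (chart_inv i x).
by apply: (Pt e i j x) => //; apply/overlapP.
Qed.

Definition piece i : set V := chart i @` first_chart i.

Lemma pieceE i : piece i = chart_img i `\` \bigcup_(j in [set j : 'I_(charts M) | (j < i)%N]) overlap i j.
Proof.
apply/seteqP; split => x.
  move=> [q [iq Hq] <-]; split; first exact: chart_imgP.
  by move=> [j /= ji /overlapP[_]]; rewrite chartK //; exact: Hq.
move=> [ix Hx]; exists (chart_inv i x); last exact: chart_invK.
split; first exact: chart_inv_dom.
by move=> j ji jx; apply: Hx; exists j => //; apply/overlapP.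
Qed.

Lemma piece_sub i : piece i `<=` chart_img i.
Proof. by rewrite pieceE => x []. Qed.

Lemma measurable_chart_img i : measurable (chart_img i : set (vec R n)).
Proof. by apply: open_measurable_vec; exact: chart_img_open. Qed.

Lemma measurable_piece i : measurable (piece i : set (vec R n)).
Proof.
rewrite pieceE; apply: measurableD; first exact: measurable_chart_img.
by apply: open_measurable_vec; apply: bigcup_open => j _; exact: overlap_open.
Qed.

Lemma exists_first_chart (q : M) : exists i, first_chart i q.
Proof.
have [i0 h0] := chart_cover q.
have h : exists k, `[< exists i : 'I_(charts M), chart_dom i q /\ i = k :> nat >].
  by exists i0; apply/asboolP; exists i0.
case: (ex_minnP h) => k /asboolP[i [iq ik]] kmin; exists i; split=> // j ji jq.
have /kmin : `[< exists i : 'I_(charts M), chart_dom i q /\ i = j :> nat >].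
  by apply/asboolP; exists j.
by rewrite leqNgt -ik ji.
Qed.

Lemma first_chart_inj i j (q : M) : first_chart i q -> first_chart j q -> i = j.
Proof.
move=> [iq Hi] [jq Hj]; apply/val_inj; case: (ltngtP i j) => //= h.
  by have := Hj _ h iq.
by have := Hi _ h jq.
Qed.

(** The part of M attributed to the chart i, seen in the chart j. For fixed j these sets partition
    the image of j. *)
Definition piece_in i j : set V := chart j @` (first_chart i `&` chart_dom j).

Lemma transition_piece i j : transition i j @` (piece i `&` overlap i j) = piece_in i j.
Proof.
apply/seteqP; split => y.
  move=> [x [[q qi <-] /overlapP[_ jq]] <-].
  have iq := qi.1; rewrite chartK // in jq; exists q => //.
  by rewrite /transition chartK.
move=> [q [qi jq] <-]; have iq := qi.1; exists (chart i q).
  by split; [exists q|apply/overlapP; split; [exact: chart_imgP|rewrite chartK]].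
by rewrite /transition chartK.
Qed.

Lemma bigcup_piece_in j : \bigcup_i piece_in i j = chart_img j.
Proof.
apply/seteqP; split => y; first by move=> [i _ [q [_ jq] <-]]; exact: chart_imgP.
move=> jy; have jq := chart_inv_dom jy; have [i iq] := exists_first_chart (chart_inv j y).
by exists i => //; exists (chart_inv j y); rewrite ?chart_invK.
Qed.

Lemma trivIset_piece_in j : trivIset setT (fun i => piece_in i j).
Proof.
apply/trivIsetP => i i' _ _ ii'; apply/seteqP; split => // y [[q [qi jq] <-] [q' [qi' jq'] E]].
have qq : q' = q by rewrite -(chartK jq) -E chartK.
by move: ii'; rewrite qq in qi'; rewrite (first_chart_inj qi qi') eqxx.
Qed.
End Pieces.

(** Continuous functions on M in the form in which curvatures and Laplacians arise, chart by chart;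
    only values on chart images count. *)
Record scalar_field (R : realType) (n : nat) (M : closedManifold R n)
    (F : 'I_(charts M) -> 'rV[R]_n -> R) : Prop := ScalarField {
  field_transition : forall i j x, overlap i j x -> F i x = F j (transition i j x) ;
  field_continuous : forall i x, chart_img i x -> {for x, continuous (F i)} }.

Section ScalarField.
Variables (R : realType) (n : nat) (M : closedManifold R n).
Local Notation V := 'rV[R]_n.
Local Notation fam := ('I_(charts M) -> V -> R).
Implicit Types (i j : 'I_(charts M)) (x : V) (F G : fam).

Lemma scalar_field_cst (c : R) : scalar_field (fun i (x : V) => c : R) (M := M).
Proof. by split=> // i x _; exact: (@cst_continuous _ _ c x). Qed.

Lemma eq_scalar_field F G : (forall i x, F i x = G i x) -> scalar_field F -> scalar_field G.
Proof. by move=> E; rewrite (_ : F = G) //; apply/funext => i; apply/funext => x. Qed.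

Lemma scalar_fieldD F G : scalar_field F -> scalar_field G ->
  scalar_field (fun i x => F i x + G i x).
Proof.
move=> [Ft Fc] [Gt Gc]; split=> [i j x o|i x ix].
  by rewrite (Ft _ _ _ o) (Gt _ _ _ o).
exact: (continuousD (Fc _ _ ix) (Gc _ _ ix)).
Qed.

Lemma scalar_fieldM F G : scalar_field F -> scalar_field G ->
  scalar_field (fun i x => F i x * G i x).
Proof.
move=> [Ft Fc] [Gt Gc]; split=> [i j x o|i x ix].
  by rewrite (Ft _ _ _ o) (Gt _ _ _ o).
exact: (continuousM (Fc _ _ ix) (Gc _ _ ix)).
Qed.

Lemma scalar_field_sum (I : Type) (r : seq I) (P : pred I) (F : I -> fam) :
  (forall a, P a -> scalar_field (F a)) -> scalar_field (fun i x => \sum_(a <- r | P a) F a i x).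
Proof.
move=> H; elim: r => [|a r ih].
  by apply: eq_scalar_field (scalar_field_cst 0) => i x; rewrite big_nil.
case Pa: (P a); last first.
  by apply: eq_scalar_field ih => i x; rewrite big_cons Pa.
by apply: eq_scalar_field (scalar_fieldD (H a Pa) ih) => i x; rewrite big_cons Pa.
Qed.

Lemma scalar_field_comp (h : R -> R) F : scalar_field F ->
  (forall i x, chart_img i x -> {for F i x, continuous h}) ->
  scalar_field (fun i x => h (F i x)).
Proof.
move=> [Ft Fc] hc; split=> [i j x o|i x ix]; first by rewrite (Ft _ _ _ o).
exact: (@continuous_comp _ _ _ (F i) h x (Fc _ _ ix) (hc _ _ ix)).
Qed.

Lemma scalar_field_bounded F : scalar_field F ->
  exists C : R, 0 < C /\ forall i x, chart_img i x -> `|F i x| <= C.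
Proof.
move=> [Ft Fc].
have : \forall C \near +oo, forall i x, chart_img i x -> `|F i x| <= C.
  apply: near_charts => [C i j x o|i x ix]; first by rewrite (Ft _ _ _ o).
  have [r r0 Hr] := continuous_ball (Fc _ _ ix) (ltr01).
  exists (ball x r, [set C : R | `|F i x| + 1 <= C]).
    by split; [exact: nbhsx_ballx|exact: nbhs_pinfty_ge].
  move=> [y C] /= [/Hr h1 h2]; apply: le_trans h2.
  have := ler_distD 0 (F i y) (F i x); have := ler_normD (F i y - F i x) (F i x).
  by rewrite subrK; lra.
move=> H; near (+oo : set_system R) => C; exists C; split.
  by near: C; exact: nbhs_pinfty_gt.
by near: C.
Unshelve. all: by end_near. Qed.

End ScalarField.

Section Volume.
Variables (R : realType) (n : nat) (M : closedManifold R n) (h : metric M).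
Hypothesis hR : riemannian h.
Local Notation V := 'rV[R]_n.
Local Notation fam := ('I_(charts M) -> V -> R).
Implicit Types (i j : 'I_(charts M)) (x : V) (F G : fam).

Definition rho i x := Num.sqrt (\det (h i x)).

Lemma rho_gt0 i x : chart_img i x -> 0 < rho i x.
Proof. by have [_ _ hp _] := hR => ix; rewrite sqrtr_gt0; apply: posdef_det; exact: hp. Qed.

Lemma rho_Ck k i : Ck k (chart_img i) (rho i).
Proof.
apply: Ck_sqrt; first exact: chart_img_open.
  by move=> x ix; rewrite -sqrtr_gt0; exact: rho_gt0.
apply: Ck_sum; first exact: chart_img_open.
move=> s _; apply: CkM; [exact: chart_img_open|exact: Ck_cst|].
by apply: Ck_prod => [|a _]; [exact: chart_img_open|exact: metric_Ck].
Qed.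

Lemma rho_continuous i x : chart_img i x -> {for x, continuous (rho i)}.
Proof. by move=> ix; exact: Ck_continuous (@rho_Ck 0 i) _ ix. Qed.

Lemma measurable_field_rho F i (D : set V) : scalar_field F -> D `<=` chart_img i ->
  measurable_fun (D : set (vec R n)) (fun x => (F i x * rho i x)%:E).
Proof.
move=> [_ Fc] Di; apply: (measurable_funS (measurable_chart_img i) Di).
apply/measurable_EFinP; apply: continuous_measurable_vec (@chart_img_openset R n M i) _.
move=> x /set_mem ix; exact: (continuousM (Fc _ _ ix) (rho_continuous ix)).
Qed.

Lemma integral_piece_transition F i j : scalar_field F ->
  (forall i x, chart_img i x -> 0 <= F i x) ->
  measurable (piece_in i j : set (vec R n)) /\
  (\int[leb R n]_(x in piece i `&` overlap i j) (F i x * rho i x)%:E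
   = \int[leb R n]_(x in piece_in i j) (F j x * rho j x)%:E)%E.
Proof.
move=> FF F0; have [Ft Fc] := FF.
have Jac x : overlap i j x -> jacobian (transition i j) x = transition_jacobian i j x.
  by move=> ox; apply/matrixP => a b; rewrite transition_jacobianE // mxE.
have mA : measurable ((piece i `&` overlap i j) : set (vec R n)).
  apply: measurableI; first exact: measurable_piece.
  by apply: open_measurable_vec; exact: overlap_open.
have b0 y : overlap j i y -> 0 <= F j y * rho j y.
  by move=> /overlap_sub jy; rewrite mulr_ge0 ?F0 // ltW // rho_gt0.
have bC y : overlap j i y -> {for y, continuous (fun y => F j y * rho j y)}.
  by move=> /overlap_sub jy; exact: (continuousM (Fc _ _ jy) (rho_continuous jy)).
have jU x : overlap i j x -> jacobian (transition i j) x \in unitmx.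
  by move=> ox; rewrite Jac //; exact: (jacobian_unit hR).
have psiC y : overlap j i y -> {for y, continuous (transition j i)}.
  move=> oy; apply: continuous_row => l.
  exact: Ck_continuous (@transition_Ck _ _ M j i 0 l) _ oy.
have [m1 E] := change_of_variables (overlap_open (i := i) (j := j))
  (overlap_open (i := j) (j := i)) (@transition_overlap _ _ M i j)
  (@transitionK _ _ M i j) (@transitionK _ _ M j i)
  (@transition_Ck _ _ M i j 1) psiC b0 bC jU mA (@subIsetr _ _ _).
rewrite -transition_piece; split => //; rewrite -E.
apply: eq_integral => x /set_mem [_ ox]; congr (_%:E).
by rewrite (Ft _ _ _ ox) /rho (volume_transition hR ox) Jac //; ring.
Qed.

(** For an integrand that vanishes off the chart j, the change of variables moves each piece to
    [piece_in i j], and these sets partition the image of j. *)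
Lemma sum_integral_pieces F j : scalar_field F ->
  (forall i x, chart_img i x -> 0 <= F i x) ->
  (forall i x, chart_img i x -> ~ overlap i j x -> F i x = 0) ->
  (\sum_i \int[leb R n]_(x in piece i) (F i x * rho i x)%:E
   = \int[leb R n]_(x in chart_img j) (F j x * rho j x)%:E)%E.
Proof.
move=> FF F0 Fj.
have E i : (\int[leb R n]_(x in piece i) (F i x * rho i x)%:E
    = \int[leb R n]_(x in piece_in i j) (F j x * rho j x)%:E)%E.
  rewrite -(integral_piece_transition i j FF F0).2 [LHS]integral_mkcond [RHS]integral_mkcond.
  apply: eq_integral => x _; rewrite !patchE.
  case: ifPn => [/set_mem xi|xi]; case: ifPn => [/set_mem xij|xij] //.
    have [xo|xo] := pselect (overlap i j x).
      by move: xij; rewrite notin_setE => /(_ (conj xi xo)).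
    by rewrite (Fj i x) // ?mul0r //; exact: piece_sub.
  by move: xi; rewrite notin_setE => /(_ xij.1).
rewrite (eq_bigr _ (fun i _ => E i)).
have -> : chart_img j = \big[setU/set0]_i piece_in i j.
  rewrite -bigcup_piece_in -bigcup_seq; apply: eq_bigcupl; split => i //= _.
  by rewrite mem_index_enum.
rewrite ge0_integral_bigsetU //.
- by move=> i; exact: (integral_piece_transition i j FF F0).1.
- exact: index_enum_uniq.
- by apply: sub_trivIset (@trivIset_piece_in _ _ M j).
- rewrite -bigcup_seq; apply: measurable_field_rho => // x [i _ [q [_ jq] <-]].
  exact: chart_imgP.
- rewrite -bigcup_seq => x [i _ [q [_ jq] <-]].
  by rewrite lee_fin mulr_ge0 ?F0 ?(ltW (rho_gt0 _)) //; exact: chart_imgP.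
Qed.

Definition integrable_field F := forall i,
  (leb R n).-integrable (piece i : set (vec R n)) (fun x => (F i x * rho i x)%:E).

Definition vol F := vol_integral h F.

(** Integrability makes the integrals of the positive and negative parts finite, so that nothing is
    lost by [fine] in [rn_integral]. *)
Lemma volE F : integrable_field F ->
  vol F = \sum_i \int[leb R n]_(x in piece i) (F i x * rho i x).
Proof.
move=> IF; apply: eq_bigr => i _; rewrite -/(piece i) /rn_integral.
set G := fun x => F i x * Num.sqrt (\det (h i x)).
have GI : (leb R n).-integrable (piece i : set (vec R n)) (EFin \o G) by exact: IF.
have mi := @measurable_piece _ _ M i.
have H (K : V -> R) : measurable_fun (piece i : set (vec R n)) (fun x => (K x)%:E) ->
    nonneg_integral (fun x : V => (Num.max (K x) 0 * \1_(piece i) x)%:E)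
    = (\int[leb R n]_(x in piece i) ((fun x => (K x)%:E)^\+ x))%E.
  move=> mK; have E : (fun x : V => (Num.max (K x) 0 * \1_(piece i) x)%:E) =
      ((fun x : vec R n => ((fun x => (K x)%:E)^\+ x)%E) \_ (piece i)).
    apply/funext => x; rewrite patchE indicE; case: ifP => _; last by rewrite mulr0.
    by rewrite mulr1 funeposE EFin_max.
  rewrite E -integral_leb.
  - by rewrite -integral_mkcond.
  - by apply/(measurable_restrictT _ mi); exact: measurable_funepos.
  - by move=> x; rewrite patchE; case: ifP.
have mG : measurable_fun (piece i : set (vec R n)) (fun x => (G x)%:E).
  by case/integrableP : GI.
rewrite (H G mG) (H (fun x => - G x)); last first.
  by apply/measurable_EFinP; apply: (measurableT_comp (@oppr_measurable _ _)); exact/measurable_EFinP.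
have k1 : (\int[leb R n]_(x in piece i) (EFin \o G)^\+ x)%E \is a fin_num.
  exact: integrable_pos_fin_num.
have k2 : (\int[leb R n]_(x in piece i) (EFin \o G)^\- x)%E \is a fin_num.
  exact: integrable_neg_fin_num.
have -> : \int[leb R n]_(x in piece i) G x = fine (\int[leb R n]_(x in piece i) (EFin \o G)^\+ x
   - \int[leb R n]_(x in piece i) (EFin \o G)^\- x)%E by rewrite /Rintegral integralE.
rewrite (fineB k1 k2).
congr (_ - fine _); apply: eq_integral => x _.
by rewrite funeposE funenegE EFinN.
Qed.

Lemma integrable_field_ge0 F : scalar_field F -> (forall i x, chart_img i x -> 0 <= F i x) ->
  (\sum_i \int[leb R n]_(x in piece i) (F i x * rho i x)%:E < +oo)%E -> integrable_field F.
Proof.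
move=> FF F0 fin i; apply/integrableP; split.
  exact: (measurable_field_rho FF (@piece_sub _ _ M i)).
apply: le_lt_trans fin; rewrite (bigD1 i) //= -[leLHS]adde0; apply: leeD.
  rewrite le_eqVlt; apply/orP; left; apply/eqP; apply: eq_integral => x /set_mem /piece_sub ix.
  by rewrite /= ger0_norm // mulr_ge0 ?F0 // ltW // rho_gt0.
apply: sume_ge0 => j _; apply: integral_ge0 => x /piece_sub jx.
by rewrite lee_fin mulr_ge0 ?F0 // ltW // rho_gt0.
Qed.

Lemma integrable_field_le F G : scalar_field F -> integrable_field G ->
  (forall i x, chart_img i x -> `|F i x| <= G i x) -> integrable_field F.
Proof.
move=> FF IG FG i; apply: (le_integrable _ _ _ (IG i)).
- exact: measurable_piece.
- exact: (measurable_field_rho FF (@piece_sub _ _ M i)).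
- move=> x /piece_sub ix; have r0 := rho_gt0 ix; rewrite lee_fin !normrM.
  by rewrite ler_wpM2r // (le_trans (FG _ _ ix)) // ler_norm.
Qed.

Section LinearVol.
Variables (F G : fam) (IF : integrable_field F) (IG : integrable_field G).

Lemma integrable_fieldD : integrable_field (fun i x => F i x + G i x).
Proof.
move=> i; have := integrableD (@measurable_piece _ _ M i) (IF i) (IG i).
by apply: eq_integrable => // [|x _ /=]; [exact: measurable_piece|rewrite mulrDl EFinD].
Qed.

Lemma integrable_fieldZ (c : R) : integrable_field (fun i x => c * F i x).
Proof.
move=> i; have := integrableZl (@measurable_piece _ _ M i) c (IF i).
by apply: eq_integrable => // [|x _ /=]; [exact: measurable_piece|rewrite -mulrA EFinM].
Qed.

Lemma vol_add : vol (fun i x => F i x + G i x) = vol F + vol G.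
Proof.
rewrite !volE //; last exact: integrable_fieldD.
rewrite -big_split; apply: eq_bigr => i _ /=.
rewrite -RintegralD ?IF ?IG //; first by apply: eq_Rintegral => x _; rewrite mulrDl.
exact: measurable_piece.
Qed.

Lemma vol_scale (c : R) : vol (fun i x => c * F i x) = c * vol F.
Proof.
rewrite !volE //; last exact: integrable_fieldZ.
rewrite mulr_sumr; apply: eq_bigr => i _ /=.
rewrite -RintegralZl ?IF //; first by apply: eq_Rintegral => x _; rewrite mulrA.
exact: measurable_piece.
Qed.

Lemma vol_le : (forall i x, chart_img i x -> F i x <= G i x) -> vol F <= vol G.
Proof.
move=> FG; rewrite !volE //; apply: ler_sum => i _; apply: le_Rintegral.
- exact: measurable_piece.
- exact: IF.
- exact: IG.
- by move=> x /piece_sub ix; rewrite ler_wpM2r ?FG // ltW // rho_gt0.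
Qed.
End LinearVol.

Lemma eq_vol F G : (forall i x, chart_img i x -> F i x = G i x) -> vol F = vol G.
Proof.
move=> FG; apply: eq_bigr => i _; rewrite /rn_integral.
by congr (fine _ - fine _); congr nonneg_integral; apply/funext => x;
  rewrite -/(piece i) indicE; case: (boolP (x \in _)) => [/set_mem /piece_sub ix|_];
  rewrite ?mulr0 // FG.
Qed.

Lemma vol_chart_ge0 F j : scalar_field F -> integrable_field F ->
  (forall i x, chart_img i x -> 0 <= F i x) ->
  (forall i x, chart_img i x -> ~ overlap i j x -> F i x = 0) ->
  (leb R n).-integrable (chart_img j : set (vec R n)) (fun x => (F j x * rho j x)%:E) /\
  vol F = \int[leb R n]_(x in chart_img j) (F j x * rho j x).
Proof.
move=> FF IF F0 Fj; have E := sum_integral_pieces FF F0 Fj.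
have fi i : (\int[leb R n]_(x in piece i) (F i x * rho i x)%:E)%E \is a fin_num.
  by apply: integrable_fin_num; [exact: measurable_piece|exact: IF].
have fin : (\int[leb R n]_(x in chart_img j) (F j x * rho j x)%:E)%E \is a fin_num.
  by rewrite -E; apply/sum_fin_numP.
split.
  apply/integrableP; split; first exact: (measurable_field_rho FF (@subset_refl _ _)).
  rewrite (eq_integral (fun x : vec R n => (F j x * rho j x)%:E)); first by rewrite ltey_eq fin.
  move=> x /set_mem jx.
  by rewrite /= ger0_norm // mulr_ge0 ?F0 // ltW // rho_gt0.
rewrite volE // /Rintegral -E sum_fine //.
Qed.

(** Reduced to the nonnegative case by the continuous parts (|F| + F)/2 and (|F| - F)/2, which are
    again scalar fields. *)
Lemma vol_chart F j : scalar_field F -> integrable_field (fun i x => `|F i x|) ->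
  (forall i x, chart_img i x -> ~ overlap i j x -> F i x = 0) ->
  vol F = \int[leb R n]_(x in chart_img j) (F j x * rho j x).
Proof.
move=> FF IaF Fj; have absC i x : chart_img i x -> {for F i x, continuous (fun y : R => `|y|)}.
  by move=> _; exact: norm_continuous.
have Fa := scalar_field_comp FF absC.
have IF : integrable_field F by exact: (integrable_field_le FF IaF).
pose P i x := (`|F i x| + F i x) / 2; pose N i x := (`|F i x| + - F i x) / 2.
have FN : scalar_field (fun i x => - F i x).
  by apply: eq_scalar_field (scalar_fieldM (scalar_field_cst _ (-1)) FF) => i x; rewrite mulN1r.
have PF : scalar_field P := scalar_fieldM (scalar_fieldD Fa FF) (scalar_field_cst _ _).
have NF : scalar_field N := scalar_fieldM (scalar_fieldD Fa FN) (scalar_field_cst _ _).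
have P0 i x : 0 <= P i x.
  by rewrite /P divr_ge0 //; have := ler_norm (- F i x); rewrite normrN; lra.
have N0 i x : 0 <= N i x by rewrite /N divr_ge0 //; have := ler_norm (F i x); lra.
have Pj i x : chart_img i x -> ~ overlap i j x -> P i x = 0.
  by move=> ix ox; rewrite /P (Fj _ _ ix ox) normr0 addr0 mul0r.
have Nj i x : chart_img i x -> ~ overlap i j x -> N i x = 0.
  by move=> ix ox; rewrite /N (Fj _ _ ix ox) normr0 oppr0 addr0 mul0r.
have IP : integrable_field P.
  apply: (integrable_field_le PF IaF) => i x _; rewrite ger0_norm // /P.
  by have := ler_norm (F i x); lra.
have IN : integrable_field N.
  apply: (integrable_field_le NF IaF) => i x _; rewrite ger0_norm // /N.
  by have := ler_norm (- F i x); rewrite normrN; lra.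
have [iP vP] := vol_chart_ge0 PF IP (fun i x _ => P0 i x) Pj.
have [iN vN] := vol_chart_ge0 NF IN (fun i x _ => N0 i x) Nj.
have -> : vol F = vol P + -1 * vol N.
  rewrite -vol_scale // -vol_add //; last exact: integrable_fieldZ.
  by apply: eq_vol => i x _; rewrite /P /N; field.
rewrite vP vN mulN1r -RintegralB //; last exact: measurable_chart_img.
by apply: eq_Rintegral => x _; rewrite /P /N; field.
Qed.
End Volume.

(** * Bump functions *)

Lemma Ck_local (R : realType) (E : normedModType R) k (O : set E) (F : E -> R) :
  (forall z, O z -> exists O' : set E, [/\ open O', O' z & Ck k O' F]) -> Ck k O F.
Proof.
elim: k F => [|k ih] F H /=.
  by move=> z /H[U [_ Uz]]; apply.
split.
- by move=> z /H[U [_ Uz [cF _ _]]]; exact: cF.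
- by move=> z v /H[U [_ Uz [_ dF _]]]; exact: dF.
- by move=> v; apply: ih => z /H[U [oU Uz [_ _ DF]]]; exists U; split=> //; exact: DF.
Qed.

Section Flat.
Variable R : realType.

(** The powers of 1/s make the family stable under differentiation: the derivative of [flat m] is a
    combination of [flat m.+1] and [flat m.+2]. *)
Definition flat (m : nat) (s : R) : R := if 0 < s then s^-1 ^+ m * expR (- s^-1) else 0.

Lemma flat_ge0 m s : 0 <= flat m s.
Proof. by rewrite /flat; case: ifP => // s0; rewrite mulr_ge0 ?expR_ge0 // exprn_ge0 // invr_ge0 ltW. Qed.

Lemma flat_gt0 m s : (0 < flat m s) = (0 < s).
Proof.
by rewrite /flat; case: ifP => s0; rewrite ?ltxx // mulr_gt0 ?expR_gt0 // exprn_gt0 // invr_gt0.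
Qed.

(** From e^x >= 1 + x^(m+1)/(m+1)! at x = 1/s. The bound gives the derivative 0 at the origin, and
    later the decay of the Gaussian away from its centre. *)
Lemma flat_le m s : flat m s <= (m.+1)`!%:R * `|s|.
Proof.
rewrite /flat; case: ifP => s0; last by rewrite mulr_ge0.
have f0 : 0 < (m.+1)`!%:R :> R by rewrite ltr0n fact_gt0.
have := expR_ge1Dxn m (ltW (_ : 0 < s^-1)); rewrite invr_gt0 => /(_ s0) H.
rewrite gtr0_norm // expRN ler_pdivrMr ?expR_gt0 //.
have k1 : s^-1 ^+ m.+1 <= (m.+1)`!%:R * expR s^-1.
  by rewrite mulrC -ler_pdivrMr //; lra.
by have := ler_wpM2l (ltW s0) k1; rewrite exprS mulrA divff ?gt_eqF // mul1r mulrCA mulrA.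
Qed.

Lemma is_derive_flat m s :
  is_derive (s : R) (1 : R) (flat m) (- m%:R * flat m.+1 s + flat m.+2 s).
Proof.
case: (ltrgt0P s) => s0.
- have sn0 : s != 0 by rewrite gt_eqF.
  have D : is_derive (s : R) (1 : R) (fun s => s^-1 ^+ m * expR (- s^-1))
      (- m%:R * flat m.+1 s + flat m.+2 s).
    have dV : is_derive (s : R) (1 : R) (fun s : R => s^-1) (- (s^-1 * s^-1)).
      have := @is_deriveV _ id s 1 1 sn0 (is_derive_id _ _).
      by rewrite -exprVn expr2 /GRing.scale /= mulr1.
    have dN : is_derive (s : R) (1 : R) (fun s : R => - s^-1) (s^-1 * s^-1).
      by have := is_deriveN dV; rewrite opprK.
    have dE : is_derive (s : R) (1 : R) (@expR R \o (fun s : R => - s^-1))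
        (expR (- s^-1) * (s^-1 * s^-1)).
      by apply: is_derive_scalar_comp dN _; exact: is_derive_expR.
    have dX : is_derive (s : R) (1 : R) (fun s : R => s^-1 ^+ m)
        (m%:R * s^-1 ^+ m.-1 * - (s^-1 * s^-1)).
      have := is_deriveX m dV; rewrite /GRing.scale /= => dX.
      by move: dX; rewrite exprfctE.
    apply: is_derive_eq (is_deriveM dX dE) _.
    rewrite /GRing.scale /= /flat s0; clear; case: m => [|m] /=; first by rewrite !expr0; ring.
    by rewrite !exprS; ring.
  apply: near_eq_is_derive D.
  near=> t; rewrite /flat ifT //; near: t; exact: lt_nbhsr.
- have D := @is_derive_cst R R R 0 s 1.
  rewrite /flat ltNge (ltW s0) /= mulr0 addr0.
  apply: near_eq_is_derive D.
  near=> t; rewrite /flat ifF //; apply/negbTE; rewrite -leNgt ltW //.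
  by near: t; exact: lt_nbhsl.
- rewrite s0 /flat ltxx mulr0 addr0 -/(flat m).
  have : h^-1 *: ((flat m \o shift (0 : R)) (h *: (1 : R)) - flat m (0 : R))
      @[h --> (0 : R)^'] --> (0 : R).
    apply/cvgrPdist_lt => e e0.
    pose C : R := (m.+2)`!%:R.
    have C0 : 0 < C by rewrite ltr0n fact_gt0.
    near=> h.
    have h0 : h != 0 by near: h; exact: nbhs_dnbhs_neq.
    have hC : C * `|h| < e.
      rewrite mulrC -ltr_pdivlMr //; near: h.
      by apply: dnbhs0_lt; rewrite divr_gt0.
    rewrite /= addr0 /GRing.scale /= mulr1 sub0r normrN [flat m 0]/flat ltxx subr0.
    have -> : h^-1 * flat m h = flat m.+1 h.
      by rewrite /flat; case: ifP => // _; rewrite ?mulr0 // exprS mulrA.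
    by rewrite ger0_norm ?flat_ge0 //; apply: le_lt_trans (flat_le _ _) hC.
  move=> cv; split; first by apply/cvg_ex; exists 0.
  exact: cvg_lim.
Unshelve. all: by end_near. Qed.

Lemma Ck_flat (E : normedModType R) k (O : set E) (F : E -> R) m : open O ->
  Ck k O F -> Ck k O (fun z => flat m (F z)).
Proof.
move=> oO; have flatC a (s : R) : {for s, continuous (flat a)}.
  by have [dhz _] := is_derive_flat a s; apply: differentiable_continuous; exact/derivable1_diffP.
elim: k m F => [|k ih] m F /=.
  by move=> cF z Oz; apply: (@continuous_comp _ _ _ F (flat m)); [exact: cF|exact: flatC].
move=> CF; have [cF dF DF] := CF.
have D z v : O z -> is_derive z v (flat m \o F)
    ((- m%:R * flat m.+1 (F z) + flat m.+2 (F z)) * 'D_v F z).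
  move=> Oz; apply: is_derive_scalar_comp; last exact: is_derive_flat.
  by apply/derivableP; exact: dF.
split.
- by move=> z Oz; apply: (@continuous_comp _ _ _ F (flat m)); [exact: cF|exact: flatC].
- by move=> z v /(D _ v) [].
- move=> v; have CkF := CkS CF.
  apply: eq_Ck (CkM oO (CkD oO (CkM oO (Ck_cst k O (- m%:R)) (ih m.+1 F CkF))
    (ih m.+2 F CkF)) (DF v)) => // z.
  by rewrite inE => Oz /=; have [_ ->] := D z v Oz.
Qed.
End Flat.

Section QuadraticForm.
Variables (R : realType) (n : nat) (G : 'M[R]_n).
Local Notation V := 'rV[R]_n.
Hypothesis Gpos : forall v : V, v != 0 -> 0 < (v *m G *m v^T) ord0 ord0.

Definition quad (x : V) : R := (x *m G *m x^T) ord0 ord0.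

Lemma quadE (x : V) : quad x = \sum_j \sum_i x ord0 i * G i j * x ord0 j.
Proof. by rewrite /quad mxE; apply: eq_bigr => j _; rewrite !mxE mulr_suml. Qed.

Lemma quad_ge0 (x : V) : 0 <= quad x.
Proof.
have [->|x0] := eqVneq x 0; first by rewrite /quad !mul0mx mxE.
exact/ltW/Gpos.
Qed.

Lemma quad_comp_Ck k (E : normedModType R) (O : set E) (y : E -> V) (c : V) : open O ->
  (forall i, Ck k O (fun z => y z ord0 i)) -> Ck k O (fun z => quad (y z - c)).
Proof.
move=> oO Cy; under eq_fun do rewrite quadE.
have CX i : Ck k O (fun z => (y z - c) ord0 i).
  have : Ck k O ((fun z => y z ord0 i) \- cst (c ord0 i)) by apply: CkB => //; exact: Ck_cst.
  by apply: eq_Ck => // x _; rewrite /= !mxE.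
apply: Ck_sum => // j _; apply: Ck_sum => // i _.
by apply: CkM => //; apply: CkM => //; exact: Ck_cst.
Qed.

Lemma quad_Ck k (O : set V) (c : V) : open O -> Ck k O (fun x => quad (x - c)).
Proof. by move=> oO; apply: (@quad_comp_Ck _ _ _ id) => // i; exact: Ck_coord. Qed.

(** A positive lower bound on the compact unit sphere, extended by homogeneity. *)
Lemma quad_coercive : exists2 l : R, 0 < l & forall x : V, l * `|x| ^+ 2 <= quad x.
Proof.
pose S := [set x : V | `|x| = 1].
have cS : compact S.
  apply: bounded_closed_compact.
    by exists 1; split => // y y1 x; rewrite /S /= => ->; exact: ltW.
  have -> : S = (fun x : V => `|x|) @^-1` [set 1] by [].
  by apply: closed_comp => [x _|]; [exact: norm_continuous|exact: closed_eq].
have qC x : {for x, continuous quad}.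
  have := Ck_continuous (quad_Ck 0 0 openT) (I : setT x).
  by congr (continuous_at _ _); apply/funext => y; rewrite subr0.
have : \forall l \near (0 : R)^'+, S `<=` (fun x => l <= quad x).
  apply: (compact_near_coveringP _).1 cS _ _ _ _ _ => x Sx.
  have x0 : x != 0 by rewrite -normr_gt0 Sx ltr01.
  have q0 := Gpos x0; rewrite -/(quad x) in q0.
  have q2 : 0 < quad x / 2 by rewrite divr_gt0.
  have [r r0 Hr] := continuous_ball (qC x) q2.
  exists (ball x r, [set l : R | l <= quad x / 2]).
    by split; [exact: nbhsx_ballx|exact: nbhs_right_le].
  by move=> [y l] /= [/Hr]; rewrite ltr_norml => /andP[h1 _] h2; lra.
move=> H; near (0 : R)^'+ => l; exists l => // x.
have Hl : S `<=` (fun x => l <= quad x) by near: l.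
have [->|x0] := eqVneq x 0; first by rewrite normr0 expr0n /= mulr0 quad_ge0.
have nx : 0 < `|x| by rewrite normr_gt0.
have := Hl (`|x|^-1 *: x); rewrite /S /= normrZ ger0_norm ?invr_ge0 // mulVf ?gt_eqF //.
move=> /(_ erefl); have -> : quad (`|x|^-1 *: x) = quad x / `|x| ^+ 2.
  rewrite /quad -!scalemxAl linearZ /= -scalemxAr !mxE; field.
  by rewrite gt_eqF.
by rewrite ler_pdivlMr // exprn_gt0.
Unshelve. all: by end_near. Qed.

Lemma quad_ball (O : set V) (c : V) : open O -> O c ->
  exists2 r0 : R, 0 < r0 & forall r, r <= r0 ->
    compact [set x : V | quad (x - c) <= r] /\ [set x : V | quad (x - c) <= r] `<=` O.
Proof.
move=> oO Oc; have [l l0 Hl] := quad_coercive.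
have /nbhs_ballP[d /= d0 Hd] := open_nbhs_nbhs (conj oO Oc).
have d2 : 0 < l * (d / 2) ^+ 2 by rewrite mulr_gt0 // exprn_gt0 // divr_gt0.
exists (l * (d / 2) ^+ 2) => // r rr.
have near_c x : quad (x - c) <= r -> `|x - c| <= d / 2.
  move=> h; have := le_trans (Hl (x - c)) (le_trans h rr).
  by rewrite ler_pM2l // ler_sqr ?nnegrE // divr_ge0 // ltW.
split; last first.
  move=> x /= /near_c h; apply: Hd; rewrite -ball_normE /= distrC.
  by apply: le_lt_trans h _; lra.
apply: bounded_closed_compact.
  exists (`|c| + d / 2); split => [|y yc x /= /near_c h]; first exact: num_real.
  have := ler_normD (x - c) c; rewrite subrK; lra.
have -> : [set x : V | quad (x - c) <= r] = (fun x => quad (x - c)) @^-1` [set s | s <= r] by [].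
apply: closed_comp => [x _|]; last exact: closed_le.
exact: (Ck_continuous (quad_Ck 0 c openT) (I : setT x)).
Qed.
End QuadraticForm.

Section SmoothFunctions.
Variables (R : realType) (n : nat) (M : closedManifold R n).
Local Notation V := 'rV[R]_n.
Implicit Types (i j : 'I_(charts M)) (x : V) (f g : M -> R).

Definition smooth_fun f := forall i k, Ck k (chart_img i) (fun x => f (chart_inv i x)).

Lemma smooth_funM f g : smooth_fun f -> smooth_fun g -> smooth_fun (fun q => f q * g q).
Proof. by move=> Sf Sg i k; apply: CkM (Sf i k) (Sg i k); exact: chart_img_open. Qed.

Lemma smooth_fun_sum (I : Type) (r : seq I) (f : I -> M -> R) :
  (forall a, smooth_fun (f a)) -> smooth_fun (fun q => \sum_(a <- r) f a q).
Proof. by move=> Sf i k; apply: Ck_sum => [|a _]; [exact: chart_img_open|exact: Sf]. Qed.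

Lemma smooth_fun_inv f : smooth_fun f -> (forall q, f q != 0) -> smooth_fun (fun q => (f q)^-1).
Proof. by move=> Sf f0 i k; apply: Ck_inv (Sf i k) => //; exact: chart_img_open. Qed.

Lemma scalar_field_comp_inv f :
  (forall i x, chart_img i x -> {for x, continuous (fun x => f (chart_inv i x))}) ->
  scalar_field (fun i x => f (chart_inv i x)).
Proof. by move=> fC; split=> // i j x o; rewrite transition_inv. Qed.

Lemma smooth_scalar_field f : smooth_fun f -> scalar_field (fun i x => f (chart_inv i x)).
Proof. by move=> Sf; apply: scalar_field_comp_inv => i x ix; exact: Ck_continuous (Sf i 0) _ ix. Qed.

Definition supported j f := exists2 B : set V, compact B /\ B `<=` chart_img j &
  forall q, f q != 0 -> chart_dom j q /\ B (chart j q).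

Lemma supported_field j f : supported j f ->
  forall i x, chart_img i x -> ~ overlap i j x -> f (chart_inv i x) = 0.
Proof.
move=> [B _ H] i x ix ox; apply/eqP/negP => /negP /H[jx _].
by apply: ox; apply/overlapP.
Qed.

Section Bump.
Variables (j : 'I_(charts M)) (c : V) (G : 'M[R]_n) (r : R).
Hypotheses (r_gt0 : 0 < r) (cB : compact [set x : V | quad G (x - c) <= r]).
Hypothesis Bj : [set x : V | quad G (x - c) <= r] `<=` chart_img j.

Definition bump (q : M) : R :=
  if `[< chart_dom j q >] then flat 0 (1 - quad G (chart j q - c) / r) else 0.

Lemma bump_ge0 q : 0 <= bump q.
Proof. by rewrite /bump; case: ifP => // _; exact: flat_ge0. Qed.

Lemma bump_chart x : chart_img j x -> bump (chart_inv j x) = flat 0 (1 - quad G (x - c) / r).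
Proof. by move=> jx; rewrite /bump asboolT ?chart_invK //; exact: chart_inv_dom. Qed.

Lemma bump_supported : supported j bump.
Proof.
exists [set x : V | quad G (x - c) <= r]; first by split.
move=> q; rewrite /bump; case: asboolP => [jq|]; last by rewrite eqxx.
rewrite /flat; case: ifP => [|_]; last by rewrite eqxx.
by rewrite subr_gt0 ltr_pdivrMr // mul1r => /ltW.
Qed.

(** Away from the chart j the function is zero nearby: the compact quadratic ball has a closed image
    in the Hausdorff space M, and the bump vanishes on its complement. *)
Lemma bump_smooth : smooth_fun bump.
Proof.
move=> i k; apply: Ck_local => x ix; have [ox|ox] := pselect (overlap i j x).
  exists (overlap i j); split=> //; first exact: overlap_open.
  have oO := overlap_open (i := i) (j := j).
  apply: (@eq_Ck _ _ _ _ (fun x => flat 0 (1 - quad G (transition i j x - c) / r))) => //.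
    move=> y; rewrite inE => /overlapP[iy jy]; rewrite /bump asboolT //.
  apply: Ck_flat => //; apply: (@CkB _ _ _ _ (cst 1)) => //; first exact: Ck_cst.
  apply: (@CkM _ _ _ _ _ (cst r^-1)) => //; last exact: Ck_cst.
  by apply: quad_comp_Ck => // l; exact: transition_Ck.
pose K := chart_inv j @` [set x : V | quad G (x - c) <= r].
have cK : closed K.
  apply: compact_closed; first exact: points_hausdorff.
  apply: continuous_compact cB; apply: continuous_in_subspaceT => y.
  by rewrite inE => /Bj jy; exact: chart_inv_at.
exists (chart_img i `&` (chart_inv i @^-1` ~` K)); split.
- rewrite openE => y [iy Ky]; apply: filterI.
    by apply: open_nbhs_nbhs; split=> //; exact: chart_img_open.
  by apply: (chart_inv_at iy); apply: open_nbhs_nbhs; split=> //; exact: closed_openC.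
- split=> // -[y /Bj jy E]; apply: ox; apply/overlapP; split => //.
  by rewrite -E; exact: chart_inv_dom.
- apply: (@eq_Ck _ _ _ _ (cst 0)); last exact: Ck_cst.
    rewrite openE => y [iy Ky]; apply: filterI.
      by apply: open_nbhs_nbhs; split=> //; exact: chart_img_open.
    by apply: (chart_inv_at iy); apply: open_nbhs_nbhs; split=> //; exact: closed_openC.
  move=> y; rewrite inE => -[iy Ky]; apply/esym/eqP/negP => /negP b0.
  apply: Ky; have [B [_ _] H] := bump_supported.
  move: b0; rewrite /bump; case: asboolP => [jy|]; last by rewrite eqxx.
  rewrite /flat; case: ifP => [|_]; last by rewrite eqxx.
  rewrite subr_gt0 ltr_pdivrMr // mul1r => /ltW h _.
  by exists (chart j (chart_inv i y)); rewrite ?chartK.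
Qed.
End Bump.

Lemma exists_bump (q : M) : exists b : M -> R,
  [/\ smooth_fun b, forall q', 0 <= b q', 0 < b q & exists j, supported j b].
Proof.
have [j jq] := chart_cover q; have jc := chart_imgP jq.
have G0 : forall v : V, v != 0 -> 0 < (v *m 1%:M *m v^T) ord0 ord0.
  by move=> v v0; rewrite mulmx1; exact: sqnorm_row_gt0.
have [r r0 H] := quad_ball G0 (@chart_img_open _ _ M j) jc; have [cB Bj] := H r (lexx _).
exists (bump j (chart j q) 1%:M r); split.
- exact: bump_smooth.
- exact: bump_ge0.
- rewrite /bump asboolT // flat_gt0 subrr /quad !mul0mx mxE mul0r subr0 //.
- by exists j; exact: bump_supported.
Qed.

Lemma partition_of_unity : exists (s : seq M) (xi : M -> M -> R),
  (forall a, [/\ smooth_fun (xi a), forall q, 0 <= xi a q & exists j, supported j (xi a)]) /\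
  (forall q, \sum_(a <- s) xi a q = 1).
Proof.
have /choice[b Hb] : forall q, exists b : M -> R,
  [/\ smooth_fun b, forall q', 0 <= b q', 0 < b q & exists j, supported j b] := exists_bump.
pose sub (s0 s : seq M) := forall a, List.In a s0 -> List.In a s.
(* The filter of lists that contain a given finite list: the covering form of compactness then
   yields one list that serves every point. *)
pose F : set_system (seq M) := [set P | exists s0 : seq M, forall s, sub s0 s -> P s].
have FF : Filter F.
  split; first by exists [::].
    move=> P Q [s0 H0] [s1 H1]; exists (s0 ++ s1) => s ss; split.
      by apply: H0 => a as0; apply: ss; apply: List.in_or_app; left.
    by apply: H1 => a as1; apply: ss; apply: List.in_or_app; right.
  by move=> P Q PQ [s0 H0]; exists s0 => s /H0 /PQ.
have : \forall s \near F, [set: M] `<=` (fun q => exists2 a, List.In a s & 0 < b a q).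
  apply: (compact_near_coveringP _).1 (@points_compact _ _ M) _ _ _ _ _ => q _.
  exists ([set q' | 0 < b q q'], [set s | List.In q s]) => /=; last first.
    by move=> [q' s] [/= h1 h2]; exists q.
  split; last by exists [:: q] => s; apply; left.
  have [i iq] := chart_cover q; have [Sb _ bq _] := Hb q.
  have bC : b q (chart_inv i (chart i q')) @[q' --> q] --> b q q.
    have C1 := Ck_continuous (Sb i 0) (chart_imgP iq).
    have E : b q q = b q (chart_inv i (chart i q)) by rewrite chartK.
    rewrite E; exact: (@continuous_comp _ _ _ (chart i) (fun x => b q (chart_inv i x)) q
      (chart_at iq) C1).
  have h0 : \forall q' \near q, 0 < b q (chart_inv i (chart i q')).
    by apply: (bC [set y : R | 0 < y]); exact: lt_nbhsr.
  have h1 : \forall q' \near q, chart_dom i q'.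
    by apply: open_nbhs_nbhs; split=> //; exact: chart_dom_open.
  by apply: filterS2 h0 h1 => q' h0' h1'; rewrite chartK in h0'.
move=> [D HD]; pose S q := \sum_(a <- D) b a q.
have S0 q : 0 < S q.
  have [a /= aD bq] := HD D (fun a h => h) q I.
  have b0 a' : 0 <= b a' q by have [_ + _ _] := Hb a'.
  rewrite /S; clear HD S; elim: D aD => //= a' D ih [->|aD]; rewrite big_cons.
    by apply: ltr_pwDl => //; apply: sumr_ge0.
  by apply: ltr_wpDl => //; exact: ih.
exists D, (fun a q => b a q * (S q)^-1); split.
  move=> a; have [Sb b0 _ [j [B HB sb]]] := Hb a; split.
  - apply: smooth_funM => //; apply: smooth_fun_inv => [|q]; last by rewrite gt_eqF.
    by apply: smooth_fun_sum => a'; have [] := Hb a'.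
  - by move=> q; rewrite mulr_ge0 // invr_ge0 ltW.
  - by exists j, B => // q; rewrite mulf_eq0 negb_or => /andP[/sb].
by move=> q; rewrite -mulr_suml -/(S q) divff // gt_eqF.
Unshelve. all: by end_near. Qed.
End SmoothFunctions.

(** * Integration by parts *)

Section CompactSupport.
Variables (R : realType) (n : nat).
Local Notation V := 'rV[R]_n.

Lemma integrable_box (a b : V) (F : V -> R) (C : R) :
  measurable_fun [set: vec R n] (F : vec R n -> measurableTypeR R) ->
  (forall x, `|F x| <= C) -> (forall x : V, ~ box a b x -> F x = 0) ->
  (leb R n).-integrable [set: vec R n] (fun x => (F x)%:E).
Proof.
move=> mF FC F0; apply/integrableP; split; first exact/measurable_EFinP.
have mB := measurable_box a b.
have -> : (\int[leb R n]_x `|(F x)%:E| = \int[leb R n]_(x in box a b) (`|F x|)%:E)%E.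
  rewrite [RHS]integral_mkcond; apply: eq_integral => x _; rewrite patchE.
  case: ifPn => // xB; have xB' : ~ box a b x by move=> h; move/negP: xB; apply; exact: mem_set.
  by rewrite /= F0 // normr0.
apply: le_lt_trans (integral_ub (leb R n) mB _ _ (c := C) _) _.
- apply/measurable_EFinP; apply: (measurableT_comp (@normr_measurable _ _)).
  exact: measurable_funS mF.
- by [].
- by move=> x _; exact: FC.
- have C0 : 0 <= C by apply: le_trans (FC 0).
  by rewrite lte_mul_pinfty // ?lee_fin // leb_box_lty.
Qed.

Lemma Rintegral_shift (c : V) (F : V -> R) :
  measurable_fun [set: vec R n] (F : vec R n -> measurableTypeR R) ->
  \int[leb R n]_x F (x + c) = \int[leb R n]_x F x.
Proof.
move=> mF; have mE : measurable_fun [set: vec R n] (fun x => (F x)%:E) by exact/measurable_EFinP.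
rewrite /Rintegral [in LHS]integralE [in RHS]integralE; congr (fine (_ - _)%E).
  apply: etrans; last by apply: (integral_leb_shift c); [exact: measurable_funepos|].
  by apply: eq_integral => x _; rewrite !funeposE.
apply: etrans; last by apply: (integral_leb_shift c); [exact: measurable_funeneg|].
by apply: eq_integral => x _; rewrite !funenegE.
Qed.

Lemma continuous_measurableT (F : V -> R) : (forall x, {for x, continuous F}) ->
  measurable_fun [set: vec R n] (F : vec R n -> measurableTypeR R).
Proof. by move=> cF; apply: continuous_measurable_vec openT _ => x _; exact: cF. Qed.

Definition cube (N : R) : set (vec R n) := box (const_mx (- N)) (const_mx N).

Lemma not_cube (N : R) (x : V) : ~ cube N x -> N <= `|x|.
Proof.
move=> H; rewrite leNgt; apply/negP => xN; apply: H => i; rewrite !mxE.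
have := entry_le_norm x i; rewrite ler_norml => /andP[h1 h2].
by apply/andP; split; lra.
Qed.

Lemma bounded_support (F : V -> R) (N : R) : (forall x, {for x, continuous F}) ->
  (forall x, N <= `|x| -> F x = 0) -> exists C : R, forall x, `|F x| <= C.
Proof.
move=> cF F0; pose S := [set x : V | `|x| <= N].
have cS : compact S.
  apply: bounded_closed_compact.
    by exists N; split => [|y y1 x]; [exact: num_real|move=> xN; exact: le_trans xN (ltW y1)].
  have -> : S = (fun x : V => `|x|) @^-1` [set s | s <= N] by [].
  by apply: closed_comp => [x _|]; [exact: norm_continuous|exact: closed_le].
have : \forall C \near +oo, S `<=` (fun x => `|F x| <= C).
  apply: (compact_near_coveringP _).1 cS _ _ _ _ _ => x Sx.
  have [r r0 Hr] := continuous_ball (cF x) ltr01.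
  exists (ball x r, [set C : R | `|F x| + 1 <= C]).
    by split; [exact: nbhsx_ballx|exact: nbhs_pinfty_ge].
  move=> [y C] /= [/Hr h1 h2]; apply: le_trans h2.
  by have := ler_normD (F y - F x) (F x); rewrite subrK; lra.
move=> H; near (+oo : set_system R) => C; exists C => x.
have [xN|/ltW xN] := leP `|x| N; last by rewrite F0 // normr0; near: C; exact: nbhs_pinfty_ge.
have HC : S `<=` (fun x => `|F x| <= C) by near: C.
exact: HC.
Unshelve. all: by end_near. Qed.

(** The difference quotients have integral zero by translation invariance, and converge to the
    derivative under domination by a constant on a cube. *)
Lemma integral_derive_eq0 (Y : V -> R) (N : R) (e : V) : Ck 1 setT Y ->
  (forall x, N <= `|x| -> Y x = 0) ->
  (leb R n).-integrable [set: vec R n] (fun x => ('D_e Y x)%:E) /\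
  \int[leb R n]_x 'D_e Y x = 0.
Proof.
move=> [cY dY DY] Y0.
have cY' x : {for x, continuous Y} by exact: cY.
have cD x : {for x, continuous ('D_e Y)} by exact: DY.
have D0 x : N + 1 <= `|x| -> 'D_e Y x = 0.
  move=> xN; have E : \forall y \near x, Y y = (cst 0 : V -> R) y.
    near=> y; apply: Y0; have xy : `|x - y| < 1.
      have : ball x 1 y by near: y; exact: nbhsx_ballx.
      by rewrite -ball_normE.
    by have := ler_normD (x - y) y; rewrite subrK; lra.
  by rewrite (near_eq_derive _ E) derive_cst.
have [C HC] := bounded_support cD D0.
have C0 : 0 <= C by apply: le_trans (HC 0).
have mY := continuous_measurableT cY'.
have mD := continuous_measurableT cD.
have mS c : measurable_fun [set: vec R n] ((fun x => Y (x + c)) : vec R n -> measurableTypeR R).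
  apply: continuous_measurableT => x.
  apply: (@continuous_comp _ _ _ (fun x : V => x + c) Y); last exact: cY'.
  by apply: (@continuousD _ _ _ (fun x : V => x) (fun=> c) x); [exact: cvg_id|exact: cst_continuous].
have [CY HCY] := bounded_support cY' Y0.
have iY : (leb R n).-integrable [set: vec R n] (fun x => (Y x)%:E).
  by apply: (integrable_box mY HCY (a := const_mx (- N)) (b := const_mx N)) => x /not_cube; exact: Y0.
have iS c : (leb R n).-integrable [set: vec R n] (fun x => (Y (x + c))%:E).
  apply: (integrable_box (mS c) (C := CY) (a := const_mx (- (N + `|c|)))
    (b := const_mx (N + `|c|))) => // x /not_cube h; apply: Y0.
  by have := ler_normB (x + c) c; rewrite addrK; lra.
pose h (m : nat) : R := (m.+1%:R)^-1.
have h0 m : 0 < h m by rewrite invr_gt0 ltr0n.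
have h1 m : h m <= 1 by rewrite invf_le1 ?ler1n ?ltr0n.
pose f_ (m : nat) (x : vec R n) : \bar R := ((h m)^-1 * (Y ((x : V) + h m *: e) - Y x))%:E.
have int0 m : (\int[leb R n]_x f_ m x = 0)%E.
  have I := integrableB measurableT (iS (h m *: e)) iY.
  have -> : (\int[leb R n]_x f_ m x = (h m)^-1%:E * \int[leb R n]_x ((Y ((x : V) + h m *: e))%:E - (Y x)%:E))%E.
    by rewrite -integralZl //; apply: eq_integral => x _; rewrite /f_ EFinM EFinB.
  rewrite integralB //.
  have := Rintegral_shift (h m *: e) mY; rewrite /Rintegral => E.
  rewrite -[X in (X - _)%E]fineK; last exact: (integrable_fin_num measurableT (iS _)).
  rewrite -[X in (_ - X)%E]fineK; last exact: (integrable_fin_num measurableT iY).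
  by rewrite E subee ?mule0.
(* The derivative vanishes beyond N + 1, and the mean value theorem evaluates it within distance |e|
   of x because the steps [h m] are at most 1. *)
pose K := N + `|e| + 1.
pose gb (x : vec R n) : \bar R := (C * \1_(cube K) x)%:E.
have mf m : measurable_fun [set: vec R n] (f_ m).
  apply/measurable_EFinP.
  have := @measurable_funB _ _ _ _ _ _ (mS (h m *: e)) mY; move=> mB.
  exact: (measurable_funM (@measurable_cst _ _ _ _ setT (h m)^-1) mB).
have mD' : measurable_fun [set: vec R n] (fun x => ('D_e Y x)%:E) by exact/measurable_EFinP.
have hcv : h m @[m --> \oo] --> (0 : R)^'.
  move=> A HA; have H : \forall m \near \oo, h m != 0 -> A (h m) := cvg_harmonic HA.
  by apply: filterS H => m; apply; rewrite gt_eqF.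
have fcv (x : vec R n) : f_ ^~ x @ \oo --> ('D_e Y x)%:E.
  apply/fine_cvgP; split; first by apply: nearW.
  have := cvg_comp _ _ hcv (dY x e I); apply: cvg_trans; apply: near_eq_cvg.
  by apply: filterE => m; rewrite /f_ /= [_ *: e + _]addrC.
have dom m (x : vec R n) : (`|f_ m x| <= gb x)%E.
  have [t /andP[t0 t1] E] := @MVT_line _ _ Y x e (h m) (fun t _ => dY _ _ I).
  rewrite /f_ /gb E mulKf ?gt_eqF // lee_fin indicE.
  case: (boolP (x \in cube K)) => xK; first by rewrite mulr1.
  rewrite mulr0 D0 ?normr0 //.
  have /not_cube : ~ cube K x by move=> h'; move/negP: xK; apply; exact: mem_set.
  have := ler_normB ((x : V) + (t * h m) *: e) ((t * h m) *: e); rewrite addrK normrZ.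
  have : `|t * h m| <= 1.
    by rewrite normrM !ger0_norm ?(ltW (h0 m)) // mulr_ile1 // ltW.
  move=> k1; have := ler_wpM2r (normr_ge0 e) k1; rewrite mul1r /K; lra.
have igb : (leb R n).-integrable [set: vec R n] gb.
  apply: (integrable_box (C := C) (a := const_mx (- K)) (b := const_mx K)).
  - by apply: measurable_funM => //; apply: measurable_indic; exact: measurable_box.
  - by move=> x; rewrite indicE; case: (x \in _); rewrite ?mulr1 ?mulr0 ?normr0 // ger0_norm.
  - by move=> x xK; rewrite indicE memNset // mulr0.
have [iD _ +] := @dominated_convergence _ _ _ (leb R n) setT measurableT f_
  (fun x => ('D_e Y x)%:E) gb mf mD' (aeW _ (fun x _ => fcv x)) igb (aeW _ (fun x m _ => dom m x)).
have -> : [sequence (\int[leb R n]_x f_ m x)%E]_m = cst 0%E.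
  by apply/funext => m; exact: int0.
move=> cv; split=> //; rewrite /Rintegral; have := cvg_lim (@ereal_hausdorff R) cv.
by rewrite lim_cst //; move=> <-.
Unshelve. all: by end_near. Qed.

Lemma integral_divergence_eq0 (Y : 'I_n -> V -> R) (N : R) : (forall l, Ck 1 setT (Y l)) ->
  (forall l x, N <= `|x| -> Y l x = 0) ->
  \int[leb R n]_x (\sum_l 'D_(unit_vec R l) (Y l) x) = 0.
Proof.
move=> CY Y0; have H l := integral_derive_eq0 (unit_vec R l) (CY l) (Y0 l).
suff [_ //] : (leb R n).-integrable [set: vec R n]
    (fun x => (\sum_l 'D_(unit_vec R l) (Y l) x)%:E) /\
  \int[leb R n]_x (\sum_l 'D_(unit_vec R l) (Y l) x) = 0.
elim: (index_enum _) => [|l s [is0 ss0]].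
  split; first by under eq_fun do rewrite big_nil; exact: integrable0.
  by under eq_Rintegral do rewrite big_nil; rewrite /Rintegral integral0.
have [il sl0] := H l; split.
  under eq_fun do rewrite big_cons EFinD; exact: integrableD.
by under eq_Rintegral do rewrite big_cons; rewrite RintegralD // sl0 ss0 addr0.
Qed.
End CompactSupport.

Section Green.
Variables (R : realType) (n : nat) (M : closedManifold R n) (h : metric M).
Hypothesis hR : riemannian h.
Local Notation V := 'rV[R]_n.
Local Notation fam := ('I_(charts M) -> V -> R).
Implicit Types (i j : 'I_(charts M)) (x : V) (F G : fam) (f u : M -> R).

Lemma supported_integrable j f : smooth_fun f -> (forall q, 0 <= f q) -> supported j f ->
  integrable_field h (fun i x => f (chart_inv i x)).
Proof.
move=> Sf f0 sf; have FF := smooth_scalar_field Sf.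
apply: (integrable_field_ge0 hR FF) => //.
rewrite (sum_integral_pieces hR FF _ (supported_field sf)) //.
have [B [cB Bj] HB] := sf.
have [N [_ HN]] := compact_bounded cB.
have BN y : B y -> `|y| <= `|N| + 1 by move=> /HN; apply; have := ler_norm N; lra.
have : \forall C \near +oo, B `<=` (fun x => f (chart_inv j x) * rho h j x <= C).
  apply: (compact_near_coveringP _).1 cB _ _ _ _ _ => x /Bj jx.
  have cF : {for x, continuous (fun x => f (chart_inv j x) * rho h j x)}.
    exact: (continuousM (field_continuous FF jx) (rho_continuous hR jx)).
  have [r r0 Hr] := continuous_ball cF ltr01.
  exists (ball x r, [set C : R | f (chart_inv j x) * rho h j x + 1 <= C]).
    by split; [exact: nbhsx_ballx|apply: nbhs_pinfty_ge; exact: num_real].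
  by move=> [y C] /= [/Hr]; rewrite ltr_norml => /andP[_ h1] h2; lra.
move=> H; near (+oo : set_system R) => C.
have HC : B `<=` (fun x => f (chart_inv j x) * rho h j x <= C) by near: C.
have C0 : 0 <= C by near: C; exact: nbhs_pinfty_ge.
have mc : measurable (cube (`|N| + 2) : set (vec R n)) by exact: measurable_box.
have mj := @measurable_chart_img _ _ M j.
have mI : measurable ((chart_img j : set (vec R n)) `&` cube (`|N| + 2)) by exact: measurableI.
have fz x : chart_img j x -> f (chart_inv j x) != 0 -> B x /\ cube (`|N| + 2) x.
  move=> jx /HB[_]; rewrite chart_invK // => Bx; split => // i.
  have := entry_le_norm x i; have := BN _ Bx; rewrite !mxE ler_norml => k1 /andP[k2 k3].
  by apply/andP; split; lra.
have -> : (\int[leb R n]_(x in chart_img j) (f (chart_inv j x) * rho h j x)%:E =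
    \int[leb R n]_(x in (chart_img j : set (vec R n)) `&` cube (`|N| + 2)) (f (chart_inv j x) * rho h j x)%:E)%E.
  rewrite [LHS]integral_mkcond [RHS]integral_mkcond; apply: eq_integral => x _; rewrite !patchE in_setI.
  case: ifPn => //= /set_mem jx; case: ifPn => // /negP xN.
  have [->|fx] := eqVneq (f (chart_inv j x)) 0; first by rewrite mul0r.
  by have [_ /mem_set] := fz x jx fx.
apply: le_lt_trans (integral_ub (leb R n) mI _ _ (c := C) _) _.
- by apply: (measurable_field_rho hR FF) => x [].
- by move=> x [jx _]; rewrite mulr_ge0 // ltW // (rho_gt0 hR).
- move=> x [jx _]; have [->|fx] := eqVneq (f (chart_inv j x)) 0; first by rewrite mul0r.
  by apply: HC; have [] := fz x jx fx.
- rewrite lte_mul_pinfty // ?lee_fin //.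
  apply: le_lt_trans (leb_box_lty _ _ : (leb R n (cube (`|N| + 2)) < +oo)%E).
  by apply: le_measure; [exact: mem_set|exact: mem_set|exact: subIsetr].
Unshelve. all: by end_near. Qed.

(** Finiteness of the volume: the density may be unbounded on a chart image, but 1 is a finite sum
    of functions with compact support in charts. *)
Lemma integrable_field1 : integrable_field h (fun i (x : V) => 1).
Proof.
have [s [xi [Hxi sxi]]] := @partition_of_unity _ _ M.
have I (t : seq M) : integrable_field h (fun i (x : V) => \sum_(a <- t) xi a (chart_inv i x)).
  elim: t => [|a t ih].
    move=> i; under eq_fun do rewrite big_nil mul0r; exact: integrable0.
  have [Sa a0 [j sa]] := Hxi a.
  have := integrable_fieldD (supported_integrable Sa a0 sa) ih.
  by congr integrable_field; apply/funext => i; apply/funext => x; rewrite big_cons.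
have := I s; congr integrable_field; apply/funext => i; apply/funext => x; exact: sxi.
Qed.

Lemma scalar_field_integrable F : scalar_field F -> integrable_field h F.
Proof.
move=> FF; have [C [C0 HC]] := scalar_field_bounded FF.
apply: (integrable_field_le hR FF (G := fun i (x : V) => C * 1)); last by move=> i x; rewrite mulr1; exact: HC.
exact: (integrable_fieldZ integrable_field1 C).
Qed.

Lemma scalar_field_laplacian u : smooth_fun u ->
  scalar_field (fun i x => laplacian h i (fun y => u (chart_inv i y)) x).
Proof.
move=> Su; split=> [i j x ox|i x ix].
  apply: (laplacian_transition hR ox (Su j)) => y oy; by rewrite transition_inv.
have := @laplacian_Ck _ _ _ _ hR i (chart_opens i) (@subset_refl _ _) 0 _ (Su i).
by move=> /Ck_continuous /(_ x ix).
Qed.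

Lemma near0_partial i l x (F : V -> R) : chart_img i x -> (\forall y \near x, F y = 0) ->
  \forall y \near x, partial i l F y = 0.
Proof.
move=> ix F0; have inear : \forall y \near x, chart_img i y.
  by apply: open_nbhs_nbhs; split=> //; exact: chart_img_open.
have := near_join F0; apply: filterS2 inear => y iy Fy.
by rewrite partialE // (near_eq_derive _ (g := cst 0)) // derive_cst.
Qed.

Lemma near0_laplacian i x (F : V -> R) : chart_img i x -> (\forall y \near x, F y = 0) ->
  laplacian h i F x = 0.
Proof.
move=> ix F0; have p0 l := near0_partial l ix F0.
rewrite /laplacian (_ : hessian h i F x = 0) ?mulmx0 ?mxtrace0 //.
apply/matrixP => k l; rewrite !mxE (nbhs_singleton (near0_partial k ix (p0 l))).
by rewrite big1 ?subr0 // => m _; rewrite (nbhs_singleton (p0 m)) mulr0.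
Qed.

Lemma laplacian_cst i x c : chart_img i x -> laplacian h i (fun=> c) x = 0.
Proof.
move=> ix.
have p0 l : \forall y \near x, partial i l (fun=> c) y = 0.
  by apply: filterS (chart_img_near ix) => y iy; rewrite partialE // derive_cst.
rewrite /laplacian (_ : hessian h i _ x = 0) ?mulmx0 ?mxtrace0 //.
apply/matrixP => k l; rewrite !mxE (nbhs_singleton (near0_partial k ix (p0 l))).
by rewrite big1 ?subr0 // => m _; rewrite (nbhs_singleton (p0 m)) mulr0.
Qed.

Lemma laplacianD i x (F G : V -> R) : chart_img i x ->
  (forall k, Ck k (chart_img i) F) -> (forall k, Ck k (chart_img i) G) ->
  laplacian h i (fun y => F y + G y) x = laplacian h i F x + laplacian h i G x.
Proof.
move=> ix CF CG; have oi := @chart_img_open _ _ M i.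
have dF (H : V -> R) y k : (forall k, Ck k (chart_img i) H) -> chart_img i y ->
    derivable H y (unit_vec R k).
  by move=> CH iy; have [_ /(_ y (unit_vec R k) iy)] := CH 1%N.
have D1 k y : chart_img i y ->
    partial i k (fun y => F y + G y) y = partial i k F y + partial i k G y.
  by move=> iy; rewrite !partialE // deriveD //; exact: dF.
have Cp H k : (forall k, Ck k (chart_img i) H) -> forall m, Ck m (chart_img i) (partial i k H).
  move=> CH m; apply: eq_Ck (Ck_derive (unit_vec R k) (CH m.+1)) => // y.
  by rewrite inE => iy; rewrite partialE.
have D2 k l : partial i k (partial i l (fun y => F y + G y)) x
    = partial i k (partial i l F) x + partial i k (partial i l G) x.
  rewrite (eq_partial k oi (@subset_refl _ _) ix (D1 l)).
  rewrite partialE // deriveD ?partialE //; exact: dF (Cp _ _ _) _.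
rewrite /laplacian -mxtraceD -mulmxDr; congr (\tr (_ *m _)); apply/matrixP => k l.
rewrite !mxE D2 addrACA -opprD -big_split /=; congr (_ - _).
by apply: eq_bigr => m _; rewrite D1 // mulrDr.
Qed.

Lemma supported_near0 j f (B : set V) i x : compact B -> B `<=` chart_img j ->
  (forall q, f q != 0 -> chart_dom j q /\ B (chart j q)) -> chart_img i x ->
  ~ (overlap i j x /\ B (transition i j x)) -> \forall y \near x, f (chart_inv i y) = 0.
Proof.
move=> cB Bj HB ix nB; pose K := chart_inv j @` B.
have cK : closed K.
  apply: compact_closed; first exact: points_hausdorff.
  apply: continuous_compact cB; apply: continuous_in_subspaceT => y.
  by rewrite inE => /Bj jy; exact: chart_inv_at.
have xK : (~` K) (chart_inv i x).
  move=> [y By E]; have jy := Bj _ By; apply: nB; split.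
    by apply/overlapP; split=> //; rewrite -E; exact: chart_inv_dom.
  by rewrite /transition -E chart_invK.
have : \forall y \near x, (~` K) (chart_inv i y).
  by apply: (chart_inv_at ix); apply: open_nbhs_nbhs; split=> //; exact: closed_openC.
apply: filterS => y Ky; apply/eqP/negP => /negP /HB[jy By].
by apply: Ky; exists (chart j (chart_inv i y)); rewrite ?chartK.
Qed.

(** The difference of the two integrands is, up to the density, the divergence of the Green field;
    as f has compact support in one chart, the field extends by zero to R^n and its divergence
    integrates to zero. *)
Lemma green_supported j f u : smooth_fun f -> smooth_fun u -> supported j f ->
  vol h (fun i x => f (chart_inv i x) * laplacian h i (fun y => u (chart_inv i y)) x)
  = vol h (fun i x => u (chart_inv i x) * laplacian h i (fun y => f (chart_inv i y)) x).
Proof.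
move=> Sf Su sf; have [B [cB Bj] HB] := sf.
have Ff := smooth_scalar_field Sf; have Fu := smooth_scalar_field Su.
have Lf := scalar_field_laplacian Sf; have Lu := scalar_field_laplacian Su.
pose D i x := f (chart_inv i x) * laplacian h i (fun y => u (chart_inv i y)) x
  + -1 * (u (chart_inv i x) * laplacian h i (fun y => f (chart_inv i y)) x).
have F1 := scalar_fieldM Ff Lu; have F2 := scalar_fieldM Fu Lf.
have F2' := scalar_fieldM (@scalar_field_cst _ _ M (-1)) F2.
have FD : scalar_field D := scalar_fieldD F1 F2'.
suff : vol h D = 0.
  rewrite vol_add ?vol_scale; try exact: scalar_field_integrable.
  by move/eqP; rewrite mulN1r subr_eq0 => /eqP.
have [Y [CY DY Y0]] := @chart_green _ _ _ _ hR j (chart_opens j) (@subset_refl _ _) _ _ (Sf j) (Su j).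
have cC : closed B by exact: (compact_closed (@norm_hausdorff _ _) cB).
(* Extension of the Green field by zero. It is of class C^1 because it already vanishes on the chart
   outside the compact set [B]. *)
pose Z l x := if `[< chart_img j x >] then Y l x else 0.
have ZE l x : chart_img j x -> Z l x = Y l x by move=> jx; rewrite /Z asboolT.
have near0 i x : chart_img i x -> ~ (overlap i j x /\ B (transition i j x)) ->
  \forall y \near x, f (chart_inv i y) = 0 by exact: supported_near0.
have ovj x : chart_img j x -> transition j j x = x by move=> jx; rewrite /transition chart_invK.
have Z0 l x : ~ B x -> Z l x = 0.
  move=> xB; rewrite /Z; case: asboolP => // jx; apply: Y0 => //.
  by apply: near0 => // -[_]; rewrite ovj.
have CZ l : Ck 1 setT (Z l).
  apply: Ck_local => x _; have [jx|jx] := pselect (chart_img j x).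
    exists (chart_img j); split=> //; first exact: chart_img_open.
    by apply: eq_Ck (CY l 1%N) => [|y]; [exact: chart_img_open|rewrite inE => jy; rewrite ZE].
  exists (~` B); split; first exact: closed_openC.
    by move=> /Bj.
  by apply: eq_Ck (Ck_cst 1 _ 0) => [|y]; [exact: closed_openC|rewrite inE => /(Z0 l) ->].
have [N [_ HN]] := compact_bounded cB.
have ZN l x : `|N| + 2 <= `|x| -> Z l x = 0.
  move=> xN; apply: Z0 => Bx; have k1 := ler_norm N.
  have k2 : `|x| <= `|N| + 1 by apply: (HN (`|N| + 1)) => //; lra.
  lra.
have Dj i x : chart_img i x -> ~ overlap i j x -> D i x = 0.
  move=> ix ox; have fx : \forall y \near x, f (chart_inv i y) = 0 by apply: near0 => // -[].
  by rewrite /D (near0_laplacian ix fx) (nbhs_singleton fx) mul0r mulr0 mulr0 addr0.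
have aD : integrable_field h (fun i x => `|D i x|).
  apply: scalar_field_integrable; apply: (scalar_field_comp FD) => i x _.
  exact: norm_continuous.
rewrite (vol_chart hR FD aD Dj) Rintegral_mkcond.
rewrite -(integral_divergence_eq0 CZ ZN); apply: eq_Rintegral => x _; rewrite patchE.
case: ifPn => [/set_mem jx|jx].
  rewrite mulrC /D mulN1r /rho -(DY x jx); apply: eq_bigr => l _.
  by apply: (@eq_derive_open _ _ (chart_img j)) => // [|y]; [exact: chart_img_open|rewrite inE => jy; rewrite ZE].
rewrite big1 // => l _; have xB : (~` B) x.
  by move=> /Bj jx'; move/negP: jx; apply; exact: mem_set.
rewrite (@near_eq_derive _ _ _ _ (cst 0)) ?derive_cst //.
have : \forall y \near x, (~` B) y by apply: open_nbhs_nbhs; split=> //; exact: closed_openC.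
by apply: filterS => y /(Z0 l).
Qed.

(** Insert 1 as the sum of the partition functions and move the Laplacian onto each of them; their
    Laplacians add up to that of 1, which is 0. *)
Lemma vol_laplacian u : smooth_fun u ->
  vol h (fun i x => laplacian h i (fun y => u (chart_inv i y)) x) = 0.
Proof.
move=> Su; have [s [xi [Hxi sxi]]] := @partition_of_unity _ _ M.
have Lu := scalar_field_laplacian Su; have Fu := smooth_scalar_field Su.
pose P a i x := xi a (chart_inv i x) * laplacian h i (fun y => u (chart_inv i y)) x.
pose Q a i x := u (chart_inv i x) * laplacian h i (fun y => xi a (chart_inv i y)) x.
have FP a : scalar_field (P a).
  by have [Sa _ _] := Hxi a; exact: scalar_fieldM (smooth_scalar_field Sa) Lu.
have FQ a : scalar_field (Q a).
  by have [Sa _ _] := Hxi a; exact: scalar_fieldM Fu (scalar_field_laplacian Sa).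
have PQ a : vol h (P a) = vol h (Q a).
  by have [Sa _ [j sa]] := Hxi a; exact: green_supported sa.
have vsum (F : M -> fam) (t : seq M) : (forall a, scalar_field (F a)) ->
    vol h (fun i x => \sum_(a <- t) F a i x) = \sum_(a <- t) vol h (F a).
  move=> FF; elim: t => [|a t ih].
    have I0 := scalar_field_integrable (@scalar_field_cst _ _ M 0).
    rewrite big_nil -[RHS](mul0r (vol h (fun i (x : V) => 0))) -(vol_scale I0).
    by apply: eq_vol => i x _; rewrite big_nil mul0r.
  rewrite big_cons -ih -vol_add; first by apply: eq_vol => i x _; rewrite big_cons.
    exact: scalar_field_integrable.
  by apply: scalar_field_integrable; exact: scalar_field_sum.
transitivity (\sum_(a <- s) vol h (P a)).
  rewrite -vsum //; apply: eq_vol => i x ix.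
  by rewrite /P -mulr_suml sxi mul1r.
rewrite (eq_bigr _ (fun a _ => PQ a)) -vsum //.
have I0 := scalar_field_integrable (@scalar_field_cst _ _ M 0).
rewrite -[RHS](mul0r (vol h (fun i (x : V) => 0))) -(vol_scale I0).
apply: eq_vol => i x ix; rewrite mul0r /Q -mulr_sumr.
suff -> : \sum_(a <- s) laplacian h i (fun y => xi a (chart_inv i y)) x = 0 by rewrite mulr0.
transitivity (laplacian h i (fun y => \sum_(a <- s) xi a (chart_inv i y)) x).
  elim: (s) => [|a t ih].
    rewrite big_nil; apply/esym/near0_laplacian => //.
    apply: filterS (chart_img_near ix) => y _; exact: big_nil.
  rewrite big_cons ih -laplacianD //; first by congr (laplacian h i _ x); apply/funext => y; rewrite big_cons.
    by have [Sa _ _] := Hxi a; exact: Sa.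
  move=> k; apply: Ck_sum => [|b _]; first exact: chart_img_open.
  by have [Sb _ _] := Hxi b; exact: Sb.
rewrite -[RHS](laplacian_cst 1 ix); congr (laplacian h i _ x).
by apply/funext => y; exact: sxi.
Qed.
End Green.

(** * Positive definite forms *)

Section Cholesky.
Variable R : realType.

(** Induction on the Schur complement of the upper left entry. *)
Lemma cholesky n (G : 'M[R]_n) : G^T = G ->
  (forall v : 'rV_n, v != 0 -> 0 < (v *m G *m v^T) ord0 ord0) ->
  exists2 A : 'M[R]_n, A \in unitmx & G = A *m A^T.
Proof.
elim: n G => [|n ih] G GT Gp.
  by exists 1%:M; rewrite ?unitmx1 //; apply/matrixP => -[].
pose H : 'M[R]_(1 + n) := G; pose a := ulsubmx H ord0 ord0.
pose b : 'cV[R]_n := dlsubmx H; pose C : 'M[R]_n := drsubmx H.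
have HT : H^T = H by [].
have ur : ursubmx H = b^T by rewrite /b trmx_dlsub HT.
have CT : C^T = C by rewrite /C trmx_drsub HT.
have Ha : ulsubmx H = a%:M by rewrite [LHS]mx11_scalar.
have HB : H = block_mx a%:M b^T b C by rewrite -[LHS]submxK Ha ur.
have form (s : R) (v : 'rV[R]_n) : (row_mx s%:M v *m H *m (row_mx s%:M v)^T) ord0 ord0
    = s ^+ 2 * a + s *+ 2 * (v *m b) ord0 ord0 + (v *m C *m v^T) ord0 ord0.
  rewrite HB mul_row_block tr_row_mx mul_row_col !mulmxDl !mul_scalar_mx tr_scalar_mx !mul_mx_scalar.
  have -> : s *: b^T *m v^T = s *: (v *m b)^T by rewrite trmx_mul -scalemxAl.
  move: (v *m b) (v *m C *m v^T) a {Ha HB} => B D a'; rewrite !mxE !eqxx mulr1n; ring.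
have a0 : 0 < a.
  have := Gp (row_mx 1%:M 0 : 'rV_(1 + n)); rewrite [X in 0 < X](form 1 0).
  rewrite !mul0mx !mxE mulr0 !addr0 expr1n mul1r; apply.
  apply/eqP => /(congr1 (fun X : 'rV[R]_(1 + n) => lsubmx X)) /=; rewrite row_mxKl => /matrixP/(_ ord0 ord0)/eqP.
  by rewrite !mxE eqxx oner_eq0.
pose r := Num.sqrt a; have r0 : 0 < r by rewrite sqrtr_gt0.
have r2 : r * r = a by rewrite -expr2 sqr_sqrtr // ltW.
pose C' := C - a^-1 *: (b *m b^T).
have [||A Au AC] := ih C'.
- by rewrite /C' raddfB /= linearZ /= trmx_mul trmxK CT.
(* This s minimises the form over the first coordinate; completing the square leaves the value of
   the Schur complement at v. *)
- move=> v v0; pose s := - (a^-1 * (v *m b) ord0 ord0).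
  have := Gp (row_mx s%:M v : 'rV_(1 + n)); rewrite [X in 0 < X](form s v).
  have -> : (v *m C' *m v^T) ord0 ord0
      = (v *m C *m v^T) ord0 ord0 - a^-1 * ((v *m b) ord0 ord0) ^+ 2.
    rewrite /C' mulmxBr mulmxBl [LHS]mxE; congr (_ + _); rewrite [LHS]mxE; congr (- _).
    rewrite -scalemxAr -scalemxAl [LHS]mxE; congr (_ * _).
    have -> : v *m (b *m b^T) *m v^T = (v *m b) *m (v *m b)^T by rewrite trmx_mul !mulmxA.
    by move: (v *m b) => B; rewrite mxE big_ord1 mxE expr2.
  have -> : s ^+ 2 * a + s *+ 2 * (v *m b) ord0 ord0 + (v *m C *m v^T) ord0 ord0
      = (v *m C *m v^T) ord0 ord0 - a^-1 * ((v *m b) ord0 ord0) ^+ 2.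
    by rewrite /s; field; rewrite gt_eqF.
  apply; apply/eqP => /(congr1 (fun X : 'rV[R]_(1 + n) => rsubmx X)) /=; rewrite row_mxKr => v00; move/eqP: v0; apply.
  by rewrite v00; apply/matrixP => k l; rewrite !mxE.
pose L : 'M[R]_(1 + n) := block_mx r%:M 0 (r^-1 *: b) A.
exists L.
  by rewrite unitmxE (det_lblock (r%:M : 'M[R]_1) (r^-1 *: b) A) det_scalar1 unitrM !unitfE gt_eqF //= -unitfE -unitmxE.
rewrite -[LHS]/H [LHS]HB -[RHS]/((block_mx r%:M 0 (r^-1 *: b) A : 'M[R]_(1 + n))
  *m (block_mx r%:M 0 (r^-1 *: b) A : 'M[R]_(1 + n))^T) tr_block_mx.
rewrite [RHS]mulmx_block tr_scalar_mx linearZ /= trmx0.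
rewrite !mulmx0 !mul0mx !addr0 mul_scalar_mx mul_mx_scalar !scalerA scale_scalar_mx r2.
rewrite mul_scalar_mx scalerA mulfV ?gt_eqF // !scale1r -AC /C'.
have -> : r^-1 *: b *m (r^-1 *: b^T) = a^-1 *: (b *m b^T).
  by rewrite -scalemxAl -scalemxAr scalerA -invfM r2.
by rewrite addrC subrK.
Qed.
End Cholesky.

Section SqnormTensor.
Variables (R : realType) (n : nat) (M : closedManifold R n) (h : metric M).
Hypothesis hR : riemannian h.
Variables (i : 'I_(charts M)) (x : 'rV[R]_n).
Hypothesis ix : chart_img i x.
Implicit Types S : 'M[R]_n.

Let hT : (h i x)^T = h i x. Proof. by have [_ H _ _] := hR; exact: H. Qed.

Let hu : h i x \in unitmx. Proof. exact: metric_unit. Qed.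

Lemma sqnorm_tensorE S : S^T = S ->
  sqnorm_tensor h i x S = \tr (invmx (h i x) *m S *m invmx (h i x) *m S).
Proof. by move=> ST; rewrite -(sqnE hT (mulVmx hu)). Qed.

(** With the metric equal to A A^T the norm is the sum of the squares of the entries of A^-1 S
    A^-T. *)
Lemma sqnorm_tensor_ge0 S : S^T = S -> 0 <= sqnorm_tensor h i x S.
Proof.
move=> ST; rewrite sqnorm_tensorE //.
have [_ _ Hp _] := hR; have [A Au EA] := cholesky hT (Hp i x ix).
have uT : A^T \in unitmx by rewrite unitmx_tr.
have -> : invmx (h i x) = invmx A^T *m invmx A.
  have E : invmx A^T *m invmx A *m h i x = 1%:M.
    by rewrite EA -!mulmxA (mulmxA (invmx A)) mulVmx // mul1mx mulVmx.
  by rewrite -[LHS]mul1mx -E -mulmxA mulmxV // mulmx1.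
pose Y := invmx A *m S *m invmx A^T.
have -> : \tr (invmx A^T *m invmx A *m S *m (invmx A^T *m invmx A) *m S) = \tr (Y *m Y^T).
  rewrite /Y !trmx_mul !trmx_inv trmxK ST -!mulmxA mxtrace_mulC.
  by rewrite -!mulmxA.
rewrite /mxtrace sumr_ge0 // => k _; rewrite mxE sumr_ge0 // => l _.
by rewrite !mxE -expr2 sqr_ge0.
Qed.

Lemma sqnorm_tensorB S (c : R) : S^T = S ->
  sqnorm_tensor h i x (S - c *: h i x)
  = sqnorm_tensor h i x S - 2 * c * \tr (invmx (h i x) *m S) + c ^+ 2 * n%:R.
Proof.
move=> ST; rewrite !sqnorm_tensorE //; last by rewrite raddfB /= linearZ /= ST hT.
have Vh : invmx (h i x) *m h i x = 1%:M by rewrite mulVmx.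
set G := invmx _.
have -> : G *m (S - c *: h i x) = G *m S - c%:M.
  by rewrite mulmxBr -scalemxAr Vh scalemx1.
rewrite -[X in \tr X]mulmxA mulmxBr -scalemxAr Vh scalemx1.
rewrite mulmxBl !mulmxBr mul_scalar_mx mul_mx_scalar -scalar_mxM.
by rewrite !mulmxA !raddfB /= mxtraceZ mxtrace_scalar -mulr_natr; ring.
Qed.
End SqnormTensor.

(** * Functions along the flow *)

Section VolumeLimits.
Variables (R : realType) (n : nat) (M : closedManifold R n).
Local Notation V := 'rV[R]_n.
Local Notation fam := ('I_(charts M) -> V -> R).
Implicit Types (i j : 'I_(charts M)) (x : V) (F G : fam) (h : metric M).

Lemma vol_change_metric h h' F G :
  (forall i x, chart_img i x -> F i x * rho h i x = G i x * rho h' i x) ->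
  vol h F = vol h' G.
Proof.
move=> FG; apply: eq_bigr => i _; rewrite /rn_integral.
by congr (fine _ - fine _); congr nonneg_integral; apply/funext => x;
  rewrite -/(piece i) indicE; case: (boolP (x \in _)) => [/set_mem /piece_sub ix|_];
  rewrite ?mulr0 // -![Num.sqrt _]/(rho _ _ _) FG.
Qed.

Lemma glue F : (forall i j x, overlap i j x -> F i x = F j (transition i j x)) ->
  exists f : M -> R, forall i x, chart_img i x -> f (chart_inv i x) = F i x.
Proof.
move=> Ft; have /choice[c Hc] := @chart_cover _ _ M.
exists (fun q => F (c q) (chart (c q) q)) => i x ix; rewrite [RHS](Ft i (c (chart_inv i x))) //.
by apply/overlapP; split=> //; exact: Hc.
Qed.

Lemma eq_laplacian h i x (F1 F2 : V -> R) : chart_img i x ->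
  (forall y, chart_img i y -> F1 y = F2 y) -> laplacian h i F1 x = laplacian h i F2 x.
Proof.
move=> ix FF; have oi := @chart_img_open _ _ M i.
have p l y : chart_img i y -> partial i l F1 y = partial i l F2 y.
  by move=> iy; exact: (eq_partial l oi (@subset_refl _ _) iy FF).
rewrite /laplacian; congr (\tr (_ *m _)); apply/matrixP => k l; rewrite !mxE.
rewrite (eq_partial k oi (@subset_refl _ _) ix (p l)); congr (_ - _).
by apply: eq_bigr => m _; rewrite p.
Qed.

Variable h : metric M.
Hypothesis hR : riemannian h.

Lemma vol_dist F G (e : R) : scalar_field F -> scalar_field G ->
  (forall i x, chart_img i x -> `|F i x - G i x| <= e) ->
  `|vol h F - vol h G| <= e * vol h (fun i (x : V) => 1).
Proof.
move=> FF FG FGe; have IF := scalar_field_integrable hR FF.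
have IG := scalar_field_integrable hR FG; have I1 := integrable_field1 hR.
have Ie := integrable_fieldZ I1 e.
have A (F1 F2 : fam) : integrable_field h F1 -> integrable_field h F2 ->
    (forall i x, chart_img i x -> F1 i x <= F2 i x + e * 1) ->
    vol h F1 <= vol h F2 + e * vol h (fun i (x : V) => 1).
  move=> I1' I2 le12; rewrite -(vol_scale I1) -(vol_add I2 Ie).
  by apply: vol_le => //; exact: integrable_fieldD.
have A1 : vol h F <= vol h G + e * vol h (fun i (x : V) => 1).
  by apply: A => // i x ix; have := FGe i x ix; rewrite ler_norml; lra.
have A2 : vol h G <= vol h F + e * vol h (fun i (x : V) => 1).
  by apply: A => // i x ix; have := FGe i x ix; rewrite ler_norml; lra.
by rewrite ler_norml; move: (e * _) A1 A2 => c; lra.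
Qed.

(** Locally uniform convergence in the charts is uniform over M by [near_charts], and the total
    volume is finite. *)
Lemma vol_cvg (I : Type) (Phi : set_system I) (FPhi : Filter Phi) (H : I -> fam) G :
  (\forall e \near Phi, scalar_field (H e)) -> scalar_field G ->
  (forall i x, chart_img i x -> forall e : R, 0 < e ->
     \forall y \near x & a \near Phi, `|H a i y - G i y| < e) ->
  vol h (H a) @[a --> Phi] --> vol h G.
Proof.
move=> FH FG HG; set m := vol h (fun i (x : V) => 1).
have m0 : 0 <= m.
  have D := @vol_dist _ _ 1 (@scalar_field_cst _ _ M 0) (@scalar_field_cst _ _ M 0).
  rewrite mul1r in D; apply: le_trans (normr_ge0 _) (D _) => i x _.
  by rewrite subrr normr0 ler01.
apply/cvgrPdist_lt => e e0; pose d := e / (m + 1).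
have m1 : 0 < m + 1 by rewrite ltr_wpDl.
have d0 : 0 < d by rewrite divr_gt0.
have : \forall a \near Phi, forall i x, chart_img i x ->
    scalar_field (H a) -> `|H a i x - G i x| < d.
  apply: near_charts => [a i j x o Hj Fa|i x ix].
    by rewrite (field_transition Fa o) (field_transition FG o); exact: Hj.
  by apply: filterS (HG i x ix d d0) => -[y a].
apply: filterS2 FH => a Fa /(_ _ _ _ Fa) Ha.
rewrite distrC; apply: le_lt_trans (vol_dist Fa FG (fun i x ix => ltW (Ha i x ix))) _.
by rewrite -/m /d mulrAC ltr_pdivrMr // ltr_pM2l // ltrDl.
Qed.
End VolumeLimits.

Section FlowFields.
Variables (R : realType) (n : nat) (M : closedManifold R n) (T : R) (g : R -> metric M).
Hypothesis g_flow : ricci_flow T g.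
Variable s : R.
Hypothesis sT : s <= T.
Local Notation V := 'rV[R]_n.
Local Notation E := ('rV[R]_n * R)%type.
Local Notation ffam := ('I_(charts M) -> V * R -> R).
Implicit Types (i j : 'I_(charts M)) (x : V) (F G : ffam) (t : R).

(** The time interval is open, so that restricted and ordinary derivatives agree. *)
Definition open_spacetime i : set E := chart_img i `*` [set t | 0 < t < s].
Local Notation ST := open_spacetime.

Lemma open_spacetime_open i : open (ST i).
Proof.
have -> : ST i = (fst @^-1` chart_img i) `&` (snd @^-1` `]0, s[%classic).
  by apply/seteqP; split=> -[x t] /=; rewrite in_itv.
apply: openI.
  by apply: open_comp => [z _|]; [exact: cvg_fst|exact: chart_img_open].
by apply: open_comp => [z _|]; [exact: cvg_snd|exact: interval_open].
Qed.

Definition STo i : opens E := Opens (open_spacetime_open (i:=i)).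

Definition space_dir (v : V) : E := (v, 0).
Definition slice (t : R) (x : V) : E := (x, t).
Local Notation time_dir := ((0, 1) : E).

Lemma slice_line t x v (c : R) : slice t (x + c *: v) = slice t x + c *: space_dir v.
Proof. by congr pair; rewrite /= [c *: 0]mulr0 addr0. Qed.

Lemma slice_cont t : continuous (slice t).
Proof. move=> x A [[B C] /= [HB HC] BC]; apply: filterS HB => y By.
by apply: (BC (y, t)); split=> //; exact: nbhs_singleton. Qed.

Lemma slice_chart i t x : oset (STo i) (slice t x) -> chart_img i x.
Proof. by case. Qed.

Lemma slice_Ck k i t (F : E -> R) : 0 < t < s -> Ck k (ST i) F ->
  Ck k (chart_img i) (fun x => F (x, t)).
Proof.
move=> t0s; elim: k F => [|k ih] F /=.
  by move=> cF x ix; apply: (@continuous_comp _ _ _ (slice t) F); [exact: slice_cont|exact: cF].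
move=> [cF dF DF]; have eq v x : (fun e => e^-1 *: (((fun x => F (x, t)) \o shift x) (e *: v) - F (x, t)))
    = (fun e => e^-1 *: ((F \o shift (slice t x)) (e *: space_dir v) - F (slice t x))).
  by apply/funext => e /=; congr (_ *: (F _ - _)); rewrite [RHS]addrC -slice_line /slice addrC.
split=> [x ix|x v ix|v].
- by apply: (@continuous_comp _ _ _ (slice t) F); [exact: slice_cont|exact: cF].
- by rewrite /derivable eq; exact: dF.
- have -> : 'D_v (fun x => F (x, t)) = (fun x => ('D_(space_dir v) F) (x, t)).
    by apply/funext => x; rewrite /derive eq.
  exact: (ih _ (DF (space_dir v))).
Qed.

Lemma static_Ck k i (F : V -> R) : Ck k (chart_img i) F -> Ck k (ST i) (fun z => F z.1).
Proof.
elim: k F => [|k ih] F /=.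
  move=> cF z [iz _]; apply: (@continuous_comp _ _ _ fst F); [exact: cvg_fst|exact: cF].
move=> [cF dF DF]; have eq (v z : E) : (fun e => e^-1 *: (((fun z => F z.1) \o shift z) (e *: v) - F z.1))
    = (fun e => e^-1 *: ((F \o shift z.1) (e *: v.1) - F z.1)) by [].
split=> [z [iz _]|z v [iz _]|v].
- by apply: (@continuous_comp _ _ _ fst F); [exact: cvg_fst|exact: cF].
- by rewrite /derivable eq; exact: dF.
- have -> : 'D_v (fun z : E => F z.1) = (fun z => ('D_(v.1) F) z.1).
    by apply/funext => x; rewrite /derive eq.
  exact: (ih _ (DF v.1)).
Qed.

Lemma time_derive (F : E -> R) x t : derivable F (x, t) time_dir ->
  is_derive t (1 : R) (fun r => F (x, r)) ('D_time_dir F (x, t)).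
Proof.
move=> dF; have := @is_derive_line _ _ F (x, 0) time_dir t _ _.
have E r : (x, 0) + r *: time_dir = (x, r) :> E.
  by congr pair; rewrite /= ?scaler0 ?addr0 //; exact: etrans (add0r _) (mulr1 _).
rewrite E => /(_ _ (derivableP dF)).
by under eq_fun do rewrite E.
Qed.

Record flow_field F : Prop := FlowField {
  flow_Ck : forall i k, Ck k (ST i) (F i) ;
  flow_transition : forall i j x t, overlap i j x -> 0 < t < s ->
    F i (x, t) = F j (transition i j x, t) }.

Lemma flow_slice F t : flow_field F -> 0 < t < s -> scalar_field (fun i x => F i (x, t)).
Proof.
move=> [CF tF] t0s; split=> [i j x o|i x ix]; first exact: tF.
by have := slice_Ck t0s (CF i 0%N); apply.
Qed.

Lemma flow_field_cst (c : R) : flow_field (fun i z => c).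
Proof. by split=> // i k; exact: Ck_cst. Qed.

Lemma flow_fieldD F G : flow_field F -> flow_field G -> flow_field (fun i z => F i z + G i z).
Proof.
move=> [CF tF] [CG tG]; split=> [i k|i j x t o t0s].
  exact: CkD (open_spacetime_open (i:=i)) (CF i k) (CG i k).
by rewrite (tF i j) // (tG i j).
Qed.

Lemma flow_fieldM F G : flow_field F -> flow_field G -> flow_field (fun i z => F i z * G i z).
Proof.
move=> [CF tF] [CG tG]; split=> [i k|i j x t o t0s].
  exact: CkM (open_spacetime_open (i:=i)) (CF i k) (CG i k).
by rewrite (tF i j) // (tG i j).
Qed.

Lemma flow_fieldZ (c : R) F : flow_field F -> flow_field (fun i z => c * F i z).
Proof. by move=> FF; apply: flow_fieldM => //; exact: flow_field_cst. Qed.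

Lemma flow_field_ln F : flow_field F -> (forall i z, ST i z -> 0 < F i z) ->
  flow_field (fun i z => ln (F i z)).
Proof.
move=> [CF tF] F0; split=> [i k|i j x t o t0s].
  exact: Ck_ln (open_spacetime_open (i:=i)) (F0 i) (CF i k).
by rewrite (tF i j).
Qed.

Lemma flow_field_time F : flow_field F -> flow_field (fun i => 'D_time_dir (F i)).
Proof.
move=> [CF tF]; split=> [i k|i j x t o t0s]; first exact: Ck_derive (CF i k.+1).
have dF a (y : V) : chart_img a y -> derivable (F a) (y, t) time_dir.
  by move=> ay; have [_ d _] := CF a 1%N; apply: d.
have [_ <-] := time_derive (dF _ _ (overlap_sub o)).
have [_ <-] := time_derive (dF _ _ (transition_img o)).
apply: (@eq_derive_open _ _ `]0, s[%classic); first exact: interval_open.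
  by move=> r; rewrite inE /= in_itv /= => r0s; exact: tF.
by rewrite /= in_itv.
Qed.
Local Notation gm i := (fun z : E => g z.2 i z.1).

Lemma spacetime_sub i : ST i `<=` spacetime T i.
Proof. by move=> [x t] [/= ix /andP[t0 ts]]; split=> //=; rewrite ltW //= (lt_le_trans ts). Qed.

Lemma flow_riemannian t : 0 < t < s -> riemannian (g t).
Proof.
by move=> /andP[t0 ts]; have [H _ _] := g_flow; apply: H; rewrite ltW //= (lt_le_trans ts).
Qed.

Lemma flow_metric_Ck i k a b : Ck k (ST i) (fun z => gm i z a b).
Proof.
have [_ H _] := g_flow.
exact: (@smooth_Ck _ _ _ _ k _ [::] (open_spacetime_open (i:=i)) (@spacetime_sub i) (H i a b)).
Qed.

Lemma flow_metric_sym i z : oset (STo i) z -> (gm i z)^T = gm i z.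
Proof. by case=> iz t0s; have [_ H _ _] := flow_riemannian t0s; exact: H. Qed.

Lemma flow_metric_pos i z : oset (STo i) z ->
  forall v : V, v != 0 -> 0 < (v *m gm i z *m v^T) ord0 ord0.
Proof. by case=> iz t0s; have [_ _ H _] := flow_riemannian t0s; exact: H. Qed.

Section Ring.
Variable i : 'I_(charts M).
Let A := cfun (STo i).

Definition gA : 'M[A]_n := @mA R n E (STo i) (gm i) (@flow_metric_Ck i).
Definition GA : 'M[A]_n := @MA R n E (STo i) (gm i) (@flow_metric_Ck i) (@flow_metric_pos i).
Definition rhoFA : A := @rhoA R n E (STo i) (gm i) (@flow_metric_Ck i) (@flow_metric_pos i).

Lemma gA_T : gA^T = gA. Proof. exact: (mA_T _ (@flow_metric_sym i)). Qed.
Lemma GgA : GA *m gA = 1%:M. Proof. exact: MmA. Qed.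
Definition dS : 'I_n -> A -> A := dk (D := STo i) space_dir.
Definition dT : A -> A := dd time_dir.
Definition RicA : 'M[A]_n := Ric (half_cst _) dS gA GA.
Definition ScalA : A := Scal (half_cst _) dS gA GA.
Definition LapA (f : A) : A := Lap (half_cst _) dS gA GA f.
Definition HessA (f : A) : 'M[A]_n := Hess (half_cst _) dS gA GA f.

Lemma flow_gAE t x : oset (STo i) (slice t x) -> g t i x = evm gA (slice t x).
Proof. by move=> Dx; rewrite evm_mA. Qed.

Lemma flow_ricciE x t : ST i (x, t) -> ricci (g t) i x = evm RicA (x, t).
Proof.
move=> D; exact: (ricci_ev (slice_line t) (slice_cont (t:=t)) (@slice_chart i t)
  gA_T GgA (@flow_gAE t) D).
Qed.

Lemma flow_scalE x t : ST i (x, t) -> scalar_curvature (g t) i x = ScalA (x, t).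
Proof.
move=> D; exact: (scalar_curvature_ev (slice_line t) (slice_cont (t:=t)) (@slice_chart i t)
  gA_T GgA (@flow_gAE t) D).
Qed.

Section Fun.
Variables (F : E -> R) (f : A).
Hypothesis Ff : forall z, ST i z -> F z = f z.
Variables (x : V) (t : R).
Hypothesis D : ST i (x, t).

Let Fft y : oset (STo i) (slice t y) -> F (y, t) = f (slice t y).
Proof. exact: Ff. Qed.

Lemma flow_lapE : laplacian (g t) i (fun y => F (y, t)) x = LapA f (x, t).
Proof.
exact: (laplacian_ev (slice_line t) (slice_cont (t:=t)) (@slice_chart i t)
  GgA (@flow_gAE t) Fft D).
Qed.

Lemma flow_gradE : sqnorm_gradient (g t) i (fun y => F (y, t)) x = Inner dS GA f f (x, t).
Proof.
exact: (sqnorm_gradient_ev (slice_line t) (slice_cont (t:=t)) (@slice_chart i t)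
  GgA (@flow_gAE t) Fft D).
Qed.

Lemma flow_hessE : hessian (g t) i (fun y => F (y, t)) x = evm (HessA f) (x, t).
Proof.
exact: (hessian_ev (slice_line t) (slice_cont (t:=t)) (@slice_chart i t)
  GgA (@flow_gAE t) Fft D).
Qed.
End Fun.

Lemma flow_sqnE (S : 'M[A]_n) x t : ST i (x, t) ->
  sqnorm_tensor (g t) i x (evm S (x, t)) = sqn GA S (x, t).
Proof.
move=> D; exact: (sqnorm_tensor_ev (sl := slice t) GgA (@flow_gAE t) S D).
Qed.

Lemma dT_derivation : derivation dT. Proof. exact: dd_derivation. Qed.
Lemma dS_derivation k : derivation (dS k). Proof. exact: dd_derivation. Qed.
Lemma dSC k l f : dS k (dS l f) = dS l (dS k f). Proof. exact: ddC. Qed.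
Lemma dTC k f : dT (dS k f) = dS k (dT f). Proof. exact: ddC. Qed.

Lemma ricci_flow_ring : dmx dT gA = - (RicA + RicA).
Proof.
apply/matrixP => a b; rewrite dmx_entry [RHS]mxE [X in - X]mxE; apply: cfunP => -[x t] D.
have [_ _ H] := g_flow; have := H i a b (x, t) (spacetime_sub D).
rewrite pderiv_interior; last first.
  apply: filterS (@spacetime_sub i) _; apply: open_nbhs_nbhs; split=> //.
  exact: open_spacetime_open.
rewrite (flow_ricciE D) [evm _ _ _ _]mxE => e.
rewrite evN evD /dT ddE //; transitivity (- 2 * RicA a b (x, t)); last first.
  by rewrite mulNr mulr_natl mulr2n.
rewrite -e.
apply: (@eq_derive_open _ _ (ST i)) => //; first exact: open_spacetime_open.
by move=> z; rewrite inE => Dz; rewrite mxE mk_cfunE.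
Qed.

Lemma flow_rhoFA : dT rhoFA = - (ScalA * rhoFA).
Proof.
have r2 : rhoFA * rhoFA = \det gA by exact: rhoA_sq.
have rV := @rhoA_inv R n E (STo i) (gm i) (@flow_metric_Ck i) (@flow_metric_pos i).
exact: (flow_volume (half_cst2 _) GgA dT_derivation ricci_flow_ring r2 rV).
Qed.
End Ring.

Definition scal_field : ffam := fun i z => scalar_curvature (g z.2) i z.1.
Definition lap_field F : ffam := fun i z => laplacian (g z.2) i (fun x => F i (x, z.2)) z.1.
Definition grad_field F : ffam :=
  fun i z => sqnorm_gradient (g z.2) i (fun x => F i (x, z.2)) z.1.
(** Density of the volume at time t with respect to that at time [t0]. Unlike the coordinate density
    it is a function on M, and it moves the time dependence of the measure into the integrand. *)
Definition volume_ratio (t0 : R) : ffam :=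
  fun i z => rho (g z.2) i z.1 / rho (g t0) i z.1.

Lemma flow_rhoE i x t : ST i (x, t) -> rho (g t) i x = rhoFA i (x, t).
Proof. by move=> D; rewrite rhoAE. Qed.

Lemma volume_ratio_transition t0 i j x t : 0 < t0 < s -> overlap i j x -> 0 < t < s ->
  volume_ratio t0 i (x, t) = volume_ratio t0 j (transition i j x, t).
Proof.
move=> t0s o ts; rewrite /volume_ratio /= /rho.
rewrite !(@volume_transition _ _ _ _ _ i j x) //; try exact: flow_riemannian.
rewrite invfM mulrACA divff ?mul1r //.
have := jacobian_unit (flow_riemannian ts) o; rewrite unitmxE unitfE => d0.
by rewrite normr_eq0.
Qed.

Lemma flow_field_volume_ratio t0 : 0 < t0 < s -> flow_field (volume_ratio t0).
Proof.
move=> t0s; split=> [i k|i j x t o ts]; last exact: volume_ratio_transition.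
have C1 : Ck k (ST i) (fun z => rho (g z.2) i z.1).
  apply: eq_Ck (cfun_Ck (rhoFA i) k) => [|z].
    exact: open_spacetime_open.
  by rewrite inE => Dz; rewrite rhoAE.
apply: (CkM (open_spacetime_open (i:=i)) C1).
apply: Ck_inv => [|z [iz _]|]; first exact: open_spacetime_open.
  by rewrite gt_eqF //; exact: (rho_gt0 (flow_riemannian t0s)).
exact: static_Ck (rho_Ck (flow_riemannian t0s) k i).
Qed.

Lemma time_derivable F i x t : flow_field F -> chart_img i x -> 0 < t < s ->
  derivable (F i) (x, t) time_dir.
Proof. by move=> [CF _] ix ts; have [_ d _] := CF i 1%N; apply: d. Qed.

Lemma derive_volume_ratio i x t : chart_img i x -> 0 < t < s ->
  'D_time_dir (volume_ratio t i) (x, t) = - scal_field i (x, t).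
Proof.
move=> ix ts; have D : ST i (x, t) by [].
have r0 := rho_gt0 (flow_riemannian ts) ix.
pose rA := rhoFA i.
have dr : dT rA = - (ScalA i * rA).
  exact: flow_rhoFA.
have [_ <-] := time_derive (time_derivable (flow_field_volume_ratio ts) ix ts).
have -> : (fun r => volume_ratio t i (x, r)) = (rho (g t) i x)^-1 *: (fun r => rho (g r) i x).
  by apply/funext => r; rewrite /volume_ratio /= mulrC.
have H : is_derive t (1 : R) (fun r => rho (g r) i x) (- scal_field i (x, t) * rho (g t) i x).
  have dA := time_derive (@cfun_derivable _ _ (STo i) rA (x, t) time_dir D).
  have <- : 'D_time_dir rA (x, t) = - scal_field i (x, t) * rho (g t) i x.
    rewrite -ddE // -/(dT rA) dr evN evM -flow_rhoE // /scal_field /= flow_scalE //.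
    by rewrite mulNr.
  apply: (@near_eq_is_derive _ _ _ (fun r => rA (x, r))) => //.
  have : t \in `]0, s[%R by rewrite in_itv.
  move=> /near_in_itvoo; apply: filterS => r; rewrite in_itv /= => rs.
  by rewrite flow_rhoE.
have [_ ->] := is_deriveZ (rho (g t) i x)^-1 H.
by rewrite /GRing.scale /= mulrCA mulVf ?mulr1 // gt_eqF.
Qed.

(** The measure is frozen at time t by means of [volume_ratio], whose derivative there is minus the
    scalar curvature. By the mean value theorem the difference quotients of the integrand converge
    locally uniformly, which permits differentiation under the integral. *)
Lemma is_derive_vol F t : flow_field F -> 0 < t < s ->
  is_derive t (1 : R) (fun r => vol (g r) (fun i x => F i (x, r)))
    (vol (g t) (fun i x => 'D_time_dir (F i) (x, t) - scal_field i (x, t) * F i (x, t))).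
Proof.
move=> FF ts; have hR := flow_riemannian ts; have FR := flow_field_volume_ratio ts.
pose K : ffam := fun i z => F i z * volume_ratio t i z.
have FK : flow_field K := flow_fieldM FF FR.
pose DK : ffam := fun i => 'D_time_dir (K i).
have FDK : flow_field DK := flow_field_time FK.
have VK r : 0 < r < s -> vol (g r) (fun i x => F i (x, r)) = vol (g t) (fun i x => K i (x, r)).
  move=> rs; apply: vol_change_metric => i x ix; rewrite /K /volume_ratio /= -mulrA divfK //.
  by rewrite gt_eqF // rho_gt0.
have ratio1 i x : chart_img i x -> volume_ratio t i (x, t) = 1.
  by move=> ix; rewrite /volume_ratio /= divff // gt_eqF // rho_gt0.
have -> : vol (g t) (fun i x => 'D_time_dir (F i) (x, t) - scal_field i (x, t) * F i (x, t))
        = vol (g t) (fun i x => DK i (x, t)).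
  apply: eq_vol => i x ix; rewrite /DK /K.
  have dF := time_derivable FF ix ts; have dR := time_derivable FR ix ts.
  rewrite (@deriveM _ _ (F i) (volume_ratio t i)) // derive_volume_ratio // ratio1 //.
  by rewrite /GRing.scale /= mul1r; ring.
have nt : \forall r \near t, 0 < r < s.
  have : t \in `]0, s[%R by rewrite in_itv.
  by move=> /near_in_itvoo; apply: filterS => r; rewrite in_itv.
apply: (@near_eq_is_derive _ _ _ (fun r => vol (g t) (fun i x => K i (x, r)))).
  by apply: filterS nt => r /VK.
have nt0 : \forall e \near (0 : R)^', 0 < t + e < s.
  apply: nbhs_dnbhs.
  have ct : (t + e) @[e --> (0 : R)] --> t.
    by rewrite -[X in _ --> X]addr0; apply: cvgD; [exact: cvg_cst|exact: cvg_id].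
  exact: ct nt.
have cv : (e^-1 * (vol (g t) (fun i x => K i (x, t + e)) - vol (g t) (fun i x => K i (x, t))))
    @[e --> (0 : R)^'] --> vol (g t) (fun i x => DK i (x, t)).
  have E0 : \forall e \near (0 : R)^',
      vol (g t) (fun i x => e^-1 * (K i (x, t + e) - K i (x, t)))
      = e^-1 * (vol (g t) (fun i x => K i (x, t + e)) - vol (g t) (fun i x => K i (x, t))).
    apply: filterS nt0 => e te.
    have I1 := scalar_field_integrable hR (flow_slice FK te).
    have I2 := scalar_field_integrable hR (flow_slice FK ts).
    rewrite -[X in _ - X]mul1r -mulNr -(vol_scale I2) -vol_add //; last exact: integrable_fieldZ.
    rewrite -vol_scale; last by apply: integrable_fieldD => //; exact: integrable_fieldZ.
    by apply: eq_vol => i x _; rewrite mulN1r.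
  apply: (cvg_trans (near_eq_cvg E0)).
  apply: vol_cvg => //.
  - apply: filterS nt0 => e te.
    have := scalar_fieldM (@scalar_field_cst _ _ M e^-1)
      (scalar_fieldD (flow_slice FK te) (scalar_fieldM (@scalar_field_cst _ _ M (-1)) (flow_slice FK ts))).
    by apply: eq_scalar_field => i x; rewrite mulN1r.
  - exact: flow_slice.
  - move=> i x ix d d0.
    have cDK : {for (x, t), continuous (DK i)}.
      by have := flow_Ck FDK i 0%N; apply; split.
    have d2 : 0 < d / 2 by rewrite divr_gt0.
    have [r r0 Hr] := continuous_ball cDK d2.
    have [r' r'0 Hr'] : exists2 r' : R, 0 < r' & forall y q, ball x r' y -> ball t r' q -> ST i (y, q).
      have /nbhs_ballP[r' r'0 H'] : nbhs ((x, t) : E) (ST i).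
        by apply: open_nbhs_nbhs; split=> //; exact: open_spacetime_open.
      by exists r' => // y q xy tq; apply: H'.
    have r1 : 0 < Num.min r r' by rewrite lt_min r0.
    exists (ball x (Num.min r r'), [set e : R | e != 0 /\ `|e| < Num.min r r']) => /=.
      split; first exact: nbhsx_ballx.
      have : \forall e \near (0 : R), ball (0 : R) (Num.min r r') e by exact: nbhsx_ballx.
      rewrite /dnbhs /within /=; apply: filterS => e H e0; split=> //.
      by move: H; rewrite -ball_normE /= sub0r normrN.
    move=> [y e] /= [xy [e0 er]].
    have bt (th : R) : 0 <= th <= 1 -> ball t (Num.min r r') (t + th * e).
      move=> /andP[th0 th1]; rewrite -ball_normE /= opprD addrA subrr sub0r normrN normrM ger0_norm //.
      by apply: le_lt_trans er; rewrite ler_piMl.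
    have le_r : Num.min r r' <= r by rewrite ge_min lexx.
    have le_r' : Num.min r r' <= r' by rewrite ge_min lexx orbT.
    have zE (c : R) : ((y, t) : E) + c *: time_dir = (y, t + c).
      by congr pair; rewrite /= ?scaler0 ?addr0 //; congr (_ + _); exact: mulr1.
    have STy th : 0 <= th <= 1 -> ST i (y, t + th * e).
      by move=> h01; apply: Hr'; [exact: le_ball le_r' _ xy|exact: le_ball le_r' _ (bt _ h01)].
    have dK th : 0 <= th <= 1 -> derivable (K i) ((y, t) + (th * e) *: time_dir) time_dir.
      by move=> h01; rewrite zE; have [iy ty] := STy _ h01; exact: time_derivable.
    have [th h01 Emv] := MVT_line dK.
    have B c : 0 <= c <= 1 -> `|DK i (y, t + c * e) - DK i (x, t)| < d / 2.
      by move=> c01; apply: Hr; split; [exact: le_ball le_r _ xy|exact: le_ball le_r _ (bt _ c01)].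
    have B0 : `|DK i (y, t) - DK i (x, t)| < d / 2.
      by have := B 0; rewrite mul0r addr0 lexx ler01; apply.
    have B1 := B th h01.
    move: Emv; rewrite !zE -/(DK i) => ->; rewrite mulKf //.
    have := ler_normB (DK i (y, t + th * e) - DK i (x, t)) (DK i (y, t) - DK i (x, t)).
    rewrite opprB addrA subrK => /le_lt_trans; apply.
    by move: B0 B1; lra.
have eqf (f : R -> R) : (fun e : R => e^-1 *: ((f \o shift t) (e *: (1 : R)) - f t))
    = (fun e => e^-1 * (f (t + e) - f t)).
  by apply/funext => e; rewrite /= [e%:A]mulr1 [e + t]addrC.
split.
  by rewrite /derivable eqf; apply/cvg_ex; exists (vol (g t) (fun i x => DK i (x, t))); exact: cv.
by rewrite /derive eqf; exact: cvg_lim cv.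
Qed.

(** Chart independence is read off from the flow: the scalar curvature is minus the time derivative
    of the volume ratio, a function on M. The curvature tensor itself is never transformed. *)
Lemma flow_field_scal : flow_field scal_field.
Proof.
split=> [i k|i j x t o ts].
  apply: eq_Ck (cfun_Ck (ScalA i) k) => [|[x t]]; first exact: open_spacetime_open.
  by rewrite inE => Dz; rewrite /scal_field flow_scalE.
have E1 := derive_volume_ratio (overlap_sub o) ts.
have E2 := derive_volume_ratio (transition_img o) ts.
have FV := flow_field_time (flow_field_volume_ratio ts).
apply/oppr_inj; apply: etrans (esym E1) (etrans _ E2).
exact: (@flow_transition (fun i => 'D_time_dir (volume_ratio t i)) FV).
Qed.

Section FieldOps.
Variable F : ffam.
Hypothesis FF : flow_field F.

Definition ring_of i : cfun (STo i) := @mk_cfun R E (STo i) (F i) (fun k => flow_Ck FF i k).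

Lemma ring_ofE i z : ST i z -> F i z = ring_of i z.
Proof. by move=> D; rewrite mk_cfunE. Qed.

Lemma lap_fieldE i z : ST i z -> lap_field F i z = LapA (ring_of i) z.
Proof. by case: z => x t D; exact: (flow_lapE (@ring_ofE i)). Qed.

Lemma grad_fieldE i z : ST i z ->
  grad_field F i z = Inner (@dS i) (GA i) (ring_of i) (ring_of i) z.
Proof. by case: z => x t D; exact: (flow_gradE (@ring_ofE i)). Qed.

Lemma flow_field_lap : flow_field (lap_field F).
Proof.
split=> [i k|i j x t o ts].
  apply: eq_Ck (cfun_Ck (LapA (ring_of i)) k) => [|z]; first exact: open_spacetime_open.
  by rewrite inE => Dz; rewrite lap_fieldE.
apply: laplacian_transition => //; first exact: flow_riemannian.
  by move=> k; exact: slice_Ck ts (flow_Ck FF j k).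
by move=> y oy; exact: (@flow_transition F FF).
Qed.

Lemma flow_field_grad : flow_field (grad_field F).
Proof.
split=> [i k|i j x t o ts].
  apply: eq_Ck (cfun_Ck (Inner (@dS i) (GA i) (ring_of i) (ring_of i)) k) => [|z].
    exact: open_spacetime_open.
  by rewrite inE => Dz; rewrite grad_fieldE.
rewrite /grad_field /= !sqnorm_gradientE; apply: inner_transition => //.
- exact: flow_riemannian.
- exact: slice_Ck ts (flow_Ck FF j 1%N).
- by move=> y oy; exact: (@flow_transition F FF).
- exact: slice_Ck ts (flow_Ck FF j 1%N).
- by move=> y oy; exact: (@flow_transition F FF).
Qed.

Lemma vol_lap_field t : 0 < t < s -> vol (g t) (fun i x => lap_field F i (x, t)) = 0.
Proof.
move=> ts; have FS := flow_slice FF ts; have [f Ff] := glue (field_transition FS).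
rewrite -(@vol_laplacian _ _ _ _ (flow_riemannian ts) f).
  apply: eq_vol => i x ix; apply: (eq_laplacian _ ix) => y iy.
  by rewrite Ff.
move=> i k; apply: eq_Ck (slice_Ck ts (flow_Ck FF i k)) => [|x]; first exact: chart_img_open.
by rewrite inE => ix; rewrite Ff.
Qed.
End FieldOps.
End FlowFields.

(** * Entropy along the conjugate heat equation *)

Lemma is_derive_le (R : realType) (f f' : R -> R) (a b : R) :
  (forall t, a < t < b -> is_derive t (1 : R) f (f' t)) ->
  (forall t, a < t < b -> 0 <= f' t) ->
  forall x y, a < x -> x <= y -> y < b -> f x <= f y.
Proof.
move=> df f0 x y ax xy yb.
have I t : x <= t <= y -> a < t < b.
  by move=> /andP[xt ty]; rewrite (lt_le_trans ax) // (le_lt_trans ty).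
have [t] : exists2 t : R, t \in `[x, y]%R & f y - f x = f' t * (y - x).
  apply: (@MVT_segment _ f f') => // [t|].
    by rewrite in_itv /= => /andP[/ltW xt /ltW ty]; apply/df/I; rewrite xt.
  apply: continuous_in_subspaceT => t; rewrite inE /= in_itv /= => /I /df [dt _].
  by apply: differentiable_continuous; apply/derivable1_diffP.
rewrite in_itv /= => /I /f0 f't E; rewrite -subr_ge0 E mulr_ge0 // subr_ge0 //.
Qed.

Lemma evmB (R : realType) (E : normedModType R) (D : opens E) m n (X Y : 'M[cfun D]_(m, n)) z :
  evm (X - Y) z = evm X z - evm Y z.
Proof. by apply/matrixP => a b; rewrite !mxE evD evN. Qed.

Lemma evmT (R : realType) (E : normedModType R) (D : opens E) m n (X : 'M[cfun D]_(m, n)) z :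
  evm X^T z = (evm X z)^T.
Proof. by apply/matrixP => a b; rewrite !mxE. Qed.

Section Entropy.
Variables (R : realType) (n : nat) (M : closedManifold R n) (T : R) (g : R -> metric M).
Hypothesis g_flow : ricci_flow T g.
Variable s : R.
Hypothesis sT : s <= T.
Local Notation V := 'rV[R]_n.
Local Notation E := ('rV[R]_n * R)%type.
Local Notation ffam := ('I_(charts M) -> V * R -> R).
Local Notation ST := (@open_spacetime R n M s).
Local Notation time_dir := ((0, 1) : E).
Local Notation field := (@flow_field R n M s).
Local Notation scal := (scal_field g).
Local Notation lap := (lap_field g).
Local Notation grad2 := (grad_field g).
Implicit Types (i j : 'I_(charts M)) (x : V) (F G : ffam) (t : R).

Lemma eq_flow_field F G : (forall i z, ST i z -> F i z = G i z) -> field F -> field G.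
Proof.
move=> FG FF; split=> [i k|i j x t o ts].
  apply: eq_Ck (flow_Ck FF i k) => [|z]; first exact: open_spacetime_open.
  by rewrite inE => /FG.
rewrite -!FG; first exact: (@flow_transition _ _ _ _ F FF).
  by split=> //; exact: transition_img.
by split=> //; exact: overlap_sub o.
Qed.

Variable u : ffam.
Hypothesis FU : field u.
Hypothesis u_gt0 : forall i z, ST i z -> 0 < u i z.
Hypothesis u_heat : forall i z, ST i z ->
  'D_time_dir (u i) z = - lap u i z + scal i z * u i z.

Definition log_field : ffam := fun i z => ln (u i z).
Local Notation L := log_field.

Lemma FL : field L. Proof. exact: flow_field_ln. Qed.

(** Perelman's integrand R + 2 Lap f - |df|^2 for f = -L, times u. It differs from
    [gradient_energy_field] by twice the Laplacian of u and so has the same integral, but its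
    evolution has a square as source. *)
Definition density_field : ffam := fun i z => (scal i z - 2 * lap L i z - grad2 L i z) * u i z.

Lemma flow_field_density : field density_field.
Proof.
have F1 := flow_field_scal g_flow sT; have F2 := flow_field_lap g_flow sT FL.
have F3 := flow_field_grad g_flow sT FL.
apply: flow_fieldM FU; apply: eq_flow_field (flow_fieldD (flow_fieldD F1 (flow_fieldZ (-2) F2)) (flow_fieldZ (-1) F3)).
by move=> i z _; ring.
Qed.

Definition gradient_energy_field : ffam := fun i z => (scal i z + grad2 L i z) * u i z.

Lemma flow_field_energy : field gradient_energy_field.
Proof.
exact: flow_fieldM (flow_fieldD (flow_field_scal g_flow sT) (flow_field_grad g_flow sT FL)) FU.
Qed.

(** For a potential f equal to -L up to a constant this is |Rc + Hess f|^2; the shift by a multiple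
    of the metric is made in [defect_field]. *)
Definition traceless_field : ffam := fun i z =>
  sqnorm_tensor (g z.2) i z.1 (ricci (g z.2) i z.1 - hessian (g z.2) i (fun x => L i (x, z.2)) z.1).

Section Pointwise.
Variable i : 'I_(charts M).
Local Notation D := (STo s i).
Local Notation hf := (half_cst D).
Local Notation gO := (gA g_flow sT i).
Local Notation GO := (GA g_flow sT i).
Local Notation dO := (@dS R n M s i).
Local Notation tO := (@dT R n M s i).
Let uA : cfun D := ring_of FU i.
Let lA : cfun D := ring_of FL i.

Lemma ring_dS v : dd v uA = uA * dd v lA.
Proof.
apply: cfunP => z Dz; rewrite evM !ddE // mk_cfunE //.
have uz := u_gt0 Dz.
have H : is_derive z v uA ('D_v uA z).
  by rewrite -ddE //; exact: is_derive_cfun.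
have lz : is_derive (uA z) 1 (@ln R) (uA z)^-1.
  by apply: is_derive1_ln; rewrite mk_cfunE.
have [_ E] := is_derive_scalar_comp H lz.
have -> : 'D_v lA z = 'D_v (@ln R \o uA) z.
  apply: (@eq_derive_open _ _ (ST i)) => //; first exact: open_spacetime_open.
  by move=> y; rewrite inE => Dy; rewrite /comp [lA y]mk_cfunE // [uA y]mk_cfunE.
by rewrite E mk_cfunE // mulrA divff ?mul1r // gt_eqF.
Qed.

Lemma ring_dk k : dO k uA = uA * dO k lA. Proof. exact: ring_dS. Qed.

Lemma ring_dT : tO uA = uA * tO lA. Proof. exact: ring_dS. Qed.

Lemma ring_u_unit z : ST i z -> uA z != 0.
Proof. by move=> Dz; rewrite mk_cfunE // gt_eqF // u_gt0. Qed.

Lemma ring_u_cancel (a b : cfun D) : uA * a = uA * b -> a = b.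
Proof.
move=> e; apply: cfunP => z Dz; apply: (mulfI (ring_u_unit Dz)).
by rewrite -!evM e.
Qed.

Lemma ring_lap_u : LapA g_flow sT uA = uA * (LapA g_flow sT lA + Inner dO GO lA lA).
Proof. exact: (Lap_exp (half_cst D) gO GO (@dS_derivation R n M s i) ring_dk). Qed.

Lemma ring_heat : tO uA = - LapA g_flow sT uA + ScalA g_flow sT i * uA.
Proof.
apply: cfunP => -[x t] Dz; rewrite evD evN evM /tO ddE // -(lap_fieldE g_flow sT FU) //.
rewrite -(flow_scalE g_flow sT) // mk_cfunE // -[scalar_curvature _ _ _]/(scal i (x, t)) -u_heat //.
apply: (@eq_derive_open _ _ (ST i)) => //; first exact: open_spacetime_open.
by move=> y; rewrite inE => Dy; rewrite mk_cfunE.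
Qed.

Lemma ring_heat_log : tO lA = - LapA g_flow sT lA - Inner dO GO lA lA + ScalA g_flow sT i.
Proof.
apply: ring_u_cancel; rewrite -ring_dT ring_heat ring_lap_u; ring.
Qed.

Lemma inner_u f : Inner dO GO uA f = uA * Inner dO GO lA f.
Proof.
rewrite /Inner mulr_sumr; apply: eq_bigr => k _; rewrite mulr_sumr.
by apply: eq_bigr => l _; rewrite ring_dk; ring.
Qed.

Lemma lap_u z : ST i z -> lap u i z = u i z * (lap L i z + grad2 L i z).
Proof.
move=> Dz; rewrite (lap_fieldE g_flow sT FU) // ring_lap_u evM evD.
by rewrite -(lap_fieldE g_flow sT FL) // -(grad_fieldE g_flow sT FL) // mk_cfunE.
Qed.

Lemma lap_ulogu z : ST i z -> lap (fun i z => u i z * L i z) i z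
  = L i z * lap u i z + lap u i z + u i z * grad2 L i z.
Proof.
move=> Dz; rewrite (lap_fieldE g_flow sT (flow_fieldM FU FL)) //.
have -> : ring_of (flow_fieldM FU FL) i = uA * lA.
  by apply: cfunP => y Dy; rewrite evM !mk_cfunE.
have E : LapA g_flow sT (uA * lA) = lA * LapA g_flow sT uA + LapA g_flow sT uA + uA * Inner dO GO lA lA.
  rewrite [LHS](LapM (half_cst D) (@dS_derivation R n M s i) (gA_T g_flow sT i) (GgA g_flow sT i)).
  rewrite -/(LapA _ _ _) -/(LapA _ _ _) inner_u ring_lap_u; ring.
rewrite E !evD !evM -(lap_fieldE g_flow sT FU) // -(grad_fieldE g_flow sT FL) //.
by rewrite !mk_cfunE.
Qed.

Let SA := RicA g_flow sT i - HessA g_flow sT lA.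

Lemma ricci_sub_hessian x t : ST i (x, t) ->
  ricci (g t) i x - hessian (g t) i (fun y => L i (y, t)) x = evm SA (x, t).
Proof.
move=> D'; rewrite (flow_ricciE g_flow sT D') (flow_hessE g_flow sT (@ring_ofE _ _ _ _ _ FL i) D').
by rewrite evmB.
Qed.

Lemma ricci_sub_hessian_sym : SA^T = SA.
Proof.
have RT := RicT (half_cst2 D) (@dS_derivation R n M s i) (@dSC R n M s i) (gA_T g_flow sT i) (GgA g_flow sT i).
have HT := HessT (half_cst D) GO (@dSC R n M s i) (gA_T g_flow sT i) lA.
by rewrite /SA mx_trD mx_trN; congr (_ - _).
Qed.

Lemma ricci_sub_hessianT x t : ST i (x, t) ->
  (ricci (g t) i x - hessian (g t) i (fun y => L i (y, t)) x)^T
  = ricci (g t) i x - hessian (g t) i (fun y => L i (y, t)) x.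
Proof. by move=> Dz; rewrite ricci_sub_hessian // -evmT ricci_sub_hessian_sym. Qed.

Lemma density_evolution z : ST i z ->
  'D_time_dir (density_field i) z + lap density_field i z - scal i z * density_field i z
  = 2 * (u i z * traceless_field i z).
Proof.
move=> Dz; have FD := flow_field_density.
pose wA := (ScalA g_flow sT i - LapA g_flow sT lA *+ 2 - Inner dO GO lA lA) * uA.
have Ew y : ST i y -> density_field i y = wA y.
  case: y => x t Dy; rewrite evM !evD !evN evMn /density_field.
  rewrite -(flow_scalE g_flow sT) // -(lap_fieldE g_flow sT FL) // -(grad_fieldE g_flow sT FL) //.
  by rewrite mk_cfunE // mulr_natl.
have -> : lap density_field i z = LapA g_flow sT wA z.
  rewrite (lap_fieldE g_flow sT FD) //.
  have -> // : ring_of FD i = wA by apply: cfunP => y Dy; rewrite mk_cfunE // Ew.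
have -> : 'D_time_dir (density_field i) z = tO wA z.
  rewrite /tO ddE //; apply: (@eq_derive_open _ _ (ST i)) => //; first exact: open_spacetime_open.
  by move=> y; rewrite inE => /Ew.
have -> : traceless_field i z = sqn GO SA z.
  case: z Dz => x t Dz; rewrite /traceless_field /= ricci_sub_hessian //.
  exact: flow_sqnE.
have H := conjugate_heat_entropy_density (half_cst2 D) (@dS_derivation R n M s i) (@dSC R n M s i)
  (gA_T g_flow sT i) (GgA g_flow sT i) (@dT_derivation R n M s i) (@dTC R n M s i) (ricci_flow_ring g_flow sT i)
  ring_dk ring_dT ring_heat_log.
have := congr1 (fun a : cfun D => a z) H; rewrite /= -/wA -/(LapA g_flow sT wA) evMn evM.
rewrite evD evN evM evD => H'; rewrite Ew // mulr_natl -(ring_ofE FU) // in H' *.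
case: z Dz Ew H' => x t Dz _; rewrite -(flow_scalE g_flow sT) // => <-.
Qed.
End Pointwise.

(** Regularity and chart independence are inherited from the left-hand side of [density_evolution],
    all of whose terms are known to be fields. *)
Lemma flow_field_traceless : field (fun i z => u i z * traceless_field i z).
Proof.
have FD := flow_field_density; have F1 := flow_field_time FD.
have F2 := flow_field_lap g_flow sT FD; have F3 := flow_fieldM (flow_field_scal g_flow sT) FD.
apply: eq_flow_field (flow_fieldZ 2^-1 (flow_fieldD (flow_fieldD F1 F2) (flow_fieldZ (-1) F3))).
move=> i z Dz; by rewrite mulN1r density_evolution // mulrA mulVf ?mul1r // pnatr_eq0.
Qed.

Definition V_ F t := vol (g t) (fun i x => F i (x, t)).
Definition energy t := V_ gradient_energy_field t.
Definition nash t := V_ (fun i z => u i z * L i z) t.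
Definition traceless t := V_ (fun i z => u i z * traceless_field i z) t.

Lemma V_linear F G (c t : R) : field F -> field G -> 0 < t < s ->
  V_ (fun i z => F i z + c * G i z) t = V_ F t + c * V_ G t.
Proof.
move=> FF FG ts; have hR := flow_riemannian g_flow sT ts.
have IF := scalar_field_integrable hR (flow_slice FF ts).
have IG := scalar_field_integrable hR (flow_slice FG ts).
by rewrite /V_ -(vol_scale IG) -(vol_add IF (integrable_fieldZ IG c)).
Qed.

Lemma eq_V F G t : 0 < t < s -> (forall i z, ST i z -> F i z = G i z) -> V_ F t = V_ G t.
Proof. by move=> ts FG; apply: eq_vol => i x ix; apply: FG. Qed.

Lemma V_lap F t : field F -> 0 < t < s -> V_ (lap F) t = 0.
Proof. by move=> FF ts; exact: (vol_lap_field g_flow sT FF ts). Qed.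

Lemma V_derive F t : field F -> 0 < t < s ->
  is_derive t (1 : R) (V_ F) (V_ (fun i z => 'D_time_dir (F i) z - scal i z * F i z) t).
Proof. by move=> FF ts; exact: (is_derive_vol g_flow sT FF ts). Qed.

(** The integrand of the derivative is the energy density minus the Laplacian of u L, and the latter
    integrates to zero. *)
Lemma nash_derive t : 0 < t < s -> is_derive t (1 : R) nash (energy t).
Proof.
move=> ts; have FG := flow_fieldM FU FL.
suff <- : V_ (fun i z => 'D_time_dir (fun z => u i z * L i z) z - scal i z * (u i z * L i z)) t = energy t.
  exact: (V_derive FG).
apply: (@etrans _ _ (energy t + (-1) * V_ (lap (fun i z => u i z * L i z)) t)); last first.
  by rewrite (V_lap FG) // mulr0 addr0.
apply: etrans (V_linear (-1) flow_field_energy (flow_field_lap g_flow sT FG) ts).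
apply: eq_V => // i [x r] [ix rs]; have D : ST i (x, r) by [].
rewrite lap_ulogu // (@deriveM _ _ (u i) (L i)); last 2 first.
- exact: (time_derivable FU ix rs).
- exact: (time_derivable FL ix rs).
have -> : 'D_time_dir (L i) (x, r) = 'D_time_dir (u i) (x, r) / u i (x, r).
  have H : is_derive (x, r) time_dir (u i) ('D_time_dir (u i) (x, r)).
    by apply/derivableP; exact: (time_derivable FU ix rs).
  have [_ ->] := is_derive_scalar_comp H (is_derive1_ln (u_gt0 D)).
  by rewrite mulrC.
rewrite /GRing.scale /= u_heat // /gradient_energy_field.
by field; rewrite gt_eqF // u_gt0.
Qed.

Lemma energy_density t : 0 < t < s -> V_ density_field t = energy t.
Proof.
move=> ts; apply: (@etrans _ _ (energy t + (- 2) * V_ (lap u) t)); last first.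
  by rewrite (V_lap FU) // mulr0 addr0.
apply: etrans (V_linear (- 2) flow_field_energy (flow_field_lap g_flow sT FU) ts).
apply: eq_V => // i z D; rewrite /density_field /gradient_energy_field lap_u //; ring.
Qed.

Lemma energy_derive t : 0 < t < s -> is_derive t (1 : R) energy (2 * traceless t).
Proof.
move=> ts; have FD := flow_field_density; have FS := flow_field_traceless.
have FLd := flow_field_lap g_flow sT FD.
suff <- : V_ (fun i z => 'D_time_dir (density_field i) z - scal i z * density_field i z) t = 2 * traceless t.
  apply: (@near_eq_is_derive _ _ _ (V_ density_field)); last exact: (V_derive FD).
  have : t \in `]0, s[%R by rewrite in_itv.
  move=> /near_in_itvoo; apply: filterS => r; rewrite in_itv /= => rs.
  exact: energy_density.
apply: (@etrans _ _ (-1 * V_ (lap density_field) t + 2 * traceless t)); last first.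
  by rewrite (V_lap FD) // mulr0 add0r.
(* [V_linear] is used with the zero field as first summand; the integral of that field is itself
   found to be 0 by linearity. *)
have <- : V_ (fun i z => -1 * lap density_field i z) t = -1 * V_ (lap density_field) t.
  have := V_linear (-1) (@flow_field_cst _ _ M s 0) FLd ts.
  have := V_linear (-1) (@flow_field_cst _ _ M s 0) (@flow_field_cst _ _ M s 0) ts.
  have -> : V_ (fun i z => 0 + -1 * 0) t = V_ (fun i z => 0) t by apply: eq_V => // i z _; rewrite mulr0 addr0.
  move: (V_ (fun i z => 0) t) => v0 E0 E1; have {E0} v00 : v0 = 0 by lra.
  by rewrite v00 add0r in E1; rewrite -E1; apply: eq_V => // i z _; rewrite add0r.
apply: etrans (V_linear 2 (flow_fieldZ (-1) FLd) FS ts).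
by apply: eq_V => // i z D; rewrite -density_evolution //; ring.
Qed.

Hypothesis u_mass : forall t, 0 < t < s -> V_ u t = 1.

(** Expansion of u |Rc - Hess L - c g|^2. The cross term contains u Lap L, which is rewritten as Lap
    u - u |dL|^2, so that its integral is expressed by the energy. *)
Definition defect_field (c : R) : ffam := fun i z => u i z * traceless_field i z
  + (- (2 * c)) * (gradient_energy_field i z + (-1) * lap u i z) + (c ^+ 2 * n%:R) * u i z.

Lemma flow_field_defect c : field (defect_field c).
Proof.
have FE := flow_field_energy; have FS := flow_field_traceless; have FLu := flow_field_lap g_flow sT FU.
have F1 := flow_fieldD FE (flow_fieldZ (-1) FLu).
exact: flow_fieldD (flow_fieldD FS (flow_fieldZ (- (2 * c)) F1)) (flow_fieldZ (c ^+ 2 * n%:R) FU).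
Qed.

Lemma defect_fieldE c i x t : ST i (x, t) ->
  u i (x, t) * sqnorm_tensor (g t) i x
     (ricci (g t) i x - hessian (g t) i (fun y => L i (y, t)) x - c *: g t i x)
  = defect_field c i (x, t).
Proof.
move=> D; have [ix ts] := D; have hR := flow_riemannian g_flow sT ts.
rewrite (sqnorm_tensorB hR ix c (ricci_sub_hessianT D)) /defect_field.
rewrite -[sqnorm_tensor _ _ _ _]/(traceless_field i (x, t)) lap_u // /gradient_energy_field.
rewrite mulmxBr raddfB /= -[\tr (_ *m ricci _ _ _)]/(scal i (x, t)) -[\tr (_ *m hessian _ _ _ _)]/(lap L i (x, t)).
ring.
Qed.

Lemma vol_defect (c t : R) : 0 < t < s ->
  V_ (defect_field c) t = traceless t - 2 * c * energy t + c ^+ 2 * n%:R.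
Proof.
move=> ts; have hR := flow_riemannian g_flow sT ts.
have FE := flow_field_energy; have FS := flow_field_traceless; have FLu := flow_field_lap g_flow sT FU.
have F1 := flow_fieldD FE (flow_fieldZ (-1) FLu).
have F2 := flow_fieldD FS (flow_fieldZ (- (2 * c)) F1).
apply: etrans (V_linear (c ^+ 2 * n%:R) F2 FU ts) _.
have -> := V_linear (- (2 * c)) FS F1 ts; have -> := V_linear (-1) FE FLu ts.
rewrite (V_lap FU) // u_mass // -[V_ gradient_energy_field t]/(energy t) /traceless; ring.
Qed.

(** Holding for every c, this carries the content of Cauchy-Schwarz without a division by n or by
    the energy. *)
Lemma vol_defect_ge0 (c t : R) : 0 < t < s -> 0 <= traceless t - 2 * c * energy t + c ^+ 2 * n%:R.
Proof.
move=> ts; rewrite -vol_defect //; have hR := flow_riemannian g_flow sT ts.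
have IF := scalar_field_integrable hR (flow_slice (flow_field_defect c) ts).
have I0 := integrable_fieldZ (integrable_field1 hR) 0.
have <- : vol (g t) (fun i x => 0 * 1) = 0 by rewrite (vol_scale (integrable_field1 hR)) mul0r.
apply: (vol_le hR I0 IF) => i x ix.
have D : ST i (x, t) by []. 
rewrite mul0r -(defect_fieldE c D); apply: mulr_ge0; first by rewrite ltW // u_gt0.
apply: sqnorm_tensor_ge0 => //.
rewrite raddfB /= (ricci_sub_hessianT D) linearZ /=.
by have [_ H _ _] := hR; rewrite H.
Qed.

(** Comparison with the solution n / (2 (r - q)) of y' = (2/n) y^2: [Q] is (r - q)^2 times the
    difference to it, is nondecreasing, and vanishes at q = r. In this form n may be 0. *)
Lemma energy_le_lt (t r : R) : 0 < t -> t < r -> r < s -> (r - t) * energy t <= n%:R / 2.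
Proof.
move=> t0 tr rs; pose Q q := (r - q) ^+ 2 * energy q - n%:R / 2 * (r - q).
pose Q' q := 2 * ((r - q) ^+ 2 * traceless q - (r - q) * energy q + n%:R / 4).
have dQ q : 0 < q < s -> is_derive q (1 : R) Q (Q' q).
  move=> qs; have dE := energy_derive qs.
  have -> : Q = (cst r - @id R) ^+ 2 * energy - (n%:R / 2) *: (cst r - @id R) by [].
  apply: is_derive_eq; rewrite /GRing.scale /= /Q'.
  have -> : ((cst r - @id R) ^+ 2) q = (r - q) ^+ 2 by [].
  have -> : (cst r - @id R) q = r - q by []. by field.
have Q'0 q : 0 < q < s -> 0 <= Q' q.
  move=> qs; have [->|rq] := eqVneq q r.
    by rewrite /Q' subrr expr0n /= !mul0r subr0 add0r mulr_ge0 // divr_ge0.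
  (* For this c the inequality times (r - q)^2 is the nonnegativity of half of [Q']. *)
  have := vol_defect_ge0 (2 * (r - q))^-1 qs; have rq0 : r - q != 0 by rewrite subr_eq0 eq_sym.
  have k2 : 0 <= (r - q) ^+ 2 by rewrite sqr_ge0.
  move=> H; have := mulr_ge0 k2 H => {}H; rewrite /Q' mulr_ge0 //; apply: le_trans H _.
  by rewrite le_eqVlt; apply/orP; left; apply/eqP; field.
have := is_derive_le dQ Q'0 t0 (ltW tr) rs; rewrite /Q subrr expr0n /= !mul0r mulr0 subrr subr_le0.
have d0 : 0 < r - t by rewrite subr_gt0.
by rewrite expr2 -mulrA (mulrC (n%:R / 2)) ler_pM2l.
Qed.

Lemma energy_le (t : R) : 0 < t < s -> (s - t) * energy t <= n%:R / 2.
Proof.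
move=> /andP[t0 ts]; rewrite leNgt; apply/negP => lt_E.
have n0 : 0 <= n%:R / 2 :> R by rewrite divr_ge0.
have st : 0 < s - t by rewrite subr_gt0.
have E0 : 0 < energy t by rewrite -(pmulr_rgt0 _ st); exact: le_lt_trans lt_E.
(* If the bound failed, n / (2 energy) would be smaller than s - t; the midpoint d of the two
   violates the estimate already proved for end times before s. *)
pose d := (n%:R / 2 / energy t + (s - t)) / 2.
have lt_d : n%:R / 2 / energy t < s - t by rewrite ltr_pdivrMr.
have nE : 0 <= n%:R / 2 / energy t by rewrite divr_ge0 // ltW.
have := @energy_le_lt t (t + d) t0 _ _; rewrite addrAC subrr add0r leNgt -ltr_pdivrMr //.
move=> H; suff : ~~ (n%:R / 2 / energy t < d) by rewrite /d; lra.
by apply: H; rewrite /d; lra.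
Qed.

(** The functional W in terms of u, after substitution of f = -L - (n/2) ln (4 pi (s - t)) and
    integration with unit mass. *)
Definition entropy t := (s - t) * energy t - nash t - n%:R / 2 * ln (4 * pi * (s - t)) - n%:R.

Lemma entropy_derive t : 0 < t < s -> is_derive t (1 : R) entropy
  (2 * (s - t) * V_ (defect_field (2 * (s - t))^-1) t).
Proof.
move=> ts; have dE := energy_derive ts; have dN := nash_derive ts.
have st : 0 < s - t by rewrite subr_gt0; case/andP: ts.
have p0 := @pi_gt0 R.
have dl : is_derive t (1 : R) (fun t => ln (4 * pi * (s - t))) (- (s - t)^-1).
  have H : is_derive t (1 : R) ((4 * pi) *: (cst s - @id R)) (- (4 * pi)).
    by apply: is_derive_eq; rewrite /GRing.scale /=; ring.
  have H2 : is_derive (((4 * pi) *: (cst s - @id R)) t) 1 (@ln R) (4 * pi * (s - t))^-1.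
    by apply: is_derive1_ln; rewrite /= /GRing.scale /= !mulr_gt0.
  have := is_derive_scalar_comp H H2; rewrite (_ : (4 * pi * (s - t))^-1 * - (4 * pi) = - (s - t)^-1) //.
  by rewrite mulrN invfM mulrAC mulVf ?mul1r // gt_eqF // mulr_gt0.
have -> : entropy = (cst s - @id R) * energy - nash - (n%:R / 2) *: (fun t => ln (4 * pi * (s - t))) - cst n%:R by [].
rewrite vol_defect //; apply: is_derive_eq; rewrite /GRing.scale /=.
have -> : (cst s - @id R) t = s - t by []. by field; rewrite gt_eqF.
Qed.

Lemma entropy_le (t r : R) : 0 < t -> t <= r -> r < s -> entropy t <= entropy r.
Proof.
move=> t0 tr rs; apply: (is_derive_le entropy_derive) t0 tr rs => q qs.
rewrite mulr_ge0 ?vol_defect // ?vol_defect_ge0 // mulr_ge0 // subr_ge0 ltW //.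
by case/andP: qs.
Qed.

Lemma entropy_le_nash t : 0 < t < s ->
  entropy t <= - nash t - n%:R / 2 * ln (4 * pi * (s - t)) - n%:R / 2.
Proof. by move=> /energy_le; rewrite /entropy; move: (_ * energy t) (_ * ln _) => a b; lra. Qed.
End Entropy.

(** * Gaussian integrals *)

Lemma is_derive_quadratic (R : realType) (E : normedModType R) (F : E -> R) (x v : E) (b c : R) :
  (forall h : R, F (x + h *: v) = F x + h * b + h ^+ 2 * c) -> is_derive x v F b.
Proof.
move=> H; apply: is_derive_line0.
have -> : (fun h => F (x + h *: v)) = cst (F x) + b *: @id R + @id R * (c *: @id R).
  by apply/funext => h; rewrite H -[RHS]/(F x + b * h + h * (c * h)); ring.
have d2 : is_derive (0 : R) (1 : R) (b *: @id R) (b *: 1) := is_deriveZ b (is_derive_id _ _).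
have d3 : is_derive (0 : R) (1 : R) (c *: @id R) (c *: 1) := is_deriveZ c (is_derive_id _ _).
have d4 := is_deriveM (is_derive_id (0 : R) (1 : R)) d3.
apply: is_derive_eq (is_deriveD (is_deriveD (is_derive_cst (F x) (0 : R) (1 : R)) d2) d4) _.
by rewrite -[(c *: @id R) 0]/(c * 0) /GRing.scale /= mul0r mulr0 mul0r !addr0 add0r mulr1.
Qed.

Lemma affine_Ck (R : realType) n (L : 'M[R]_n) (d : 'rV[R]_n) k (O : set 'rV[R]_n) l : open O ->
  Ck k O (fun x => (x *m L + d) ord0 l).
Proof.
move=> oO; apply: (@eq_Ck _ _ k O (fun x : 'rV[R]_n => \sum_m x ord0 m * L m l + d ord0 l)) => //.
  by move=> x _; rewrite [RHS]mxE; congr (_ + _); rewrite mxE.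
apply: CkD => //; last exact: Ck_cst.
by apply: Ck_sum => // m _; apply: CkM => //; [exact: Ck_coord|exact: Ck_cst].
Qed.

Section Gauss.
Variable R : realType.

Lemma integral_gauss1 (a : R) : 0 < a ->
  (\int[@lebesgue_measure R]_t (expR (- t ^+ 2 / a))%:E = (Num.sqrt (pi * a))%:E)%E.
Proof.
move=> a0; pose sg := Num.sqrt (a / 2).
have sg2 : sg ^+ 2 = a / 2 by rewrite sqr_sqrtr // divr_ge0 // ltW.
have sg0 : sg != 0 by rewrite gt_eqF // sqrtr_gt0 divr_gt0.
have k0 : 0 < Num.sqrt (pi * a) by rewrite sqrtr_gt0 mulr_gt0 // pi_gt0.
transitivity (\int[@lebesgue_measure R]_t ((Num.sqrt (pi * a))%:E * (normal_pdf 0 sg t)%:E))%E.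
  apply: eq_integral => t _; rewrite normal_pdfE // /normal_peak /normal_fun -EFinM subr0 sg2.
  have -> : a / 2 * pi *+ 2 = pi * a by rewrite -mulr_natr; field.
  have -> : (a / 2) *+ 2 = a by rewrite -mulr_natr; field.
  by rewrite mulrA mulfV ?mul1r // gt_eqF.
rewrite ge0_integralZl_EFin ?ltW //; last 2 first.
- by move=> t _; rewrite lee_fin normal_pdf_ge0.
- by apply/measurable_EFinP; exact: measurable_normal_pdf.
by rewrite integral_normal_pdf // mule1.
Qed.

Lemma nonneg_integral_gauss n (a k : R) : 0 < a -> 0 <= k ->
  nonneg_integral (fun v : 'rV[R]_n => (k * expR (- (v *m v^T) ord0 ord0 / a))%:E)
  = (k * Num.sqrt (pi * a) ^+ n)%:E.
Proof.
move=> a0; elim: n k => [|n ih] k k0 /=.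
  by rewrite mul0mx mxE oppr0 mul0r expR0 expr0.
have E (t : R) (v : 'rV[R]_n) : k * expR (- (row_mx (const_mx t : 'rV[R]_1) v *m (row_mx (const_mx t : 'rV[R]_1) v)^T) ord0 ord0 / a)
    = (k * expR (- t ^+ 2 / a)) * expR (- (v *m v^T) ord0 ord0 / a).
  rewrite tr_row_mx mul_row_col -mulrA -expRD; congr (_ * expR _).
  rewrite -mulrDl -opprD; congr (- _ / a); move: (v *m v^T) => B.
  have E1 : ((const_mx t : 'rV[R]_1) *m (const_mx t : 'rV[R]_1)^T) ord0 ord0 = t ^+ 2.
    by rewrite mxE big_ord1 !mxE expr2.
  by rewrite [LHS]mxE E1.
transitivity (\int[@lebesgue_measure R]_t ((k * Num.sqrt (pi * a) ^+ n)%:E * (expR (- t ^+ 2 / a))%:E))%E.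
  apply: eq_integral => t _; under eq_fun do rewrite E.
  by rewrite ih ?mulr_ge0 ?expR_ge0 // -EFinM mulrAC.
rewrite ge0_integralZl_EFin ?mulr_ge0 ?exprn_ge0 ?sqrtr_ge0 //; last first.
  apply/measurable_EFinP; rewrite (_ : (fun t => _) = normal_fun 0 (Num.sqrt (a / 2))).
    exact: measurable_normal_fun.
  apply/funext => t; rewrite /normal_fun subr0 sqr_sqrtr ?divr_ge0 ?ltW // -mulr_natr.
  by rewrite divfK // pnatr_eq0.
by rewrite integral_gauss1 // -EFinM exprSr mulrA.
Qed.

(** The substitution y = (x - c) A, with G = A A^T, leads to the standard Gaussian; |det A| is the
    square root of det G. *)
Lemma integral_gauss n (G : 'M[R]_n) (c : 'rV[R]_n) (a : R) : 0 < a -> G^T = G ->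
  (forall v : 'rV_n, v != 0 -> 0 < (v *m G *m v^T) ord0 ord0) ->
  (\int[leb R n]_x (expR (- quad G (x - c) / a) * Num.sqrt (\det G))%:E
  = (Num.sqrt (pi * a) ^+ n)%:E)%E.
Proof.
move=> a0 GT Gp; have [A Au EG] := cholesky GT Gp.
pose phi (x : 'rV[R]_n) := x *m A + - (c *m A); pose psi (y : 'rV[R]_n) := y *m invmx A + c.
pose b (y : 'rV[R]_n) := expR (- (y *m y^T) ord0 ord0 / a).
have phiE x : phi x = (x - c) *m A by rewrite mulmxBl.
have jacE x : jacobian phi x = A.
  apply/matrixP => k l; rewrite mxE.
  suff [_ ->] : is_derive x (unit_vec R k) (fun y => phi y ord0 l) (A k l) by [].
  apply: (@is_derive_quadratic _ _ _ _ _ _ 0) => h; rewrite mulr0 addr0 /phi mulmxDl addrAC [LHS]mxE.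
  by congr (_ + _); rewrite -scalemxAl -rowE !mxE.
have bC y : {for y, continuous b}.
  suff : Ck 0 setT b by apply.
  apply: Ck_exp; first exact: openT.
  apply: CkM; [exact: openT| |exact: Ck_cst]; apply: CkN; first exact: openT.
  apply: (@eq_Ck _ _ 0 setT (fun y : 'rV[R]_n => \sum_m y ord0 m * y ord0 m)); first exact: openT.
    by move=> z _; rewrite mxE; apply: eq_bigr => m _; rewrite mxE.
  by apply: Ck_sum; [exact: openT|move=> m _; apply: CkM; try exact: openT; exact: Ck_coord openT].
have dA : `|\det A| = Num.sqrt (\det G) by rewrite EG det_mulmx det_tr -expr2 sqrtr_sqr.
have psiphi x : psi (phi x) = x by rewrite /psi phiE mulmxK ?subrK.
have phipsi y : phi (psi y) = y by rewrite phiE /psi addrK mulmxKV.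
have jU x : setT x -> jacobian phi x \in unitmx by rewrite jacE.
have [_ +] := @change_of_variables R n setT setT phi psi b openT openT (fun _ _ => I)
  (fun x _ => psiphi x) (fun y _ => phipsi y) (fun l => affine_Ck A _ 1 l openT)
  (fun y _ => continuous_row (fun l => Ck_continuous (affine_Ck (invmx A) c 0 l openT) I))
  (fun y _ => expR_ge0 _) (fun y _ => bC y) jU setT measurableT (@subset_refl _ _).
have -> : phi @` setT = setT by apply/seteqP; split=> // y _; exists (psi y).
have -> : (\int[leb R n]_y (b y)%:E = (Num.sqrt (pi * a) ^+ n)%:E)%E.
  have mb : measurable_fun [set: vec R n] (fun y : vec R n => (b y)%:E).
    by apply/measurable_EFinP; exact: continuous_measurableT.
  rewrite (integral_leb mb); last by move=> y; rewrite lee_fin expR_ge0.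
  rewrite -[X in X%:E]mul1r -(nonneg_integral_gauss n a0 ler01).
  by congr nonneg_integral; apply/funext => v; rewrite mul1r.
move=> <-; apply: eq_integral => x _; rewrite jacE dA; congr ((expR (- _ / a) * _)%:E).
by rewrite phiE /quad EG trmx_mul !mulmxA.
Qed.
End Gauss.

(** * Adjoint heat kernels near their pole *)

Lemma left_limit_ge (R : realType) (f : R -> R) (a s l : R) : a < s ->
  (forall x y, a < x -> x <= y -> y < s -> f x <= f y) ->
  f x @[x --> s^'-] --> l -> forall t, a < t -> t < s -> f t <= l.
Proof.
move=> as_ fm fl t at_ ts; rewrite -(cvg_lim (@Rhausdorff R) fl); apply: limr_ge.
  by apply/cvg_ex; exists l.
near=> r; have tr : t <= r by near: r; exact: nbhs_left_ge.
have rs : r < s by near: r; exact: nbhs_left_lt.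
exact: fm.
Unshelve. all: by end_near. Qed.

Lemma ln_le_subr1 (R : realType) (x : R) : 0 < x -> ln x <= x - 1.
Proof. by move=> x0; have := expR_ge1Dx (ln x); rewrite lnK ?posrE //; lra. Qed.

(** Tangent line at z = 1: the inequality e^y >= 1 + y for y = 1/z - 1. With z = 1 - |x-c|^2/r it
    compares the bump with the quadratic exponent of the Gaussian, sharply at the pole. *)
Lemma flat0_le (R : realType) (z : R) : 0 <= z -> expR 1 * flat 0 z <= z.
Proof.
rewrite le_eqVlt => /orP[/eqP <-|z0]; first by rewrite /flat ltxx mulr0.
rewrite /flat z0 expr0 mul1r -expRD.
have := expR_ge1Dx (z^-1 - 1); rewrite addrC subrK => H.
have -> : 1 - z^-1 = - (z^-1 - 1) by rewrite opprB.
by rewrite expRN -[X in _ <= X]invrK lef_pV2 ?posrE ?expR_gt0 ?invr_gt0.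
Qed.

Section BumpLaplacian.
Variables (R : realType) (n : nat) (M : closedManifold R n) (h : metric M).
Hypothesis hR : riemannian h.
Local Notation V := 'rV[R]_n.
Variables (j : 'I_(charts M)) (c : V) (r : R).
Hypotheses (jc : chart_img j c) (r_gt0 : 0 < r).
Let G := h j c.

Let GT : G^T = G. Proof. by have [_ H _ _] := hR; exact: H. Qed.

Let B (y v : V) : R := (y *m G *m v^T) ord0 ord0.

Let BC y v : B y v = B v y.
Proof.
rewrite /B; transitivity ((y *m G *m v^T)^T ord0 ord0); first by rewrite [RHS]mxE.
by rewrite !trmx_mul trmxK GT mulmxA.
Qed.

Let BD y y' v : B (y + y') v = B y v + B y' v.
Proof. by rewrite /B !mulmxDl mxE. Qed.

Let BZ (e : R) y v : B (e *: y) v = e * B y v.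
Proof. by rewrite /B -!scalemxAl mxE. Qed.

Let F (x : V) : R := 1 - quad G (x - c) / r.

Let F_line x v (e : R) : F (x + e *: v) = F x + e * (- (2 * B (x - c) v) / r) + e ^+ 2 * (- quad G v / r).
Proof.
have E : quad G (x - c + e *: v) = quad G (x - c) + 2 * e * B (x - c) v + e ^+ 2 * quad G v.
  rewrite -![quad G _]/(B _ _); move: (x - c) => y.
  rewrite BD BZ (BC y (_ + _)) (BC v (_ + _)) !BD !BZ (BC v y); ring.
by rewrite /F addrAC E; field; rewrite gt_eqF.
Qed.

Let dF x v : is_derive x v F (- (2 * B (x - c) v) / r).
Proof. exact: is_derive_quadratic (F_line x v). Qed.

Let f (x : V) : R := flat 0 (F x).

Let df x v : is_derive x v f (flat 2 (F x) * (- (2 * B (x - c) v) / r)).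
Proof.
have := is_derive_scalar_comp (dF x v) (is_derive_flat 0 (F x)).
by rewrite oppr0 mul0r add0r.
Qed.

Let ddf v w : is_derive c w ('D_v f) (expR (- 1) * (- (2 * B w v) / r)).
Proof.
have -> : 'D_v f = (flat 2 \o F) * (fun x => - (2 * B (x - c) v) / r).
  by apply/funext => x; have [_ ->] := df x v.
have d1 := is_derive_scalar_comp (dF c w) (is_derive_flat 2 (F c)).
have d2 : is_derive c w (fun x => - (2 * B (x - c) v) / r) (- (2 * B w v) / r).
  apply: (@is_derive_quadratic _ _ _ _ _ _ 0) => e; rewrite mulr0 addr0 addrAC BD BZ.
  by field; rewrite gt_eqF.
have B0 : B (c - c) v = 0 by rewrite subrr /B !mul0mx mxE.
have Fc : (flat 2 \o F) c = expR (- 1).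
  by rewrite /= /F subrr /quad !mul0mx mxE mul0r subr0 /flat ltr01 invr1 expr1n mul1r.
apply: is_derive_eq (is_deriveM d1 d2) _; rewrite Fc B0 /GRing.scale /=.
by rewrite mulr0 oppr0 mul0r mul0r addr0.
Qed.

(** The centre is critical, so the Christoffel terms drop out, and the Hessian there is -2 e^-1 / r
    times the metric at the centre, whose trace is n. *)
Lemma laplacian_flat_quad :
  laplacian h j (fun x => flat 0 (1 - quad G (x - c) / r)) c = - (2 * n%:R * expR (- 1) / r).
Proof.
rewrite -/F -/f; have oj := @chart_img_open _ _ M j.
have p k x : chart_img j x -> partial j k f x = 'D_(unit_vec R k) f x by exact: partialE.
have -> : laplacian h j f c = \tr (invmx G *m ((- (2 * expR (- 1) / r)) *: G)).
  congr (\tr (_ *m _)); apply/matrixP => k l; rewrite mxE [RHS]mxE.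
  rewrite big1 ?subr0; last first.
    move=> m _; rewrite p //; have [_ ->] := df c (unit_vec R m).
    by rewrite subrr /B !mul0mx [fun_of_matrix 0 _ _]mxE mulr0 oppr0 mul0r !mulr0.
  rewrite (eq_partial k oj (@subset_refl _ _) jc (p l)) partialE //.
  have [_ ->] := ddf (unit_vec R l) (unit_vec R k).
  have -> : B (unit_vec R k) (unit_vec R l) = G k l.
    by rewrite /B trmx_delta -rowE -colE [LHS]mxE [LHS]mxE.
  by field; rewrite gt_eqF.
rewrite -scalemxAr mulVmx ?metric_unit // mxtraceZ mxtrace1; field.
by rewrite gt_eqF.
Qed.
End BumpLaplacian.

(** For pi a <= 1 the square root of pi a is at least pi a, so the left-hand side is at most a
    constant multiple of [flat n (a / r)], which is O(a). *)
Lemma gauss_decay (R : realType) (n : nat) (r e : R) : 0 < r -> 0 < e ->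
  exists2 d : R, 0 < d & forall a, 0 < a -> a < d ->
    (Num.sqrt (pi * a) ^+ n)^-1 * expR (- (r / a)) <= e.
Proof.
move=> r0 e0; have p0 := @pi_gt0 R; pose C := ((pi * r) ^+ n)^-1 * (n.+1)`!%:R / r.
have C0 : 0 < C by rewrite divr_gt0 // mulr_gt0 ?invr_gt0 ?exprn_gt0 ?mulr_gt0 // ltr0n fact_gt0.
exists (Num.min (pi^-1) (e / C)); first by rewrite lt_min invr_gt0 p0 divr_gt0.
move=> a a0; rewrite lt_min => /andP[api aeC].
have y1 : pi * a <= 1 by rewrite mulrC -ler_pdivlMr // mul1r ltW.
have y0 : 0 < pi * a by rewrite mulr_gt0.
have s0 : 0 < Num.sqrt (pi * a) by rewrite sqrtr_gt0.
have ys : pi * a <= Num.sqrt (pi * a).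
  have s1 : Num.sqrt (pi * a) <= 1 by rewrite -sqrtr1 ler_sqrt.
  by rewrite -{1}(sqr_sqrtr (ltW y0)) expr2 ler_piMl // ltW.
have ra : 0 < a / r by rewrite divr_gt0.
have fl : flat n (a / r) = (r / a) ^+ n * expR (- (r / a)) by rewrite /flat ra invf_div.
apply: (@le_trans _ _ (((pi * r) ^+ n)^-1 * flat n (a / r))).
  rewrite fl mulrA; apply: ler_wpM2r; first exact: expR_ge0.
  have -> : ((pi * r) ^+ n)^-1 * (r / a) ^+ n = ((pi * a) ^+ n)^-1.
    have E : (pi * a)^-1 = (pi * r)^-1 * (r / a).
      by rewrite invfM [in RHS]invfM -mulrA mulKf // gt_eqF.
    by rewrite -[RHS]exprVn E [RHS]exprMn exprVn.
  by rewrite lef_pV2 ?posrE ?exprn_gt0 // lerXn2r // nnegrE ltW.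
have := flat_le n (a / r); rewrite ger0_norm ?(ltW ra) // => H.
apply: (@le_trans _ _ (((pi * r) ^+ n)^-1 * ((n.+1)`!%:R * (a / r)))).
  by apply: ler_wpM2l => //; rewrite invr_ge0 exprn_ge0 // ltW // mulr_gt0.
have -> : ((pi * r) ^+ n)^-1 * ((n.+1)`!%:R * (a / r)) = C * a by rewrite /C; ring.
by rewrite mulrC -ler_pdivlMr // ltW.
Qed.

Lemma near_left_interval (R : realType) (s : R) (P : R -> Prop) : 0 < s ->
  (\forall t \near s^'-, P t) ->
  exists2 t0 : R, 0 < t0 < s & forall t, t0 < t -> t < s -> P t.
Proof.
move=> s0 nP; have : nbhs s [set t | t < s -> P t] by exact: nP.
move=> /nbhs_ballP[d /= d0 Hd]; exists (Num.max (s / 2) (s - d)).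
  by rewrite lt_max divr_gt0 //= gt_max; apply/andP; split; lra.
move=> t; rewrite gt_max => /andP[t1 t2] ts; apply: Hd => //.
by rewrite -ball_normE /= ger0_norm; lra.
Qed.

Lemma continuous_of_field (R : realType) (n : nat) (M : closedManifold R n)
    (F : 'I_(charts M) -> 'rV[R]_n -> R) (P : M -> R) : scalar_field F ->
  (forall i x, chart_img i x -> P (chart_inv i x) = F i x) -> continuous P.
Proof.
move=> FF HP q; have [i iq] := chart_cover q.
have E0 : \forall q' \near q, (F i \o chart i) q' = P q'.
  have : \forall q' \near q, chart_dom i q' by apply: open_nbhs_nbhs; split=> //; exact: chart_dom_open.
  by apply: filterS => q' iq'; rewrite /= -(HP _ _ (chart_imgP iq')) chartK.
have c1 : {for q, continuous (F i \o chart i)}.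
  apply: continuous_comp; first exact: chart_at.
  by apply: (field_continuous FF); exact: chart_imgP.
have := nbhs_singleton E0 => /= Eq; rewrite /continuous_at -Eq.
by apply: cvg_trans c1; exact: near_eq_cvg.
Qed.

Lemma near_at_left (R : realType) (s : R) (P : R -> Prop) :
  (\forall t \near s, P t) -> \forall t \near s^'-, P t.
Proof.
move=> nP; have H : nbhs s [set t | t < s -> P t] by apply: filterS nP => t Pt _.
exact: H.
Qed.

Lemma flow_field_near (R : realType) (n : nat) (M : closedManifold R n) (T : R)
    (F : 'I_(charts M) -> 'rV[R]_n * R -> R) (t0 e : R) :
  @flow_field R n M T F -> 0 < t0 < T -> 0 < e ->
  \forall t \near t0, forall i x, chart_img i x -> `|F i (x, t) - F i (x, t0)| < e.
Proof.
move=> FF t0T e0.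
have nT : \forall t \near t0, 0 < t < T.
  have : t0 \in `]0, T[%R by rewrite in_itv.
  by move=> /near_in_itvoo; apply: filterS => t; rewrite in_itv.
have : \forall t \near t0, forall i x, chart_img i x -> 0 < t < T -> `|F i (x, t) - F i (x, t0)| < e.
  apply: (@near_charts R n M R (nbhs t0) _
    (fun t i x => 0 < t < T -> `|F i (x, t) - F i (x, t0)| < e)) => [t i j x o H tT|i x ix].
    rewrite (@flow_transition _ _ _ _ F FF i j x t o tT) (@flow_transition _ _ _ _ F FF i j x t0 o t0T).
    exact: H.
  have cF : {for (x, t0), continuous (F i)} by have := flow_Ck FF i 0%N; apply; split.
  have e2 : 0 < e / 2 by rewrite divr_gt0.
  have [r r0 Hr] := continuous_ball cF e2.
  exists (ball x r, ball t0 r) => /=; first by split; exact: nbhsx_ballx.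
  move=> [y t] /= [xy tt] _; have H1 := Hr (y, t) (conj xy tt).
  have H2 := Hr (y, t0) (conj xy (ballxx t0 r0)).
  have := ler_normB (F i (y, t) - F i (x, t0)) (F i (y, t0) - F i (x, t0)).
  rewrite opprB addrA subrK => /le_lt_trans; apply; move: H1 H2; lra.
by apply: filterS2 nT => t tT H i x ix; exact: H.
Qed.

Section Kernel.
Variables (R : realType) (n : nat) (M : closedManifold R n) (T : R) (g : R -> metric M).
Hypothesis g_flow : ricci_flow T g.
Variables (p : M) (s : R) (u : M -> R -> R).
Hypotheses (s_gt0 : 0 < s) (sT : s < T).
Hypothesis Hu : adjoint_heat_kernel g p s u.
Local Notation V := 'rV[R]_n.
Local Notation E := ('rV[R]_n * R)%type.
Local Notation time_dir := ((0, 1) : E).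
Local Notation ST := (@open_spacetime R n M s).
Local Notation field := (@flow_field R n M s).
Implicit Types (i j : 'I_(charts M)) (x : V) (t : R).

Lemma smooth_spacetime_field (s0 : R) (v : M -> R -> R) : smooth_spacetime s0 v ->
  @flow_field R n M s0 (fun i => in_chart i v).
Proof.
move=> Sv; split=> [i k|i j x t o ts]; last by rewrite /in_chart /= transition_inv.
apply: (@smooth_Ck _ _ (spacetime s0 i) _ k _ [::]) => //; first exact: open_spacetime_open.
by move=> [x t] [/= ix /andP[t0 ts]]; split=> //=; rewrite ltW.
Qed.

Lemma kernel_field : field (fun i => in_chart i u).
Proof. by case: Hu => Su _ _ _; exact: smooth_spacetime_field. Qed.

Lemma kernel_gt0 i z : ST i z -> 0 < in_chart i u z.
Proof.
by case: Hu => _ u0 _ _; case: z => x t [/= ix /andP[t0 ts]]; apply: u0; rewrite ltW.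
Qed.

Lemma kernel_heat i z : ST i z -> 'D_time_dir (in_chart i u) z
  = - lap_field g (fun i => in_chart i u) i z + scal_field g i z * in_chart i u z.
Proof.
case: Hu => _ _ H _ Dz; have [iz /andP[t0 ts]] := Dz.
have sz : spacetime s i z by split=> //=; rewrite ltW.
rewrite -(H i z sz) pderiv_interior //.
have : \forall y \near z, ST i y by apply: open_nbhs_nbhs; split=> //; exact: open_spacetime_open.
by apply: filterS => y [iy /andP[y0 ys]]; split=> //=; rewrite ltW.
Qed.

Lemma static_field (s0 : R) (b : M -> R) : smooth_fun b -> @flow_field R n M s0 (fun i z => b (chart_inv i z.1)).
Proof.
move=> Sb; split=> [i k|i j x t o ts] /=; last by rewrite transition_inv.
exact: static_Ck (Sb i k).
Qed.

Lemma kernel_smooth t : 0 < t < s -> smooth_fun (u ^~ t).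
Proof. by move=> ts i k; exact: (slice_Ck ts (flow_Ck kernel_field i k)). Qed.

(** The mass is constant, its derivative being the integral of a Laplacian, and testing against the
    constant 1 gives its limit at the pole. *)
Lemma kernel_mass t : 0 < t < s -> V_ g (fun i => in_chart i u) t = 1.
Proof.
have FU := kernel_field; pose m := V_ g (fun i => in_chart i u).
have dm r : 0 < r < s -> is_derive r (1 : R) m 0.
  move=> rs; apply: is_derive_eq (is_derive_vol g_flow (ltW sT) FU rs) _.
  rewrite -[RHS]oppr0 -(vol_lap_field g_flow (ltW sT) FU rs).
  have hR := flow_riemannian g_flow (ltW sT) rs.
  have I := scalar_field_integrable hR (flow_slice (flow_field_lap g_flow (ltW sT) FU) rs).
  rewrite -mulN1r -(vol_scale I); apply: eq_vol => i x ix; rewrite kernel_heat //; ring.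
have lim : m x @[x --> s^'-] --> (1 : R).
  have [_ _ _ H] := Hu; have := H (fun=> 1) (@cst_continuous _ _ _).
  suff -> : (fun t => vol_integral (g t) (fun i x => 1 * u (chart_inv i x) t)) = m by [].
  by apply/funext => r; apply: eq_vol => i x _; rewrite mul1r.
move=> /andP[t0 ts]; apply/eqP; rewrite eq_le; apply/andP; split.
  apply: (left_limit_ge s_gt0) lim _ t0 ts => x y x0 xy ys.
  by apply: (is_derive_le dm) x0 xy ys.
rewrite -lerN2; apply: (left_limit_ge (f := \- m) s_gt0) _ t0 ts => [x y x0 xy ys|]; last exact: cvgN lim.
apply: (@is_derive_le _ (\- m) (fun=> 0)) x0 xy ys => // r rs.
by have := is_deriveN (dm r rs); rewrite oppr0.
Qed.

Section Cutoff.
Variables (j : 'I_(charts M)) (r : R).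
Hypothesis jp : chart_dom j p.
Let c := chart j p.
Let G := g s j c.
Hypotheses (r_gt0 : 0 < r) (cB : compact [set x : V | quad G (x - c) <= r]).
Hypothesis Bj : [set x : V | quad G (x - c) <= r] `<=` chart_img j.
Let b := bump j c G r.

Let hs : riemannian (g s).
Proof. by have [H _ _] := g_flow; apply: H; rewrite ltW. Qed.

Let jc : chart_img j c. Proof. exact: chart_imgP. Qed.

Let Gpos (v : V) : v != 0 -> 0 < (v *m G *m v^T) ord0 ord0.
Proof. by have [_ _ H _] := hs; exact: H. Qed.

Let bS : smooth_fun b. Proof. exact: bump_smooth. Qed.

Let bump_center : b p = expR (- 1).
Proof.
by rewrite -(chartK jp) /b bump_chart // subrr /quad !mul0mx mxE mul0r subr0 /flat ltr01 expr0 invr1 mul1r.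
Qed.

Let lap_center : laplacian (g s) j (fun x => b (chart_inv j x)) c = - (2 * n%:R * expR (- 1) / r).
Proof.
rewrite -(laplacian_flat_quad hs jc r_gt0); apply: eq_laplacian => // y jy.
by rewrite /b bump_chart.
Qed.

(** The derivative of the mean of b is minus the mean of its Laplacian, and tends to 2 n e^-1 / r at
    the pole. Integration from t to s bounds the mean from below by b(p) minus that rate, up to e,
    times s - t. *)
Lemma vol_bump_lower (e : R) : 0 < e -> exists2 t0 : R, 0 < t0 < s & forall t, t0 < t -> t < s ->
  expR (- 1) - (2 * n%:R * expR (- 1) / r + e) * (s - t)
  <= V_ g (fun i z => in_chart i u z * b (chart_inv i z.1)) t.
Proof.
move=> e0; pose k := 2 * n%:R * expR (- 1) / r.
have FU := kernel_field; have Fb := static_field s bS; have FL := flow_field_lap g_flow (ltW sT) Fb.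
(* The Laplacian at the fixed time s is a continuous function on M against which the weak limit can
   be tested; the Laplacian at nearby times is uniformly close to it. *)
pose psi i x := laplacian (g s) i (fun x => b (chart_inv i x)) x.
have Fpsi : scalar_field psi by exact: scalar_field_laplacian.
have [P HP] := glue (field_transition Fpsi).
have cP := continuous_of_field Fpsi HP.
have Pp : P p = - k by rewrite -{1}(chartK jp) HP.
have near1 : \forall t \near s, forall i x, chart_img i x ->
    `|lap_field g (fun i z => b (chart_inv i z.1)) i (x, t) - psi i x| < e / 2.
  have FT := flow_field_lap g_flow (lexx T) (static_field T bS).
  have s0T : 0 < s < T by rewrite s_gt0.
  have e2 : 0 < e / 2 by rewrite divr_gt0.
  exact: (flow_field_near FT s0T e2).
have near2 : \forall t \near s^'-, - k - e / 2 < V_ g (fun i z => P (chart_inv i z.1) * in_chart i u z) t.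
  have [_ _ _ H] := Hu; have /cvgrPdist_lt/(_ (e / 2)) := H P cP; rewrite Pp.
  move=> H2; have {}H2 := H2 (divr_gt0 e0 (ltr0Sn _ _)); apply: filterS H2 => t.
  rewrite -[vol_integral _ _]/(V_ g (fun i z => P (chart_inv i z.1) * in_chart i u z) t) ltr_norml.
  by move=> /andP[]; move: (V_ _ _ _) => v; lra.
have [t0 /andP[t00 t0s] Ht0] : exists2 t0 : R, 0 < t0 < s & forall t, t0 < t -> t < s ->
   (forall i x, chart_img i x -> `|lap_field g (fun i z => b (chart_inv i z.1)) i (x, t) - psi i x| < e / 2)
   /\ - k - e / 2 < V_ g (fun i z => P (chart_inv i z.1) * in_chart i u z) t.
  have near1' : \forall t \near s^'-, forall i x, chart_img i x ->
      `|lap_field g (fun i z => b (chart_inv i z.1)) i (x, t) - psi i x| < e / 2.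
    exact: near_at_left near1.
  exact: (near_left_interval s_gt0 (filterI near1' near2)).
exists t0; first by rewrite t00.
(* The margin e makes f nondecreasing close to s, and its limit at s is known from the weak
   convergence. *)
pose f t := (k + e) * t - V_ g (fun i z => in_chart i u z * b (chart_inv i z.1)) t.
pose D t := (k + e) + V_ g (fun i z => in_chart i u z * lap_field g (fun i z => b (chart_inv i z.1)) i z) t.
have I0 t : t0 < t -> t < s -> 0 < t < s by move=> h1 ->; rewrite (lt_trans t00).
have df t : t0 < t < s -> is_derive t (1 : R) f (D t).
  move=> /andP[t0t ts]; have t0s' := I0 t t0t ts; have hR := flow_riemannian g_flow (ltW sT) t0s'.
  have FUb := flow_fieldM FU Fb.
  have d1 := is_deriveB (is_deriveZ (k + e) (is_derive_id t (1 : R))) (is_derive_vol g_flow (ltW sT) FUb t0s').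
  apply: is_derive_eq d1 _; rewrite /GRing.scale /= mulr1; congr (_ + _); apply/eqP.
  rewrite eqr_oppLR; apply/eqP.
  have Gr := green_supported hR bS (kernel_smooth t0s') (bump_supported r_gt0 cB Bj).
  have I1 := scalar_field_integrable hR (flow_slice (flow_fieldM FU FL) t0s').
  rewrite /V_ -mulN1r; apply: etrans (congr1 ( *%R (-1)) Gr); rewrite -vol_scale; last first.
    exact: (scalar_field_integrable hR
      (scalar_fieldM (flow_slice Fb t0s') (flow_slice (flow_field_lap g_flow (ltW sT) FU) t0s'))).
  apply: eq_vol => i x ix; have Dx : ST i (x, t) by [].
  rewrite (@deriveM _ _ (in_chart i u) (fun z => b (chart_inv i z.1))); last 2 first.
  - exact: (time_derivable FU ix t0s').
  - exact: (time_derivable Fb ix t0s').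
  have [_ <-] := time_derive (time_derivable Fb ix t0s').
  rewrite -[fun r => _]/(cst (b (chart_inv i x)) : R -> R) derive_cst.
  rewrite kernel_heat // /GRing.scale /= /lap_field /=; ring.
have D0 t : t0 < t < s -> 0 <= D t.
  move=> /andP[t0t ts]; have [H1 H2] := Ht0 t t0t ts; have t0s' := I0 t t0t ts.
  have hR := flow_riemannian g_flow (ltW sT) t0s'; have SU := flow_slice FU t0s'.
  have I1 := scalar_field_integrable hR (scalar_fieldM Fpsi SU).
  have I2 := scalar_field_integrable hR SU.
  have I3 := scalar_field_integrable hR (flow_slice (flow_fieldM FU FL) t0s').
  have le : vol (g t) (fun i x => psi i x * in_chart i u (x, t) + (- (e / 2)) * in_chart i u (x, t))
     <= vol (g t) (fun i x => in_chart i u (x, t) * lap_field g (fun i z => b (chart_inv i z.1)) i (x, t)).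
    apply: (vol_le hR (integrable_fieldD I1 (integrable_fieldZ I2 _)) I3) => i x ix.
    have := H1 i x ix; have u0 : 0 < in_chart i u (x, t) by exact: kernel_gt0.
    rewrite ltr_norml => /andP[k1 _]; rewrite -mulrDl mulrC ler_pM2l //.
    by move: (lap_field _ _ _ _) (psi _ _) k1 => a a'; lra.
  have E1 : vol (g t) (fun i x => psi i x * in_chart i u (x, t))
      = V_ g (fun i z => P (chart_inv i z.1) * in_chart i u z) t.
    by apply: eq_vol => i x ix; rewrite /= HP.
  move: le; rewrite (vol_add I1 (integrable_fieldZ I2 _)) (vol_scale I2) E1.
  rewrite -[vol (g t) (fun i x => in_chart i u (x, t))]/(V_ g (fun i => in_chart i u) t) kernel_mass //.
  move=> le2; have le3 := lt_le_trans (ltr_leD H2 (lexx (- (e / 2) * 1))) le2.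
  rewrite /D -lerBlDl sub0r; apply: le_trans (ltW le3).
  by rewrite le_eqVlt; apply/orP; left; apply/eqP; field.
have lim : f x @[x --> s^'-] --> (k + e) * s - expR (- 1).
  apply: cvgB.
    apply: cvg_within_filter; apply: (@continuousM _ _ (fun=> k + e) id); [exact: cst_continuous|exact: cvg_id].
  have cb : continuous b by exact: (continuous_of_field (smooth_scalar_field bS)).
  have [_ _ _ H] := Hu; have := H b cb; rewrite bump_center.
  suff -> : (fun t => vol_integral (g t) (fun i x => b (chart_inv i x) * u (chart_inv i x) t))
    = V_ g (fun i z => in_chart i u z * b (chart_inv i z.1)) by [].
  by apply/funext => q; apply: eq_vol => i x _; rewrite mulrC.
move=> t t0t ts; have := left_limit_ge t0s (is_derive_le df D0) lim t0t ts; rewrite /f -/k.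
by move: (V_ _ _ _) => v; lra.
Qed.

(** On the quadratic ball the density K e^(C b) is below the Gaussian with parameter a, by
    [flat0_le]; elsewhere b vanishes and the density is the constant K. The factor 1 + d accounts
    for the volume density of the metric at time t. *)
Lemma vol_gauss_upper (d t : R) : 0 < d -> 0 < t < s ->
  (forall x, quad G (x - c) <= r -> rho (g t) j x <= (1 + d) * Num.sqrt (\det G)) ->
  forall a K C, a = 4 * (s - t) -> K = (Num.sqrt (pi * a) ^+ n)^-1 * expR (- (r / a)) ->
  C = r * expR 1 / a ->
  vol (g t) (fun i x => K * expR (C * b (chart_inv i x)))
  <= 1 + d + K * vol (g t) (fun i (x : V) => 1).
Proof.
move=> d0 ts Hrho a K C aE KE CE; have hR := flow_riemannian g_flow (ltW sT) ts.
have a0 : 0 < a by rewrite aE mulr_gt0 // subr_gt0; case/andP: ts.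
have k0 : 0 < Num.sqrt (pi * a) ^+ n by rewrite exprn_gt0 // sqrtr_gt0 mulr_gt0 // pi_gt0.
have K0 : 0 < K by rewrite KE mulr_gt0 ?expR_gt0 // invr_gt0.
have C0 : 0 < C by rewrite CE divr_gt0 // mulr_gt0 // expR_gt0.
have b0 q : 0 <= b q by exact: bump_ge0.
have exp1 y : 0 <= y -> 1 <= expR y by move=> y0; have := expR_ge1Dx y; lra.
(* Without the constant K the density is supported in the chart j, where it can be compared with the
   Gaussian; the constant is integrated over M separately. *)
pose F i x := K * (expR (C * b (chart_inv i x)) - 1).
have FF : scalar_field F.
  apply: (@scalar_field_comp _ _ _ (fun y => K * (expR (C * y) - 1))
    (fun i x => b (chart_inv i x))) => [|i x _].
    exact: smooth_scalar_field bS.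
  rewrite /continuous_at; apply: cvgM; first exact: cvg_cst.
  apply: cvgB; last exact: cvg_cst.
  apply: (@continuous_comp _ _ _ ( *%R C) (@expR R)); last exact: continuous_expR.
  exact: mulrl_continuous.
have F0 i x : chart_img i x -> 0 <= F i x.
  by move=> _; rewrite mulr_ge0 ?(ltW K0) // subr_ge0 exp1 // mulr_ge0 // ltW.
have Fj i x : chart_img i x -> ~ overlap i j x -> F i x = 0.
  move=> ix ox; have B0 : b (chart_inv i x) = 0 := supported_field (bump_supported r_gt0 cB Bj) ix ox.
  by rewrite /F B0 mulr0 expR0 subrr mulr0.
have IF := scalar_field_integrable hR FF; have I1 := integrable_field1 hR.
have -> : vol (g t) (fun i x => K * expR (C * b (chart_inv i x)))
   = vol (g t) F + K * vol (g t) (fun i (x : V) => 1).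
  rewrite -(vol_scale I1) -(vol_add IF (integrable_fieldZ I1 K)).
  by apply: eq_vol => i x _; rewrite /F; ring.
rewrite lerD2r; have [iF ->] := vol_chart_ge0 hR FF IF F0 Fj.
pose H (x : V) := (Num.sqrt (pi * a) ^+ n)^-1 * (1 + d) * (expR (- quad G (x - c) / a) * Num.sqrt (\det G)).
have d1 : 0 < 1 + d by rewrite addr_gt0.
have H0 x : 0 <= H x by rewrite !mulr_ge0 ?invr_ge0 ?(ltW k0) ?expR_ge0 ?sqrtr_ge0 // ltW.
have qC : Ck 0 setT (fun x : V => expR (- quad G (x - c) / a) * Num.sqrt (\det G)).
  apply: CkM; [exact: openT| |exact: Ck_cst]; apply: Ck_exp; first exact: openT.
  apply: CkM; [exact: openT| |exact: Ck_cst]; apply: CkN; first exact: openT.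
  by apply: quad_Ck; exact: openT.
have mG : measurable_fun [set: vec R n] (fun x : vec R n => (expR (- quad G ((x : V) - c) / a) * Num.sqrt (\det G))%:E).
  by apply/measurable_EFinP; apply: continuous_measurableT => x; exact: qC.
have mH : measurable_fun [set: vec R n] (fun x : vec R n => (H x)%:E).
  under eq_fun do rewrite EFinM; exact: measurable_funeM.
have mj := @measurable_chart_img _ _ M j.
have FH x : chart_img j x -> F j x * rho (g t) j x <= H x.
  move=> jx; have r0 := ltW (rho_gt0 hR jx); rewrite /F /b bump_chart //.
  have [y1|y1] := leP (1 - quad G (x - c) / r) 0.
    by rewrite /flat ltNge y1 /= mulr0 expR0 subrr mulr0 mul0r H0.
  have qr : quad G (x - c) <= r by move: y1; rewrite subr_gt0 ltr_pdivrMr // mul1r => /ltW.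
  apply: (@le_trans _ _ (((Num.sqrt (pi * a) ^+ n)^-1 * expR (- quad G (x - c) / a)) * ((1 + d) * Num.sqrt (\det G)))); last first.
    by rewrite le_eqVlt; apply/orP; left; apply/eqP; rewrite /H; ring.
  apply: ler_pM => //; last exact: Hrho.
    rewrite mulr_ge0 ?(ltW K0) // subr_ge0 exp1 // mulr_ge0 ?(ltW C0) //; exact: flat_ge0.
  rewrite KE -mulrA ler_pM2l ?invr_gt0 //.
  apply: (@le_trans _ _ (expR (- (r / a)) * expR (C * flat 0 (1 - quad G (x - c) / r)))).
    by rewrite ler_pM2l ?expR_gt0 // lerBlDr lerDl.
  rewrite -expRD ler_expR.
  have := flat0_le (ltW y1); rewrite -(ler_pM2l (divr_gt0 r_gt0 a0)) => H1.
  have -> : - quad G (x - c) / a = - (r / a) + r / a * (1 - quad G (x - c) / r).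
    by field; rewrite !gt_eqF.
  by rewrite lerD2l; apply: le_trans H1; rewrite CE le_eqVlt; apply/orP; left; apply/eqP; ring.
have le1 : (\int[leb R n]_(x in chart_img j) (F j x * rho (g t) j x)%:E <= (1 + d)%:E)%E.
  have -> : (1 + d)%:E = (\int[leb R n]_x (H x)%:E)%E.
    have E1 : (\int[leb R n]_x (H x)%:E = ((Num.sqrt (pi * a) ^+ n)^-1 * (1 + d))%:E *
       \int[leb R n]_x (expR (- quad G (x - c) / a) * Num.sqrt (\det G))%:E)%E.
      rewrite -ge0_integralZl_EFin //.
      by rewrite mulr_ge0 ?invr_ge0 ?(ltW k0) // ltW.
    rewrite E1 integral_gauss //; last by have [_ Hs _ _] := hs; exact: Hs.
    by rewrite -EFinM mulrAC mulVf ?mul1r // gt_eqF.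
  apply: (@le_trans _ _ (\int[leb R n]_(x in chart_img j) (H x)%:E)%E).
    apply: ge0_le_integral => //.
    - by move=> x jx; rewrite lee_fin mulr_ge0 ?F0 // ltW // rho_gt0.
    - by move: iF => /integrableP[].
    - exact: measurable_funTS.
  by apply: ge0_subset_integral => // x _; rewrite lee_fin.
rewrite /Rintegral -lee_fin fineK //; exact: integrable_fin_num iF.
Qed.

(** The inequality u ln q - u ln u <= q - u is integrated for q = K e^(C b). The mean of ln q is ln
    K plus C times the mean of b, and in the lower bound for the latter the term r / a cancels the
    one in ln K while n / 2 remains. *)
Lemma kernel_nash_le (d e : R) : 0 < d -> 0 < e ->
  (\forall t \near s, forall x, quad G (x - c) <= r -> rho (g t) j x <= (1 + d) * Num.sqrt (\det G)) ->
  exists2 t0 : R, 0 < t0 < s & forall t, t0 < t -> t < s ->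
    - nash g (fun i => in_chart i u) t - n%:R / 2 * ln (4 * pi * (s - t)) - n%:R / 2 <= d + e.
Proof.
move=> d0 e0 Hrho; have e1 := expR_gt0 (1 : R).
have FU := kernel_field; have FL := FL FU kernel_gt0; have Fb := static_field s bS.
have sT' : 0 < s < T by rewrite s_gt0.
pose m := vol (g s) (fun i (x : V) => 1) + 1.
have near_m : \forall t \near s, vol (g t) (fun i (x : V) => 1) < m.
  have [dv _] := is_derive_vol g_flow (lexx T) (@flow_field_cst _ _ M T 1) sT'.
  have cv : {for s, continuous (fun t => vol (g t) (fun i (x : V) => 1))}.
    by apply: differentiable_continuous; apply/derivable1_diffP.
  have [d' d'0 H] := continuous_ball cv ltr01.
  by apply: filterS (nbhsx_ballx s d' d'0) => t /H; rewrite ltr_norml /m; lra.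
have m0 : 0 < m.
  have hRs := hs; have := vol_le hRs (integrable_fieldZ (integrable_field1 hRs) 0) (integrable_field1 hRs).
  rewrite (vol_scale (integrable_field1 hRs)) mul0r /m => H.
  have : 0 * vol (g s) (fun i (x : V) => 1) <= vol (g s) (fun i (x : V) => 1).
    by apply: H => i x _; exact: ler01.
  by rewrite mul0r; lra.
(* Chosen such that C e' (s - t) = e / 2; the other half of e is spent on K times the volume. *)
pose e' := 2 * e / (r * expR 1).
have re0 : 0 < r * expR 1 by rewrite mulr_gt0.
have e'0 : 0 < e' by rewrite divr_gt0 // mulr_gt0.
have [t1 /andP[t10 t1s] Ht1] := vol_bump_lower e'0.
have em : 0 < e / (2 * m) by rewrite divr_gt0 // mulr_gt0.
have [dl dl0 Hdl] := gauss_decay n r_gt0 em.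
have [t2 /andP[t20 t2s] Ht2] := near_left_interval s_gt0 (near_at_left (filterI Hrho near_m)).
exists (Num.max (Num.max t1 t2) (s - dl / 4)).
  by rewrite !lt_max t10 /= !gt_max t1s t2s /=; lra.
move=> t; rewrite !gt_max => /andP[/andP[t1t t2t] tdl] ts.
have {}Ht1 := Ht1 t t1t ts; have {Ht2}[Ht2 Hm] := Ht2 t t2t ts.
have t0s : 0 < t < s by rewrite (lt_trans t10 t1t).
pose a := 4 * (s - t); pose k0 := (Num.sqrt (pi * a) ^+ n)^-1.
pose K := k0 * expR (- (r / a)); pose C := r * expR 1 / a.
have a0 : 0 < a by rewrite mulr_gt0 // subr_gt0.
have pa0 : 0 < pi * a by rewrite mulr_gt0 // pi_gt0.
have k00 : 0 < k0 by rewrite invr_gt0 exprn_gt0 // sqrtr_gt0.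
have K0 : 0 < K by rewrite mulr_gt0 ?expR_gt0.
have KL : ln K = - (n%:R / 2 * ln (4 * pi * (s - t))) - r / a.
  have -> : ln K = ln k0 + (- (r / a)) by rewrite [LHS]lnM ?posrE ?expR_gt0 // expRK.
  congr (_ - _); rewrite /k0 lnV ?posrE ?exprn_gt0 ?sqrtr_gt0 //; congr (- _).
  rewrite lnXn ?sqrtr_gt0 // (_ : 4 * pi * (s - t) = pi * a); last by rewrite /a; ring.
  have E2 : ln (pi * a) = 2 * ln (Num.sqrt (pi * a)).
    by rewrite -{1}(sqr_sqrtr (ltW pa0)) lnXn ?sqrtr_gt0 // mulr_natl.
  by rewrite E2 -mulr_natl; field.
have Kle : K <= e / (2 * m).
  by apply: Hdl => //; rewrite /a; lra.
have q_le := @vol_gauss_upper d t d0 t0s Ht2 a K C erefl erefl erefl.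
have hR := flow_riemannian g_flow (ltW sT) t0s.
pose q i x := K * expR (C * b (chart_inv i x)).
pose U i x := in_chart i u (x, t).
pose Ub i x := in_chart i u (x, t) * b (chart_inv i x).
pose UL i x := in_chart i u (x, t) * log_field (fun i => in_chart i u) i (x, t).
have SU : scalar_field U := flow_slice FU t0s.
have SUb : scalar_field Ub := flow_slice (flow_fieldM FU Fb) t0s.
have SUL : scalar_field UL := flow_slice (flow_fieldM FU FL) t0s.
have Sq : scalar_field q.
  apply: (@scalar_field_comp _ _ _ (fun y => K * expR (C * y)) (fun i x => b (chart_inv i x))) => [|i x _].
    exact: smooth_scalar_field bS.
  rewrite /continuous_at; apply: cvgM; first exact: cvg_cst.
  apply: (@continuous_comp _ _ _ ( *%R C) (@expR R)); last exact: continuous_expR.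
  exact: mulrl_continuous.
have IU := scalar_field_integrable hR SU; have IUb := scalar_field_integrable hR SUb.
have IUL := scalar_field_integrable hR SUL; have Iq := scalar_field_integrable hR Sq.
have J1 := integrable_fieldD (integrable_fieldZ IU (- ln K - 1)) (integrable_fieldZ IUb (- C)).
have ineq : vol (g t) (fun i x => -1 * UL i x)
    <= vol (g t) (fun i x => (- ln K - 1) * U i x + (- C) * Ub i x + q i x).
  apply: (vol_le hR (integrable_fieldZ IUL (-1)) (integrable_fieldD J1 Iq)) => i x ix.
  have u0 : 0 < U i x by exact: kernel_gt0.
  have q0 : 0 < q i x by rewrite mulr_gt0 ?expR_gt0.
  have := ln_le_subr1 (divr_gt0 q0 u0); rewrite ln_div ?posrE // /q lnM ?posrE ?expR_gt0 // expRK.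
  rewrite -(ler_pM2l u0) => H; rewrite /UL /log_field -/(U i x) /Ub -/(U i x).
  have E3 : U i x * (K * expR (C * b (chart_inv i x)) / U i x - 1) = K * expR (C * b (chart_inv i x)) - U i x.
    by field; rewrite gt_eqF.
  move: H; rewrite E3; move: (expR _) (ln (U i x)) (ln K) => X1 X2 X3; lra.
have mass : vol (g t) U = 1 by exact: kernel_mass.
move: ineq; rewrite (vol_scale IUL) (vol_add J1 Iq) (vol_add (integrable_fieldZ IU _) (integrable_fieldZ IUb _)).
rewrite (vol_scale IU) (vol_scale IUb) mass mulr1.
rewrite -[vol (g t) UL]/(nash g (fun i => in_chart i u) t).
move: Ht1; rewrite -[V_ _ _ _]/(vol (g t) Ub) => Ht1.
have C0 : 0 < C by rewrite divr_gt0.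
have {}Ht1 := ler_wpM2l (ltW C0) Ht1.
have Et : C * (expR (- 1) - (2 * n%:R * expR (- 1) / r + e') * (s - t)) = r / a - n%:R / 2 - e / 2.
  have ee : expR 1 * expR (- 1) = 1 :> R by rewrite -expRD subrr expR0.
  rewrite /C /e' /a; transitivity ((expR 1 * expR (-1)) * (r / (4 * (s - t)) - n%:R / 2) - e / 2).
    by field; rewrite !gt_eqF // subr_gt0.
  by rewrite ee mul1r.
rewrite Et in Ht1.
have Km : K * vol (g t) (fun i (x : V) => 1) <= e / 2.
  apply: (@le_trans _ _ (K * m)); first by rewrite ler_pM2l // ltW.
  apply: (@le_trans _ _ (e / (2 * m) * m)); first by rewrite ler_pM2r.
  by rewrite le_eqVlt; apply/orP; left; apply/eqP; field; rewrite gt_eqF.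
rewrite KL; move: q_le Km Ht1; rewrite -/q.
move: (r / a) (n%:R / 2) (n%:R / 2 * ln _) (nash _ _ _) (K * vol _ _) (vol (g t) q) => x1 x2 x3 x4 x5 x6.
rewrite mulN1r mulNr; move: (C * vol _ _) => x7; move=> k1 k2 k3 k4; lra.
Qed.
End Cutoff.

(** By monotonicity the entropy at t is at most that at a later time t' close to the pole, where it
    is bounded by the Nash entropy. *)
Lemma kernel_entropy_le0 t : 0 < t < s -> entropy g s (fun i => in_chart i u) t <= 0.
Proof.
move=> /andP[t0 ts]; have [j jp] := chart_cover p; pose c := chart j p; pose G := g s j c.
have hs : riemannian (g s) by have [H _ _] := g_flow; apply: H; rewrite ltW.
have jc : chart_img j c by exact: chart_imgP.
have Gpos : forall v : V, v != 0 -> 0 < (v *m G *m v^T) ord0 ord0.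
  by have [_ _ H _] := hs; exact: H.
have D0 : 0 < Num.sqrt (\det G) := rho_gt0 hs jc.
apply/ler_addgt0Pr => e e0; rewrite add0r; pose d := e / 2.
have d0 : 0 < d by rewrite divr_gt0.
have sT' : 0 < s < T by rewrite s_gt0.
have Dx : @open_spacetime R n M T j (c, s) by [].
have cR : {for (c, s), continuous (rhoFA g_flow (lexx T) j)}.
  by have := cfun_Ck (rhoFA g_flow (lexx T) j) 0; apply.
have [r1 r10 Hr1] := continuous_ball cR (mulr_gt0 d0 D0).
have [l l0 Hl] := quad_coercive Gpos.
have [r0 r00 Hr0] := quad_ball Gpos (@chart_img_open _ _ M j) jc.
have [r2 r20 Hr2] : exists2 r2 : R, 0 < r2 & forall y, ball c r2 y -> chart_img j y.
  have /nbhs_ballP[r2 r20 H] : nbhs c (chart_img j) by exact: chart_img_near.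
  by exists r2.
pose r3 := Num.min r1 r2.
have r30 : 0 < r3 by rewrite lt_min r10.
(* r <= r0 keeps the quadratic ball compact in the chart; the second bound puts it, by coercivity,
   within r3 of the centre, where the volume density at times near s exceeds that at the pole by a
   factor of at most 1 + d. *)
pose r := Num.min r0 (l * r3 ^+ 2 / 2).
have r_gt0 : 0 < r by rewrite lt_min r00 divr_gt0 // mulr_gt0 // exprn_gt0.
have gml (x y : R) : Num.min x y <= x by rewrite ge_min lexx.
have [cB Bj] := Hr0 r (gml _ _).
have Hrho : \forall t \near s, forall x, quad G (x - c) <= r ->
    rho (g t) j x <= (1 + d) * Num.sqrt (\det G).
  have nT : \forall t \near s, 0 < t < T.
    have : s \in `]0, T[%R by rewrite in_itv.
    by move=> /near_in_itvoo; apply: filterS => q; rewrite in_itv.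
  apply: filterS2 nT (nbhsx_ballx s r1 r10) => q qT qs x xr.
  have xc : `|x - c| < r3.
    rewrite -(@ltr_pXn2r _ 2) ?nnegrE ?(ltW r30) // -(ltr_pM2l l0).
    apply: le_lt_trans (Hl _) _; apply: le_lt_trans xr _; rewrite /r.
    apply: le_lt_trans (_ : _ <= l * r3 ^+ 2 / 2) _; first by rewrite ge_min lexx orbT.
    by rewrite ltr_pdivrMr // ltr_pMr ?mulr_gt0 ?exprn_gt0 // ltr1n.
  have xb r' : r3 <= r' -> ball c r' x by move=> r3r'; rewrite -ball_normE /= distrC; exact: lt_le_trans r3r'.
  have jx : chart_img j x by apply/Hr2/xb; rewrite ge_min lexx orbT.
  have := Hr1 (x, q) (conj (xb _ (gml _ _)) qs).
  rewrite -!(flow_rhoE g_flow (lexx T)) // -[rho (g s) j c]/(Num.sqrt (\det G)) ltr_norml.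
  by move=> /andP[_]; rewrite mulrDl mul1r; lra.
have [t1 /andP[t10 t1s] Ht1] := kernel_nash_le jp r_gt0 cB Bj d0 d0 Hrho.
pose t' := (Num.max t t1 + s) / 2.
have m1 : Num.max t t1 < s by rewrite gt_max ts.
have tm : t <= Num.max t t1 by rewrite le_max lexx.
have t1m : t1 <= Num.max t t1 by rewrite le_max lexx orbT.
have t'1 : t1 < t' by rewrite /t'; move: (Num.max t t1) m1 tm t1m => m; lra.
have t't : t <= t' by rewrite /t'; move: (Num.max t t1) m1 tm t1m => m; lra.
have t's : t' < s by rewrite /t'; move: (Num.max t t1) m1 tm t1m => m; lra.
have FU := kernel_field.
have ent := entropy_le g_flow (ltW sT) FU kernel_gt0 kernel_heat kernel_mass t0 t't t's.
apply: le_trans ent _.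
have t'0s : 0 < t' < s by rewrite (lt_le_trans t0 t't).
apply: le_trans (entropy_le_nash g_flow (ltW sT) FU kernel_gt0 kernel_heat kernel_mass t'0s) _.
by apply: le_trans (Ht1 t' t'1 t's) _; rewrite /d; lra.
Qed.
End Kernel.

(** * Derivatives of monotone functions *)

Lemma near_at_right (R : realType) (s : R) (P : R -> Prop) :
  (\forall t \near s, P t) -> \forall t \near s^'+, P t.
Proof.
move=> nP; have H : nbhs s [set t | s < t -> P t] by apply: filterS nP => t Pt _.
exact: H.
Qed.

Lemma near_dnbhs_right (R : realType) (s : R) (P : R -> Prop) :
  (\forall t \near s^', P t) -> \forall t \near s^'+, P t.
Proof.
move=> nP; have H : nbhs s [set t | t != s -> P t] by exact: nP.
have H2 : nbhs s [set t | s < t -> P t].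
  by apply: filterS H => t Pt st; apply: Pt; rewrite gt_eqF.
exact: H2.
Qed.

Section MonotoneDerivative.
Variables (R : realType) (theta : R -> R) (T : R).
Hypothesis theta_nd : forall x y, x <= y -> theta x <= theta y.
Local Notation mu := (@lebesgue_measure R).
Local Notation RR := (measurableTypeR R).

Let D : set RR := `]0, T[%classic.

(* [beta] expands distances, so that its inverse [alpha] is 1-Lipschitz. *)
Let beta (t : R) : R := t + theta t.

Let beta_lt x y : x <= y -> y - x <= beta y - beta x.
Proof. by move=> xy; have := theta_nd xy; rewrite /beta; lra. Qed.

Let beta_nd x y : x <= y -> beta x <= beta y.
Proof. by move=> xy; have := beta_lt xy; lra. Qed.

Let mbeta : measurable_fun [set: RR] (beta : RR -> RR).
Proof. by apply: nondecreasing_measurable => // x y; exact: beta_nd. Qed.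

Let mD : measurable D. Proof. exact: measurable_itv. Qed.

Let mpre (A : set RR) : measurable A -> measurable (D `&` beta @^-1` A).
Proof. by move=> mA; apply: measurableI => //; rewrite -[X in measurable X]setTI; exact: mbeta. Qed.

(** Push-forward under [beta] of Lebesgue measure on the interval from 0 to T. *)
Definition time_measure (A : set RR) : \bar R := mu (D `&` beta @^-1` A).
Local Notation nu := time_measure.

Let nu0 : nu set0 = 0%E. Proof. by rewrite /nu preimage_set0 setI0 measure0. Qed.

Let nu_ge0 A : (0 <= nu A)%E. Proof. exact: measure_ge0. Qed.

Let nu_sigma_additive : semi_sigma_additive nu.
Proof.
move=> F mF tF mUF; rewrite /nu preimage_bigcup setI_bigcupr.
apply: measure_semi_sigma_additive.
- by move=> k; exact: mpre.
- apply/trivIsetP => i j _ _ ij; rewrite setIACA setIid -preimage_setI.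
  by move/trivIsetP : tF => /(_ _ _ I I ij) ->; rewrite preimage_set0 setI0.
- by rewrite -setI_bigcupr -preimage_bigcup; exact: mpre.
Qed.

HB.instance Definition _ := isMeasure.Build _ _ _ nu nu0 nu_ge0 nu_sigma_additive.

Let nu_fin : fin_num_fun nu.
Proof.
move=> A mA; rewrite ge0_fin_numE //; apply: (@le_lt_trans _ _ (mu D)).
  by apply: le_measure; rewrite ?inE //; exact: mpre.
by rewrite lebesgue_measure_itv /=; case: ifP => _; rewrite ?ltry.
Qed.

HB.instance Definition _ := Measure_isFinite.Build _ _ _ nu nu_fin.

(** As [beta] expands distances, the times that it sends into an interval lie in an interval of the
    same length. *)
Let nu_itv_le (a b : R) : a <= b -> (nu `]a, b]%classic <= (b - a)%:E)%E.
Proof.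
move=> ab; set S := D `&` beta @^-1` `]a, b]%classic.
have [S0|/set0P[x0 Sx0]] := eqVneq S set0; first by rewrite /nu -/S S0 measure0 lee_fin subr_ge0.
have SD x y : S x -> S y -> x - (b - a) <= y.
  move=> [_ /=]; rewrite in_itv /= => /andP[_ xb] [_ /=]; rewrite in_itv /= => /andP[ya _].
  have [yx|/ltW xy] := leP y x; first by have := beta_lt yx; lra.
  lra.
have infS : has_inf S.
  by split; [exists x0|exists 0 => x [/=]; rewrite in_itv /= => /andP[/ltW]].
have sub : S `<=` `[inf S, inf S + (b - a)]%classic.
  move=> x Sx /=; rewrite in_itv /=; apply/andP; split; first exact: ge_inf infS.2 _ Sx.
  by rewrite -lerBlDr; apply: lb_le_inf infS.1 _ => y Sy; exact: SD.
apply: (@le_trans _ _ (mu `[inf S, inf S + (b - a)]%classic)).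
  by apply: le_measure => //; rewrite inE //; exact: mpre.
by rewrite lebesgue_measure_itv /= lte_fin -EFinB; case: ifP => _; rewrite lee_fin; lra.
Qed.

(** Distribution function of [nu]: a left inverse of [beta] on the time interval, and constant over
    its jumps. *)
Definition time_of (y : R) : R := fine (nu `]-oo, y]%classic).
Local Notation alpha := time_of.

Let alphaE y : nu `]-oo, y]%classic = (alpha y)%:E.
Proof. by rewrite fineK // nu_fin. Qed.

Let alpha_itv a b : a <= b -> nu `]a, b]%classic = (alpha b - alpha a)%:E.
Proof.
move=> ab; have E : `]-oo, b]%classic = `]-oo, a]%classic `|` `]a, b]%classic :> set R.
  apply/seteqP; split=> x /=; rewrite !in_itv /=.
    by move=> xb; have [xa|xa] := leP x a; [left|right; rewrite xb].
  by case; [move=> /le_trans; apply|move=> /andP[]].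
have dis : `]-oo, a]%classic `&` `]a, b]%classic = set0 :> set R.
  apply/seteqP; split=> // x [/=]; rewrite !in_itv /= => xa /andP[ax _].
  by move: (le_lt_trans xa ax); rewrite ltxx.
have U : nu (`]-oo, a]%classic `|` `]a, b]%classic) = (nu `]-oo, a]%classic + nu `]a, b]%classic)%E.
  exact: measureU.
have := alphaE b; rewrite E U alphaE => H.
have f1 : nu `]a, b]%classic \is a fin_num by exact: nu_fin.
by move: H; rewrite -(fineK f1) -EFinD => -[<-]; congr EFin; lra.
Qed.

Let alpha_lip a b : a <= b -> 0 <= alpha b - alpha a <= b - a.
Proof.
by move=> ab; rewrite -!lee_fin -(alpha_itv ab) nu_ge0 nu_itv_le.
Qed.

(** Nondecreasing since [alpha] is 1-Lipschitz. Its Stieltjes measure and [nu] add up to Lebesgue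
    measure, whence [nu] is absolutely continuous. *)
Definition time_gap (y : R) : R := y - alpha y.

Let gap_nd : {homo time_gap : x y / x <= y}.
Proof. by move=> x y xy; have := alpha_lip xy; rewrite /time_gap; lra. Qed.

Let gap_rc : forall x, time_gap y @[y --> x^'+] --> time_gap x.
Proof.
move=> x; apply/cvgrPdist_lt => e e0; near=> y.
have xy : x <= y by near: y; exact: nbhs_right_ge.
have yx : y < x + e by near: y; apply: nbhs_right_lt; lra.
have := alpha_lip xy; have := gap_nd xy; rewrite /time_gap => h1 h2.
by rewrite distrC ger0_norm; lra.
Unshelve. all: by end_near. Qed.

HB.instance Definition _ := isCumulative.Build R _ R time_gap gap_nd gap_rc.

Let nu_dom : nu `<< mu.
Proof.
apply/null_content_dominatesP => A mA A0.
have E := @lebesgue_measure_unique R (measure_add nu (lebesgue_stieltjes_measure time_gap)).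
have {E}E : mu A = measure_add nu (lebesgue_stieltjes_measure time_gap) A.
  apply: E => // _ [[a b] /= _ <-]; apply: etrans _ (esym (measure_addE _ _ _)).
  have [ab|ba] := leP a b; last first.
    have -> : `]a, b]%classic = set0 :> set R by rewrite set_itv_ge ?bnd_simp -?leNgt //; exact: ltW.
    have e1 : mu set0 = 0%E by exact: measure0.
    have e2 : nu set0 = 0%E by exact: measure0.
    have e3 : lebesgue_stieltjes_measure time_gap set0 = 0%E by exact: measure0.
    exact: etrans e1 (esym (etrans (f_equal2 (fun x y => (x + y)%E) e2 e3) (adde0 _))).
  have e1 : lebesgue_stieltjes_measure time_gap `]a, b]%classic = (time_gap b - time_gap a)%:E.
    rewrite /lebesgue_stieltjes_measure/= /measure_extension/= measurable_mu_extE/=; last exact: is_ocitv.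
    exact: wlength_itv_bnd.
  apply: etrans _ (esym (f_equal2 (fun x y => (x + y)%E) (alpha_itv ab) e1)).
  have e2 : mu `]a, b]%classic = (b - a)%:E.
    rewrite lebesgue_measure_itv /= lte_fin -EFinB.
    by case: ltP => // ba; rewrite (le_anti (introT andP (conj ab ba))) subrr.
  by apply: etrans e2 _; rewrite -EFinD; congr EFin; rewrite /time_gap; ring.
have {}A0 : mu A = 0%E by exact: A0.
have {}E := etrans E (measure_addE _ _ _); rewrite A0 in E.
have ge : (0 <= lebesgue_stieltjes_measure time_gap A)%E by exact: measure_ge0.
by apply/eqP; rewrite eq_le nu_ge0 andbT; apply: le_trans (leeDl (nu A) ge) _; rewrite -E.
Qed.

Let f := Radon_Nikodym_SigmaFinite.f (nu : {finite_measure set RR -> \bar R}) mu.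

(** [alpha] is the integral of a Radon-Nikodym density, so Lebesgue differentiation applies. *)
Let alpha_derivable : {ae mu, forall y, derivable alpha y 1}.
Proof.
have fi : mu.-integrable setT f by exact: (Radon_Nikodym_SigmaFinite.f_integrable nu_dom).
have ff x : f x \is a fin_num by exact: (Radon_Nikodym_SigmaFinite.f_fin_num nu_dom).
have fE : EFin \o (fine \o f) = f by apply/funext => x; rewrite /= fineK.
have gi : mu.-integrable setT (EFin \o (fine \o f)) by rewrite fE.
have gy y : mu.-integrable `]-oo, y]%classic (EFin \o (fine \o f)).
  by apply: integrableS gi.
have := FTC1Ny gy (open_integrable_locally openT gi).
have -> : (fun x => \int[mu]_(t in [set` `]-oo, x]]) (fine \o f) t) = alpha.
  apply/funext => x; rewrite /alpha /Rintegral; congr fine.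
  rewrite (Radon_Nikodym_SigmaFinite.f_integral nu_dom) //.
  by apply: eq_integral => t _; rewrite /= fineK.
by apply: negligibleS => y /= H H'; apply: H; case: H'.
Qed.

(** The exceptional values of [beta] form a Lebesgue null set, which is also [nu]-null; this says
    that the exceptional times are null. *)
Let alpha_derivable_time : {ae mu, forall t, 0 < t < T -> derivable alpha (beta t) 1}.
Proof.
have [B [mB B0 HB]] := alpha_derivable.
have /null_content_dominatesP dom := nu_dom; have nB : nu B = 0%E by exact: dom.
exists (D `&` beta @^-1` B); split; [exact: mpre|exact: nB|].
move=> t /= H; have tT : 0 < t < T by apply: contrapT => h; apply: H.
split; first by rewrite /D /= in_itv.
by apply: HB => /= H'; apply: H.
Qed.

Let alpha_beta t : 0 < t < T -> alpha (beta t) = t.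
Proof.
move=> /andP[t0 tT]; rewrite /alpha /nu.
have -> : D `&` beta @^-1` `]-oo, beta t]%classic = `]0, t]%classic.
  apply/seteqP; split=> x; rewrite /D /= !in_itv /=.
    move=> [/andP[x0 xT] bx]; rewrite x0 /=; have [//|tx] := leP x t.
    by have := beta_lt (ltW tx); lra.
  by move=> /andP[x0 xt]; rewrite x0 (le_lt_trans xt tT) beta_nd.
by rewrite lebesgue_measure_itv /= lte_fin t0 oppr0 adde0.
Qed.

(** The difference quotients of [beta] at t are the inverses of those of [alpha] at [beta t]. To
    pass to the limit, the derivative A of [alpha] must be nonzero and [beta] continuous at t; the
    touching function secures the first, and A > 0 then implies the second. *)
Lemma monotone_derivable_ae : {ae mu, forall t, 0 < t < T ->
  (exists phi : R -> R, [/\ derivable phi t 1, phi t = theta t &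
     \forall r \near t, theta r <= phi r]) -> derivable theta t 1}.
Proof.
apply: (negligibleS _ alpha_derivable_time) => t /= Ht dal; apply: Ht => t0T [phi [dphi phit phir]].
have {dal}dal := dal t0T; set y0 := beta t; pose A := 'D_1 alpha y0.
have qa : (k^-1 * (alpha (y0 + k) - t)) @[k --> (0 : R)^'] --> A.
  have := dal; rewrite /derivable => /cvg_ex[l Hl].
  have -> : A = l by rewrite /A /derive; exact: cvg_lim Hl.
  apply: cvg_trans Hl; apply: near_eq_cvg; near=> k.
  by rewrite /= [k%:A]mulr1 (addrC k) -[in RHS](alpha_beta t0T).
have nT : \forall h \near (0 : R), 0 < t + h < T.
  have ct : (t + e) @[e --> (0 : R)] --> t.
    by rewrite -[X in _ --> X]addr0; apply: cvgD; [exact: cvg_cst|exact: cvg_id].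
  have H : \forall r \near t, 0 < r < T.
    by have /near_in_itvoo := (t0T : t \in `]0, T[%R); apply: filterS => r; rewrite in_itv.
  exact: (ct _ H).
pose k h := beta (t + h) - y0.
have ak h : 0 < t + h < T -> alpha (y0 + k h) - t = h.
  by move=> hT; rewrite /k (_ : y0 + (beta (t + h) - y0) = beta (t + h)) ?alpha_beta //; ring.
have k_gt0 h : 0 < h -> h <= k h.
  by move=> h0; rewrite /k /y0; have := @beta_lt t (t + h); rewrite lerDl (ltW h0) => /(_ isT); lra.
have k_lt0 h : h < 0 -> k h <= h.
  move=> h0; rewrite /k /y0; have := @beta_lt (t + h) t.
  by rewrite gerDl (ltW h0) => /(_ isT); lra.
have k_neq0 h : h != 0 -> k h != 0.
  by rewrite neq_lt => /orP[/[dup] h0 /k_lt0|/[dup] h0 /k_gt0] kh; rewrite neq_lt; apply/orP; [left|right]; lra.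
have nT' : \forall h \near (0 : R)^'+, 0 < t + h < T by exact: near_at_right.
(* The touching function bounds the right increments of theta by |l| + 1 times h; the linear part of
   [beta] adds 1. *)
have [C C0 HC] : exists2 C : R, 0 < C & \forall h \near (0 : R)^'+, k h <= C * h.
  have /cvg_ex[l Hl] := dphi; have /cvgrPdist_lt/(_ 1 ltr01) Hl1 := Hl.
  exists (`|l| + 2); first by have := normr_ge0 l; lra.
  have Hl2 : \forall h \near (0 : R)^'+, `|l - h^-1 *: ((phi \o shift t) h%:A - phi t)| < 1.
    exact: (near_dnbhs_right Hl1).
  have Hr : \forall h \near (0 : R)^'+, theta (t + h) <= phi (t + h).
    have ct : (t + e) @[e --> (0 : R)] --> t.
      by rewrite -[X in _ --> X]addr0; apply: cvgD; [exact: cvg_cst|exact: cvg_id].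
    have H := ct _ phir; exact: near_at_right.
  near=> h; have h0 : 0 < h by near: h; exact: nbhs_right_gt.
  have H1 : `|l - h^-1 *: ((phi \o shift t) h%:A - phi t)| < 1 by near: h.
  have H2 : theta (t + h) <= phi (t + h) by near: h.
  move: H1; rewrite /= [h%:A]mulr1 addrC ltr_norml => /andP[H1 _].
  have H3 : h^-1 * (phi (h + t) - phi t) <= `|l| + 1.
    by have := ler_norm l; move: H1; rewrite /GRing.scale /=; lra.
  rewrite mulrC ler_pdivrMr // in H3; rewrite (addrC h) in H3.
  by rewrite /k /y0 /beta -phit; lra.
have k0r : k h @[h --> (0 : R)^'+] --> (0 : R)^'.
  move=> P; rewrite /dnbhs /within /= => HP.
  have ck : k h @[h --> (0 : R)^'+] --> (0 : R).
    apply: (@squeeze_cvgr _ _ _ _ (fun=> 0) (fun h => C * h)).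
    - near=> h; have h0 : 0 < h by near: h; exact: nbhs_right_gt.
      rewrite (le_trans (ltW h0) (k_gt0 _ h0)) /=; near: h; exact: HC.
    - exact: cvg_cst.
    - rewrite -[X in _ --> X](mulr0 C); apply: cvg_within_filter; exact: mulrl_continuous.
  have := ck _ HP; apply: filterS2 (nbhs_right_gt (0 : R)) => h h0 H; apply: H.
  by rewrite k_neq0 // gt_eqF.
have A0 : 0 < A.
  apply: (@lt_le_trans _ _ C^-1); first by rewrite invr_gt0.
  have H := cvg_comp _ _ k0r qa; rewrite -(cvg_lim (@Rhausdorff R) H); apply: limr_ge.
    by apply/cvg_ex; exists A.
  near=> h; have h0 : 0 < h by near: h; exact: nbhs_right_gt.
  have hT : 0 < t + h < T by near: h.
  have kC : k h <= C * h by near: h.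
  rewrite /= ak // ler_pdivlMl ?(lt_le_trans h0 (k_gt0 _ h0)) //.
  by rewrite ler_pdivrMr // mulrC.
(* A jump at t would make [alpha] constant on one side of y0. As A > 0, [alpha] is below t at y0 -
   e' and above t at y0 + e', and for small h the time t + h lies between these values, which
   confines [beta (t + h)]. *)
have k0 : k h @[h --> (0 : R)^'] --> (0 : R)^'.
  have /cvgrPdist_lt/(_ A A0) := qa; rewrite /dnbhs /within /= => /nbhs_ballP[d /= d0 Hd].
  have pos e : e != 0 -> `|e| < d -> 0 < e^-1 * (alpha (y0 + e) - t).
    move=> e0 ed; have := Hd e; rewrite -ball_normE /= sub0r normrN => /(_ ed e0).
    by rewrite ltr_norml => /andP[]; lra.
  move=> P /nbhs_ballP[e /= e0 He].
  pose e' := Num.min (e / 2) (d / 2).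
  have e'0 : 0 < e' by rewrite lt_min !divr_gt0.
  have e'd : e' < d by rewrite (@le_lt_trans _ _ (d / 2)) ?ge_min ?lexx ?orbT //; lra.
  have e'e : e' < e by rewrite (@le_lt_trans _ _ (e / 2)) ?ge_min ?lexx //; lra.
  have up : t < alpha (y0 + e').
    have := pos e'; rewrite gt_eqF // gtr0_norm // => /(_ isT e'd).
    by rewrite pmulr_rgt0 ?invr_gt0 // subr_gt0.
  have dn : alpha (y0 - e') < t.
    have := pos (- e'); rewrite oppr_eq0 gt_eqF // normrN gtr0_norm // => /(_ isT e'd).
    by rewrite invrN mulNr -mulrN pmulr_rgt0 ?invr_gt0 // opprB subr_gt0.
  have nb : \forall h \near (0 : R), alpha (y0 - e') < t + h < alpha (y0 + e').
    have ct : (t + h) @[h --> (0 : R)] --> t.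
      by rewrite -[X in _ --> X]addr0; apply: cvgD; [exact: cvg_cst|exact: cvg_id].
    have tI : t \in `](alpha (y0 - e')), (alpha (y0 + e'))[%R by rewrite in_itv /= dn up.
    have H : \forall r \near t, alpha (y0 - e') < r < alpha (y0 + e').
      by have /near_in_itvoo := tI; apply: filterS => r; rewrite in_itv.
    exact: (ct _ H).
  rewrite /dnbhs /within /=; apply: filterS2 nb nT => h /andP[h1 h2] hT h0.
  apply: He; last exact: k_neq0.
  have a_nd x y : x <= y -> alpha x <= alpha y by move=> xy; have := alpha_lip xy; lra.
  have b1 : y0 - e' <= beta (t + h).
    rewrite leNgt; apply/negP => /ltW /a_nd; rewrite alpha_beta //; lra.
  have b2 : beta (t + h) <= y0 + e'.
    rewrite leNgt; apply/negP => /ltW /a_nd; rewrite alpha_beta //; lra.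
  rewrite -ball_normE /= sub0r normrN; apply: le_lt_trans e'e.
  by rewrite ler_norml /k; apply/andP; split; lra.
have q := cvgV (lt0r_neq0 A0) (cvg_comp _ _ k0 qa).
have nT0 : \forall h \near (0 : R)^', 0 < t + h < T by exact: nbhs_dnbhs nT.
apply/cvg_ex; exists (A^-1 - 1).
have q1 : (h^-1 * k h - 1) @[h --> (0 : R)^'] --> A^-1 - 1.
  apply: cvgB; last exact: cvg_cst.
  have {}q := q ltac:(exact _).
  apply: cvg_trans q; apply: near_eq_cvg; apply: filterS nT0 => h hT.
  by rewrite /= /unstable.inv_fun /= ak // invfM invrK mulrC.
apply: cvg_trans q1; apply: near_eq_cvg; near=> h.
have h0 : h != 0 by near: h; exact: nbhs_dnbhs_neq.
rewrite /= [h%:A]mulr1 (addrC h) /k /y0 /beta /GRing.scale /=.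
by field.
Unshelve. all: by end_near. Qed.
End MonotoneDerivative.

(** * Kernels based at the singular time *)

Section MatrixLimits.
Variables (R : realType) (I : Type) (Phi : set_system I).
Context {FPhi : Filter Phi}.

Lemma cvg_prodr (J : Type) (r : seq J) (P : pred J) (f : J -> I -> R) (l : J -> R) :
  (forall j, P j -> f j x @[x --> Phi] --> l j) ->
  (\prod_(j <- r | P j) f j x) @[x --> Phi] --> \prod_(j <- r | P j) l j.
Proof.
move=> fl; elim: r => [|j r ih].
  by rewrite big_nil; under eq_cvg do rewrite big_nil; exact: cvg_cst.
rewrite big_cons; under eq_cvg do rewrite big_cons.
by case: ifP => // Pj; apply: cvgM => //; exact: fl.
Qed.

Lemma cvg_det n (A : I -> 'M[R]_n) (B : 'M[R]_n) :
  (forall a b, A x a b @[x --> Phi] --> B a b) -> \det (A x) @[x --> Phi] --> \det B.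
Proof.
move=> AB; rewrite /determinant; apply: cvg_sumr => s _; apply: cvgM; first exact: cvg_cst.
by apply: cvg_prodr => a _; exact: AB.
Qed.

Lemma cvg_adjugate n (A : I -> 'M[R]_n) (B : 'M[R]_n) a b :
  (forall a b, A x a b @[x --> Phi] --> B a b) -> \adj (A x) a b @[x --> Phi] --> \adj B a b.
Proof.
move=> AB; rewrite mxE /cofactor; under eq_cvg do rewrite mxE /cofactor.
apply: cvgM; first exact: cvg_cst.
by apply: cvg_det => c d; rewrite !mxE; under eq_cvg do rewrite !mxE; exact: AB.
Qed.

Lemma cvg_invmx n (A : I -> 'M[R]_n) (B : 'M[R]_n) a b : \det B != 0 ->
  (forall a b, A x a b @[x --> Phi] --> B a b) -> invmx (A x) a b @[x --> Phi] --> invmx B a b.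
Proof.
move=> B0 AB; have d := cvg_det AB.
have nz : \forall x \near Phi, \det (A x) != 0 by exact: (cvgr_neq0 (\det B) d B0).
have q : ((\det (A x))^-1 * \adj (A x) a b) @[x --> Phi] --> (\det B)^-1 * \adj B a b.
  by apply: cvgM; [exact: (cvgV B0 d)|exact: cvg_adjugate].
have -> : invmx B a b = (\det B)^-1 * \adj B a b by rewrite /invmx unitmxE unitfE B0 mxE.
apply: cvg_trans q; apply: near_eq_cvg; apply: filterS nz => x nx.
by apply: esym; rewrite /invmx unitmxE unitfE nx mxE.
Qed.
End MatrixLimits.

Lemma vol_cvg_prod (R : realType) (n : nat) (M : closedManifold R n) (h : metric M)
    (hR : riemannian h) (I : Type) (Phi : set_system I) (FPhi : Filter Phi)
    (H : I -> 'I_(charts M) -> 'rV[R]_n -> R) (G : 'I_(charts M) -> 'rV[R]_n -> R) :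
  (\forall a \near Phi, scalar_field (H a)) -> scalar_field G ->
  (forall i x, chart_img i x -> H z.2 i z.1 @[z --> filter_prod (nbhs x) Phi] --> G i x) ->
  vol h (H a) @[a --> Phi] --> vol h G.
Proof.
move=> nH FG Hc; apply: (vol_cvg hR FPhi nH FG) => i x ix e e0.
have cG : G i z.1 @[z --> filter_prod (nbhs x) Phi] --> G i x.
  have cx : G i y @[y --> x] --> G i x := field_continuous FG ix.
  by apply: cvg_comp cx; exact: cvg_fst.
have : (H z.2 i z.1 - G i z.1) @[z --> filter_prod (nbhs x) Phi] --> 0.
  by rewrite -(subrr (G i x)); apply: cvgB; [exact: Hc|].
by move=> /cvgr0Pnorm_lt/(_ e e0).
Qed.

Section SpacetimeDerivatives.
Variables (R : realType) (n : nat) (M : closedManifold R n) (T : R) (g : R -> metric M).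
Hypothesis g_flow : ricci_flow T g.
Local Notation V := 'rV[R]_n.
Local Notation E := ('rV[R]_n * R)%type.
Local Notation ST := (@open_spacetime R n M T).
Local Notation dir k := ((unit_vec R k, 0) : E).
Local Notation derives l F := (foldr (fun (v : E) G => 'D_v G) F l).
Implicit Types (i : 'I_(charts M)) (x : V) (t : R) (F : E -> R).

Lemma iter_pderivE i l F z : ST i z -> iter_pderiv (spacetime T i) l F z = derives l F z.
Proof.
elim: l z => [//|w l ih] z Dz; have oST := @open_spacetime_open R n M T i.
rewrite -[LHS]/(pderiv (spacetime T i) w (iter_pderiv (spacetime T i) l F) z).
rewrite -[RHS]/('D_w (derives l F) z).
rewrite pderiv_interior; last first.
  have : \forall y \near z, ST i y by apply: open_nbhs_nbhs; split.
  by apply: filterS => y [iy /andP[y0 ys]]; split=> //=; rewrite ltW.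
by apply: (@eq_derive_open _ _ (ST i)) => // y; rewrite inE; exact: ih.
Qed.

Lemma partial_slice i k F x t : chart_img i x ->
  partial i k (fun y => F (y, t)) x = 'D_(dir k) F (x, t).
Proof.
by move=> ix; rewrite partialE //; exact: (derive_slice (@slice_line R n t) F (unit_vec R k) x).
Qed.

Lemma partial2_slice i k l F x t : chart_img i x ->
  partial i k (partial i l (fun y => F (y, t))) x = 'D_(dir k) ('D_(dir l) F) (x, t).
Proof.
move=> ix; rewrite -(partial_slice k ('D_(dir l) F) t ix).
apply: (eq_partial k (@chart_img_open _ _ M i) (@subset_refl _ _) ix) => y iy.
exact: partial_slice.
Qed.

(** The form in which limits are taken: a finite combination of spacetime derivatives with
    coefficients that depend on the metric alone. *)
Lemma lap_slice (F : 'I_(charts M) -> E -> R) i x t : chart_img i x ->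
  lap_field g F i (x, t) = \sum_a \sum_b invmx (g t i x) a b *
    ('D_(dir b) ('D_(dir a) (F i)) (x, t)
     - \sum_m christoffel (g t) i m b a x * 'D_(dir m) (F i) (x, t)).
Proof.
move=> ix; rewrite /lap_field /laplacian /mxtrace; apply: eq_bigr => a _.
rewrite mxE; apply: eq_bigr => b _; rewrite mxE partial2_slice //; congr (_ * (_ - _)).
by apply: eq_bigr => m _; rewrite partial_slice.
Qed.

Lemma grad_log_slice (s : R) (F : 'I_(charts M) -> E -> R) i x t : @flow_field R n M s F ->
  chart_img i x -> 0 < t < s -> 0 < F i (x, t) ->
  grad_field g (log_field F) i (x, t) = \sum_a \sum_b invmx (g t i x) a b *
    ((F i (x, t))^-1 * 'D_(dir a) (F i) (x, t)) * ((F i (x, t))^-1 * 'D_(dir b) (F i) (x, t)).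
Proof.
move=> FF ix ts F0.
have p k : partial i k (fun y => log_field F i (y, t)) x = (F i (x, t))^-1 * 'D_(dir k) (F i) (x, t).
  rewrite partial_slice //.
  have [_ dF _] := flow_Ck FF i 1.
  have /derivableP dFk := dF (x, t) (dir k) (conj ix ts).
  by have [_ <-] := is_derive_scalar_comp dFk (is_derive1_ln F0).
by apply: eq_bigr => a _; apply: eq_bigr => b _; rewrite !p.
Qed.

Section Limit.
Variables (v : nat -> M -> R -> R) (u : M -> R -> R).
Hypotheses (vu : smooth_limit T v u) (Su : smooth_spacetime T u).

(** Uniform convergence on a compact quadratic ball at the fixed time t, combined with continuity of
    the limit. Convergence in the point and in the index together is what [vol_cvg_prod]
    consumes. *)
Lemma joint_limit i l x t : chart_img i x -> 0 < t < T ->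
  derives l (in_chart i (v z.2)) (z.1, t) @[z --> filter_prod (nbhs x) \oo]
  --> derives l (in_chart i u) (x, t).
Proof.
move=> ix tT; have [t0 ts] := andP tT; pose D := spacetime T i; pose G := g t i x.
have Gpos (w : V) : w != 0 -> 0 < (w *m G *m w^T) ord0 ord0.
  by have [_ _ H _] := flow_riemannian g_flow (lexx T) tT; exact: H.
have [r r0 Hr] := quad_ball Gpos (@chart_img_open _ _ M i) ix.
have {Hr}[cB Bi] := Hr r (lexx r).
pose K : set E := [set y | quad G (y - x) <= r] `*` [set t].
have cK : compact K by apply: compact_setX => //; exact: compact_set1.
have KD : K `<=` D by move=> [y b] [/= /Bi iy ->]; split=> //=; rewrite ltW.
apply/cvgrPdist_lt => e e0; have e2 : 0 < e / 2 by rewrite divr_gt0.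
have nK := @vu i l K cK KD (e / 2) e2.
have nB : \forall y \near x, quad G (y - x) <= r.
  have /continuous_ball/(_ r0)[d d0 Hd] := Ck_continuous (quad_Ck G 0 x openT) (I : [set: V] x).
  apply: filterS (nbhsx_ballx x d d0) => y /Hd.
  have -> : quad G (x - x) = 0 by rewrite subrr /quad !mul0mx mxE.
  by rewrite subr0 => /ltW; apply: le_trans; exact: ler_norm.
have nC : \forall y \near x,
    `|iter_pderiv D l (in_chart i u) (y, t) - iter_pderiv D l (in_chart i u) (x, t)| < e / 2.
  have SD : ST i `<=` D by move=> [y b] [iy /andP[b0 bT]]; split=> //=; rewrite ltW.
  have C := smooth_Ck 0 l (@open_spacetime_open R n M T i) SD (@Su i).
  have /continuous_ball/(_ e2)[d d0 Hd] := C (x, t) (conj ix tT).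
  apply: filterS (nbhsx_ballx x d d0) => y xy; apply: Hd; split=> //=; exact: ballxx.
exists ([set y | quad G (y - x) <= r /\
    `|iter_pderiv D l (in_chart i u) (y, t) - iter_pderiv D l (in_chart i u) (x, t)| < e / 2],
  [set k | forall z, K z -> `|iter_pderiv D l (in_chart i (v k)) z
     - iter_pderiv D l (in_chart i u) z| < e / 2]) => /=; first by split=> //; exact: filterI.
move=> [y k] [/= [yr yc] /(_ (y, t) (conj yr erefl)) Hk].
rewrite -(@iter_pderivE i l _ (x, t)) // -(@iter_pderivE i l _ (y, t)); last by split=> //; exact: Bi.
rewrite distrC; have := ler_normD (iter_pderiv D l (in_chart i (v k)) (y, t) - iter_pderiv D l (in_chart i u) (y, t))
  (iter_pderiv D l (in_chart i u) (y, t) - iter_pderiv D l (in_chart i u) (x, t)).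
rewrite addrA subrK => /le_lt_trans; apply; move: Hk yc.
by move: (`|_|) (`|_|) => A B; lra.
Qed.

Lemma pointwise_limit i l x t : chart_img i x -> 0 < t < T ->
  derives l (in_chart i (v k)) (x, t) @[k --> \oo] --> derives l (in_chart i u) (x, t).
Proof.
move=> ix tT; have H : (x, k) @[k --> \oo] --> filter_prod (nbhs x) \oo.
  move=> A [[P Q] /= [nP nQ] sub]; apply: filterS nQ => k Qk.
  by apply: (sub (x, k)); split=> //=; exact: nbhs_singleton nP.
by move=> A HA; exact: (H _ (@joint_limit i l x t ix tT A HA)).
Qed.
End Limit.
End SpacetimeDerivatives.

Section SingularKernel.
Variables (R : realType) (n : nat) (M : closedManifold R n) (T : R) (g : R -> metric M).
Hypothesis g_flow : ricci_flow T g.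
Variables (p : M) (u : M -> R -> R) (s : nat -> R) (v : nat -> M -> R -> R).
Hypotheses (s_in : forall k, 0 < s k < T) (s_lim : s k @[k --> \oo] --> T).
Hypotheses (Hv : forall k, adjoint_heat_kernel g p (s k) (v k)) (vu : smooth_limit T v u).
Hypothesis Su : smooth_spacetime T u.
Hypothesis u_gt0 : forall q t, 0 < t < T -> 0 < u q t.
Local Notation V := 'rV[R]_n.
Local Notation E := ('rV[R]_n * R)%type.
Local Notation time_dir := ((0, 1) : E).
Local Notation dir k := ((unit_vec R k, 0) : E).
Local Notation ST := (@open_spacetime R n M T).
Local Notation U := (fun i => in_chart i u).
Local Notation Uk k := (fun i => in_chart i (v k)).
Implicit Types (i j : 'I_(charts M)) (x : V) (t : R).

Let s0 k : 0 < s k. Proof. by case/andP: (s_in k). Qed.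
Let sT k : s k < T. Proof. by case/andP: (s_in k). Qed.

Lemma singular_field : @flow_field R n M T U.
Proof. exact: smooth_spacetime_field. Qed.

Lemma singular_gt0 i z : ST i z -> 0 < U i z.
Proof. by case: z => x t [ix tT]; exact: u_gt0. Qed.

Let FUk k := kernel_field (Hv k).
Let uk_gt0 k := kernel_gt0 (Hv k).

Let near_base t : 0 < t < T -> \forall k \near \oo, 0 < t < s k.
Proof. by move=> /andP[t0 tT]; rewrite t0; exact: (cvgr_gt T s_lim t tT). Qed.

Lemma singular_heat i z : ST i z ->
  'D_time_dir (U i) z = - lap_field g U i z + scal_field g i z * U i z.
Proof.
case: z => x t [ix tT].
have A := @pointwise_limit R n M T g g_flow v u vu Su i [:: time_dir] x t ix tT.
have P l := @pointwise_limit R n M T g g_flow v u vu Su i l x t ix tT.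
have B : (- lap_field g (Uk k) i (x, t) + scal_field g i (x, t) * Uk k i (x, t)) @[k --> \oo]
    --> - lap_field g U i (x, t) + scal_field g i (x, t) * U i (x, t).
  apply: cvgD; last by apply: cvgM; [exact: cvg_cst|exact: (P [::])].
  apply: cvgN; rewrite lap_slice //; under eq_cvg do rewrite lap_slice //.
  apply: cvg_sumr => a _; apply: cvg_sumr => b _; apply: cvgM; first exact: cvg_cst.
  apply: cvgB; first exact: (P [:: dir b; dir a]).
  apply: cvg_sumr => m _; apply: cvgM; first exact: cvg_cst.
  exact: (P [:: dir m]).
have A' : 'D_time_dir (Uk k i) (x, t) @[k --> \oo]
    --> - lap_field g U i (x, t) + scal_field g i (x, t) * U i (x, t).
  apply: cvg_trans B; apply: near_eq_cvg; apply: filterS (near_base tT) => k tk.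
  by rewrite (kernel_heat (Hv k)).
by rewrite -(cvg_lim (@Rhausdorff R) A'); exact: (esym (cvg_lim (@Rhausdorff R) A)).
Qed.

Section FixedTime.
Variable t : R.
Hypothesis tT : 0 < t < T.
Let hR : riemannian (g t). Proof. exact: (flow_riemannian g_flow (lexx T) tT). Qed.
Let joint i l x (ix : chart_img i x) := @joint_limit R n M T g g_flow v u vu Su i l x t ix tT.

Let cvg_field F i x : scalar_field F -> chart_img i x ->
  F i z.1 @[z --> filter_prod (nbhs x) (\oo : set_system nat)] --> F i x.
Proof. move=> FF ix; have cx : F i y @[y --> x] --> F i x := field_continuous FF ix.
by apply: cvg_comp cx; exact: cvg_fst. Qed.

Lemma singular_mass : V_ g U t = 1.
Proof.
have nF : \forall k \near \oo, scalar_field (fun i x => Uk k i (x, t)).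
  by apply: filterS (near_base tT) => k tk; exact: (flow_slice (FUk k) tk).
have H := vol_cvg_prod hR _ nF (flow_slice singular_field tT) (fun i x ix => @joint i [::] x ix).
have H1 : V_ g (Uk k) t @[k --> \oo] --> (1 : R).
  have C : (fun=> 1 : R) k @[k --> (\oo : set_system nat)] --> (1 : R) by exact: cvg_cst.
  apply: cvg_trans C; apply: near_eq_cvg; apply: filterS (near_base tT) => k tk.
  by rewrite (kernel_mass g_flow (s0 k) (sT k) (Hv k) tk).
have {}H := H ltac:(exact _).
by rewrite -(cvg_lim (@Rhausdorff R) H1); exact: (esym (cvg_lim (@Rhausdorff R) H)).
Qed.

Let log_limit i x : chart_img i x ->
  log_field (Uk z.2) i (z.1, t) @[z --> filter_prod (nbhs x) \oo] --> log_field U i (x, t).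
Proof.
move=> ix; apply: (cvg_comp _ _ (@joint i [::] x ix)); apply: continuous_ln.
exact: singular_gt0.
Qed.

Lemma singular_nash : nash g (Uk k) t @[k --> \oo] --> nash g U t.
Proof.
apply: (vol_cvg_prod hR).
- apply: filterS (near_base tT) => k tk.
  have Fk := FUk k; have Lk := FL Fk (@uk_gt0 k).
  have FM := flow_fieldM Fk Lk; exact: (flow_slice FM tk).
- exact: (flow_slice (flow_fieldM singular_field (FL singular_field singular_gt0)) tT).
- by move=> i x ix; apply: cvgM; [exact: (@joint i [::] x ix)|exact: log_limit].
Qed.

Lemma singular_energy : energy g (Uk k) t @[k --> \oo] --> energy g U t.
Proof.
apply: (vol_cvg_prod hR).
- apply: filterS (near_base tT) => k tk.
  have Fk := FUk k; have sk := ltW (sT k).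
  have FE := flow_field_energy g_flow sk Fk (@uk_gt0 k); exact: (flow_slice FE tk).
- exact: (flow_slice (flow_field_energy g_flow (lexx T) singular_field singular_gt0) tT).
move=> i x ix; apply: cvgM; last exact: (@joint i [::] x ix).
apply: cvgD; first exact: (cvg_field (flow_slice (flow_field_scal g_flow (lexx T)) tT) ix).
rewrite (grad_log_slice g singular_field ix tT); last exact: singular_gt0.
have P l := @joint i l x ix.
have Q a : ((Uk z.2 i (z.1, t))^-1 * 'D_(dir a) (Uk z.2 i) (z.1, t)) @[z --> filter_prod (nbhs x) \oo]
    --> (U i (x, t))^-1 * 'D_(dir a) (U i) (x, t).
  apply: cvgM; last exact: (P [:: dir a]).
  by apply: cvgV; [rewrite gt_eqF // singular_gt0|exact: (P [::])].
have C : (\sum_a \sum_b invmx (g t i z.1) a b * ((Uk z.2 i (z.1, t))^-1 * 'D_(dir a) (Uk z.2 i) (z.1, t))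
    * ((Uk z.2 i (z.1, t))^-1 * 'D_(dir b) (Uk z.2 i) (z.1, t))) @[z --> filter_prod (nbhs x) \oo]
  --> \sum_a \sum_b invmx (g t i x) a b * ((U i (x, t))^-1 * 'D_(dir a) (U i) (x, t))
    * ((U i (x, t))^-1 * 'D_(dir b) (U i) (x, t)).
  apply: cvg_sumr => a _; apply: cvg_sumr => b _.
  apply: cvgM; last exact: Q. apply: cvgM; last exact: Q.
  have ci : invmx (g t i y) a b @[y --> x] --> invmx (g t i x) a b.
    have gx : \det (g t i x) != 0.
      by rewrite gt_eqF //; apply: posdef_det; have [_ _ H _] := hR; exact: H.
    apply: (@cvg_invmx R V (nbhs x) _ n (g t i) (g t i x) a b gx) => c d.
    have [Hs _ _ _] := hR; have oi := @chart_img_open _ _ M i.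
    exact: (@smooth_Ck R V (chart_img i) (fun y => g t i y c d) 0 (chart_img i) [::] oi (@subset_refl _ _) (@Hs i c d) x ix).
  by apply: cvg_comp ci; exact: cvg_fst.
apply: cvg_trans C; apply: near_eq_cvg.
exists (chart_img i, [set k | 0 < t < s k]) => /=; first by split; [exact: chart_img_near|exact: near_base].
by move=> [y k] [/= iy tk]; rewrite (grad_log_slice g (FUk k) iy tk) //; exact: uk_gt0.
Qed.

(** Each approximating kernel has its own scale s k - t, which tends to T - t; all three ingredients
    of the entropy converge. *)
Lemma singular_entropy_le0 : entropy g T U t <= 0.
Proof.
have H : entropy g (s k) (Uk k) t @[k --> \oo] --> entropy g T U t.
  have sk : (s k - t) @[k --> \oo] --> T - t by apply: cvgB; [exact: s_lim|exact: cvg_cst].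
  rewrite /entropy; apply: cvgB; last exact: cvg_cst.
  apply: cvgB; first by apply: cvgB; [apply: cvgM => //; exact: singular_energy|exact: singular_nash].
  apply: cvgM; first exact: cvg_cst.
  have p0 := @pi_gt0 R; have t1 : 0 < 4 * pi * (T - t).
    by rewrite !mulr_gt0 // subr_gt0; case/andP: tT.
  have mk : (4 * pi * (s k - t)) @[k --> \oo] --> 4 * pi * (T - t) by apply: cvgM => //; exact: cvg_cst.
  exact: (cvg_comp _ _ mk (continuous_ln t1)).
rewrite -(cvg_lim (@Rhausdorff R) H); apply: limr_le; first by apply/cvg_ex; exists (entropy g T U t).
by apply: filterS (near_base tT) => k tk; exact: (kernel_entropy_le0 g_flow (s0 k) (sT k) (Hv k) tk).
Qed.
End FixedTime.
End SingularKernel.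

Lemma near_itv (R : realType) (a b t : R) : a < t < b -> \forall r \near t, a < r < b.
Proof.
move=> tI; have /near_in_itvoo := tI : t \in `]a, b[%R.
by apply: filterS => r; rewrite in_itv.
Qed.

Section AffineChange.
Variables (R : realType) (n : nat) (M : closedManifold R n) (h : metric M).
Variables (i : 'I_(charts M)) (F L : 'rV[R]_n -> R) (a b : R).
Hypothesis FL : forall y, chart_img i y -> F y = a * L y + b.

Lemma partial_affine k x : Ck 1 (chart_img i) L -> chart_img i x ->
  partial i k F x = a * partial i k L x.
Proof.
move=> CL ix; rewrite (eq_partial k (@chart_img_open _ _ M i) (@subset_refl _ _) ix FL) !partialE //.
have [_ dL _] := CL; have /derivableP d := dL x (unit_vec R k) ix.
by have [_ ->] := is_deriveD (is_deriveZ a d) (is_derive_cst b x (unit_vec R k)); rewrite addr0.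
Qed.
End AffineChange.

Section AffineGeometry.
Variables (R : realType) (n : nat) (M : closedManifold R n) (h : metric M).
Variables (i : 'I_(charts M)) (F L : 'rV[R]_n -> R) (a b : R).
Hypothesis FL : forall y, chart_img i y -> F y = a * L y + b.

Lemma sqnorm_gradient_affine x : Ck 1 (chart_img i) L -> chart_img i x ->
  sqnorm_gradient h i F x = a ^+ 2 * sqnorm_gradient h i L x.
Proof.
move=> CL ix; rewrite /sqnorm_gradient mulr_sumr; apply: eq_bigr => k _.
rewrite mulr_sumr; apply: eq_bigr => l _; rewrite !(partial_affine FL _ CL ix); ring.
Qed.

Lemma hessian_affine x : Ck 2 (chart_img i) L -> chart_img i x ->
  hessian h i F x = a *: hessian h i L x.
Proof.
move=> CL ix; have p l y : chart_img i y -> partial i l F y = a * partial i l L y + 0.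
  by move=> iy; rewrite addr0; exact: (partial_affine FL l (CkS CL) iy).
apply/matrixP => k l; rewrite !mxE (partial_affine (p l) k _ ix); last first.
  apply: eq_Ck (Ck_derive (unit_vec R l) CL) => [|y]; first exact: chart_img_open.
  by rewrite inE => iy; rewrite partialE.
rewrite mulrBr mulr_sumr; congr (_ - _); apply: eq_bigr => m _; rewrite (p m) //; ring.
Qed.
End AffineGeometry.

Section GaussWeight.
Variables (R : realType) (n : nat) (tau : R).
Hypothesis tau_gt0 : 0 < tau.

Let p_gt0 : 0 < 4 * pi * tau.
Proof. by rewrite !mulr_gt0 // pi_gt0. Qed.

Lemma gauss_weight_gt0 y : 0 < gauss_weight n tau y.
Proof. by rewrite divr_gt0 ?expR_gt0 // powR_gt0. Qed.

Lemma ln_gauss_weight y : ln (gauss_weight n tau y) = - y - n%:R / 2 * ln (4 * pi * tau).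
Proof.
have -> : ln (gauss_weight n tau y) = ln (expR (- y)) - ln ((4 * pi * tau) `^ (n%:R / 2)).
  by apply: ln_div; rewrite posrE ?expR_gt0 // powR_gt0.
by rewrite expRK ln_powR.
Qed.
End GaussWeight.

Lemma eq_scalar_field_chart (R : realType) (n : nat) (M : closedManifold R n)
    (F G : 'I_(charts M) -> 'rV[R]_n -> R) :
  (forall i x, chart_img i x -> F i x = G i x) -> scalar_field G -> scalar_field F.
Proof.
move=> FG SG; split=> [i j x o|i x ix].
  rewrite (FG _ _ (overlap_sub o)) (FG _ _ (transition_img o)); exact: (field_transition SG o).
have c : G i y @[y --> x] --> F i x by rewrite FG //; exact: field_continuous.
have H : \forall y \near x, G i y = F i y.
  by apply: filterS (chart_img_near ix) => y iy; rewrite FG.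
exact: (cvg_trans (@near_eq_cvg _ _ (nbhs x) _ _ _ H) c).
Qed.

Section Potential.
Variables (R : realType) (n : nat) (M : closedManifold R n) (T : R) (g : R -> metric M).
Hypothesis g_flow : ricci_flow T g.
Variables (p : M) (f : M -> R -> R).
Hypothesis Hf : singular_potential T g p f.
Local Notation V := 'rV[R]_n.
Local Notation E := ('rV[R]_n * R)%type.
Local Notation ST := (@open_spacetime R n M T).
Local Notation u := (fun q t => gauss_weight n (T - t) (f q t)).
Local Notation U := (fun i => in_chart i u).
Local Notation L := (log_field U).
Local Notation W t := (W_entropy (g t) (f ^~ t) (T - t)).
Implicit Types (i j : 'I_(charts M)) (x : V) (t : R).

Let Su : smooth_spacetime T u. Proof. by case: Hf => _ []. Qed.

Let u_gt0 q t : 0 < t < T -> 0 < u q t.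
Proof. by move=> /andP[_ tT]; apply: gauss_weight_gt0; rewrite subr_gt0. Qed.

Let FU : @flow_field R n M T U. Proof. exact: smooth_spacetime_field. Qed.

Let U_gt0 i z : ST i z -> 0 < U i z.
Proof. by case: z => x t [ix tT]; exact: u_gt0. Qed.

Let FLU : @flow_field R n M T L. Proof. exact: (FL FU U_gt0). Qed.

Let U_heat i z : ST i z ->
  'D_((0, 1) : E) (U i) z = - lap_field g U i z + scal_field g i z * U i z.
Proof.
by case: Hf => _ [_ [s [v [sI sL Hv vu]]]]; exact: (singular_heat g_flow sL Hv vu Su).
Qed.

Let U_mass t : 0 < t < T -> V_ g U t = 1.
Proof.
by case: Hf => _ [_ [s [v [sI sL Hv vu]]]]; exact: (singular_mass g_flow sI sL Hv vu Su).
Qed.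

Let U_entropy t : 0 < t < T -> entropy g T U t <= 0.
Proof.
by case: Hf => _ [_ [s [v [sI sL Hv vu]]]]; exact: (singular_entropy_le0 g_flow sI sL Hv vu Su u_gt0).
Qed.

Let c t := n%:R / 2 * ln (4 * pi * (T - t)).

Let potentialE i t x : 0 < t < T -> f (chart_inv i x) t = (-1) * L i (x, t) + (- c t).
Proof.
move=> /andP[_ tT]; rewrite /log_field /in_chart /= ln_gauss_weight ?subr_gt0 // /c; ring.
Qed.

(** Expressed by f rather than by the fields on the open interval, so that it makes sense at time
    0. *)
Definition W_density i (z : E) : R :=
  ((T - z.2) * (scalar_curvature (g z.2) i z.1
     + sqnorm_gradient (g z.2) i (fun y => f (chart_inv i y) z.2) z.1)
   + f (chart_inv i z.1) z.2 - n%:R) * gauss_weight n (T - z.2) (f (chart_inv i z.1) z.2).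

Lemma W_vol t : W t = vol (g t) (fun i x => W_density i (x, t)).
Proof. by []. Qed.

Lemma W_densityE i x t : chart_img i x -> 0 < t < T -> W_density i (x, t)
  = (T - t) * gradient_energy_field g U i (x, t) + (-1) * (U i (x, t) * L i (x, t))
    + (- (c t + n%:R)) * U i (x, t).
Proof.
move=> ix tT; have CL := slice_Ck tT (flow_Ck FLU i 1%N).
have E2 := sqnorm_gradient_affine (g t) (fun y _ => potentialE i y tT) CL ix.
rewrite /W_density /= E2 sqrrN expr1n mul1r /gradient_energy_field /scal_field /grad_field /=.
rewrite -[gauss_weight _ _ _]/(U i (x, t)) (potentialE i x tT); ring.
Qed.

Section Time.
Variable t : R.
Hypothesis tT : 0 < t < T.

Let hR : riemannian (g t). Proof. exact: (flow_riemannian g_flow (lexx T) tT). Qed.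
Let SE := flow_slice (flow_field_energy g_flow (lexx T) FU U_gt0) tT.
Let SN := flow_slice (flow_fieldM FU FLU) tT.
Let SU := flow_slice FU tT.

Lemma W_density_scalar_field : scalar_field (fun i x => W_density i (x, t)).
Proof.
apply: eq_scalar_field_chart (fun i x ix => W_densityE ix tT) _.
have F1 := flow_field_energy g_flow (lexx T) FU U_gt0.
have F2 := flow_fieldD (flow_fieldD (flow_fieldZ (T - t) F1) (flow_fieldZ (-1) (flow_fieldM FU FLU)))
  (flow_fieldZ (- (c t + n%:R)) FU).
exact: (flow_slice F2 tT).
Qed.

Lemma W_entropyE : W t = entropy g T U t.
Proof.
have IE := scalar_field_integrable hR SE; have IN := scalar_field_integrable hR SN.
have IU := scalar_field_integrable hR SU.
rewrite W_vol (eq_vol (g t) (fun i x ix => W_densityE ix tT)).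
rewrite (vol_add (integrable_fieldD (integrable_fieldZ IE (T - t)) (integrable_fieldZ IN (-1)))
  (integrable_fieldZ IU (- (c t + n%:R)))).
rewrite (vol_add (integrable_fieldZ IE (T - t)) (integrable_fieldZ IN (-1))).
rewrite (vol_scale IE) (vol_scale IN) (vol_scale IU).
rewrite -[vol (g t) (fun i x => U i (x, t))]/(V_ g U t) U_mass //.
rewrite /entropy -/(c t) /energy /nash /V_; ring.
Qed.

Lemma soliton_defectE : soliton_defect (g t) (f ^~ t) (T - t) = V_ g (defect_field g U (2 * (T - t))^-1) t.
Proof.
apply: eq_vol => i x ix; have CL := slice_Ck tT (flow_Ck FLU i 2%N).
rewrite -(defect_fieldE g_flow (lexx T) FU U_gt0 (2 * (T - t))^-1 (conj ix tT)).
have E2 := hessian_affine (g t) (fun y _ => potentialE i y tT) CL ix.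
by rewrite /= E2 scaleN1r mulrC.
Qed.

Lemma soliton_defect_ge0 : 0 <= soliton_defect (g t) (f ^~ t) (T - t).
Proof.
rewrite soliton_defectE (vol_defect g_flow (lexx T) FU U_gt0 U_heat U_mass) //.
exact: (vol_defect_ge0 g_flow (lexx T) FU U_gt0 U_heat U_mass).
Qed.

End Time.

Lemma W_entropy_derive t : 0 < t < T -> is_derive t (1 : R) (fun r => W r)
  (2 * (T - t) * soliton_defect (g t) (f ^~ t) (T - t)).
Proof.
move=> tT; rewrite soliton_defectE //.
apply: near_eq_is_derive (entropy_derive g_flow (lexx T) FU U_gt0 U_heat U_mass tT).
by apply: filterS (near_itv tT) => r rT; rewrite W_entropyE.
Qed.

Lemma W_entropy_le0 t : 0 < t < T -> W t <= 0.
Proof. by move=> tT; rewrite W_entropyE // U_entropy. Qed.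

Lemma W_entropy_le_pos t r : 0 < t -> t <= r -> r < T -> W t <= W r.
Proof.
move=> t0 tr rT; rewrite !W_entropyE ?t0 ?(lt_le_trans t0 tr) ?rT ?(le_lt_trans tr rT) //.
exact: (entropy_le g_flow (lexx T) FU U_gt0 U_heat U_mass t0 tr rT).
Qed.

(** * Continuity of the entropy at the initial time *)

Section InitialTime.
Hypothesis T_gt0 : 0 < T.
Local Notation D i := (@spacetime R n M T i).
Local Notation start i x := (within (D i) (nbhs ((x, 0) : E))).

Let ST0 i x : chart_img i x -> D i (x, 0). Proof. by move=> ix; split=> //=; rewrite lexx. Qed.

Let h0 : riemannian (g 0). Proof. by have [H _ _] := g_flow; apply: H; rewrite lexx. Qed.

Lemma partial_pderiv i k (F : E -> R) x t : 0 <= t < T ->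
  partial i k (fun y => F (y, t)) x = pderiv (D i) (space_dir (unit_vec R k)) F (x, t).
Proof.
move=> tT; rewrite /partial /pderiv.
have -> : diff_quotient (delta_mx ord0 k) (fun y => F (y, t)) x
    = diff_quotient (space_dir (unit_vec R k)) F (x, t).
  apply/funext => r; rewrite /diff_quotient; congr (_ * (F _ - _)).
  exact: (slice_line t x (unit_vec R k) r).
have E1 r : (x, t) + r *: space_dir (unit_vec R k) = (x + r *: delta_mx ord0 k, t).
  exact: (esym (slice_line t x (unit_vec R k) r)).
have E2 : [set r | chart_img i (x + r *: delta_mx ord0 k)]
    = [set r | D i ((x, t) + r *: space_dir (unit_vec R k))].
  by apply/seteqP; split=> r /=; rewrite E1; [split|case].
by rewrite /increments E2.
Qed.

Let near_start : \forall t \near (0 : R)^'+, 0 < t < T.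
Proof.
near=> t; apply/andP; split; near: t; [exact: nbhs_right_gt|exact: nbhs_right_lt].
Unshelve. all: by end_near. Qed.

Let smooth_start i x (F : E -> R) l : chart_img i x -> smooth (D i) F ->
  iter_pderiv (D i) l F z @[z --> start i x] --> iter_pderiv (D i) l F (x, 0).
Proof. by move=> ix SF; have [/subspace_continuousP H _] := SF l; exact: (H _ (ST0 ix)). Qed.

Let start_joint i x : chart_img i x -> z @[z --> filter_prod (nbhs x) (0 : R)^'+] --> start i x.
Proof.
move=> ix A [[P Q] /= [nP nQ] sub].
have [d /= d0 Hd] : nbhs_ball (0 : R) Q by apply/nbhs_ballP.
exists (P `&` chart_img i, Q `&` [set t | 0 < t < T]) => /=.
  split; first by apply: filterI => //; exact: chart_img_near.
  apply: filterI; first exact: near_at_right.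
  exact: near_start.
move=> [y t] /= [[Py iy] [Qt /andP[t0 tT]]]; apply: (sub (y, t)) => //=.
by split=> //=; rewrite ltW.
Qed.

Let start_time i x : chart_img i x -> (x, t) @[t --> (0 : R)^'+] --> start i x.
Proof.
move=> ix A /(@start_joint i x ix)[[P Q] /= [nP nQ] sub]; apply: filterS nQ => t Qt.
by apply: (sub (x, t)); split=> //=; exact: nbhs_singleton nP.
Qed.

Let start_space i x : chart_img i x -> (y, 0 : R) @[y --> x] --> start i x.
Proof.
move=> ix A [[P Q] /= [nP nQ] sub]; apply: filterS2 nP (chart_img_near ix) => y Py iy.
by apply: (sub (y, 0)) => //=; [split=> //; exact: nbhs_singleton nQ|exact: ST0].
Qed.

Let nearD i x : \forall z \near start i x, D i z. Proof. exact: withinT. Qed.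

Section Point.
Variables (i : 'I_(charts M)) (x : V).
Hypothesis ix : chart_img i x.

Let g_start a b : g z.2 i z.1 a b @[z --> start i x] --> g 0 i x a b.
Proof. by have [_ Hg _] := g_flow; exact: (@smooth_start i x _ [::] ix (@Hg i a b)). Qed.

Let inv_start a b : invmx (g z.2 i z.1) a b @[z --> start i x] --> invmx (g 0 i x) a b.
Proof.
have gx : \det (g 0 i x) != 0.
  by rewrite gt_eqF //; apply: posdef_det; have [_ _ H _] := h0; exact: H.
exact: (@cvg_invmx R E (start i x) _ n (fun z => g z.2 i z.1) (g 0 i x) a b gx g_start).
Qed.

Let f_start : f (chart_inv i z.1) z.2 @[z --> start i x] --> f (chart_inv i x) 0.
Proof. by case: Hf => Sf _; exact: (@smooth_start i x _ [::] ix (@Sf i)). Qed.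

(** The flow equation replaces the Ricci tensor by -1/2 times the time derivative of the metric, a
    single restricted derivative that is continuous up to time 0. *)
Let scal_start : scalar_curvature (g z.2) i z.1 @[z --> start i x] --> scalar_curvature (g 0) i x.
Proof.
have [_ Hg Hric] := g_flow.
pose r a b (z : E) := (- 2^-1) * pderiv (D i) (0, 1) (fun y => g y.2 i y.1 a b) z.
have rE a b z : D i z -> ricci (g z.2) i z.1 a b = r a b z.
  by move=> Dz; rewrite /r Hric //; field.
pose X (z : E) := \sum_a \sum_b invmx (g z.2 i z.1) a b * r b a z.
have XE z : D i z -> scalar_curvature (g z.2) i z.1 = X z.
  move=> Dz; rewrite /scalar_curvature /mxtrace; apply: eq_bigr => a _.
  by rewrite mxE; apply: eq_bigr => b _; rewrite rE.
have CX : X z @[z --> start i x] --> X (x, 0).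
  apply: cvg_sumr => a _; apply: cvg_sumr => b _; apply: cvgM; first exact: inv_start.
  apply: cvgM; first exact: cvg_cst.
  exact: (@smooth_start i x _ [:: ((0, 1) : E)] ix (@Hg i b a)).
have XE0 : scalar_curvature (g 0) i x = X (x, 0) := XE (x, 0) (ST0 ix).
rewrite XE0; apply: cvg_trans CX; apply: near_eq_cvg.
by apply: filterS (nearD i x) => z Dz; rewrite XE.
Qed.

Let grad_start : sqnorm_gradient (g z.2) i (fun y => f (chart_inv i y) z.2) z.1 @[z --> start i x]
  --> sqnorm_gradient (g 0) i (fun y => f (chart_inv i y) 0) x.
Proof.
have [Sf _] := Hf.
pose q a := pderiv (D i) (space_dir (unit_vec R a)) (in_chart i f).
pose X (z : E) := \sum_a \sum_b invmx (g z.2 i z.1) a b * q a z * q b z.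
have XE z : D i z -> sqnorm_gradient (g z.2) i (fun y => f (chart_inv i y) z.2) z.1 = X z.
  case: z => y t [iy tT]; apply: eq_bigr => a _; apply: eq_bigr => b _.
  by rewrite !(partial_pderiv _ _ (in_chart i f)).
have CX : X z @[z --> start i x] --> X (x, 0).
  have Cq a : q a z @[z --> start i x] --> q a (x, 0).
    exact: (@smooth_start i x _ [:: space_dir (unit_vec R a)] ix (@Sf i)).
  apply: cvg_sumr => a _; apply: cvg_sumr => b _; apply: cvgM; last exact: Cq.
  by apply: cvgM; [exact: inv_start|exact: Cq].
have XE0 : sqnorm_gradient (g 0) i (fun y => f (chart_inv i y) 0) x = X (x, 0) := XE (x, 0) (ST0 ix).
rewrite XE0; apply: cvg_trans CX; apply: near_eq_cvg.
by apply: filterS (nearD i x) => z Dz; rewrite XE.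
Qed.

Let tau_start : (T - z.2) @[z --> start i x] --> T - 0.
Proof.
apply: cvgB; first exact: cvg_cst.
have H : z.2 @[z --> nbhs ((x, 0) : E)] --> (0 : R) by exact: cvg_snd.
by apply: cvg_trans H; apply: cvg_app; exact: cvg_within.
Qed.

Let weight_start : gauss_weight n (T - z.2) (f (chart_inv i z.1) z.2) @[z --> start i x]
  --> gauss_weight n (T - 0) (f (chart_inv i x) 0).
Proof.
pose X (z : E) := expR (- f (chart_inv i z.1) z.2 - n%:R / 2 * ln (4 * pi * (T - z.2))).
have XE z : D i z -> gauss_weight n (T - z.2) (f (chart_inv i z.1) z.2) = X z.
  case=> _ /andP[_ zT]; have tp : 0 < T - z.2 by rewrite subr_gt0.
  by rewrite /X -ln_gauss_weight // lnK // posrE gauss_weight_gt0.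
have CX : X z @[z --> start i x] --> X (x, 0).
  have t1 : 0 < 4 * pi * (T - 0) by rewrite !mulr_gt0 ?pi_gt0 // subr0.
  have mk : (4 * pi * (T - z.2)) @[z --> start i x] --> 4 * pi * (T - 0).
    by apply: cvgM; [exact: cvg_cst|exact: tau_start].
  have C0 : (- f (chart_inv i z.1) z.2 - n%:R / 2 * ln (4 * pi * (T - z.2))) @[z --> start i x]
      --> - f (chart_inv i x) 0 - n%:R / 2 * ln (4 * pi * (T - 0)).
    apply: cvgB; first by apply: cvgN; exact: f_start.
    by apply: cvgM; [exact: cvg_cst|exact: (cvg_comp _ _ mk (continuous_ln t1))].
  exact: (cvg_comp _ _ C0 (@continuous_expR R _)).
have XE0 : gauss_weight n (T - 0) (f (chart_inv i x) 0) = X (x, 0) := XE (x, 0) (ST0 ix).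
rewrite XE0; apply: cvg_trans CX; apply: near_eq_cvg.
by apply: filterS (nearD i x) => z Dz; rewrite XE.
Qed.

Lemma W_density_start : W_density i z @[z --> start i x] --> W_density i (x, 0).
Proof.
apply: cvgM; last exact: weight_start.
apply: cvgB; last exact: cvg_cst.
apply: cvgD; last exact: f_start.
apply: cvgM; first exact: tau_start.
by apply: cvgD; [exact: scal_start|exact: grad_start].
Qed.

Lemma rho_start : rho (g z.2) i z.1 @[z --> start i x] --> rho (g 0) i x.
Proof.
have H : \det (g z.2 i z.1) @[z --> start i x] --> \det (g 0 i x) by apply: cvg_det => a b; exact: g_start.
exact: (cvg_comp _ _ H (@sqrt_continuous R _)).
Qed.
End Point.

(** At time 0 the transition rule is the limit of the one at positive times. *)
Let W_density_field t : 0 <= t < T -> scalar_field (fun i x => W_density i (x, t)).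
Proof.
move=> /andP[]; rewrite le_eqVlt => /orP[/eqP <- _|t0 tT]; last first.
  by apply: W_density_scalar_field; rewrite t0.
split=> [i j x o|i x ix].
  have ix := overlap_sub o; have jx := transition_img o.
  have A : W_density i (x, t) @[t --> (0 : R)^'+] --> W_density i (x, 0).
    exact: (cvg_comp _ _ (@start_time i x ix) (W_density_start ix)).
  have B : W_density j (transition i j x, t) @[t --> (0 : R)^'+] --> W_density j (transition i j x, 0).
    exact: (cvg_comp _ _ (@start_time j (transition i j x) jx) (W_density_start jx)).
  have {}B : W_density i (x, t) @[t --> (0 : R)^'+] --> W_density j (transition i j x, 0).
    apply: cvg_trans B; apply: near_eq_cvg; apply: filterS near_start => r rT.
    by rewrite (field_transition (W_density_scalar_field rT) o).
  by rewrite -(cvg_lim (@Rhausdorff R) B) -(cvg_lim (@Rhausdorff R) A).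
exact: (cvg_comp _ _ (@start_space i x ix) (W_density_start ix)).
Qed.

Let ratio t i x := rho (g t) i x / rho (g 0) i x.

Let ratio_field t : 0 <= t < T -> scalar_field (ratio t).
Proof.
move=> tT; have ht : riemannian (g t) by have [H _ _] := g_flow; exact: H.
split=> [i j x o|i x ix].
  rewrite /ratio /rho (volume_transition ht o) (volume_transition h0 o) invfM mulrACA divff ?mul1r //.
  have := rho_gt0 h0 (overlap_sub o); rewrite /rho (volume_transition h0 o) => H.
  by apply: contraTneq H => ->; rewrite mul0r ltxx.
have ct : rho (g t) i y @[y --> x] --> rho (g t) i x := Ck_continuous (rho_Ck ht 0 i) ix.
have c0 : rho (g 0) i y @[y --> x] --> rho (g 0) i x := Ck_continuous (rho_Ck h0 0 i) ix.
have C : (rho (g t) i y / rho (g 0) i y) @[y --> x] --> ratio t i x.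
  exact: (cvgM ct (cvgV (lt0r_neq0 (rho_gt0 h0 ix)) c0)).
exact: C.
Qed.

Let W_initial t : 0 <= t < T -> W t = vol (g 0) (fun i x => W_density i (x, t) * ratio t i x).
Proof.
move=> tT; apply: vol_change_metric => i x ix; rewrite /ratio /= -[RHS]mulrA divfK // gt_eqF //.
exact: rho_gt0.
Qed.

(** The measure is frozen at time 0, which turns the entropy into an integral of a continuously
    varying integrand over a fixed volume. *)
Lemma W_entropy_start : W t @[t --> (0 : R)^'+] --> W 0.
Proof.
have I0 : 0 <= (0 : R) < T by rewrite lexx.
have nT : \forall t \near (0 : R)^'+, 0 <= t < T.
  by apply: filterS near_start => t /andP[t0 ->]; rewrite ltW.
have F t : 0 <= t < T -> scalar_field (fun i x => W_density i (x, t) * ratio t i x).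
  by move=> tT; have := scalar_fieldM (W_density_field tT) (ratio_field tT).
have nF : \forall t \near (0 : R)^'+, scalar_field (fun i x => W_density i (x, t) * ratio t i x).
  by apply: filterS nT => t tT; exact: F.
have C : vol (g 0) (fun i x => W_density i (x, t) * ratio t i x) @[t --> (0 : R)^'+]
    --> vol (g 0) (fun i x => W_density i (x, 0) * ratio 0 i x).
  apply: (vol_cvg_prod h0 _ nF (F 0 I0)) => i x ix; apply: cvgM.
    have H := cvg_comp _ _ (@start_joint i x ix) (W_density_start ix).
    by apply: cvg_trans H; apply: near_eq_cvg; apply: nearW => -[y t].
  apply: cvgM; first exact: (cvg_comp _ _ (@start_joint i x ix) (rho_start ix)).
  apply: cvgV; first by rewrite gt_eqF // rho_gt0.
  have cx : rho (g 0) i y @[y --> x] --> rho (g 0) i x := Ck_continuous (rho_Ck h0 0 i) ix.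
  by apply: cvg_comp cx; exact: cvg_fst.
rewrite (W_initial I0); apply: cvg_trans C; apply: near_eq_cvg.
by apply: filterS nT => t tT; rewrite W_initial.
Qed.

Lemma W_entropy_le t r : 0 <= t -> t <= r -> r < T -> W t <= W r.
Proof.
rewrite le_eqVlt => /orP[/eqP <-|t0 tr rT]; last exact: W_entropy_le_pos.
rewrite le_eqVlt => /orP[/eqP <- //|r0 rT].
rewrite -(cvg_lim (@Rhausdorff R) W_entropy_start); apply: limr_le.
  by apply/cvg_ex; exists (W 0); exact: W_entropy_start.
near=> t0; have a : 0 < t0 by near: t0; exact: nbhs_right_gt.
have b : t0 <= r by near: t0; exact: nbhs_right_le.
exact: (W_entropy_le_pos a b rT).
Unshelve. all: by end_near. Qed.
End InitialTime.
End Potential.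

Lemma derive_local_min (R : realType) (f : R -> R) (t l : R) :
  is_derive t (1 : R) f l -> (\forall r \near t, f t <= f r) -> l = 0.
Proof.
move=> [df dE] nf; pose q (h : R) := h^-1 * (f (t + h) - f t).
have Hq : q h @[h --> (0 : R)^'] --> l.
  have := df; rewrite /derivable => /cvg_ex[l' Hl]; have E : l = l'.
    by rewrite -dE /derive; exact: cvg_lim Hl.
  rewrite E; apply: cvg_trans Hl; apply: near_eq_cvg; apply: nearW => h.
  by rewrite /q /= [h%:A]mulr1 (addrC t).
have nq : \forall h \near (0 : R), f t <= f (t + h).
  have ct : (t + h) @[h --> (0 : R)] --> t.
    by rewrite -[X in _ --> X]addr0; apply: cvgD; [exact: cvg_cst|exact: cvg_id].
  exact: (ct _ nf).
have Hr : q h @[h --> (0 : R)^'+] --> l by move=> A HA; exact: (near_dnbhs_right (Hq A HA)).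
have Hl : q h @[h --> (0 : R)^'-] --> l.
  move=> A HA; have H : nbhs (0 : R) [set h | h != 0 -> A (q h)] by exact: (Hq A HA).
  have H2 : nbhs (0 : R) [set h | h < 0 -> A (q h)].
    by apply: filterS H => h Ah h0; apply: Ah; rewrite lt_eqF.
  exact: H2.
have nr := near_at_right nq; have nl := near_at_left nq.
apply/eqP; rewrite eq_le; apply/andP; split.
  rewrite -(cvg_lim (@Rhausdorff R) Hl); apply: limr_le; first by apply/cvg_ex; exists l.
  near=> h; have h0 : h < 0 by near: h; exact: nbhs_left_lt.
  have fh : f t <= f (t + h) by near: h.
  by rewrite /q nmulr_rle0 ?invr_lt0 // subr_ge0.
rewrite -(cvg_lim (@Rhausdorff R) Hr); apply: limr_ge; first by apply/cvg_ex; exists l.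
near=> h; have h0 : 0 < h by near: h; exact: nbhs_right_gt.
have fh : f t <= f (t + h) by near: h.
by rewrite /q mulr_ge0 ?subr_ge0 // invr_ge0 ltW.
Unshelve. all: by end_near. Qed.

Theorem proposition1p3 (R : realType) (n : nat) (M : closedManifold R n)
    (T : R) (g : R -> metric M) (p : M) (fhat : R -> M -> R)
    (T_gt0 : 0 < T) (g_flow : ricci_flow T g)
    (fhat_min : forall t : R, 0 <= t < T ->
       minimizing_potential T g p t (fhat t)) :
  let theta (t : R) : R := W_entropy (g t) (fhat t) (T - t) in
  [/\ forall t : R, 0 <= t < T -> theta t <= 0,
      forall t1 t2 : R, 0 <= t1 -> t1 <= t2 -> t2 < T -> theta t1 <= theta t2 &
      {ae @lebesgue_measure R, forall t : R, 0 <= t < T ->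
         is_derive t (1 : R) theta
           (2 * (T - t) * soliton_defect (g t) (fhat t) (T - t))
         /\ 0 <= 2 * (T - t) * soliton_defect (g t) (fhat t) (T - t)}].
Proof.
move=> theta.
have opt t : 0 <= t < T -> exists f : M -> R -> R, [/\ singular_potential T g p f,
    theta t = W_entropy (g t) (f ^~ t) (T - t), fhat t = f ^~ t &
    forall f', singular_potential T g p f' -> theta t <= W_entropy (g t) (f' ^~ t) (T - t)].
  move=> tT; have [f [Hf fmin fE]] := fhat_min t tT; exists f; split=> //.
    by rewrite /theta fE.
  by move=> f' Hf'; rewrite /theta fE; exact: fmin.
have mono t1 t2 : 0 <= t1 -> t1 <= t2 -> t2 < T -> theta t1 <= theta t2.
  move=> t10 t12 t2T.
  have I1 : 0 <= t1 < T by rewrite t10 (le_lt_trans t12).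
  have I2 : 0 <= t2 < T by rewrite (le_trans t10 t12).
  have [f [Hf -> _ _]] := opt t2 I2; have [_ [_ _ _ fmin]] := opt t1 I1.
  exact: le_trans (fmin f Hf) (W_entropy_le g_flow Hf T_gt0 t10 t12 t2T).
have le0 t : 0 <= t < T -> theta t <= 0.
  (* [W_entropy_le0] concerns positive times; monotonicity from t to the midpoint r also covers t =
     0. *)
  move=> /andP[t0 tT]; pose r := (t + T) / 2.
  have r0 : 0 < r by rewrite /r; lra.
  have rT : r < T by rewrite /r; lra.
  have tr : t <= r by rewrite /r; lra.
  apply: le_trans (mono t r t0 tr rT) _.
  have I : 0 <= r < T by rewrite rT ltW.
  have [f [Hf -> _ _]] := opt r I.
  have I' : 0 < r < T by rewrite r0.
  exact: (W_entropy_le0 g_flow Hf I').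
split=> //.
(* Nondecreasing extension of theta to the real line: constant before 0, and 0 from T on, which is
   an upper bound of theta. *)
pose eta (t : R) := if t < 0 then theta 0 else if t < T then theta t else 0.
have etaE t : 0 <= t < T -> eta t = theta t.
  by move=> /andP[t0 tT]; rewrite /eta ltNge t0 /= tT.
have eta_nd : {homo eta : x y / x <= y}.
  move=> x y xy; rewrite /eta; have I0 : 0 <= (0 : R) < T by rewrite lexx.
  have [x0|x0] := ltP x 0; have [y0|y0] := ltP y 0 => //.
  - have [yT|yT] := ltP y T; last exact: le0.
    by apply: mono.
  - by move: (lt_le_trans y0 (le_trans x0 xy)); rewrite ltxx.
  - have [xT|xT] := ltP x T; have [yT|yT] := ltP y T => //.
    + exact: mono.
    + by apply: le0; rewrite x0.
    + by move: (le_lt_trans (le_trans xT xy) yT); rewrite ltxx.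
have ae := monotone_derivable_ae T eta_nd.
(* Time 0 joins the exceptional set, since [is_derive] is two-sided. *)
have N0 : (@lebesgue_measure R).-negligible [set 0 : R].
  by exists [set 0 : R]; split=> //; exact: lebesgue_measure_set1.
apply: (negligibleS _ (negligibleU ae N0)) => t /= H.
have [->|t_neq0] := eqVneq t 0; [by right|left => Pt; apply: H => tT].
have t0T : 0 < t < T by case/andP: tT => t0 ->; rewrite lt_neqAle eq_sym t_neq0 t0.
have [f [Hf fE fh fmin]] := opt t tT.
have dW := W_entropy_derive g_flow Hf t0T; rewrite -fh in dW.
have tau : 0 < T - t by rewrite subr_gt0; case/andP: tT.
have S0 : 0 <= 2 * (T - t) * soliton_defect (g t) (fhat t) (T - t).
  by rewrite mulr_ge0 ?mulr_ge0 ?(ltW tau) // fh; exact: (soliton_defect_ge0 g_flow Hf t0T).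
split=> //.
(* The minimiser chosen at time t is a competitor at every other time r. *)
have below : \forall r \near t, eta r <= W_entropy (g r) (f ^~ r) (T - r).
  apply: filterS (near_itv t0T) => r /andP[r0 rT].
  have rI : 0 <= r < T by rewrite rT ltW.
  by rewrite etaE //; have [_ [_ _ _ rmin]] := opt r rI; exact: rmin.
have touch : W_entropy (g t) (f ^~ t) (T - t) = eta t by rewrite etaE.
have deta : derivable eta t 1.
  by apply: Pt t0T _; exists (fun r => W_entropy (g r) (f ^~ r) (T - r)); split=> //; case: dW.
have /derivableP dE := deta.
have gap := is_deriveB dW dE.
have gap0 : 2 * (T - t) * soliton_defect (g t) (fhat t) (T - t) - 'D_1 eta t = 0.
  apply: (derive_local_min gap); apply: filterS below => r; rewrite /= -subr_ge0.
  by apply: le_trans; rewrite -[leLHS]/(W_entropy (g t) (f ^~ t) (T - t) - eta t) touch subrr.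
have eE : 'D_1 eta t = 2 * (T - t) * soliton_defect (g t) (fhat t) (T - t).
  by apply/eqP; rewrite eq_sym -subr_eq0 gap0.
rewrite -eE; apply: near_eq_is_derive dE.
by apply: filterS (near_itv t0T) => r /andP[r0 rT]; rewrite etaE // rT ltW.
Qed.
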